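(* Let $b$ satisfy the standing assumptions below and, in addition: (a) there is $x_0\in\mathbb{R}$ such that $b^{(p)}(x)\neq 0$ for all $p\in\mathbb{N}$ and all $x\ge x_0$; (b) $b'(x)=o(b_+-b(x))$ and, for every $p\in\mathbb{N}$, $b^{(p+1)}(x)=o(b^{(p)}(x))$ as $x\to+\infty$; (c) $(b')^2(x)=o(b''(x))$ as $x\to+\infty$. Then for every $n\in\mathbb{N}$ there exist $\sigma>0$ and $\tau>0$ such that, with $\epsilon=\epsilon_{\sigma,\tau}$, as $k\to+\infty$, $$E_n(k)=b_k\Lambda_n+\gamma_n b_k^{-1}b_k''+O(\epsilon(k)),$$ $$E_n'(k)=b_k^{-1}\Lambda_n b_k'+O(\epsilon(k)),\qquad E_n''(k)=b_k^{-2}\Lambda_n b_k''+O(\epsilon(k)),$$ where $\Lambda_n=2n-1$, $\gamma_n=\tfrac14(2n^2-2n+1)$, and the remainders depend on $n$.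
   Context: Standing assumptions: $b\in C^\infty(\mathbb{R})$ is increasing, $\lim_{x\to-\infty}b(x)=b_-$, $\lim_{x\to+\infty}b(x)=b_+$ with $b_+>b_->0$; $a(x)=\int_0^x b(t)\,dt$. For $k\in\mathbb{R}$, $h(k)=-\frac{d^2}{dx^2}+(a(x)-k)^2$ is self-adjoint in $L^2(\mathbb{R})$ with compact resolvent and simple spectrum; its eigenvalues in increasing order are $E_1(k)<E_2(k)<\dots$ (the band functions). Notation: $x_k:=a^{-1}(k)$, $b_k:=b(x_k)$, $b_k^{(p)}:=b^{(p)}(x_k)$ for $p\ge1$ (so $b_k'=b'(x_k)$, $b_k''=b''(x_k)$). For $\sigma,\tau>0$, $$\epsilon_{\sigma,\tau}(k):=(b_k')^2+\sup_{x\in(\sigma k,+\infty)}\{|b'(x)b''(x)|+|b^{(3)}(x)|\}+e^{-\tau k^2}.$$ *)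

(* Defs.v *)
From Stdlib Require Import Reals Lra List.
Open Scope R_scope.

(* bd : nat -> R -> R encodes a C^infinity function b = bd 0 together with
   all its derivatives: bd (S p) is the derivative of bd p everywhere. *)
Definition smooth_derivs (bd : nat -> R -> R) : Prop :=
  forall (p : nat) (x : R), derivable_pt_lim (bd p) x (bd (S p) x).

Definition little_o_infty (f g : R -> R) : Prop :=
  forall eps, 0 < eps -> exists X, forall x, X <= x -> Rabs (f x) <= eps * Rabs (g x).

(* u is square integrable on R (u is continuous in our use, so this is
   equivalent to u in L^2(R)). *)
Definition sq_integrable (u : R -> R) : Prop :=
  exists B, forall (L : R) (pr : Riemann_integrable (fun x => u x * u x) (- L) L),
    RiemannInt pr <= B.

(* E is an eigenvalue of h(k) = -d^2/dx^2 + (a(x) - k)^2 in L^2(R):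
   there is a nonzero C^2 solution u in L^2 of -u'' + (a-k)^2 u = E u. *)
Definition is_eigenvalue (a : R -> R) (k E : R) : Prop :=
  exists (u u1 u2 : R -> R),
    (forall x, derivable_pt_lim u x (u1 x)) /\
    (forall x, derivable_pt_lim u1 x (u2 x)) /\
    (forall x, - u2 x + (a x - k) ^ 2 * u x = E * u x) /\
    (exists x, u x <> 0) /\
    sq_integrable u.

Definition is_band (a : R -> R) (n : nat) (k E : R) : Prop :=
  is_eigenvalue a k E /\
  exists l : list R, length l = (n - 1)%nat /\ NoDup l /\
    forall y, In y l <-> (is_eigenvalue a k y /\ y < E).

Definition is_eps (bd : nat -> R -> R) (a : R -> R) (sigma tau k e : R) : Prop :=
  exists xk S,
    a xk = k /\
    is_lub (fun s => exists x, sigma * k < x /\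
                     s = Rabs (bd 1%nat x * bd 2%nat x) + Rabs (bd 3%nat x)) S /\
    e = (bd 1%nat xk) ^ 2 + S + exp (- tau * k ^ 2).

(* Main.v *)
Require Import Defs.
From Stdlib Require Import Reals Lra Lia List FinFun Classical IndefiniteDescription.
From Coquelicot Require Import Coquelicot.
Open Scope R_scope.

(** With x_k = a^{-1}(k), the substitution x = x_k + z / sqrt(b_k) turns h(k + sqrt(b_k) s)
    into b_k times -d^2/dz^2 + (al(z) - s)^2, where al(z) = z (1 + O(b_k' cosh (c z))) is a small
    perturbation of z in an exponentially weighted sense.  The harmonic oscillator has a spectral
    gap (ladder operators), exponential weights cost nothing because the potential confines, so
    eigenfunctions near 2j+1 are close to the Hermite functions in every exponentially weighted
    norm; the eigenvalue exists because 1/<(h - lam)^{-1} phi_j, phi_j> changes sign.  In the shift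
    s the first derivative is the Feynman-Hellmann slope, and the difference quotient of the
    eigenfunction is -u' up to a small correction, which gives the second one.  Taylor expanding al
    to second order and using the moments of the Hermite functions yields the three expansions.
    The remainder of the expansion of b is bounded by |b'''(x_k)| times an exponential weight:
    b''' decays subexponentially by (b), so the weight also absorbs the far field. *)

(** The delicate point is the precision of the second derivative: replacing the difference quotient
    by -u' costs an error of order ep, about |b'(x_k)|, while the target only allows ep^2. That
    error enters through a pairing; symmetry of the operator turns the pairing into explicit terms
    in u', and what is left pairs two quantities of order ep. No abstract spectral theory is used:
    integrals are limits over [-n, n] of continuous functions decaying faster than every
    exponential, and the resolvent is obtained by matching at 0 the ODE solutions that decay at one
    end. The n-th eigenvalue is located by counting, each of the first n windows [2i, 2i+2]
    containing exactly one rescaled eigenvalue. Since al changes with k, every constant must be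
    uniform over all admissible profiles; the O-estimates are therefore stated over an arbitrary
    index type, later instantiated with a record of all the data. The picture is re-centred at each
    k, so the expansions are needed only at s = 0. *)

Ltac mult_pos :=
  repeat match goal with |- 0 <= _ * _ => apply Rmult_le_pos end; try lra.

(* [ring] does not see through Coquelicot's canonical carriers of R. *)
Ltac ringR :=
  match goal with |- @eq _ ?a ?b => let H := fresh in assert (H : @eq R a b) by ring; exact H end.

(** * Exponential weights *)

(** This is 2 cosh(c z), preferred to exp(c |z|) because it is smooth: its second derivative is c^2
    times itself, which keeps weighted integrations by parts in closed form. *)
Definition Wt (c z : R) : R := exp (c * z) + exp (- (c * z)).

Lemma Wt_opp_l (c z : R) : Wt (- c) z = Wt c z.
Proof.
  unfold Wt. replace (- c * z) with (- (c * z)) by ring. rewrite Ropp_involutive. ring.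
Qed.

Lemma Wt_opp_r (c z : R) : Wt c (- z) = Wt c z.
Proof.
  unfold Wt. replace (c * - z) with (- (c * z)) by ring. rewrite Ropp_involutive. ring.
Qed.

Lemma Wt_pos (c z : R) : 0 < Wt c z.
Proof. unfold Wt. generalize (exp_pos (c * z)), (exp_pos (- (c * z))). lra. Qed.

(** With p = exp(a z) and q = exp((b - a) z) the difference is (q - 1)(p^2 q - 1)/(p q), and both
    factors of the numerator have the sign of z. *)
Lemma Wt_mono (a b z : R) : 0 <= a <= b -> Wt a z <= Wt b z.
Proof.
  intros Hab. unfold Wt.
  replace (b * z) with (a * z + (b - a) * z) by ring.
  replace (- (a * z + (b - a) * z)) with (- (a * z) + - ((b - a) * z)) by ring.
  rewrite !exp_plus, !exp_Ropp.
  set (p := exp (a * z)). set (q := exp ((b - a) * z)).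
  assert (Hp : 0 < p) by apply exp_pos. assert (Hq : 0 < q) by apply exp_pos.
  assert (H : 0 <= (q - 1) * (p * p * q - 1)).
  { destruct (Rle_or_lt 0 z) as [Hz | Hz].
    - assert (1 <= p). { unfold p. rewrite <- exp_0.
        destruct (Req_dec (a * z) 0) as [-> | Hn]; [lra | left; apply exp_increasing; nra]. }
      assert (1 <= q). { unfold q. rewrite <- exp_0.
        destruct (Req_dec ((b - a) * z) 0) as [-> | Hn]; [lra | left; apply exp_increasing; nra]. }
      apply Rmult_le_pos; nra.
    - assert (p <= 1). { unfold p. rewrite <- exp_0.
        destruct (Req_dec (a * z) 0) as [-> | Hn]; [lra | left; apply exp_increasing; nra]. }
      assert (q <= 1). { unfold q. rewrite <- exp_0.
        destruct (Req_dec ((b - a) * z) 0) as [-> | Hn]; [lra | left; apply exp_increasing; nra]. }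
      assert (p * p * q <= 1) by nra. nra. }
  assert (E : p * q + / p * / q - (p + / p) = (q - 1) * (p * p * q - 1) * (/ p * / q)) by (field; lra).
  assert (0 <= / p * / q) by (apply Rmult_le_pos; left; apply Rinv_0_lt_compat; assumption).
  nra.
Qed.

Lemma Wt_0 (z : R) : Wt 0 z = 2.
Proof. unfold Wt. rewrite Rmult_0_l, Ropp_0, exp_0. ring. Qed.

Lemma Wt_ge2 (c z : R) : 0 <= c -> 2 <= Wt c z.
Proof. intros Hc. rewrite <- (Wt_0 z). apply Wt_mono. lra. Qed.

(** Product formula for cosh: the product equals Wt (a + b) z + Wt (a - b) z, and the first term
    dominates the second. *)
Lemma Wt_mult (a b z : R) : 0 <= a -> 0 <= b -> Wt a z * Wt b z <= 2 * Wt (a + b) z.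
Proof.
  intros Ha Hb.
  assert (E : Wt a z * Wt b z = Wt (a + b) z + Wt (a - b) z).
  { unfold Wt.
    replace ((a + b) * z) with (a * z + b * z) by ring.
    replace ((a - b) * z) with (a * z + - (b * z)) by ring.
    replace (- (a * z + b * z)) with (- (a * z) + - (b * z)) by ring.
    replace (- (a * z + - (b * z))) with (- (a * z) + b * z) by ring.
    rewrite !exp_plus. ring. }
  assert (Wt (a - b) z <= Wt (a + b) z).
  { destruct (Rle_or_lt 0 (a - b)).
    - apply Wt_mono. lra.
    - rewrite <- Wt_opp_l. apply Wt_mono. lra. }
  lra.
Qed.

Lemma exp_mono (x y : R) : x <= y -> exp x <= exp y.
Proof. intros [H | ->]; [left; now apply exp_increasing | lra]. Qed.

Lemma exp_le_Wt (c z : R) : exp (c * z) <= Wt c z.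
Proof. unfold Wt. generalize (exp_pos (- (c * z))). lra. Qed.

Lemma exp_abs_le_Wt (c z : R) : exp (c * Rabs z) <= Wt c z.
Proof.
  destruct (Rle_or_lt 0 z) as [Hz | Hz].
  - rewrite Rabs_pos_eq by assumption. apply exp_le_Wt.
  - rewrite Rabs_left by assumption. rewrite <- (Wt_opp_r c z). apply exp_le_Wt.
Qed.

Lemma Wt_le_exp_abs (c z : R) : 0 <= c -> Wt c z <= 2 * exp (c * Rabs z).
Proof.
  intros Hc. unfold Wt.
  assert (exp (c * z) <= exp (c * Rabs z)).
  { apply exp_mono, Rmult_le_compat_l; [assumption | apply Rle_abs]. }
  assert (exp (- (c * z)) <= exp (c * Rabs z)).
  { apply exp_mono. rewrite <- Ropp_mult_distr_r_reverse. apply Rmult_le_compat_l; [assumption |].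
    rewrite <- Rabs_Ropp. apply Rle_abs. }
  lra.
Qed.

Lemma abs_le_Wt1 (z : R) : Rabs z <= Wt 1 z.
Proof.
  apply Rle_trans with (2 := exp_abs_le_Wt 1 z). rewrite Rmult_1_l.
  generalize (exp_ineq1_le (Rabs z)). lra.
Qed.

(** [Wt] is symmetric in its two arguments, so monotonicity in |z| is monotonicity in the
    exponent. *)
Lemma Wt_le_Rabs (c z w : R) : 0 <= c -> Rabs z <= Rabs w -> Wt c z <= Wt c w.
Proof.
  intros Hc H.
  assert (K : forall a, Wt c a = Wt c (Rabs a)).
  { intros a. unfold Rabs. destruct (Rcase_abs a); [now rewrite Wt_opp_r | reflexivity]. }
  rewrite (K z), (K w).
  assert (E : forall a, Wt c a = Wt a c) by (intros; unfold Wt; now rewrite (Rmult_comm c a)).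
  rewrite (E (Rabs z)), (E (Rabs w)). apply Wt_mono. split; [apply Rabs_pos | assumption].
Qed.

Lemma is_derive_Wt (c z : R) :
  is_derive (Wt c) z (c * (exp (c * z) - exp (- (c * z)))).
Proof. unfold Wt. auto_derive; [trivial | ring]. Qed.

Lemma continuous_Wt (c z : R) : continuous (Wt c) z.
Proof. apply (@ex_derive_continuous R_AbsRing R_NormedModule). eexists. apply is_derive_Wt. Qed.

(** * Rapidly decaying functions *)

(** Plays the part of a Schwartz space. As the exponent is arbitrary, the class absorbs every factor
    of exponential growth, and integrations by parts leave no boundary terms. *)
Definition fast (f : R -> R) : Prop :=
  (forall x, continuous f x) /\
  forall c, 0 <= c -> exists C, forall z, Rabs (f z) * Wt c z <= C.

Definition slow (f : R -> R) : Prop :=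
  (forall x, continuous f x) /\
  exists c C, 0 <= c /\ 0 <= C /\ forall z, Rabs (f z) <= C * Wt c z.

Lemma fast_ext (f g : R -> R) : (forall z, f z = g z) -> fast f -> fast g.
Proof.
  intros E [H1 H2]. split.
  - intros x. apply continuous_ext with f; auto.
  - intros c Hc. destruct (H2 c Hc) as [C HC]. exists C. intros z. rewrite <- E. apply HC.
Qed.

Lemma fast_slow (f : R -> R) : fast f -> slow f.
Proof.
  intros [H1 H2]. split; [assumption |].
  destruct (H2 0) as [C HC]; [lra |].
  exists 0, (Rabs C). split; [lra |]. split; [apply Rabs_pos |].
  intros z. specialize (HC z). rewrite Wt_0 in *.
  generalize (Rle_abs C), (Rabs_pos (f z)). lra.
Qed.

Lemma slow_const (a : R) : slow (fun _ => a).
Proof.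
  split.
  - intros x. apply continuous_const.
  - exists 0, (Rabs a). split; [lra |]. split; [apply Rabs_pos |].
    intros z. rewrite Wt_0. generalize (Rabs_pos a). lra.
Qed.

Lemma slow_id : slow (fun z => z).
Proof.
  split.
  - intros x. apply continuous_id.
  - exists 1, 1. split; [lra |]. split; [lra |].
    intros z. generalize (abs_le_Wt1 z). lra.
Qed.

Lemma slow_Wt (c : R) : 0 <= c -> slow (Wt c).
Proof.
  intros Hc. split.
  - intros x. apply continuous_Wt.
  - exists c, 1. split; [lra |]. split; [lra |].
    intros z. rewrite Rabs_pos_eq; [lra | left; apply Wt_pos].
Qed.

Lemma slow_plus (f g : R -> R) : slow f -> slow g -> slow (fun z => f z + g z).
Proof.
  intros [H1 [c [C [Hc [HC H2]]]]] [K1 [d [D [Hd [HD K2]]]]]. split.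
  - intros x. apply @continuous_plus with (f := f) (g := g); auto.
  - exists (c + d), (C + D). split; [lra |]. split; [lra |].
    intros z. eapply Rle_trans; [apply Rabs_triang |].
    specialize (H2 z). specialize (K2 z).
    assert (Wt c z <= Wt (c + d) z) by (apply Wt_mono; lra).
    assert (Wt d z <= Wt (c + d) z) by (apply Wt_mono; lra).
    nra.
Qed.

Lemma slow_mult (f g : R -> R) : slow f -> slow g -> slow (fun z => f z * g z).
Proof.
  intros [H1 [c [C [Hc [HC H2]]]]] [K1 [d [D [Hd [HD K2]]]]]. split.
  - intros x. apply @continuous_mult with (f := f) (g := g); auto.
  - exists (c + d), (2 * (C * D)). split; [lra |]. split; [apply Rmult_le_pos; [lra | now apply Rmult_le_pos] |].
    intros z. rewrite Rabs_mult.
    apply Rle_trans with ((C * Wt c z) * (D * Wt d z)).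
    + apply Rmult_le_compat; auto using Rabs_pos.
    + generalize (Wt_mult c d z Hc Hd). assert (0 <= C * D) by now apply Rmult_le_pos. nra.
Qed.

Lemma slow_opp (f : R -> R) : slow f -> slow (fun z => - f z).
Proof.
  intros [H1 [c [C [Hc [HC H2]]]]]. split.
  - intros x. apply @continuous_opp with (f := f); auto.
  - exists c, C. split; [lra |]. split; [lra |]. intros z. rewrite Rabs_Ropp. apply H2.
Qed.

Lemma slow_minus (f g : R -> R) : slow f -> slow g -> slow (fun z => f z - g z).
Proof. intros Hf Hg. now apply slow_plus, slow_opp. Qed.

Lemma slow_pow (f : R -> R) (n : nat) : slow f -> slow (fun z => f z ^ n).
Proof.
  intros Hf. induction n as [| n IH]; simpl.
  - apply slow_const.
  - now apply slow_mult.
Qed.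

Lemma slow_div (f : R -> R) (a : R) : slow f -> slow (fun z => f z / a).
Proof. intros Hf. apply slow_mult; [assumption | apply slow_const]. Qed.

Lemma fast_mult_l (f g : R -> R) : fast f -> slow g -> fast (fun z => f z * g z).
Proof.
  intros [H1 H2] [K1 [d [D [Hd [HD K2]]]]]. split.
  - intros x. apply @continuous_mult with (f := f) (g := g); auto.
  - intros c Hc. destruct (H2 (c + d)) as [C HC]; [lra |].
    exists (2 * D * C). intros z. rewrite Rabs_mult.
    specialize (HC z). specialize (K2 z).
    generalize (Wt_mult c d z Hc Hd), (Rabs_pos (f z)), (Wt_pos c z). intros W A B.
    apply Rle_trans with (Rabs (f z) * (D * Wt d z) * Wt c z).
    + apply Rmult_le_compat_r; [lra |]. now apply Rmult_le_compat_l.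
    + assert (0 <= D * Rabs (f z)) by now apply Rmult_le_pos.
      nra.
Qed.

Lemma fast_mult_r (f g : R -> R) : slow f -> fast g -> fast (fun z => f z * g z).
Proof.
  intros Hf Hg. apply fast_ext with (fun z => g z * f z); [intros; ring |]. now apply fast_mult_l.
Qed.

Lemma fast_plus (f g : R -> R) : fast f -> fast g -> fast (fun z => f z + g z).
Proof.
  intros [H1 H2] [K1 K2]. split.
  - intros x. apply @continuous_plus with (f := f) (g := g); auto.
  - intros c Hc. destruct (H2 c Hc) as [C HC]. destruct (K2 c Hc) as [D HD].
    exists (C + D). intros z. specialize (HC z). specialize (HD z).
    apply Rle_trans with ((Rabs (f z) + Rabs (g z)) * Wt c z).
    + apply Rmult_le_compat_r; [left; apply Wt_pos | apply Rabs_triang].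
    + lra.
Qed.

Lemma fast_opp (f : R -> R) : fast f -> fast (fun z => - f z).
Proof.
  intros Hf. apply fast_ext with (fun z => -1 * f z); [intros; ring |].
  apply fast_mult_r; [apply slow_const | assumption].
Qed.

Lemma fast_minus (f g : R -> R) : fast f -> fast g -> fast (fun z => f z - g z).
Proof. intros Hf Hg. now apply fast_plus, fast_opp. Qed.

Lemma fast_pow (f : R -> R) (n : nat) : fast f -> fast (fun z => f z ^ S n).
Proof.
  intros Hf. apply fast_mult_l; [assumption |]. now apply slow_pow, fast_slow.
Qed.

Lemma fast_div (f : R -> R) (a : R) : fast f -> fast (fun z => f z / a).
Proof. intros Hf. apply fast_mult_l; [assumption | apply slow_const]. Qed.

Ltac slow_tac :=
  lazymatch goal with
  | |- slow (fun z => _ + _) => apply slow_plus; slow_tac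
  | |- slow (fun z => _ - _) => apply slow_minus; slow_tac
  | |- slow (fun z => _ * _) => apply slow_mult; slow_tac
  | |- slow (fun z => - _) => apply slow_opp; slow_tac
  | |- slow (fun z => _ ^ _) => apply slow_pow; slow_tac
  | |- slow (fun z => _ / _) => apply slow_div; slow_tac
  | |- slow (fun z => z) => apply slow_id
  | |- slow (Rmult ?a) => apply (slow_mult (fun _ => a) (fun z => z)); slow_tac
  | |- slow (Rplus ?a) => apply (slow_plus (fun _ => a) (fun z => z)); slow_tac
  | |- slow (Rminus ?a) => apply (slow_minus (fun _ => a) (fun z => z)); slow_tac
  | |- slow Ropp => apply (slow_opp (fun z => z)); slow_tac
  | |- slow (fun z => ?a) => apply slow_const
  | |- slow (fun z => Wt ?c z) => apply slow_Wt; first [assumption | lra | idtac]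
  | |- slow (Wt ?c) => apply slow_Wt; first [assumption | lra | idtac]
  | |- slow _ => first [assumption | apply fast_slow; assumption | eauto]
  end.

Ltac fast_tac :=
  lazymatch goal with
  | |- fast (fun z => _ + _) => apply fast_plus; fast_tac
  | |- fast (fun z => _ - _) => apply fast_minus; fast_tac
  | |- fast (fun z => - _) => apply fast_opp; fast_tac
  | |- fast (fun z => _ ^ S _) => apply fast_pow; fast_tac
  | |- fast (fun z => _ / _) => apply fast_div; fast_tac
  | |- fast (fun z => _ * _) =>
      first [ solve [apply fast_mult_r; [solve [slow_tac] | solve [fast_tac]]]
            | solve [apply fast_mult_l; [solve [fast_tac] | solve [slow_tac]]] ]
  | |- fast _ => solve [assumption | eauto]
  end.

(** * Integration over the line *)

(** [Lim_seq] and [real] make this total, with a default value if there is no finite limit; the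
    linearity and order rules therefore assume [fast], under which the limit exists. *)
Definition integ (f : R -> R) : R :=
  real (Lim_seq (fun n => RInt f (- INR n) (INR n))).

Lemma ex_RInt_cont (f : R -> R) (a b : R) : (forall x, continuous f x) -> ex_RInt f a b.
Proof. intros H. apply (@ex_RInt_continuous R_CompleteNormedModule). auto. Qed.

Lemma fast_exp_bound (f : R -> R) (c : R) : 0 <= c -> fast f ->
  exists C, 0 <= C /\ forall z, Rabs (f z) <= C * exp (- (c * Rabs z)).
Proof.
  intros Hc [_ H]. destruct (H c Hc) as [C HC]. exists C. split.
  - specialize (HC 0). generalize (Rabs_pos (f 0)), (Wt_pos c 0). nra.
  - intros z. specialize (HC z). rewrite exp_Ropp.
    apply Rmult_le_reg_r with (exp (c * Rabs z)); [apply exp_pos |].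
    rewrite Rmult_assoc, Rinv_l by (generalize (exp_pos (c * Rabs z)); lra).
    rewrite Rmult_1_r. apply Rle_trans with (2 := HC).
    apply Rmult_le_compat_l; [apply Rabs_pos | apply exp_abs_le_Wt].
Qed.

Lemma RInt_exp_tail (C c a b : R) : 0 < c -> 0 <= C -> a <= b ->
  RInt (fun x => C * exp (- (c * x))) a b <= C / c * exp (- (c * a)).
Proof.
  intros Hc HC Hab.
  rewrite (is_RInt_unique _ a b (- C / c * exp (- (c * b)) - - C / c * exp (- (c * a)))).
  - assert (0 <= C / c) by (apply Rmult_le_pos; [assumption | left; now apply Rinv_0_lt_compat]).
    generalize (exp_pos (- (c * b))). intros.
    replace (- C / c) with (- (C / c)) by (field; lra). nra.
  - apply (@is_RInt_derive R_CompleteNormedModule (fun x => - C / c * exp (- (c * x)))).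
    + intros x _. auto_derive; [trivial | field; lra].
    + intros x _. apply (@ex_derive_continuous R_AbsRing R_NormedModule). auto_derive. trivial.
Qed.

Lemma RInt_tail_bound (f : R -> R) (C c a b : R) : 0 < c -> 0 <= C -> a <= b ->
  (forall x, continuous f x) ->
  (forall x, a <= x -> Rabs (f x) <= C * exp (- (c * x))) ->
  Rabs (RInt f a b) <= C / c * exp (- (c * a)).
Proof.
  intros Hc HC Hab Hf H.
  apply Rle_trans with (2 := RInt_exp_tail C c a b Hc HC Hab).
  apply Rle_trans with (RInt (fun x => Rabs (f x)) a b).
  - apply abs_RInt_le; [lra | now apply ex_RInt_cont].
  - apply RInt_le; [lra | | |].
    + apply ex_RInt_cont. intros x. apply continuous_comp; [apply Hf |].
      apply (continuous_Rabs (f x)).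
    + apply ex_RInt_cont. intros x. apply (@ex_derive_continuous R_AbsRing R_NormedModule). auto_derive. trivial.
    + intros x Hx. apply H. lra.
Qed.

Lemma RInt_opp_arg (f : R -> R) (a b : R) : (forall x, continuous f x) ->
  RInt (fun x => f (- x)) a b = RInt f (- b) (- a).
Proof.
  intros Hf.
  assert (E : RInt (fun y => scal (-1) (f (-1 * y + 0))) a b = RInt f (-1 * a + 0) (-1 * b + 0)).
  { apply (@RInt_comp_lin R_CompleteNormedModule f (-1) 0 a b). now apply ex_RInt_cont. }
  replace (-1 * a + 0) with (- a) in E by ring. replace (-1 * b + 0) with (- b) in E by ring.
  rewrite <- (opp_RInt_swap f (- a) (- b)) by now apply ex_RInt_cont.
  rewrite <- E.
  assert (E2 : RInt (fun y => scal (-1) (f (-1 * y + 0))) a b = -1 * RInt (fun y => f (- y)) a b).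
  { transitivity (RInt (fun y => scal (-1) (f (- y))) a b).
    - apply RInt_ext. intros x _. do 2 f_equal. ring.
    - apply (@RInt_scal R_CompleteNormedModule (fun y => f (- y)) a b (-1)).
      apply ex_RInt_cont. intros x. apply (continuous_comp Ropp f); [| apply Hf].
      apply (@continuous_opp _ R_AbsRing R_NormedModule (fun x => x)), continuous_id. }
  rewrite E2. assert (Z : forall r : R, r = - (-1 * r)) by (intros; ring). apply Z.
Qed.

Lemma fast_opp_arg (f : R -> R) : fast f -> fast (fun x => f (- x)).
Proof.
  intros [H1 H2]. split.
  - intros x. apply (continuous_comp Ropp f); [| apply H1].
    apply (@continuous_opp _ R_AbsRing R_NormedModule (fun x => x)), continuous_id.
  - intros c Hc. destruct (H2 c Hc) as [C HC]. exists C. intros z.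
    rewrite <- (Wt_opp_r c z). apply HC.
Qed.

Lemma integ_tail (f : R -> R) : fast f ->
  exists C, 0 <= C /\ forall a b, 0 <= a <= b ->
    Rabs (RInt f a b) <= C * exp (- a) /\ Rabs (RInt f (- b) (- a)) <= C * exp (- a).
Proof.
  intros Hf. destruct (fast_exp_bound f 1 Rle_0_1 Hf) as [C [HC HB]].
  exists C. split; [assumption |]. intros a b Hab.
  split.
  - replace (C * exp (- a)) with (C / 1 * exp (- (1 * a))) by (rewrite Rmult_1_l; field).
    apply RInt_tail_bound; try lra; [apply Hf |].
    intros x Hx. rewrite <- (Rabs_pos_eq x) at 2 by lra. apply HB.
  - rewrite <- RInt_opp_arg by apply Hf.
    replace (C * exp (- a)) with (C / 1 * exp (- (1 * a))) by (rewrite Rmult_1_l; field).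
    apply RInt_tail_bound; try lra; [apply fast_opp_arg, Hf |].
    intros x Hx. rewrite <- (Rabs_pos_eq x) at 2 by lra.
    rewrite <- (Rabs_Ropp x). apply HB.
Qed.

Lemma exp_opp_small (eps : R) : 0 < eps -> exists n0 : nat, forall n, (n0 <= n)%nat -> exp (- INR n) < eps.
Proof.
  intros He. destruct (INR_unbounded (/ eps)) as [n0 Hn0]. exists n0. intros n Hn.
  rewrite exp_Ropp. rewrite <- (Rinv_inv eps).
  assert (0 < / eps) by now apply Rinv_0_lt_compat.
  apply Rinv_lt_contravar.
  - apply Rmult_lt_0_compat; [assumption | apply exp_pos].
  - apply le_INR in Hn. generalize (exp_ineq1_le (INR n)). lra.
Qed.

Lemma is_lim_integ (f : R -> R) : fast f ->
  is_lim_seq (fun n => RInt f (- INR n) (INR n)) (integ f).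
Proof.
  intros Hf. apply Lim_seq_correct'.
  apply ex_lim_seq_cauchy_corr. intros eps.
  destruct (integ_tail f Hf) as [C [HC HT]].
  destruct (exp_opp_small (eps / (4 * (C + 1)))) as [n0 Hn0].
  { apply Rdiv_lt_0_compat; [apply cond_pos | lra]. }
  assert (K : forall n m, (n0 <= n)%nat -> (n <= m)%nat ->
    Rabs (RInt f (- INR n) (INR n) - RInt f (- INR m) (INR m)) < eps).
  { intros n m Hn Hm.
    assert (Hnm : 0 <= INR n <= INR m) by (split; [apply pos_INR | now apply le_INR]).
    destruct (HT _ _ Hnm) as [T1 T2].
    assert (E : RInt f (- INR m) (INR m) =
      RInt f (- INR m) (- INR n) + RInt f (- INR n) (INR n) + RInt f (INR n) (INR m)).
    { rewrite <- (RInt_Chasles f (- INR m) (- INR n) (INR m)) by (apply ex_RInt_cont, Hf).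
      rewrite <- (RInt_Chasles f (- INR n) (INR n) (INR m)) by (apply ex_RInt_cont, Hf).
      unfold plus; simpl. ring. }
    specialize (Hn0 n Hn).
    assert (S : C * exp (- INR n) <= eps / 4).
    { apply Rle_trans with ((C + 1) * (eps / (4 * (C + 1)))).
      - apply Rmult_le_compat; try lra. left. apply exp_pos.
      - right. field. lra. }
    generalize (cond_pos eps). intros.
    apply Rabs_def1; apply Rabs_le_between in T1; apply Rabs_le_between in T2; lra. }
  exists n0. intros n m Hn Hm.
  destruct (Nat.le_ge_cases n m).
  - apply K; assumption.
  - rewrite Rabs_minus_sym. apply K; assumption.
Qed.

Lemma integ_eq (f : R -> R) (l : R) :
  is_lim_seq (fun n => RInt f (- INR n) (INR n)) l -> integ f = l.
Proof. intros H. unfold integ. now rewrite (is_lim_seq_unique _ _ H). Qed.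

Lemma integ_ext (f g : R -> R) : (forall z, f z = g z) -> integ f = integ g.
Proof.
  intros E. unfold integ. f_equal. apply Lim_seq_ext. intros n. apply RInt_ext. intros; apply E.
Qed.

Lemma integ_plus (f g : R -> R) : fast f -> fast g ->
  integ (fun z => f z + g z) = integ f + integ g.
Proof.
  intros Hf Hg. apply integ_eq.
  apply is_lim_seq_ext with (fun n => RInt f (- INR n) (INR n) + RInt g (- INR n) (INR n)).
  - intros n. symmetry. apply (RInt_plus f g); apply ex_RInt_cont; [apply Hf | apply Hg].
  - apply is_lim_seq_plus'; now apply is_lim_integ.
Qed.

Lemma integ_scal (a : R) (f : R -> R) : fast f ->
  integ (fun z => a * f z) = a * integ f.
Proof.
  intros Hf. apply integ_eq.
  apply is_lim_seq_ext with (fun n => a * RInt f (- INR n) (INR n)).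
  - intros n. symmetry. apply (RInt_scal f (- INR n) (INR n) a); apply ex_RInt_cont, Hf.
  - apply (is_lim_seq_scal_l _ a (integ f)). now apply is_lim_integ.
Qed.

Lemma integ_opp (f : R -> R) : fast f -> integ (fun z => - f z) = - integ f.
Proof.
  intros Hf. replace (- integ f) with (-1 * integ f) by ring.
  rewrite <- integ_scal by assumption. apply integ_ext. intros; ring.
Qed.

Lemma integ_minus (f g : R -> R) : fast f -> fast g ->
  integ (fun z => f z - g z) = integ f - integ g.
Proof.
  intros Hf Hg. unfold Rminus. rewrite <- integ_opp by assumption.
  apply integ_plus; [assumption | now apply fast_opp].
Qed.

Lemma integ_le (f g : R -> R) : fast f -> fast g -> (forall z, f z <= g z) ->
  integ f <= integ g.
Proof.
  intros Hf Hg H.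
  apply (is_lim_seq_le (fun n => RInt f (- INR n) (INR n)) (fun n => RInt g (- INR n) (INR n))
    (integ f) (integ g)); [| now apply is_lim_integ..].
  intros n. generalize (pos_INR n). intros Hn.
  apply RInt_le; [lra | apply ex_RInt_cont, Hf | apply ex_RInt_cont, Hg | auto].
Qed.

Lemma integ_ge0 (f : R -> R) : fast f -> (forall z, 0 <= f z) -> 0 <= integ f.
Proof.
  intros Hf H. replace 0 with (0 * integ f) by ring. rewrite <- integ_scal by assumption.
  apply integ_le; [| assumption |].
  - apply fast_mult_r; [apply slow_const | assumption].
  - intros z. rewrite Rmult_0_l. apply H.
Qed.

Lemma is_lim_seq_fast (f : R -> R) : fast f ->
  is_lim_seq (fun n => f (INR n)) 0 /\ is_lim_seq (fun n => f (- INR n)) 0.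
Proof.
  intros Hf. destruct (fast_exp_bound f 1 Rle_0_1 Hf) as [C [HC HB]].
  assert (K : forall g : nat -> R, (forall n, Rabs (g n) <= C * exp (- INR n)) -> is_lim_seq g 0).
  { intros g Hg. apply is_lim_seq_spec. intros eps.
    destruct (exp_opp_small (eps / (C + 1))) as [n0 Hn0].
    { apply Rdiv_lt_0_compat; [apply cond_pos | lra]. }
    exists n0. intros n Hn. rewrite Rminus_0_r. apply Rle_lt_trans with (1 := Hg n).
    specialize (Hn0 n Hn). generalize (exp_pos (- INR n)). intros.
    apply Rlt_le_trans with ((C + 1) * (eps / (C + 1))).
    - nra.
    - right. field. lra. }
  split; apply K; intros n; eapply Rle_trans; [apply HB | | apply HB |];
    rewrite ?Rabs_Ropp, Rabs_pos_eq by apply pos_INR; rewrite Rmult_1_l; lra.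
Qed.

Lemma integ_derive (F f : R -> R) : fast F -> fast f -> (forall z, is_derive F z (f z)) ->
  integ f = 0.
Proof.
  intros HF Hf HD. apply integ_eq.
  apply is_lim_seq_ext with (fun n => F (INR n) - F (- INR n)).
  - intros n. symmetry. apply is_RInt_unique.
    apply (@is_RInt_derive R_CompleteNormedModule F f); intros; [apply HD | apply Hf].
  - replace 0 with (0 - 0) by ring.
    destruct (is_lim_seq_fast F HF). now apply is_lim_seq_minus'.
Qed.

Lemma integ_pos (f : R -> R) (z0 : R) : fast f -> (forall z, 0 <= f z) -> 0 < f z0 -> 0 < integ f.
Proof.
  intros Hf Hp H0.
  destruct (proj1 Hf z0 (fun y => f z0 / 2 < y)) as [d Hd].
  { apply (open_gt (f z0 / 2)). lra. }
  set (e := d / 2). assert (He : 0 < e) by (unfold e; generalize (cond_pos d); lra).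
  destruct (INR_unbounded (Rabs z0 + e)) as [n0 Hn0].
  assert (K : forall n, (n0 <= n)%nat -> e * f z0 <= RInt f (- INR n) (INR n)).
  { intros n Hn. apply le_INR in Hn.
    assert (- INR n <= z0 - e /\ z0 + e <= INR n) as [L1 L2].
    { assert (Hz : Rabs z0 <= INR n - e) by lra. apply Rabs_le_between in Hz. lra. }
    assert (ex : forall a b, ex_RInt f a b) by (intros; apply ex_RInt_cont, Hf).
    rewrite <- (RInt_Chasles f (- INR n) (z0 - e) (INR n)) by auto.
    rewrite <- (RInt_Chasles f (z0 - e) (z0 + e) (INR n)) by auto.
    unfold plus; simpl.
    assert (0 <= RInt f (- INR n) (z0 - e)) by (apply RInt_ge_0; auto).
    assert (0 <= RInt f (z0 + e) (INR n)) by (apply RInt_ge_0; auto).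
    assert (e * f z0 <= RInt f (z0 - e) (z0 + e)).
    { replace (e * f z0) with (RInt (fun _ => f z0 / 2) (z0 - e) (z0 + e)).
      - apply RInt_le; [lra | apply ex_RInt_const | auto |].
        intros x Hx. left. apply Hd. apply Rabs_def1; unfold minus, plus, opp; simpl; unfold e in *; lra.
      - rewrite RInt_const. unfold scal; simpl; unfold mult; simpl. field. }
    lra. }
  assert (Q : Rbar_le (e * f z0) (integ f)).
  { apply (is_lim_seq_le_loc (fun _ => e * f z0) (fun n => RInt f (- INR n) (INR n))).
    - exists n0. exact K.
    - apply is_lim_seq_const.
    - now apply is_lim_integ. }
  simpl in Q. nra.
Qed.

Lemma integ_sq_zero (f : R -> R) : fast f -> integ (fun z => f z ^ 2) <= 0 -> forall z, f z = 0.
Proof.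
  intros Hf H z. destruct (Req_dec (f z) 0) as [| N]; [assumption | exfalso].
  assert (0 < integ (fun z => f z ^ 2)); [| lra].
  apply integ_pos with z; [fast_tac | intros; apply pow2_ge_0 |].
  now apply pow2_gt_0.
Qed.

Lemma quadratic_discr (a b c : R) : 0 <= a -> (forall t, 0 <= a * t ^ 2 - 2 * b * t + c) -> b ^ 2 <= a * c.
Proof.
  intros Ha H. destruct (Req_dec a 0) as [-> | Hn].
  - assert (b = 0).
    { destruct (Req_dec b 0) as [| Hb]; [assumption | exfalso].
      (* At this t the degenerate polynomial c - 2 b t equals -1. *)
      specialize (H ((c + 1) / (2 * b))).
      replace (0 * ((c + 1) / (2 * b)) ^ 2 - 2 * b * ((c + 1) / (2 * b)) + c) with (-1) in H by (field; lra).
      lra. }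
    subst b. lra.
  - specialize (H (b / a)).
    replace (a * (b / a) ^ 2 - 2 * b * (b / a) + c) with ((a * c - b ^ 2) / a) in H by (field; lra).
    assert (0 <= a * c - b ^ 2); [| lra].
    apply Rmult_le_reg_r with (/ a); [apply Rinv_0_lt_compat; lra |]. rewrite Rmult_0_l. exact H.
Qed.

Lemma integ_cauchy_schwarz (f g : R -> R) : fast f -> fast g ->
  (integ (fun z => f z * g z)) ^ 2 <= integ (fun z => f z ^ 2) * integ (fun z => g z ^ 2).
Proof.
  intros Hf Hg. apply quadratic_discr.
  - apply integ_ge0; [fast_tac | intros; apply pow2_ge_0].
  - intros t.
    replace (integ (fun z => f z ^ 2) * t ^ 2 - 2 * integ (fun z => f z * g z) * t + integ (fun z => g z ^ 2))
      with (integ (fun z => (t * f z - g z) ^ 2)).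
    + apply integ_ge0; [fast_tac | intros; apply pow2_ge_0].
    + rewrite (integ_ext _ (fun z => t ^ 2 * f z ^ 2 - 2 * t * (f z * g z) + g z ^ 2)) by (intros; ring).
      rewrite integ_plus, integ_minus, !integ_scal by fast_tac. ring.
Qed.

(** * Hermite functions *)

(** Hermite functions H_j(z) exp(-z^2/2), unnormalized, with the physicists' polynomials H_j; the
    inner match encodes H_{-1} = 0 in the three-term recurrence. *)
Fixpoint hf (j : nat) (z : R) : R :=
  match j with
  | O => exp (- (z ^ 2 / 2))
  | S i => 2 * z * hf i z - 2 * INR i * match i with O => 0 | S l => hf l z end
  end.

Definition hf_pred (j : nat) (z : R) : R := match j with O => 0 | S l => hf l z end.

(** The lowering relation: d/dz + z sends [hf j] to 2 j times its predecessor. Likewise [hf2] is the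
    oscillator equation solved for the second derivative. *)
Definition hf1 (j : nat) (z : R) : R := 2 * INR j * hf_pred j z - z * hf j z.

Definition hf2 (j : nat) (z : R) : R := (z ^ 2 - (2 * INR j + 1)) * hf j z.

Definition hn (j : nat) : R := integ (fun z => hf j z ^ 2).

Lemma hf_S (j : nat) (z : R) : hf (S j) z = z * hf j z - hf1 j z.
Proof. unfold hf1, hf_pred. simpl hf. ring. Qed.

Lemma is_derive_multR (f g : R -> R) (z df dg : R) :
  is_derive f z df -> is_derive g z dg -> is_derive (fun y => f y * g y) z (df * g z + f z * dg).
Proof.
  intros Hf Hg. apply (is_derive_mult f g z df dg Hf Hg). intros; apply Rmult_comm.
Qed.

Lemma is_derive_plusR (f g : R -> R) (z df dg : R) :
  is_derive f z df -> is_derive g z dg -> is_derive (fun y => f y + g y) z (df + dg).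
Proof. apply (@is_derive_plus R_AbsRing R_NormedModule f g). Qed.

Lemma is_derive_minusR (f g : R -> R) (z df dg : R) :
  is_derive f z df -> is_derive g z dg -> is_derive (fun y => f y - g y) z (df - dg).
Proof. apply (@is_derive_minus R_AbsRing R_NormedModule f g). Qed.

Lemma is_derive_idR (z : R) : is_derive (fun y : R => y) z 1.
Proof. apply (is_derive_id z). Qed.

Lemma is_derive_hf (j : nat) (z : R) : is_derive (hf j) z (hf1 j z).
Proof.
  enough (H : is_derive (hf j) z (hf1 j z) /\ is_derive (hf (S j)) z (hf1 (S j) z)) by apply H.
  induction j as [| j [IH1 IH2]].
  - assert (D0 : is_derive (hf 0) z (hf1 0 z)).
    { unfold hf1, hf_pred, hf. auto_derive; [trivial |].
      replace (z * (z * 1) * / 2) with (z ^ 2 / 2) by field. field. }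
    split; [exact D0 |].
    apply is_derive_ext with (fun y => 2 * y * hf 0 y); [intros; simpl; ring |].
    evar_last.
    + apply is_derive_multR; [| exact D0]. apply is_derive_scal, is_derive_idR.
    + unfold hf1, hf_pred; simpl. ring.
  - split; [exact IH2 |].
    apply is_derive_ext with (fun y => 2 * y * hf (S j) y - 2 * INR (S j) * hf j y);
      [intros; reflexivity |].
    evar_last.
    + apply is_derive_minusR; [| apply is_derive_scal; exact IH1].
      apply is_derive_multR; [| exact IH2]. apply is_derive_scal, is_derive_idR.
    + unfold hf1, hf_pred.
      change (hf (S (S j)) z) with (2 * z * hf (S j) z - 2 * INR (S j) * hf j z).
      change (hf (S j) z) with (2 * z * hf j z - 2 * INR j * match j with O => 0 | S l => hf l z end).
      rewrite !S_INR. ring.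
Qed.

Lemma is_derive_hf1 (j : nat) (z : R) : is_derive (hf1 j) z (hf2 j z).
Proof.
  apply is_derive_ext with (fun y => y * hf j y - hf (S j) y).
  { intros. rewrite hf_S. lra. }
  evar_last.
  - apply is_derive_minusR; [| apply is_derive_hf].
    apply is_derive_multR; [apply is_derive_idR | apply is_derive_hf].
  - unfold hf2.
    unfold hf1 at 2. rewrite hf_S. unfold hf_pred. rewrite S_INR.
    ring.
Qed.

Lemma fast_hf0 : fast (hf 0).
Proof.
  split.
  - intros x. apply (@ex_derive_continuous R_AbsRing R_NormedModule). eexists. apply is_derive_hf.
  - intros c Hc. exists (2 * exp (c ^ 2 / 2)). intros z. simpl hf.
    rewrite Rabs_pos_eq by (left; apply exp_pos). unfold Wt.
    rewrite Rmult_plus_distr_l, <- !exp_plus.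
    assert (exp (- (z ^ 2 / 2) + c * z) <= exp (c ^ 2 / 2)).
    { apply exp_mono. generalize (pow2_ge_0 (z - c)). nra. }
    assert (exp (- (z ^ 2 / 2) + - (c * z)) <= exp (c ^ 2 / 2)).
    { apply exp_mono. generalize (pow2_ge_0 (z + c)). nra. }
    simpl in *. lra.
Qed.

Lemma fast_hf (j : nat) : fast (hf j).
Proof.
  enough (H : fast (hf j) /\ fast (hf (S j))) by apply H.
  induction j as [| j [IH1 IH2]].
  - split; [apply fast_hf0 |].
    apply fast_ext with (fun z => 2 * z * hf 0 z); [intros; simpl; ring |].
    generalize fast_hf0. intros. fast_tac.
  - split; [exact IH2 |].
    apply fast_ext with (fun y => 2 * y * hf (S j) y - 2 * INR (S j) * hf j y); [reflexivity |].
    fast_tac.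
Qed.

Lemma fast_hf1 (j : nat) : fast (hf1 j).
Proof.
  apply fast_ext with (fun y => y * hf j y - hf (S j) y).
  { intros. rewrite hf_S. lra. }
  generalize (fast_hf j), (fast_hf (S j)). intros. fast_tac.
Qed.

Lemma fast_hf2 (j : nat) : fast (hf2 j).
Proof. unfold hf2. generalize (fast_hf j). intros. fast_tac. Qed.

(** Operator domain with the derivatives carried as data; the decay of all three functions is what
    makes the operator symmetric on it. *)
Definition dom (w w1 w2 : R -> R) : Prop :=
  fast w /\ fast w1 /\ fast w2 /\
  (forall z, is_derive w z (w1 z)) /\ (forall z, is_derive w1 z (w2 z)).

Lemma dom_hf (j : nat) : dom (hf j) (hf1 j) (hf2 j).
Proof.
  exact (conj (fast_hf j) (conj (fast_hf1 j) (conj (fast_hf2 j)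
    (conj (is_derive_hf j) (is_derive_hf1 j))))).
Qed.

Lemma dom_plus_scal (a : R) (w w1 w2 v v1 v2 : R -> R) : dom w w1 w2 -> dom v v1 v2 ->
  dom (fun z => w z + a * v z) (fun z => w1 z + a * v1 z) (fun z => w2 z + a * v2 z).
Proof.
  intros (H0 & H1 & H2 & D0 & D1) (K0 & K1 & K2 & E0 & E1).
  split; [fast_tac |]. split; [fast_tac |]. split; [fast_tac |]. split.
  - intros z. apply is_derive_plusR; [apply D0 |].
    apply is_derive_scal, E0.
  - intros z. apply is_derive_plusR; [apply D1 |].
    apply is_derive_scal, E1.
Qed.

Lemma integ_dom_sym (w w1 w2 v v1 v2 : R -> R) : dom w w1 w2 -> dom v v1 v2 ->
  integ (fun z => w2 z * v z) = integ (fun z => w z * v2 z).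
Proof.
  intros (H0 & H1 & H2 & D0 & D1) (K0 & K1 & K2 & E0 & E1).
  assert (E : integ (fun z => w2 z * v z - w z * v2 z) = 0).
  { apply integ_derive with (fun z => w1 z * v z - w z * v1 z); [fast_tac.. |].
    intros z. evar_last.
    - apply is_derive_minusR; apply is_derive_multR; [apply D1 | apply E0 | apply D0 | apply E1].
    - ring. }
  rewrite integ_minus in E by fast_tac. lra.
Qed.

Lemma hn_pos (j : nat) : 0 < hn j.
Proof.
  assert (F := fast_hf).
  induction j as [| j IH].
  - apply integ_pos with 0; [fast_tac | intros; apply pow2_ge_0 |].
    apply pow2_gt_0. simpl. generalize (exp_pos (- (0 * (0 * 1) / 2))). lra.
  - assert (E : hn (S j) = 2 * INR (S j) * hn j); [| rewrite E].
    { unfold hn. rewrite <- integ_scal by (specialize (F j); fast_tac).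
      assert (Fj := F j).
      assert (Z : integ (fun z => 2 * INR (S j) * hf j z ^ 2 - hf (S j) z ^ 2) = 0).
      { apply integ_derive with (fun z => hf (S j) z * hf j z); [fast_tac.. |].
        intros z. evar_last; [apply is_derive_multR; apply is_derive_hf |].
        unfold hf1 at 1. simpl hf_pred. rewrite (hf_S j z). ring. }
      rewrite integ_minus in Z by fast_tac. lra. }
    apply Rmult_lt_0_compat; [| assumption]. rewrite S_INR. generalize (pos_INR j). lra.
Qed.

Lemma hf_orth (i j : nat) : i <> j -> integ (fun z => hf i z * hf j z) = 0.
Proof.
  intros Hij. generalize (fast_hf i), (fast_hf j). intros Fi Fj.
  generalize (integ_dom_sym _ _ _ _ _ _ (dom_hf i) (dom_hf j)). intros E.
  rewrite (integ_ext _ (fun z => z ^ 2 * hf i z * hf j z - (2 * INR i + 1) * (hf i z * hf j z))) in E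
    by (intros; unfold hf2; ring).
  rewrite (integ_ext (fun z => hf i z * hf2 j z)
    (fun z => z ^ 2 * hf i z * hf j z - (2 * INR j + 1) * (hf i z * hf j z))) in E
    by (intros; unfold hf2; ring).
  rewrite !integ_minus, !integ_scal in E by fast_tac.
  apply (f_equal (fun x => x)) in E.
  assert (INR i - INR j <> 0).
  { intros Q. apply Hij, INR_eq. lra. }
  apply Rmult_eq_reg_l with (INR i - INR j); [lra | assumption].
Qed.

(* The integrand is the derivative of
   [r (phi'^2 + (Lam - z^2) phi^2) - r' phi phi' + r'' phi^2 / 2]. *)
Lemma hf_hypervirial (j : nat) (r r1 r2 r3 : R -> R) : slow r -> slow r1 -> slow r2 -> slow r3 ->
  (forall z, is_derive r z (r1 z)) -> (forall z, is_derive r1 z (r2 z)) -> (forall z, is_derive r2 z (r3 z)) ->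
  integ (fun z => (2 * (2 * INR j + 1 - z ^ 2) * r1 z - 2 * z * r z + / 2 * r3 z) * hf j z ^ 2) = 0.
Proof.
  intros S0 S1 S2 S3 D0 D1 D2. assert (F0 := fast_hf j). assert (F1 := fast_hf1 j).
  apply integ_derive with (fun z => r z * (hf1 j z * hf1 j z + (2 * INR j + 1 - z * z) * (hf j z * hf j z))
    - r1 z * (hf j z * hf1 j z) + / 2 * (r2 z * (hf j z * hf j z))); [fast_tac.. |].
  intros z. evar_last.
  - apply is_derive_plusR; [apply is_derive_minusR |].
    + apply is_derive_multR; [apply D0 |]. apply is_derive_plusR.
      * apply is_derive_multR; apply is_derive_hf1.
      * apply is_derive_multR; [| apply is_derive_multR; apply is_derive_hf].
        apply is_derive_minusR; [apply is_derive_const |]. apply is_derive_multR; apply is_derive_idR.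
    + apply is_derive_multR; [apply D1 |]. apply is_derive_multR; [apply is_derive_hf | apply is_derive_hf1].
    + apply is_derive_scal. apply is_derive_multR; [apply D2 |]. apply is_derive_multR; apply is_derive_hf.
  - unfold hf2, zero; simpl. field.
Qed.

(** The hypervirial identity with r = 1, z, z^2, z^3 is a triangular system for the moments of
    orders 1 to 4. The quartic moment is the origin of gamma_n. *)
Lemma hf_moments (j : nat) :
  integ (fun z => z * hf j z ^ 2) = 0 /\
  integ (fun z => z ^ 2 * hf j z ^ 2) = (2 * INR j + 1) / 2 * hn j /\
  integ (fun z => z ^ 3 * hf j z ^ 2) = 0 /\
  integ (fun z => z ^ 4 * hf j z ^ 2) = 3 / 8 * ((2 * INR j + 1) ^ 2 + 1) * hn j.
Proof.
  set (L := 2 * INR j + 1). assert (F := fast_hf j).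
  assert (H0 := hf_hypervirial j (fun _ => 1) (fun _ => 0) (fun _ => 0) (fun _ => 0)).
  assert (H1 := hf_hypervirial j (fun z => z) (fun _ => 1) (fun _ => 0) (fun _ => 0)).
  assert (H2 := hf_hypervirial j (fun z => z ^ 2) (fun z => 2 * z) (fun _ => 2) (fun _ => 0)).
  assert (H3 := hf_hypervirial j (fun z => z ^ 3) (fun z => 3 * z ^ 2) (fun z => 6 * z) (fun _ => 6)).
  fold L in H0, H1, H2, H3.
  specialize (H0 ltac:(slow_tac) ltac:(slow_tac) ltac:(slow_tac) ltac:(slow_tac)
    ltac:(intros; auto_derive; [trivial | ring]) ltac:(intros; auto_derive; [trivial | ring]) ltac:(intros; auto_derive; [trivial | ring])).
  specialize (H1 ltac:(slow_tac) ltac:(slow_tac) ltac:(slow_tac) ltac:(slow_tac)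
    ltac:(intros; auto_derive; [trivial | ring]) ltac:(intros; auto_derive; [trivial | ring]) ltac:(intros; auto_derive; [trivial | ring])).
  specialize (H2 ltac:(slow_tac) ltac:(slow_tac) ltac:(slow_tac) ltac:(slow_tac)
    ltac:(intros; auto_derive; [trivial | ring]) ltac:(intros; auto_derive; [trivial | ring]) ltac:(intros; auto_derive; [trivial | ring])).
  specialize (H3 ltac:(slow_tac) ltac:(slow_tac) ltac:(slow_tac) ltac:(slow_tac)
    ltac:(intros; auto_derive; [trivial | ring]) ltac:(intros; auto_derive; [trivial | ring]) ltac:(intros; auto_derive; [trivial | ring])).
  rewrite (integ_ext _ (fun z => -2 * (z * hf j z ^ 2))) in H0 by (intros; field).
  rewrite (integ_ext _ (fun z => 2 * L * hf j z ^ 2 - 4 * (z ^ 2 * hf j z ^ 2))) in H1 by (intros; field).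
  rewrite (integ_ext _ (fun z => 4 * L * (z * hf j z ^ 2) - 6 * (z ^ 3 * hf j z ^ 2))) in H2 by (intros; field).
  rewrite (integ_ext _ (fun z => 6 * L * (z ^ 2 * hf j z ^ 2) - 8 * (z ^ 4 * hf j z ^ 2) + 3 * hf j z ^ 2)) in H3 by (intros; field).
  rewrite integ_scal in H0 by fast_tac. rewrite integ_minus, !integ_scal in H1 by fast_tac.
  rewrite integ_minus, !integ_scal in H2 by fast_tac. rewrite integ_plus, integ_minus, !integ_scal in H3 by fast_tac.
  fold (hn j) in H1, H3.
  assert (E1 : integ (fun z => z * hf j z ^ 2) = 0) by lra.
  assert (E2 : integ (fun z => z ^ 2 * hf j z ^ 2) = L / 2 * hn j) by lra.
  rewrite E1 in H2. rewrite E2 in H3.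
  split; [exact E1 |]. split; [exact E2 |]. split; lra.
Qed.

(** * The ladder inequality *)

(** The factor exp(-a^2/2) is kept in the bound because it must later cancel the growth exp(z^2/2)
    of the solutions of z w - w' = 0. *)
Lemma gauss_tail (v : R -> R) (m : R) : 0 < m -> fast v ->
  exists C, 0 <= C /\ forall a b, 0 <= a <= b ->
    Rabs (RInt (fun s => v s * hf 0 s) a b) <= C * (exp (- (a ^ 2 / 2)) * exp (- (m * a))).
Proof.
  intros Hm Hv. destruct (fast_exp_bound v m (Rlt_le _ _ Hm) Hv) as [C [HC HB]].
  exists (C / m). split; [apply Rmult_le_pos; [assumption | left; now apply Rinv_0_lt_compat] |].
  intros a b Hab.
  replace (C / m * (exp (- (a ^ 2 / 2)) * exp (- (m * a))))
    with (C * exp (- (a ^ 2 / 2)) / m * exp (- (m * a))) by (unfold Rdiv; ring).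
  apply RInt_tail_bound; try lra.
  - apply Rmult_le_pos; [assumption | left; apply exp_pos].
  - intros x. generalize fast_hf0. intros F. apply (proj1 (ltac:(fast_tac) : fast (fun s => v s * hf 0 s))).
  - intros x Hx. rewrite Rabs_mult. simpl hf. rewrite (Rabs_pos_eq (exp _)) by (left; apply exp_pos).
    specialize (HB x). rewrite (Rabs_pos_eq x) in HB by lra.
    assert (exp (- (x * (x * 1) / 2)) <= exp (- (a ^ 2 / 2))) by (apply exp_mono; nra).
    replace (C * exp (- (a ^ 2 / 2)) * exp (- (m * x))) with (C * exp (- (m * x)) * exp (- (a ^ 2 / 2))) by ring.
    apply Rmult_le_compat; auto using Rabs_pos. left; apply exp_pos.
Qed.

(** The limit c is fixed before the tail bound K, since the same c is used first with a crude K and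
    then with Gaussian tails. *)
Lemma half_line_limit (g : R -> R) (C : R) : (forall x, continuous g x) -> 0 <= C ->
  (forall a b, 0 <= a <= b -> Rabs (RInt g a b) <= C * exp (- a)) ->
  exists c, forall a K, 0 <= a -> (forall b, a <= b -> Rabs (RInt g a b) <= K) ->
    Rabs (c - RInt g 0 a) <= K /\ is_lim_seq (fun n => RInt g 0 (INR n)) c.
Proof.
  intros Hg HC HT.
  assert (ex : forall a b, ex_RInt g a b) by (intros; now apply ex_RInt_cont).
  assert (L : ex_finite_lim_seq (fun n => RInt g 0 (INR n))).
  { apply ex_lim_seq_cauchy_corr. intros eps.
    destruct (exp_opp_small (eps / (C + 1))) as [n0 Hn0].
    { apply Rdiv_lt_0_compat; [apply cond_pos | lra]. }
    assert (K : forall n m, (n0 <= n)%nat -> (n <= m)%nat ->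
      Rabs (RInt g 0 (INR n) - RInt g 0 (INR m)) < eps).
    { intros n m Hn Hm.
      assert (Hnm : 0 <= INR n <= INR m) by (split; [apply pos_INR | now apply le_INR]).
      specialize (HT _ _ Hnm).
      rewrite <- (RInt_Chasles g 0 (INR n) (INR m)) by auto. unfold plus; simpl.
      replace (RInt g 0 (INR n) - (RInt g 0 (INR n) + RInt g (INR n) (INR m)))
        with (- RInt g (INR n) (INR m)) by (assert (Z : forall p q : R, - q = p - (p + q)) by (intros; ring); apply Z).
      rewrite Rabs_Ropp. apply Rle_lt_trans with (1 := HT).
      specialize (Hn0 n Hn). generalize (exp_pos (- INR n)). intros.
      apply Rlt_le_trans with ((C + 1) * (eps / (C + 1))); [nra | right; field; lra]. }
    exists n0. intros n m Hn Hm. destruct (Nat.le_ge_cases n m).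
    - apply K; assumption.
    - rewrite Rabs_minus_sym. apply K; assumption. }
  destruct L as [c Hc]. exists c. intros a K Ha HK. split; [| assumption].
  destruct (INR_unbounded a) as [n0 Hn0].
  assert (Q : Rbar_le (Rabs (c - RInt g 0 a)) K).
  { apply (is_lim_seq_le_loc (fun n => Rabs (RInt g 0 (INR n) - RInt g 0 a)) (fun _ => K)).
    - exists n0. intros n Hn. apply le_INR in Hn.
      rewrite <- (RInt_Chasles g 0 a (INR n)) by auto. unfold plus; simpl.
      replace (RInt g 0 a + RInt g a (INR n) - RInt g 0 a)
        with (RInt g a (INR n)) by (assert (Z : forall p q : R, q = p + q - p) by (intros; ring); apply Z).
      apply HK. lra.
    - apply (is_lim_seq_abs _ (c - RInt g 0 a)).
      apply is_lim_seq_minus'; [assumption | apply is_lim_seq_const].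
    - apply is_lim_seq_const. }
  exact Q.
Qed.

(** Variation of constants for z w - w' = v: w is exp(z^2/2) times the integral of v [hf 0] over [z,
    oo). Orthogonality to the ground state makes this also minus the integral over (-oo, z], hence w
    decays at both ends. *)
Lemma creation_surjective (v : R -> R) : fast v -> integ (fun z => v z * hf 0 z) = 0 ->
  exists w w1, fast w /\ fast w1 /\ (forall z, is_derive w z (w1 z)) /\
    forall z, v z = z * w z - w1 z.
Proof.
  intros Hv HI.
  set (g := fun s => v s * hf 0 s).
  assert (F0 := fast_hf0).
  assert (Fg : fast g) by (unfold g; fast_tac).
  assert (Hv' := fast_opp_arg v Hv).
  assert (Fg' := fast_opp_arg g Fg).
  assert (ex : forall a b, ex_RInt g a b) by (intros; apply ex_RInt_cont, Fg).
  assert (Egm : forall a b, RInt (fun s => v (- s) * hf 0 s) a b = RInt (fun s => g (- s)) a b).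
  { intros a b. apply RInt_ext. intros x _. unfold g. simpl.
    replace (- x * (- x * 1)) with (x * (x * 1)) by ring. reflexivity. }
  destruct (integ_tail g Fg) as [C [HC HT]].
  destruct (half_line_limit g C) as [c Hc]; [apply Fg | assumption | intros; now apply HT |].
  destruct (half_line_limit (fun s => g (- s)) C) as [d Hd]; [apply Fg' | assumption | |].
  { intros a b Hab. rewrite RInt_opp_arg by apply Fg. now apply HT. }
  assert (Ecd : c = - d).
  { destruct (Hc 0 C) as [_ L1]; [lra | intros b Hb; destruct (HT 0 b) as [T _]; [lra |] |].
    { rewrite Ropp_0, exp_0, Rmult_1_r in T. exact T. }
    destruct (Hd 0 C) as [_ L2]; [lra | intros b Hb; destruct (HT 0 b) as [_ T]; [lra |] |].
    { rewrite RInt_opp_arg by apply Fg. rewrite Ropp_0, exp_0, Rmult_1_r in *. exact T. }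
    assert (L3 : is_lim_seq (fun n => RInt g (- INR n) (INR n)) (d + c)).
    { apply is_lim_seq_ext with (fun n => RInt (fun s => g (- s)) 0 (INR n) + RInt g 0 (INR n)).
      - intros n. rewrite RInt_opp_arg by apply Fg. rewrite Ropp_0. apply (RInt_Chasles g); auto.
      - now apply is_lim_seq_plus'. }
    apply integ_eq in L3. unfold g in L3. lra. }
  set (w := fun z => exp (z ^ 2 / 2) * (c - RInt g 0 z)).
  set (w1 := fun z => z * w z - v z).
  assert (Dw : forall z, is_derive w z (w1 z)).
  { intros z. evar_last.
    - apply is_derive_multR.
      + instantiate (1 := z * exp (z ^ 2 / 2)). auto_derive; [trivial |].
        replace (z ^ 2 / 2) with (z * (z * 1) * / 2) by (field; lra). field.
      + apply is_derive_minusR; [apply (is_derive_const c) |].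
        apply (is_derive_RInt g _ 0).
        * apply filter_forall. intros y. apply (@RInt_correct R_CompleteNormedModule). auto.
        * apply Fg.
    - unfold zero; simpl. unfold w1, w, g. simpl hf.
      replace (exp (z * (z * 1) / 2) * (0 - (v z * exp (- (z * (z * 1) / 2)))))
        with (- (v z * (exp (z * (z * 1) / 2) * exp (- (z * (z * 1) / 2))))) by ring.
      rewrite <- exp_plus, Rplus_opp_r, exp_0. simpl. ring. }
  assert (Fw : fast w).
  { split.
    - intros x. apply (@ex_derive_continuous R_AbsRing R_NormedModule). eexists. apply Dw.
    - intros e He.
      (* The rate e + 1 beats the weight e and stays positive for e = 0. *)
      destruct (gauss_tail v (e + 1)) as [A [HA TA]]; [lra | assumption |].
      destruct (gauss_tail (fun s => v (- s)) (e + 1)) as [B [HB TB]]; [lra | assumption |].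
      assert (W : forall K z, 0 <= K -> Rabs (c - RInt g 0 z) <= K * (exp (- (z ^ 2 / 2)) * exp (- ((e + 1) * Rabs z))) ->
        Rabs (w z) * Wt e z <= 2 * K).
      { intros K z HK H. unfold w. rewrite Rabs_mult, (Rabs_pos_eq (exp _)) by (left; apply exp_pos).
        apply Rle_trans with (exp (z ^ 2 / 2) * (K * (exp (- (z ^ 2 / 2)) * exp (- ((e + 1) * Rabs z)))) *
          (2 * exp (e * Rabs z))).
        - apply Rmult_le_compat.
          + apply Rmult_le_pos; [left; apply exp_pos | apply Rabs_pos].
          + left; apply Wt_pos.
          + apply Rmult_le_compat_l; [left; apply exp_pos | assumption].
          + now apply Wt_le_exp_abs.
        - replace (exp (z ^ 2 / 2) * (K * (exp (- (z ^ 2 / 2)) * exp (- ((e + 1) * Rabs z)))) * (2 * exp (e * Rabs z)))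
            with (2 * K * ((exp (z ^ 2 / 2) * exp (- (z ^ 2 / 2))) * (exp (- ((e + 1) * Rabs z)) * exp (e * Rabs z)))) by ring.
          rewrite <- (exp_plus (z ^ 2 / 2)), Rplus_opp_r, exp_0, Rmult_1_l, <- exp_plus.
          assert (exp (- ((e + 1) * Rabs z) + e * Rabs z) <= 1).
          { apply Rle_trans with (exp 0); [apply exp_mono | rewrite exp_0; lra].
            generalize (Rabs_pos z). lra. }
          nra. }
      exists (2 * (A + B)). intros z.
      destruct (Rle_or_lt 0 z) as [Hz | Hz].
      + apply Rle_trans with (2 * A); [| lra]. apply W; [assumption |].
        rewrite Rabs_pos_eq with (x := z) by assumption.
        apply (Hc z); [assumption |]. intros b Hb. apply TA. lra.
      + apply Rle_trans with (2 * B); [| lra]. apply W; [assumption |].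
        rewrite Rabs_left with (r := z) by assumption.
        replace (c - RInt g 0 z) with (- (d - RInt (fun s => g (- s)) 0 (- z))).
        * rewrite Rabs_Ropp. apply (Hd (- z)); [lra |]. intros b Hb.
          rewrite <- Egm. replace (z ^ 2) with ((- z) ^ 2) by ring. apply TB. lra.
        * rewrite RInt_opp_arg by apply Fg. rewrite Ropp_0, Ropp_involutive.
          rewrite <- (opp_RInt_swap g 0 z) by auto. rewrite Ecd.
          assert (Z : forall p q : R, - (p - - q) = - p - q) by (intros; ring). apply Z. }
  exists w, w1. split; [exact Fw |]. split; [unfold w1; fast_tac |]. split; [exact Dw |].
  intros z. unfold w1. ring.
Qed.

(* Surjectivity of the creation operator off the ground state turns the
   lower bound for [creation] into one for [annihilation]:
   if [v = A* w] then [|v|^2 = <w, A v>]. *)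
Lemma ladder_bound (J : nat) : forall v v1 : R -> R, fast v -> fast v1 ->
  (forall z, is_derive v z (v1 z)) ->
  (forall i, (i < J)%nat -> integ (fun z => v z * hf i z) = 0) ->
  2 * INR J * integ (fun z => v z ^ 2) <= integ (fun z => (v1 z + z * v z) ^ 2).
Proof.
  induction J as [| J IH]; intros v v1 Hv Hv1 Dv Ho.
  - rewrite Rmult_0_r, Rmult_0_l. apply integ_ge0; [fast_tac | intros; apply pow2_ge_0].
  - destruct (creation_surjective v Hv) as [w [w1 [Hw [Hw1 [Dw Evw]]]]]; [apply Ho; lia |].
    assert (Ow : forall i, (i < J)%nat -> integ (fun z => w z * hf i z) = 0).
    { intros i Hi. generalize (fast_hf i), (fast_hf (S i)), (fast_hf1 (S i)). intros F0 F1 F2.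
      assert (Z : integ (fun z => 2 * INR (S i) * (w z * hf i z) - v z * hf (S i) z) = 0).
      { apply integ_derive with (fun z => w z * hf (S i) z); [fast_tac.. |].
        intros z. evar_last; [apply is_derive_multR; [apply Dw | apply is_derive_hf] |].
        rewrite Evw. unfold hf1. simpl hf_pred. ring. }
      rewrite integ_minus, integ_scal, Ho in Z by (lia || fast_tac).
      apply Rmult_eq_reg_l with (2 * INR (S i)); [lra |]. rewrite S_INR. generalize (pos_INR i). lra. }
    specialize (IH w w1 Hw Hw1 Dw Ow).
    (* The commutation relation A A^* = A^* A + 2 in integrated form, with A = d/dz + z. *)
    assert (Q1 : integ (fun z => v z ^ 2) = integ (fun z => (w1 z + z * w z) ^ 2) + 2 * integ (fun z => w z ^ 2)).
    { assert (Z : integ (fun z => -2 * w z ^ 2 - 4 * (z * (w z * w1 z))) = 0).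
      { apply integ_derive with (fun z => -2 * (z * (w z * w z))); [fast_tac.. |].
        intros z. evar_last.
        - apply is_derive_scal, is_derive_multR; [apply is_derive_idR |].
          apply is_derive_multR; apply Dw.
        - cbv beta. ring. }
      rewrite (integ_ext (fun z => v z ^ 2)
        (fun z => (w1 z + z * w z) ^ 2 + 2 * w z ^ 2 + (-2 * w z ^ 2 - 4 * (z * (w z * w1 z)))))
        by (intros; rewrite Evw; ring).
      rewrite integ_plus, Z, integ_plus, integ_scal by fast_tac. ring. }
    assert (Q2 : integ (fun z => v z ^ 2) = integ (fun z => w z * (v1 z + z * v z))).
    { assert (Z : integ (fun z => w z * (v1 z + z * v z) - v z ^ 2) = 0).
      { apply integ_derive with (fun z => w z * v z); [fast_tac.. |].
        intros z. evar_last; [apply is_derive_multR; [apply Dw | apply Dv] |].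
        replace (w1 z) with (z * w z - v z) by (rewrite Evw; ring). ring. }
      rewrite integ_minus in Z by fast_tac. lra. }
    assert (CS := integ_cauchy_schwarz w (fun z => v1 z + z * v z) Hw ltac:(fast_tac)).
    set (V := integ (fun z => v z ^ 2)) in *. set (W := integ (fun z => w z ^ 2)) in *.
    set (AV := integ (fun z => (v1 z + z * v z) ^ 2)) in *.
    assert (HV : 0 <= V) by (apply integ_ge0; [fast_tac | intros; apply pow2_ge_0]).
    assert (HA : 0 <= AV) by (apply integ_ge0; [fast_tac | intros; apply pow2_ge_0]).
    rewrite S_INR. generalize (pos_INR J). intros HJ.
    destruct (Req_dec V 0) as [-> | HVn]; [nra |].
    (* [Q1] and the induction hypothesis give 2 (J + 1) W <= V, while [Q2] and Cauchy-Schwarz give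
       V^2 <= W AV. *)
    apply Rmult_le_reg_r with V; [lra |].
    apply Rle_trans with (2 * (INR J + 1) * (W * AV)); [nra |].
    nra.
Qed.

Fixpoint rsum (f : nat -> R) (n : nat) : R :=
  match n with O => 0 | S m => rsum f m + f m end.

Lemma rsum_S (f : nat -> R) (n : nat) : rsum f (S n) = rsum f n + f n.
Proof. reflexivity. Qed.

Lemma rsum_le (f g : nat -> R) (n : nat) :
  (forall i, (i < n)%nat -> f i <= g i) -> rsum f n <= rsum g n.
Proof.
  intros H. induction n as [| n IH]; simpl; [lra |].
  apply Rplus_le_compat; [apply IH; intros; apply H; lia | apply H; lia].
Qed.

Lemma rsum_affine (a b : R) (f : nat -> R) (n : nat) :
  rsum (fun i => a + b * f i) n = INR n * a + b * rsum f n.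
Proof. induction n as [| n IH]; simpl rsum; [simpl; ring |]. rewrite IH, S_INR. ring. Qed.

Lemma rsum_ext (f g : nat -> R) (n : nat) :
  (forall i, (i < n)%nat -> f i = g i) -> rsum f n = rsum g n.
Proof. intros H. apply Rle_antisym; apply rsum_le; intros; rewrite H; auto; lra. Qed.

(** The residual (h - E) w of a trial function, with h = -d^2/dz^2 + U; it vanishes for
    eigenfunctions, and the gap estimates bound w by it. *)
Definition res (U : R -> R) (E : R) (w w2 : R -> R) (z : R) : R := - w2 z + (U z - E) * w z.

Lemma fast_res (U : R -> R) (E : R) (w w1 w2 : R -> R) : slow U -> dom w w1 w2 -> fast (res U E w w2).
Proof. intros HU (H0 & H1 & H2 & _). unfold res. fast_tac. Qed.

Lemma integ_grad_sq (w w1 w2 : R -> R) : dom w w1 w2 ->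
  integ (fun z => w1 z ^ 2) = - integ (fun z => w z * w2 z).
Proof.
  intros (H0 & H1 & H2 & D0 & D1).
  assert (Z : integ (fun z => w1 z ^ 2 + w z * w2 z) = 0).
  { apply integ_derive with (fun z => w z * w1 z); [fast_tac.. |].
    intros z. evar_last; [apply is_derive_multR; [apply D0 | apply D1] |]. ring. }
  rewrite integ_plus in Z by fast_tac. lra.
Qed.

(** * The spectral gap *)

(** Quadratic form of the harmonic oscillator. *)
Definition osc_energy (w w1 : R -> R) : R := integ (fun z => w1 z ^ 2 + z ^ 2 * w z ^ 2).

Lemma osc_energy_ladder (w w1 w2 : R -> R) : dom w w1 w2 ->
  integ (fun z => (w1 z + z * w z) ^ 2) = osc_energy w w1 - integ (fun z => w z ^ 2).
Proof.
  intros (H0 & H1 & H2 & D0 & D1). unfold osc_energy.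
  assert (Z : integ (fun z => w z ^ 2 + 2 * (z * (w z * w1 z))) = 0).
  { apply integ_derive with (fun z => z * (w z * w z)); [fast_tac.. |].
    intros z. evar_last.
    - apply is_derive_multR; [apply is_derive_idR |]. apply is_derive_multR; apply D0.
    - cbv beta. ring. }
  rewrite <- (Rplus_0_r (integ (fun z => w1 z ^ 2 + _))), <- Z.
  rewrite <- integ_plus, <- integ_minus by fast_tac. apply integ_ext. intros; ring.
Qed.

Lemma osc_energy_proj (i : nat) (c : R) (w w1 w2 : R -> R) : dom w w1 w2 ->
  osc_energy (fun z => w z + c * hf i z) (fun z => w1 z + c * hf1 i z) =
  osc_energy w w1 + (2 * INR i + 1) * (2 * c * integ (fun z => w z * hf i z) + c ^ 2 * hn i).
Proof.
  intros Hd. assert (F0 := fast_hf i). assert (F1 := fast_hf1 i). assert (F2 := fast_hf2 i).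
  assert (X : forall v v1 v2, dom v v1 v2 ->
    integ (fun z => v1 z * hf1 i z + z ^ 2 * (v z * hf i z)) = (2 * INR i + 1) * integ (fun z => v z * hf i z)).
  { intros v v1 v2 (H0 & H1 & H2 & D0 & D1).
    assert (Z : integ (fun z => v1 z * hf1 i z + v z * hf2 i z) = 0).
    { apply integ_derive with (fun z => v z * hf1 i z); [fast_tac.. |].
      intros z. apply is_derive_multR; [apply D0 | apply is_derive_hf1]. }
    rewrite <- (Rplus_0_r (_ * integ _)), <- Z, <- integ_scal, <- integ_plus by fast_tac.
    apply integ_ext. intros z. unfold hf2. ring. }
  assert (Xw := X _ _ _ Hd). assert (Xi := X _ _ _ (dom_hf i)).
  destruct Hd as (H0 & H1 & H2 & D0 & D1).
  unfold osc_energy, hn.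
  rewrite (integ_ext (fun z => hf i z ^ 2) (fun z => hf i z * hf i z)) by (intros; ring).
  rewrite Rmult_plus_distr_l.
  replace ((2 * INR i + 1) * (2 * c * integ (fun z => w z * hf i z)))
    with (2 * c * ((2 * INR i + 1) * integ (fun z => w z * hf i z))) by ring.
  replace ((2 * INR i + 1) * (c ^ 2 * integ (fun z => hf i z * hf i z)))
    with (c ^ 2 * ((2 * INR i + 1) * integ (fun z => hf i z * hf i z))) by ring.
  rewrite <- Xw, <- Xi, <- !integ_scal, <- !integ_plus by fast_tac.
  apply integ_ext. intros z. ring.
Qed.

(** Induction on the number i of low modes not assumed to vanish. Removing mode i lowers the form by
    (2 i + 1) a^2/hn and the squared norm by a^2/hn, so the defect is 2 (J - i) a^2/hn; the factor 2
    J covers all modes at once. *)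
Lemma osc_energy_bound (J : nat) (w w1 w2 : R -> R) : dom w w1 w2 ->
  (2 * INR J + 1) * integ (fun z => w z ^ 2) <=
  osc_energy w w1 + 2 * INR J * rsum (fun i => integ (fun z => w z * hf i z) ^ 2 / hn i) J.
Proof.
  enough (K : forall i, (i <= J)%nat -> forall w w1 w2 : R -> R, dom w w1 w2 ->
    (forall l, (i <= l < J)%nat -> integ (fun z => w z * hf l z) = 0) ->
    (2 * INR J + 1) * integ (fun z => w z ^ 2) <=
    osc_energy w w1 + 2 * INR J * rsum (fun i => integ (fun z => w z * hf i z) ^ 2 / hn i) i).
  { intros Hd. apply (K J (le_n J) w w1 w2 Hd). intros; lia. }
  clear w w1 w2. induction i as [| i IH]; intros Hi w w1 w2 Hd Ho.
  - assert (L := ladder_bound J w w1 (proj1 Hd) (proj1 (proj2 Hd)) (proj1 (proj2 (proj2 (proj2 Hd))))).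
    rewrite (osc_energy_ladder _ _ _ Hd) in L. simpl rsum.
    specialize (L ltac:(intros; apply Ho; lia)). lra.
  - assert (Hp := hn_pos i).
    assert (F := fast_hf i). assert (Fw := proj1 Hd).
    set (a := integ (fun z => w z * hf i z)). set (c := - a / hn i).
    assert (Hv := dom_plus_scal c _ _ _ _ _ _ Hd (dom_hf i)).
    assert (Ov : forall l, integ (fun z => (w z + c * hf i z) * hf l z) =
      integ (fun z => w z * hf l z) + c * integ (fun z => hf i z * hf l z)).
    { intros l. assert (Fl := fast_hf l).
      rewrite <- integ_scal, <- integ_plus by fast_tac. apply integ_ext. intros; ring. }
    assert (B := IH ltac:(lia) _ _ _ Hv).
    assert (Hol : forall l, (i <= l < J)%nat -> integ (fun z => (w z + c * hf i z) * hf l z) = 0).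
    { intros l Hl. rewrite Ov. destruct (Nat.eq_dec l i) as [-> | Hn].
      - rewrite (integ_ext (fun z => hf i z * hf i z) (fun z => hf i z ^ 2)) by (intros; ring).
        fold a. fold (hn i). unfold c. field. lra.
      - rewrite Ho, hf_orth by lia. ring. }
    specialize (B Hol).
    rewrite (osc_energy_proj i c _ _ _ Hd) in B. fold a in B.
    rewrite (integ_ext _ (fun z => w z ^ 2 + (2 * c * (w z * hf i z) + c ^ 2 * hf i z ^ 2))) in B
      by (intros; ring).
    rewrite integ_plus, integ_plus, !integ_scal in B by fast_tac. fold a in B. fold (hn i) in B.
    rewrite (rsum_ext _ (fun l => integ (fun z => w z * hf l z) ^ 2 / hn l) i) in B.
    2: { intros l Hl. rewrite Ov, hf_orth by lia. do 2 f_equal. ring. }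
    replace (2 * c * a + c ^ 2 * hn i) with (- (a ^ 2 / hn i)) in B by (unfold c; field; lra).
    rewrite rsum_S. fold a. assert (0 <= a ^ 2 / hn i).
    { apply Rmult_le_pos; [apply pow2_ge_0 | left; now apply Rinv_0_lt_compat]. }
    assert (0 <= INR i * (a ^ 2 / hn i)) by (apply Rmult_le_pos; [apply pos_INR | assumption]). lra.
Qed.

Lemma slow_dWt (c : R) : 0 <= c -> slow (fun z => c * (exp (c * z) - exp (- (c * z)))).
Proof.
  intros Hc. split.
  - intros x. apply (@ex_derive_continuous R_AbsRing R_NormedModule). auto_derive. trivial.
  - exists c, c. repeat split; try assumption. intros z.
    rewrite Rabs_mult, Rabs_pos_eq by assumption. apply Rmult_le_compat_l; [assumption |].
    unfold Wt. generalize (exp_pos (c * z)), (exp_pos (- (c * z))). intros.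
    apply Rabs_le. lra.
Qed.

Lemma is_derive_dWt (c z : R) :
  is_derive (fun z => c * (exp (c * z) - exp (- (c * z)))) z (c ^ 2 * Wt c z).
Proof. unfold Wt. auto_derive; [trivial | ring]. Qed.

(** After two integrations by parts the weight W enters only through W''/2 = c^2 W/2, a bounded
    shift of the energy. This is why exponential weights are harmless for a confining potential. *)
Lemma integ_weighted_energy (c E : R) (U w w1 w2 : R -> R) : 0 <= c -> slow U -> dom w w1 w2 ->
  integ (fun z => Wt c z * (res U E w w2 z * w z)) =
  integ (fun z => Wt c z * w1 z ^ 2) + integ (fun z => Wt c z * ((U z - E - c ^ 2 / 2) * w z ^ 2)).
Proof.
  intros Hc HU Hd. assert (Fr := fast_res U E w w1 w2 HU Hd).
  assert (SD := slow_dWt c Hc).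
  destruct Hd as (H0 & H1 & H2 & D0 & D1).
  set (dW := fun z => c * (exp (c * z) - exp (- (c * z)))) in *.
  assert (Z : integ (fun z => Wt c z * (w1 z ^ 2 + w z * w2 z) - c ^ 2 / 2 * (Wt c z * w z ^ 2)) = 0).
  { apply integ_derive with (fun z => Wt c z * (w z * w1 z) - / 2 * (dW z * (w z * w z))); [fast_tac.. |].
    intros z. evar_last.
    - apply is_derive_minusR.
      + apply is_derive_multR; [apply is_derive_Wt |]. apply is_derive_multR; [apply D0 | apply D1].
      + apply is_derive_scal. apply is_derive_multR; [apply is_derive_dWt |]. apply is_derive_multR; apply D0.
    - unfold dW. field. }
  rewrite <- integ_plus by fast_tac. rewrite <- (Rplus_0_r (integ (fun z => Wt c z * (res _ _ _ _ _ * _)))), <- Z, <- integ_plus by fast_tac.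
  apply integ_ext. intros z. unfold res. field.
Qed.

Lemma sq_nonneg_mult (a b : R) : 0 <= a -> 0 <= a * b ^ 2.
Proof. intros. apply Rmult_le_pos; [assumption | apply pow2_ge_0]. Qed.

Section Oscillator.

Variables kappa c0 : R.
Hypothesis Hkappa : 0 < kappa.
Hypothesis Hc0 : 0 <= c0.

(** Closeness to z^2 relative to an exponential weight says little far out; the separate quadratic
    lower bound supplies the confinement there. *)
Definition adm (U : R -> R) (eta : R) : Prop :=
  (forall x, continuous U x) /\ (forall z, kappa * z ^ 2 - 1 <= U z) /\
  forall z, Rabs (U z - z ^ 2) <= eta * Wt c0 z.

Lemma adm_eta_pos (U : R -> R) (eta : R) : adm U eta -> 0 <= eta.
Proof.
  intros (_ & _ & H). specialize (H 0). generalize (Rabs_pos (U 0 - 0 ^ 2)), (Wt_pos c0 0). nra.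
Qed.

Lemma adm_slow (U : R -> R) (eta : R) : adm U eta -> slow U.
Proof.
  intros (HC & _ & H).
  assert (S : slow (fun z => (U z - z ^ 2) + z ^ 2)).
  { apply slow_plus; [| apply slow_pow, slow_id]. split.
    - intros x. apply (@continuous_minus _ R_AbsRing R_NormedModule U (fun z => z ^ 2)); [apply HC |].
      apply (proj1 (slow_pow _ 2 slow_id)).
    - exists c0, (Rabs eta). split; [assumption |]. split; [apply Rabs_pos |].
      intros z. apply Rle_trans with (1 := H z). apply Rmult_le_compat_r; [left; apply Wt_pos | apply Rle_abs]. }
  destruct S as [_ S]. split; [exact HC |]. destruct S as (c & C & Hc & HC' & HS).
  exists c, C. repeat split; try assumption. intros z. specialize (HS z).
  replace (U z - z ^ 2 + z ^ 2) with (U z) in HS by ring. exact HS.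
Qed.

(* The confinement [kappa z^2 - 1 <= U] controls every exponential moment by
   the plain L^2 norm and the source. *)
Lemma weighted_bound (c M : R) : 0 <= c -> exists C, 0 <= C /\
  forall U E w w1 w2, slow U -> (forall z, kappa * z ^ 2 - 1 <= U z) -> E <= M -> dom w w1 w2 ->
  integ (fun z => Wt c z * w z ^ 2) <=
  C * (integ (fun z => w z ^ 2) + integ (fun z => Wt c z * res U E w w2 z ^ 2)).
Proof.
  (* A - kappa z^2 bounds 3/2 - (U - E - c^2/2) from above: 5/2 is 3/2 plus the 1 lost in the
     confinement bound. In 3/2, the unit yields the weighted norm and the half absorbs the product
     of w with the residual. Beyond r the bound is negative; inside, the weight is at most Wt c
     r. *)
  intros Hc. set (A := M + c ^ 2 / 2 + 5 / 2).
  set (r := Rabs A / kappa + 1). set (B := Rabs A * Wt c r).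
  assert (HA := Rabs_pos A).
  assert (Hr : 1 <= r).
  { unfold r. assert (0 <= Rabs A / kappa) by (apply Rmult_le_pos; [assumption | left; now apply Rinv_0_lt_compat]). lra. }
  assert (HB : 0 <= B) by (apply Rmult_le_pos; [assumption | left; apply Wt_pos]).
  exists (B + 1). split; [lra |]. intros U E w w1 w2 SU HU HE Hd.
  assert (Fr := fast_res U E w w1 w2 SU Hd).
  assert (I1 := integ_weighted_energy c E U w w1 w2 Hc SU Hd).
  destruct Hd as (H0 & H1 & H2 & D0 & D1).
  assert (P1 : 0 <= integ (fun z => Wt c z * w1 z ^ 2)).
  { apply integ_ge0; [fast_tac |]. intros z. apply sq_nonneg_mult. left; apply Wt_pos. }
  assert (P2 : 0 <= integ (fun z => Wt c z * res U E w w2 z ^ 2)).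
  { apply integ_ge0; [fast_tac |]. intros z. apply sq_nonneg_mult. left; apply Wt_pos. }
  assert (P3 : 0 <= integ (fun z => w z ^ 2)).
  { apply integ_ge0; [fast_tac |]. intros z. apply pow2_ge_0. }
  assert (K : integ (fun z => Wt c z * w z ^ 2) <= integ (fun z =>
    B * w z ^ 2 + Wt c z * ((U z - E - c ^ 2 / 2) * w z ^ 2)
    + (/ 2 * (Wt c z * res U E w w2 z ^ 2) - Wt c z * (res U E w w2 z * w z)))).
  { apply integ_le; [fast_tac.. |]. intros z.
    assert (Wp := Wt_pos c z).
    assert (Q : Wt c z * (3 / 2 - (U z - E - c ^ 2 / 2)) <= B).
    { assert (HUz := HU z).
      apply Rle_trans with (Wt c z * (A - kappa * z ^ 2)).
      - apply Rmult_le_compat_l; [lra |]. unfold A. lra.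
      - destruct (Rle_or_lt (Rabs z) r) as [Hz | Hz].
        + unfold B. rewrite (Rmult_comm (Rabs A)).
          apply Rle_trans with (Wt c z * Rabs A).
          * apply Rmult_le_compat_l; [lra |]. generalize (Rle_abs A), (pow2_ge_0 z). nra.
          * apply Rmult_le_compat_r; [assumption |]. apply Wt_le_Rabs; [assumption |].
            rewrite (Rabs_pos_eq r); lra.
        + apply Rle_trans with 0; [| assumption].
          assert (r * r <= z ^ 2).
          { rewrite <- pow2_abs. apply Rmult_le_compat; lra. }
          assert (Rabs A <= kappa * r).
          { unfold r. replace (kappa * (Rabs A / kappa + 1)) with (Rabs A + kappa) by (field; lra). lra. }
          assert (A - kappa * z ^ 2 <= 0) by (generalize (Rle_abs A); nra).
          nra. }
    assert (Q3 : 0 <= Wt c z * (res U E w w2 z - w z) ^ 2) by (apply sq_nonneg_mult; lra).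
    nra. }
  rewrite integ_plus, integ_plus, integ_minus, !integ_scal in K by fast_tac.
  nra.
Qed.

(** Symmetry moves the oscillator onto [hf i], where it acts as 2 i + 1. Away from the level of E
    this controls the i-th component of w; at that level it is the perturbation formula for E. *)
Lemma integ_test (i : nat) (U : R -> R) (E : R) (w w1 w2 : R -> R) : slow U -> dom w w1 w2 ->
  (2 * INR i + 1 - E) * integ (fun z => w z * hf i z) =
  integ (fun z => res U E w w2 z * hf i z) - integ (fun z => (U z - z ^ 2) * (w z * hf i z)).
Proof.
  intros SU Hd. assert (Fr := fast_res U E w w1 w2 SU Hd).
  assert (S := integ_dom_sym _ _ _ _ _ _ Hd (dom_hf i)).
  destruct Hd as (H0 & H1 & H2 & D0 & D1).
  assert (F0 := fast_hf i). assert (F2 := fast_hf2 i).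
  rewrite <- integ_minus, <- integ_scal by fast_tac.
  rewrite <- (Rplus_0_r (integ (fun z => res _ _ _ _ _ * _ - _))).
  replace 0 with (integ (fun z => w2 z * hf i z) - integ (fun z => w z * hf2 i z)) by lra.
  rewrite <- integ_minus, <- integ_plus by fast_tac.
  apply integ_ext. intros z. unfold res, hf2. ring.
Qed.

(** Cauchy-Schwarz with the whole weight put on v, in all uses a fixed Hermite function; only the
    plain norm of w then enters. *)
Lemma integ_pert_sq (Q : R -> R) (eta : R) (v w : R -> R) : slow Q ->
  (forall z, Rabs (Q z) <= eta * Wt c0 z) -> fast w -> fast v ->
  integ (fun z => Q z * (w z * v z)) ^ 2 <=
  eta ^ 2 * (integ (fun z => w z ^ 2) * integ (fun z => (Wt c0 z * v z) ^ 2)).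
Proof.
  intros SQ HQ Hw Hv.
  rewrite (integ_ext _ (fun z => w z * (Q z * v z))) by (intros; ring).
  assert (CS := integ_cauchy_schwarz w (fun z => Q z * v z) Hw ltac:(fast_tac)).
  apply Rle_trans with (1 := CS).
  replace (eta ^ 2 * (integ (fun z => w z ^ 2) * integ (fun z => (Wt c0 z * v z) ^ 2)))
    with (integ (fun z => w z ^ 2) * (eta ^ 2 * integ (fun z => (Wt c0 z * v z) ^ 2))) by ring.
  apply Rmult_le_compat_l.
  - apply integ_ge0; [fast_tac |]. intros; apply pow2_ge_0.
  - rewrite <- integ_scal by fast_tac. apply integ_le; [fast_tac.. |].
    intros z. replace ((Q z * v z) ^ 2) with (Q z ^ 2 * v z ^ 2) by ring.
    replace (eta ^ 2 * (Wt c0 z * v z) ^ 2) with ((eta * Wt c0 z) ^ 2 * v z ^ 2) by ring.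
    apply Rmult_le_compat_r; [apply pow2_ge_0 |]. rewrite <- (pow2_abs (Q z)).
    apply pow_incr. split; [apply Rabs_pos | apply HQ].
Qed.

(** The perturbation is squared, which costs 2 c0 in the exponent; the 4 comes from two uses of the
    product rule for weights. *)
Lemma integ_Wt_pert_sq (c eta : R) (Q f : R -> R) : 0 <= c -> slow Q ->
  (forall z, Rabs (Q z) <= eta * Wt c0 z) -> fast f ->
  integ (fun z => Wt c z * (Q z * f z) ^ 2) <= eta ^ 2 * (4 * integ (fun z => Wt (c + 2 * c0) z * f z ^ 2)).
Proof.
  intros Hc SQ HQ Hf.
  rewrite <- !integ_scal by fast_tac. apply integ_le; [fast_tac.. |].
  intros z. replace (Wt c z * (Q z * f z) ^ 2) with (Wt c z * Q z ^ 2 * f z ^ 2) by ring.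
  rewrite <- !Rmult_assoc. apply Rmult_le_compat_r; [apply pow2_ge_0 |].
  assert (Q z ^ 2 <= (eta * Wt c0 z) ^ 2).
  { rewrite <- (pow2_abs (Q z)). apply pow_incr. split; [apply Rabs_pos | apply HQ]. }
  assert (W1 := Wt_mult c c0 z Hc Hc0). assert (W2 := Wt_mult (c + c0) c0 z ltac:(lra) Hc0).
  replace (c + c0 + c0) with (c + 2 * c0) in W2 by ring.
  assert (W0 := Wt_pos c0 z). assert (Wc := Wt_pos c z).
  apply Rle_trans with (Wt c z * (eta * Wt c0 z) ^ 2); [apply Rmult_le_compat_l; lra |].
  replace (Wt c z * (eta * Wt c0 z) ^ 2) with (eta ^ 2 * (Wt c z * Wt c0 z * Wt c0 z)) by ring.
  rewrite (Rmult_assoc (eta ^ 2) 4). apply Rmult_le_compat_l; [apply pow2_ge_0 |]. nra.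
Qed.

Lemma adm_slow_pert (U : R -> R) (eta : R) : adm U eta -> slow (fun z => U z - z ^ 2).
Proof. intros HU. assert (S := adm_slow U eta HU). slow_tac. Qed.

Lemma integ_le_Wt (c : R) (f : R -> R) : 0 <= c -> fast f ->
  integ (fun z => f z ^ 2) <= integ (fun z => Wt c z * f z ^ 2).
Proof.
  intros Hc Hf. apply integ_le; [fast_tac.. |].
  intros z. generalize (Wt_ge2 c z Hc), (pow2_ge_0 (f z)). nra.
Qed.

(** Modes above j have oscillator energy at least 2 j + 3 >= E + 1. Modes below j are small because
    [integ_test] divides by 2 i + 1 - E, of modulus at least 1. Mode j is excluded by orthogonality.
    The perturbation is absorbed for small eta, its weight being paid for by [weighted_bound]. *)
Lemma gap (j : nat) : exists C eta0, 0 < C /\ 0 < eta0 /\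
  forall U eta E w w1 w2, adm U eta -> eta <= eta0 -> Rabs (E - (2 * INR j + 1)) <= 1 ->
  dom w w1 w2 -> integ (fun z => w z * hf j z) = 0 ->
  integ (fun z => w z ^ 2) <= C * integ (fun z => Wt c0 z * res U E w w2 z ^ 2).
Proof.
  destruct (weighted_bound c0 (2 * INR j + 2) Hc0) as [C1 [HC1 WB]].
  assert (HJ := pos_INR j). set (J := INR j + 1).
  set (Kf := fun i => integ (fun z => (Wt c0 z * hf i z) ^ 2) / hn i).
  set (K := rsum Kf (S j)).
  assert (HKf : forall i, 0 <= Kf i).
  { intros i. assert (F := fast_hf i). apply Rmult_le_pos.
    - apply integ_ge0; [fast_tac | intros; apply pow2_ge_0].
    - left. apply Rinv_0_lt_compat, hn_pos. }
  assert (HK : 0 <= K).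
  { replace 0 with (rsum (fun i => 0 + 0 * 0) (S j)) by (rewrite (rsum_affine 0 0 (fun _ => 0)); ring).
    apply rsum_le. intros. rewrite Rmult_0_l, Rplus_0_l. apply HKf. }
  (* For eta <= 1/D the perturbation terms eta C1 and 4 J K eta are together at most 1/4; another
     1/4 is lost to the source, so half of N survives on the left. *)
  set (D := 4 * (C1 + 4 * J * K + 1)).
  assert (HJK : 0 <= 4 * J * K) by (apply Rmult_le_pos; unfold J; lra).
  assert (HD : 0 < D) by (unfold D; lra).
  exists (2 * (2 + 4 * J ^ 2)), (Rmin 1 (/ D)).
  split; [unfold J; nra |]. split; [apply Rmin_glb_lt; [lra | now apply Rinv_0_lt_compat] |].
  intros U eta E w w1 w2 HU Heta HE Hd Ho.
  assert (SU := adm_slow U eta HU). assert (Hep := adm_eta_pos U eta HU).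
  assert (Fr := fast_res U E w w1 w2 SU Hd). assert (Hw := proj1 Hd).
  apply Rabs_le_between in HE.
  assert (W := WB U E w w1 w2 SU (proj1 (proj2 HU)) ltac:(lra) Hd).
  set (N := integ (fun z => w z ^ 2)) in *.
  set (F := integ (fun z => Wt c0 z * res U E w w2 z ^ 2)) in *.
  assert (HN : 0 <= N) by (apply integ_ge0; [fast_tac | intros; apply pow2_ge_0]).
  assert (HfF : integ (fun z => res U E w w2 z ^ 2) <= F) by (apply integ_le_Wt; assumption).
  assert (Hf0 : 0 <= integ (fun z => res U E w w2 z ^ 2)) by (apply integ_ge0; [fast_tac | intros; apply pow2_ge_0]).
  assert (B := osc_energy_bound (S j) w w1 w2 Hd). fold N in B. rewrite S_INR in B. fold J in B.
  assert (Qe : osc_energy w w1 = integ (fun z => res U E w w2 z * w z) + E * N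
    - integ (fun z => (U z - z ^ 2) * w z ^ 2)).
  { unfold osc_energy. assert (G := integ_grad_sq w w1 w2 Hd).
    destruct Hd as (_ & H1 & H2 & _).
    rewrite integ_plus, G by fast_tac. unfold N.
    rewrite <- integ_opp, <- integ_scal, <- !integ_plus, <- integ_minus by fast_tac.
    apply integ_ext. intros z. unfold res. ring. }
  assert (Y1 : integ (fun z => res U E w w2 z * w z) <= / 4 * N + F).
  { apply Rle_trans with (/ 4 * N + integ (fun z => res U E w w2 z ^ 2)); [| lra].
    unfold N. rewrite <- integ_scal, <- integ_plus by fast_tac. apply integ_le; [fast_tac.. |].
    intros z. generalize (pow2_ge_0 (res U E w w2 z - w z / 2)). nra. }
  assert (Y2 : - integ (fun z => (U z - z ^ 2) * w z ^ 2) <= eta * (C1 * (N + F))).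
  { apply Rle_trans with (eta * integ (fun z => Wt c0 z * w z ^ 2)).
    - rewrite <- integ_opp, <- integ_scal by fast_tac. apply integ_le; [fast_tac.. |].
      intros z. generalize (proj2 (proj2 HU) z), (pow2_ge_0 (w z)). intros A1 A2.
      apply Rabs_le_between in A1. nra.
    - now apply Rmult_le_compat_l. }
  assert (Y3 : rsum (fun i => integ (fun z => w z * hf i z) ^ 2 / hn i) (S j) <= INR (S j) * (2 * F) + 2 * eta ^ 2 * N * K).
  { unfold K. rewrite <- rsum_affine. apply rsum_le. intros i Hi.
    assert (Fi := fast_hf i). assert (Hn := hn_pos i).
    assert (0 <= eta ^ 2 * N) by (apply Rmult_le_pos; [apply pow2_ge_0 | assumption]).
    destruct (Nat.eq_dec i j) as [-> | Hij].
    - rewrite Ho. specialize (HKf j). replace (0 ^ 2 / hn j) with 0 by (field; lra).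
      assert (0 <= eta ^ 2 * N * Kf j) by now apply Rmult_le_pos. lra.
    - assert (T := integ_test i U E w w1 w2 SU Hd).
      assert (CS := integ_cauchy_schwarz (res U E w w2) (hf i) Fr Fi).
      assert (PS := integ_pert_sq (fun z => U z - z ^ 2) eta (hf i) w (adm_slow_pert U eta HU) (proj2 (proj2 HU)) Hw Fi).
      fold (hn i) in CS. fold N in PS. unfold Kf.
      set (a := integ (fun z => w z * hf i z)) in *.
      set (p := integ (fun z => res U E w w2 z * hf i z)) in *.
      set (q := integ (fun z => (U z - z ^ 2) * (w z * hf i z))) in *.
      set (k := integ (fun z => (Wt c0 z * hf i z) ^ 2)) in *.
      assert (Hi1 : INR i + 1 <= INR j) by (rewrite <- S_INR; apply le_INR; lia).
      assert (a ^ 2 <= 2 * p ^ 2 + 2 * q ^ 2).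
      { assert (1 <= (2 * INR i + 1 - E) ^ 2) by nra.
        generalize (pow2_ge_0 (p + q)). nra. }
      apply Rmult_le_reg_r with (hn i); [assumption |].
      replace (a ^ 2 / hn i * hn i) with (a ^ 2) by (field; lra).
      replace ((2 * F + 2 * eta ^ 2 * N * (k / hn i)) * hn i) with (2 * (F * hn i) + 2 * (eta ^ 2 * (N * k))) by (field; lra).
      assert (integ (fun z => res U E w w2 z ^ 2) * hn i <= F * hn i) by (apply Rmult_le_compat_r; lra).
      lra. }
  rewrite S_INR in Y3. fold J in Y3.
  assert (HJ1 : 1 <= J) by (unfold J; lra).
  assert (Heta1 : eta <= 1) by (apply Rle_trans with (1 := Heta); apply Rmin_l).
  assert (HetaD : eta * D <= 1).
  { apply Rle_trans with (/ D * D); [| right; field; lra]. apply Rmult_le_compat_r; [lra |].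
    apply Rle_trans with (1 := Heta); apply Rmin_r. }
  assert (Z1 : N <= (2 * J + 1 - E) * N) by (unfold J; nra).
  assert (Z4 : eta ^ 2 * (4 * J * K) <= eta * (4 * J * K)).
  { apply Rmult_le_compat_r; [assumption |]. nra. }
  assert (Z5 : eta * C1 + eta * (4 * J * K) <= / 4) by (unfold D in HetaD; nra).
  assert (Z6 : eta * C1 <= / 4) by nra.
  nra.
Qed.

(** Confinement upgrades the plain norm to any weight c. The threshold eta0 is chosen before c,
    since smallness is only used in the plain gap; a single threshold thus serves all weights. *)
Lemma gap_weighted (j : nat) : exists eta0, 0 < eta0 /\ forall c, c0 <= c -> exists C, 0 < C /\
  forall U eta E w w1 w2, adm U eta -> eta <= eta0 -> Rabs (E - (2 * INR j + 1)) <= 1 ->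
  dom w w1 w2 -> integ (fun z => w z * hf j z) = 0 ->
  integ (fun z => Wt c z * w z ^ 2) <= C * integ (fun z => Wt c z * res U E w w2 z ^ 2).
Proof.
  destruct (gap j) as [C [eta0 [HC [He G]]]]. exists eta0. split; [assumption |].
  intros c Hc. assert (Hcp : 0 <= c) by lra.
  destruct (weighted_bound c (2 * INR j + 2) Hcp) as [C1 [HC1 WB]].
  exists (C1 * (C + 1) + 1). split; [nra |].
  intros U eta E w w1 w2 HU Heta HE Hd Ho.
  assert (SU := adm_slow U eta HU). assert (Fr := fast_res U E w w1 w2 SU Hd).
  specialize (G U eta E w w1 w2 HU Heta HE Hd Ho).
  apply Rabs_le_between in HE.
  specialize (WB U E w w1 w2 SU (proj1 (proj2 HU)) ltac:(lra) Hd).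
  assert (Q : integ (fun z => Wt c0 z * res U E w w2 z ^ 2) <= integ (fun z => Wt c z * res U E w w2 z ^ 2)).
  { apply integ_le; [fast_tac.. |]. intros z. apply Rmult_le_compat_r; [apply pow2_ge_0 |].
    apply Wt_mono. lra. }
  assert (P : 0 <= integ (fun z => Wt c z * res U E w w2 z ^ 2)).
  { apply integ_ge0; [fast_tac |]. intros z. apply sq_nonneg_mult. left; apply Wt_pos. }
  set (F := integ (fun z => Wt c z * res U E w w2 z ^ 2)) in *.
  apply Rle_trans with (1 := WB).
  apply Rle_trans with (C1 * (C * F + F)).
  - apply Rmult_le_compat_l; [assumption |]. apply Rplus_le_compat_r.
    apply Rle_trans with (1 := G). apply Rmult_le_compat_l; lra.
  - lra.
Qed.

End Oscillator.

(** * Eigenfunctions close to Hermite functions *)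

Definition eigf (U : R -> R) (E : R) (v v1 v2 : R -> R) : Prop :=
  dom v v1 v2 /\ forall z, v2 z = (U z - E) * v z.

Lemma eigf_scal (a : R) (U : R -> R) (E : R) (v v1 v2 : R -> R) : eigf U E v v1 v2 ->
  eigf U E (fun z => a * v z) (fun z => a * v1 z) (fun z => a * v2 z).
Proof.
  intros [(H0 & H1 & H2 & D0 & D1) He]. split.
  - split; [fast_tac |]. split; [fast_tac |]. split; [fast_tac |].
    split; intros z; apply is_derive_scal; auto.
  - intros z. rewrite He. ring.
Qed.

Lemma eigf_res (U : R -> R) (E : R) (v v1 v2 : R -> R) : eigf U E v v1 v2 -> forall z, res U E v v2 z = 0.
Proof. intros [_ H] z. unfold res. rewrite H. ring. Qed.

Lemma integ_0 : integ (fun _ => 0) = 0.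
Proof.
  apply integ_eq. apply is_lim_seq_ext with (fun _ => 0); [| apply is_lim_seq_const].
  intros n. rewrite RInt_const. unfold scal; simpl; unfold mult; simpl. ring.
Qed.

Lemma integ_sq_ge0 (f : R -> R) : fast f -> 0 <= integ (fun z => f z ^ 2).
Proof. intros Hf. apply integ_ge0; [fast_tac | intros; apply pow2_ge_0]. Qed.

Lemma integ_Wt_sq_ge0 (c : R) (f : R -> R) : 0 <= c -> fast f -> 0 <= integ (fun z => Wt c z * f z ^ 2).
Proof.
  intros Hc Hf.
  apply integ_ge0; [fast_tac |]. intros z. apply sq_nonneg_mult. left; apply Wt_pos.
Qed.

Lemma integ_Wt_sq_plus (c : R) (f g : R -> R) : 0 <= c -> fast f -> fast g ->
  integ (fun z => Wt c z * (f z + g z) ^ 2) <=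
  2 * integ (fun z => Wt c z * f z ^ 2) + 2 * integ (fun z => Wt c z * g z ^ 2).
Proof.
  intros Hc Hf Hg.
  rewrite <- !integ_scal, <- integ_plus by fast_tac. apply integ_le; [fast_tac.. |].
  intros z. assert (0 <= Wt c z * (f z - g z) ^ 2) by (apply sq_nonneg_mult; left; apply Wt_pos). lra.
Qed.

Lemma integ_Wt_sq_scal (c a : R) (f : R -> R) : 0 <= c -> fast f ->
  integ (fun z => Wt c z * (a * f z) ^ 2) = a ^ 2 * integ (fun z => Wt c z * f z ^ 2).
Proof.
  intros Hc Hf.
  rewrite <- integ_scal by fast_tac. apply integ_ext. intros; ring.
Qed.

Lemma integ_Wt_mono (c d : R) (f : R -> R) : 0 <= c <= d -> fast f ->
  integ (fun z => Wt c z * f z ^ 2) <= integ (fun z => Wt d z * f z ^ 2).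
Proof.
  intros Hc Hf.
  apply integ_le; [fast_tac.. |]. intros z. apply Rmult_le_compat_r; [apply pow2_ge_0 | now apply Wt_mono].
Qed.

Section Eigenfunctions.

Variables kappa c0 : R.
Hypothesis Hkappa : 0 < kappa.
Hypothesis Hc0 : 0 <= c0.

(** Orthogonality would let the gap act on a zero residual and force v = 0. The lemma makes the
    normalization by the pairing with [hf j] available. *)
Lemma eigf_nonorth (j : nat) : exists eta0, 0 < eta0 /\
  forall U eta E v v1 v2, adm kappa c0 U eta -> eta <= eta0 -> Rabs (E - (2 * INR j + 1)) <= 1 ->
  eigf U E v v1 v2 -> (exists z, v z <> 0) -> integ (fun z => v z * hf j z) <> 0.
Proof.
  destruct (gap kappa c0 Hkappa Hc0 j) as [C [eta0 [HC [He G]]]].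
  exists eta0. split; [assumption |]. intros U eta E v v1 v2 HU Heta HE Hv [z Hz] Ho.
  assert (L := G U eta E v v1 v2 HU Heta HE (proj1 Hv) Ho).
  rewrite (integ_ext (fun z => Wt c0 z * _) (fun _ => 0)), integ_0 in L.
  2: { intros y. rewrite (eigf_res _ _ _ _ _ Hv). ring. }
  apply Hz. apply integ_sq_zero; [apply Hv | lra].
Qed.

(** The eigenvalue equation eliminates v: the residual of v - hf_j is -(U - z^2) hf_j + (E - (2 j +
    1)) hf_j, which involves the Hermite function only. *)
Lemma eigf_close_res (c : R) (j : nat) (U : R -> R) (eta E : R) (v v1 v2 : R -> R) : 0 <= c ->
  adm kappa c0 U eta -> eigf U E v v1 v2 ->
  integ (fun z => Wt c z * res U E (fun z => v z + -1 * hf j z) (fun z => v2 z + -1 * hf2 j z) z ^ 2) <=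
  2 * (eta ^ 2 * (4 * integ (fun z => Wt (c + 2 * c0) z * hf j z ^ 2))) +
  2 * ((E - (2 * INR j + 1)) ^ 2 * integ (fun z => Wt c z * hf j z ^ 2)).
Proof.
  intros Hc HU Hv. assert (F := fast_hf j).
  assert (SU := adm_slow kappa c0 Hc0 U eta HU). assert (SP := adm_slow_pert kappa c0 Hc0 U eta HU).
  set (d := E - (2 * INR j + 1)).
  rewrite (integ_ext _ (fun z => Wt c z * (- ((U z - z ^ 2) * hf j z) + d * hf j z) ^ 2)).
  2: { intros z. f_equal. f_equal. unfold res, hf2. rewrite (proj2 Hv). unfold d. ring. }
  eapply Rle_trans; [apply integ_Wt_sq_plus; [assumption | fast_tac | fast_tac] |].
  cbv beta. rewrite integ_Wt_sq_scal by assumption. apply Rplus_le_compat_r.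
  apply Rmult_le_compat_l; [lra |].
  rewrite (integ_ext _ (fun z => Wt c z * ((U z - z ^ 2) * hf j z) ^ 2)) by (intros; ring).
  apply (integ_Wt_pert_sq c0 Hc0 c eta (fun z => U z - z ^ 2)); try assumption. apply HU.
Qed.

(** Two estimates feed each other: the gap bounds W, the weighted distance of v to [hf j], by eta^2
    and the squared energy shift d^2, while testing with [hf j] bounds d^2 by eta^2 (W + hn j). For
    small eta the loop closes. *)
Lemma eigf_close_base (j : nat) : exists C eta0, 0 < C /\ 0 < eta0 /\
  forall U eta E v v1 v2, adm kappa c0 U eta -> eta <= eta0 -> Rabs (E - (2 * INR j + 1)) <= 1 ->
  eigf U E v v1 v2 -> integ (fun z => v z * hf j z) = hn j ->
  (E - (2 * INR j + 1)) ^ 2 <= C * eta ^ 2.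
Proof.
  destruct (gap_weighted kappa c0 Hkappa Hc0 j) as [eta1 [He1 GW]].
  set (c := c0). assert (Hcp : 0 <= c) by exact Hc0. destruct (GW c (Rle_refl _)) as [C [HC G]].
  assert (F := fast_hf j). assert (Hn := hn_pos j).
  set (A := 4 * integ (fun z => Wt (c + 2 * c0) z * hf j z ^ 2)).
  set (B := integ (fun z => Wt c z * hf j z ^ 2)).
  set (K := integ (fun z => (Wt c0 z * hf j z) ^ 2)).
  assert (HA : 0 <= A) by (unfold A; generalize (integ_Wt_sq_ge0 (c + 2 * c0) (hf j) ltac:(lra) F); lra).
  assert (HB : 0 <= B) by now apply integ_Wt_sq_ge0.
  assert (HK : 0 <= K) by (apply (integ_sq_ge0 (fun z => Wt c0 z * hf j z)); fast_tac).
  set (k := 2 * (K / hn j ^ 2)).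
  assert (Hk : 0 <= k).
  { apply Rmult_le_pos; [lra |]. apply Rmult_le_pos; [assumption |].
    left. apply Rinv_0_lt_compat, pow_lt; assumption. }
  (* The coefficient of eta^2 W once the bound on d^2 is inserted in the bound on W; the threshold
     makes eta^2 X at most 1/2. *)
  set (X := 2 * C * B * k).
  assert (HX : 0 <= X) by (unfold X; mult_pos).
  set (C1 := 2 * (C * (2 * A + 2 * B * (k * hn j)))).
  assert (HBk : 0 <= B * (k * hn j)) by (mult_pos).
  assert (HC1 : 0 <= C1) by (unfold C1; mult_pos).
  set (C2 := k * (C1 + hn j)).
  assert (HC2 : 0 <= C2) by (unfold C2; mult_pos).
  exists (C1 + C2 + 1), (Rmin eta1 (Rmin 1 (/ (2 * (X + 1))))).
  split; [lra |]. split.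
  { apply Rmin_glb_lt; [assumption |]. apply Rmin_glb_lt; [lra |]. apply Rinv_0_lt_compat; lra. }
  intros U eta E v v1 v2 HU Heta HE Hv Ho.
  assert (Hep := adm_eta_pos _ _ _ _ HU). assert (SU := adm_slow kappa c0 Hc0 U eta HU).
  assert (SP := adm_slow_pert kappa c0 Hc0 U eta HU).
  assert (E1 : eta <= eta1) by (apply Rle_trans with (1 := Heta); apply Rmin_l).
  assert (E2 : eta <= 1).
  { apply Rle_trans with (1 := Heta). eapply Rle_trans; [apply Rmin_r | apply Rmin_l]. }
  assert (E3 : eta * (2 * (X + 1)) <= 1).
  { apply Rle_trans with (/ (2 * (X + 1)) * (2 * (X + 1))); [| right; field; lra].
    apply Rmult_le_compat_r; [lra |].
    apply Rle_trans with (1 := Heta). eapply Rle_trans; [apply Rmin_r | apply Rmin_r]. }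
  set (d := E - (2 * INR j + 1)) in *.
  assert (Fv := proj1 (proj1 Hv)).
  assert (Hw := dom_plus_scal (-1) _ _ _ _ _ _ (proj1 Hv) (dom_hf j)).
  specialize (G U eta E _ _ _ HU E1 HE Hw).
  assert (Ow : integ (fun z => (v z + -1 * hf j z) * hf j z) = 0).
  { rewrite (integ_ext _ (fun z => v z * hf j z - hf j z ^ 2)) by (intros; ring).
    rewrite integ_minus, Ho by fast_tac. unfold hn. ring. }
  specialize (G Ow).
  set (W := integ (fun z => Wt c z * (v z - hf j z) ^ 2)).
  rewrite (integ_ext _ (fun z => Wt c z * (v z - hf j z) ^ 2)) in G by (intros; ring). fold W in G.
  assert (HW : 0 <= W) by (apply (integ_Wt_sq_ge0 c (fun z => v z - hf j z)); [assumption | fast_tac]).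
  assert (HF := eigf_close_res c j U eta E v v1 v2 Hcp HU Hv). fold A B d in HF.
  assert (T := integ_test j U E v v1 v2 SU (proj1 Hv)).
  rewrite (integ_ext (fun z => res U E v v2 z * _) (fun _ => 0)), integ_0, Ho in T.
  2: { intros y. rewrite (eigf_res _ _ _ _ _ Hv). ring. }
  assert (PS := integ_pert_sq c0 Hc0 (fun z => U z - z ^ 2) eta (hf j) v SP (proj2 (proj2 HU)) Fv F).
  fold K in PS.
  assert (Hv2 : integ (fun z => v z ^ 2) <= 2 * W + 2 * hn j).
  { apply Rle_trans with (2 * integ (fun z => (v z - hf j z) ^ 2) + 2 * hn j).
    - unfold hn. rewrite <- !integ_scal, <- integ_plus by fast_tac. apply integ_le; [fast_tac.. |].
      intros z. generalize (pow2_ge_0 (v z - 2 * hf j z)). lra.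
    - apply Rplus_le_compat_r, Rmult_le_compat_l; [lra |].
      apply (integ_le_Wt c (fun z => v z - hf j z)); [assumption | fast_tac]. }
  assert (Hd2 : d ^ 2 <= eta ^ 2 * (k * (W + hn j))).
  { apply Rmult_le_reg_r with (hn j ^ 2); [apply pow_lt; assumption |].
    replace (d ^ 2 * hn j ^ 2) with (((2 * INR j + 1 - E) * hn j) ^ 2) by (unfold d; ring).
    rewrite T.
    replace ((0 - integ (fun z => (U z - z ^ 2) * (v z * hf j z))) ^ 2)
      with (integ (fun z => (U z - z ^ 2) * (v z * hf j z)) ^ 2) by ring.
    apply Rle_trans with (1 := PS).
    replace (eta ^ 2 * (k * (W + hn j)) * hn j ^ 2) with (eta ^ 2 * ((2 * W + 2 * hn j) * K)) by (unfold k; field; lra).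
    apply Rmult_le_compat_l; [apply pow2_ge_0 |]. apply Rmult_le_compat_r; assumption. }
  assert (He2 : 0 <= eta ^ 2 <= eta) by nra.
  assert (G2 : W <= C * (2 * (eta ^ 2 * A) + 2 * (eta ^ 2 * (k * (W + hn j)) * B))).
  { apply Rle_trans with (1 := G). apply Rmult_le_compat_l; [lra |]. apply Rle_trans with (1 := HF).
    assert (d ^ 2 * B <= eta ^ 2 * (k * (W + hn j)) * B) by (apply Rmult_le_compat_r; assumption). lra. }
  assert (G3 : W <= eta ^ 2 * (C1 / 2) + eta ^ 2 * X * W).
  { apply Rle_trans with (1 := G2). right. unfold C1, X. field. }
  assert (G4 : eta ^ 2 * X <= / 2) by nra.
  assert (G5 : eta ^ 2 * X * W <= / 2 * W) by (apply Rmult_le_compat_r; assumption).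
  assert (G7 : C1 * eta ^ 2 <= C1) by nra.
  apply Rle_trans with (1 := Hd2). apply Rle_trans with (eta ^ 2 * C2).
  - apply Rmult_le_compat_l; [lra |]. apply Rmult_le_compat_l; lra.
  - nra.
Qed.

(** With the energy shift already bounded at weight c0, it is a known source here, and the gap
    applies at every weight without shrinking the threshold. The normalization makes v - hf_j
    orthogonal to hf_j. *)
Lemma eigf_close (j : nat) : exists eta0, 0 < eta0 /\ forall c, c0 <= c -> exists C, 0 < C /\
  forall U eta E v v1 v2, adm kappa c0 U eta -> eta <= eta0 -> Rabs (E - (2 * INR j + 1)) <= 1 ->
  eigf U E v v1 v2 -> integ (fun z => v z * hf j z) = hn j ->
  integ (fun z => Wt c z * (v z - hf j z) ^ 2) <= C * eta ^ 2 /\ (E - (2 * INR j + 1)) ^ 2 <= C * eta ^ 2.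
Proof.
  destruct (gap_weighted kappa c0 Hkappa Hc0 j) as [eta1 [He1 GW]].
  destruct (eigf_close_base j) as [C0 [eta2 [HC0 [He2 CB]]]].
  exists (Rmin eta1 eta2). split; [now apply Rmin_glb_lt |].
  intros c Hc. assert (Hcp : 0 <= c) by lra. destruct (GW c Hc) as [C [HC G]].
  assert (F := fast_hf j).
  set (A := 4 * integ (fun z => Wt (c + 2 * c0) z * hf j z ^ 2)).
  set (B := integ (fun z => Wt c z * hf j z ^ 2)).
  assert (HA : 0 <= A) by (unfold A; generalize (integ_Wt_sq_ge0 (c + 2 * c0) (hf j) ltac:(lra) F); lra).
  assert (HB : 0 <= B) by now apply integ_Wt_sq_ge0.
  assert (HCAB : 0 <= C * (2 * A + 2 * C0 * B)).
  { apply Rmult_le_pos; [lra |]. assert (0 <= C0 * B) by (apply Rmult_le_pos; lra). lra. }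
  exists (C0 + C * (2 * A + 2 * C0 * B)). split; [lra |].
  intros U eta E v v1 v2 HU Heta HE Hv Ho.
  assert (E1 := Rle_trans _ _ _ Heta (Rmin_l _ _)). assert (E2 := Rle_trans _ _ _ Heta (Rmin_r _ _)).
  specialize (CB U eta E v v1 v2 HU E2 HE Hv Ho). assert (He := pow2_ge_0 eta).
  split; [| apply Rle_trans with (1 := CB); apply Rmult_le_compat_r; lra].
  assert (Fv := proj1 (proj1 Hv)).
  assert (Hw := dom_plus_scal (-1) _ _ _ _ _ _ (proj1 Hv) (dom_hf j)).
  specialize (G U eta E _ _ _ HU E1 HE Hw).
  assert (Ow : integ (fun z => (v z + -1 * hf j z) * hf j z) = 0).
  { rewrite (integ_ext _ (fun z => v z * hf j z - hf j z ^ 2)) by (intros; ring).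
    rewrite integ_minus, Ho by fast_tac. unfold hn. ring. }
  specialize (G Ow).
  rewrite (integ_ext _ (fun z => Wt c z * (v z - hf j z) ^ 2)) in G by (intros; ring).
  apply Rle_trans with (1 := G).
  assert (HF := eigf_close_res c j U eta E v v1 v2 Hcp HU Hv). fold A B in HF.
  apply Rle_trans with (C * (2 * (eta ^ 2 * A) + 2 * (C0 * eta ^ 2 * B))).
  - apply Rmult_le_compat_l; [lra |]. apply Rle_trans with (1 := HF).
    assert ((E - (2 * INR j + 1)) ^ 2 * B <= C0 * eta ^ 2 * B) by (apply Rmult_le_compat_r; assumption). lra.
  - assert (0 <= C0 * eta ^ 2) by (apply Rmult_le_pos; lra). lra.
Qed.

Lemma eigf_bound (j : nat) : exists eta0, 0 < eta0 /\ forall c, c0 <= c -> exists C, 0 < C /\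
  forall U eta E v v1 v2, adm kappa c0 U eta -> eta <= eta0 -> Rabs (E - (2 * INR j + 1)) <= 1 ->
  eigf U E v v1 v2 -> integ (fun z => v z * hf j z) = hn j ->
  integ (fun z => Wt c z * v z ^ 2) <= C.
Proof.
  destruct (eigf_close j) as [eta0 [He0 HH]].
  exists (Rmin 1 eta0). split; [apply Rmin_glb_lt; lra |].
  intros c Hc. assert (Hcp : 0 <= c) by lra. destruct (HH c Hc) as [C [HC H]].
  assert (F := fast_hf j).
  set (B := integ (fun z => Wt c z * hf j z ^ 2)).
  assert (HB : 0 <= B) by now apply integ_Wt_sq_ge0.
  exists (2 * C + 2 * B). split; [lra |].
  intros U eta E v v1 v2 HU Heta HE Hv Ho.
  assert (E1 : eta <= 1) by (apply Rle_trans with (1 := Heta); apply Rmin_l).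
  assert (E2 : eta <= eta0) by (apply Rle_trans with (1 := Heta); apply Rmin_r).
  destruct (H U eta E v v1 v2 HU E2 HE Hv Ho) as [W _].
  assert (Hep := adm_eta_pos _ _ _ _ HU). assert (Fv := proj1 (proj1 Hv)).
  rewrite (integ_ext _ (fun z => Wt c z * ((v z - hf j z) + hf j z) ^ 2)) by (intros; ring).
  eapply Rle_trans; [apply integ_Wt_sq_plus; [assumption | fast_tac | fast_tac] |].
  fold B. assert (C * eta ^ 2 <= C * 1) by (apply Rmult_le_compat_l; nra). lra.
Qed.

Lemma eigf_compare_res (c A delta : R) (U U' : R -> R) (E E' : R) (v v1 v2 u u1 u2 : R -> R) : 0 <= c ->
  slow U -> slow U' -> (forall z, Rabs (U z - U' z) <= delta * Wt c0 z) -> eigf U E v v1 v2 -> eigf U' E' u u1 u2 ->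
  integ (fun z => Wt (c + 2 * c0) z * u z ^ 2) <= A ->
  integ (fun z => Wt c z * res U E (fun z => v z + -1 * u z) (fun z => v2 z + -1 * u2 z) z ^ 2) <=
  2 * (delta ^ 2 * (4 * A)) + 2 * ((E - E') ^ 2 * A).
Proof.
  intros Hcp SU SU' HD Hv Hu GA'.
  assert (SD : slow (fun z => U z - U' z)) by slow_tac.
  assert (Fu := proj1 (proj1 Hu)).
  assert (HAu : integ (fun z => Wt c z * u z ^ 2) <= A).
  { apply Rle_trans with (2 := GA'). apply integ_Wt_mono; [lra | assumption]. }
  set (d := E - E').
  rewrite (integ_ext _ (fun z => Wt c z * (- ((U z - U' z) * u z) + d * u z) ^ 2)).
  2: { intros z. f_equal. f_equal. unfold res. rewrite (proj2 Hv), (proj2 Hu). unfold d. ring. }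
  eapply Rle_trans; [apply integ_Wt_sq_plus; [assumption | fast_tac | fast_tac] |].
  cbv beta. rewrite integ_Wt_sq_scal by assumption. apply Rplus_le_compat.
  - apply Rmult_le_compat_l; [lra |].
    rewrite (integ_ext _ (fun z => Wt c z * ((U z - U' z) * u z) ^ 2)) by (intros; ring).
    eapply Rle_trans; [apply (integ_Wt_pert_sq c0 Hc0 c delta (fun z => U z - U' z)); assumption |].
    apply Rmult_le_compat_l; [apply pow2_ge_0 | lra].
  - apply Rmult_le_compat_l; [lra |]. apply Rmult_le_compat_l; [apply pow2_ge_0 | assumption].
Qed.

(** The loop of [eigf_close_base] with u in place of the Hermite function. Smallness for the
    absorption comes from eta, while the outcome is proportional to delta, the distance between the
    two potentials. *)
Lemma eigf_compare_base (j : nat) : exists C eta0, 0 < C /\ 0 < eta0 /\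
  forall U U' eta delta E E' v v1 v2 u u1 u2, adm kappa c0 U eta -> adm kappa c0 U' eta -> eta <= eta0 ->
  (forall z, Rabs (U z - U' z) <= delta * Wt c0 z) ->
  Rabs (E - (2 * INR j + 1)) <= 1 -> Rabs (E' - (2 * INR j + 1)) <= 1 ->
  eigf U E v v1 v2 -> integ (fun z => v z * hf j z) = hn j ->
  eigf U' E' u u1 u2 -> integ (fun z => u z * hf j z) = hn j ->
  (E - E') ^ 2 <= C * delta ^ 2.
Proof.
  destruct (gap_weighted kappa c0 Hkappa Hc0 j) as [eta1 [He1 GW]].
  set (c := c0). assert (Hcp : 0 <= c) by exact Hc0. destruct (GW c (Rle_refl _)) as [C [HC G]].
  destruct (eigf_bound j) as [eta2 [He2 GB]].
  destruct (GB (c + 2 * c0)) as [A [HA GA]]; [unfold c; lra |].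
  assert (F := fast_hf j). assert (Hn := hn_pos j).
  set (K := integ (fun z => (Wt c0 z * hf j z) ^ 2)).
  assert (HK : 0 <= K) by (apply (integ_sq_ge0 (fun z => Wt c0 z * hf j z)); fast_tac).
  set (k := 2 * (K / hn j ^ 2)).
  assert (Hk : 0 <= k).
  { apply Rmult_le_pos; [lra |]. apply Rmult_le_pos; [assumption |].
    left. apply Rinv_0_lt_compat, pow_lt; assumption. }
  set (X := 2 * C * A * k).
  assert (HX : 0 <= X) by (unfold X; mult_pos).
  set (C1 := 2 * (C * (8 * A + 2 * A * (k * A)))).
  assert (HBk : 0 <= A * (k * A)) by (mult_pos).
  assert (HC1 : 0 <= C1) by (unfold C1; mult_pos).
  set (C2 := k * (C1 + A)).
  assert (HC2 : 0 <= C2) by (unfold C2; mult_pos).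
  exists (C1 + C2 + 1), (Rmin eta1 (Rmin eta2 (Rmin 1 (/ (2 * (X + 1)))))).
  split; [lra |]. split.
  { repeat apply Rmin_glb_lt; try assumption; try lra. apply Rinv_0_lt_compat; lra. }
  intros U U' eta delta E E' v v1 v2 u u1 u2 HU HU' Heta HD HE HE' Hv Ov Hu Ou.
  assert (Hep := adm_eta_pos _ _ _ _ HU). assert (SU := adm_slow kappa c0 Hc0 U eta HU).
  assert (SU' := adm_slow kappa c0 Hc0 U' eta HU').
  assert (SP := adm_slow_pert kappa c0 Hc0 U eta HU).
  assert (SD : slow (fun z => U z - U' z)) by slow_tac.
  assert (E1 : eta <= eta1) by (apply Rle_trans with (1 := Heta); apply Rmin_l).
  assert (Heta' := Rle_trans _ _ _ Heta (Rmin_r _ _)).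
  assert (E2 : eta <= eta2) by (apply Rle_trans with (1 := Heta'); apply Rmin_l).
  assert (Heta'' := Rle_trans _ _ _ Heta' (Rmin_r _ _)).
  assert (E3 : eta <= 1) by (apply Rle_trans with (1 := Heta''); apply Rmin_l).
  assert (E4 : eta * (2 * (X + 1)) <= 1).
  { apply Rle_trans with (/ (2 * (X + 1)) * (2 * (X + 1))); [| right; field; lra].
    apply Rmult_le_compat_r; [lra |]. apply Rle_trans with (1 := Heta''). apply Rmin_r. }
  set (d := E - E') in *.
  assert (Fv := proj1 (proj1 Hv)). assert (Fu := proj1 (proj1 Hu)).
  assert (GA' := GA U' eta E' u u1 u2 HU' E2 HE' Hu Ou).
  assert (Hw := dom_plus_scal (-1) _ _ _ _ _ _ (proj1 Hv) (proj1 Hu)).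
  specialize (G U eta E _ _ _ HU E1 HE Hw).
  assert (Ow : integ (fun z => (v z + -1 * u z) * hf j z) = 0).
  { rewrite (integ_ext _ (fun z => v z * hf j z - u z * hf j z)) by (intros; ring).
    rewrite integ_minus, Ov, Ou by fast_tac. ring. }
  specialize (G Ow).
  set (W := integ (fun z => Wt c z * (v z - u z) ^ 2)).
  rewrite (integ_ext _ (fun z => Wt c z * (v z - u z) ^ 2)) in G by (intros; ring). fold W in G.
  assert (HW : 0 <= W) by (apply (integ_Wt_sq_ge0 c (fun z => v z - u z)); [assumption | fast_tac]).
  assert (HAu : integ (fun z => Wt c z * u z ^ 2) <= A).
  { apply Rle_trans with (2 := GA'). apply integ_Wt_mono; [lra | assumption]. }
  assert (HAu2 : integ (fun z => u z ^ 2) <= A).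
  { apply Rle_trans with (2 := HAu). now apply integ_le_Wt. }
  assert (HF := eigf_compare_res c A delta U U' E E' v v1 v2 u u1 u2 Hcp SU SU' HD Hv Hu GA'). fold d in HF.
  assert (Tv := integ_test j U E v v1 v2 SU (proj1 Hv)).
  rewrite (integ_ext (fun z => res U E v v2 z * _) (fun _ => 0)), integ_0, Ov in Tv.
  2: { intros y. rewrite (eigf_res _ _ _ _ _ Hv). ring. }
  assert (Tu := integ_test j U' E' u u1 u2 SU' (proj1 Hu)).
  rewrite (integ_ext (fun z => res U' E' u u2 z * _) (fun _ => 0)), integ_0, Ou in Tu.
  2: { intros y. rewrite (eigf_res _ _ _ _ _ Hu). ring. }
  assert (PS := integ_pert_sq c0 Hc0 (fun z => U z - z ^ 2) eta (hf j) (fun z => v z - u z) SP (proj2 (proj2 HU))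
    ltac:(fast_tac) F).
  fold K in PS.
  assert (PD := integ_pert_sq c0 Hc0 (fun z => U z - U' z) delta (hf j) u SD HD Fu F).
  fold K in PD.
  (* Difference of the two tested equations, split so that v - u is multiplied by the eta-small U -
     z^2 and u by the delta-small U - U'. *)
  assert (TT : d * hn j = integ (fun z => (U z - z ^ 2) * ((v z - u z) * hf j z)) + integ (fun z => (U z - U' z) * (u z * hf j z))).
  { rewrite <- integ_plus by fast_tac.
    rewrite (integ_ext _ (fun z => (U z - z ^ 2) * (v z * hf j z) - (U' z - z ^ 2) * (u z * hf j z))) by (intros; ring).
    rewrite integ_minus by fast_tac. unfold d. lra. }
  assert (HIw : integ (fun z => (v z - u z) ^ 2) <= W).
  { apply (integ_le_Wt c (fun z => v z - u z)); [assumption | fast_tac]. }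
  assert (Hd2 : d ^ 2 <= eta ^ 2 * (k * W) + delta ^ 2 * (k * A)).
  { apply Rmult_le_reg_r with (hn j ^ 2); [apply pow_lt; assumption |].
    replace (d ^ 2 * hn j ^ 2) with ((d * hn j) ^ 2) by ring. rewrite TT.
    set (p := integ (fun z => (U z - z ^ 2) * ((v z - u z) * hf j z))) in *.
    set (q := integ (fun z => (U z - U' z) * (u z * hf j z))) in *.
    apply Rle_trans with (2 * p ^ 2 + 2 * q ^ 2); [generalize (pow2_ge_0 (p - q)); lra |].
    replace ((eta ^ 2 * (k * W) + delta ^ 2 * (k * A)) * hn j ^ 2)
      with (2 * (eta ^ 2 * (W * K)) + 2 * (delta ^ 2 * (A * K))) by (unfold k; field; lra).
    apply Rplus_le_compat; (apply Rmult_le_compat_l; [lra |]).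
    - apply Rle_trans with (1 := PS). apply Rmult_le_compat_l; [apply pow2_ge_0 |]. apply Rmult_le_compat_r; assumption.
    - apply Rle_trans with (1 := PD). apply Rmult_le_compat_l; [apply pow2_ge_0 |]. apply Rmult_le_compat_r; assumption. }
  assert (He : 0 <= eta ^ 2 <= eta) by nra.
  assert (G2 : W <= C * (2 * (delta ^ 2 * (4 * A)) + 2 * ((eta ^ 2 * (k * W) + delta ^ 2 * (k * A)) * A))).
  { apply Rle_trans with (1 := G). apply Rmult_le_compat_l; [lra |]. apply Rle_trans with (1 := HF).
    assert (d ^ 2 * A <= (eta ^ 2 * (k * W) + delta ^ 2 * (k * A)) * A) by (apply Rmult_le_compat_r; lra). lra. }
  assert (G3 : W <= delta ^ 2 * (C1 / 2) + eta ^ 2 * X * W).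
  { apply Rle_trans with (1 := G2). right. unfold C1, X. field. }
  assert (G4 : eta ^ 2 * X <= / 2) by nra.
  assert (G5 : eta ^ 2 * X * W <= / 2 * W) by (apply Rmult_le_compat_r; assumption).
  apply Rle_trans with (1 := Hd2).
  assert (eta ^ 2 * (k * W) <= 1 * (k * W)) by (apply Rmult_le_compat_r; [apply Rmult_le_pos; lra | lra]).
  assert (k * W <= k * (C1 * delta ^ 2)) by (apply Rmult_le_compat_l; lra).
  apply Rle_trans with (C2 * delta ^ 2); [unfold C2; lra |]. nra.
Qed.

Lemma eigf_compare (j : nat) : exists eta0, 0 < eta0 /\ forall c, c0 <= c -> exists C, 0 < C /\
  forall U U' eta delta E E' v v1 v2 u u1 u2, adm kappa c0 U eta -> adm kappa c0 U' eta -> eta <= eta0 ->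
  (forall z, Rabs (U z - U' z) <= delta * Wt c0 z) ->
  Rabs (E - (2 * INR j + 1)) <= 1 -> Rabs (E' - (2 * INR j + 1)) <= 1 ->
  eigf U E v v1 v2 -> integ (fun z => v z * hf j z) = hn j ->
  eigf U' E' u u1 u2 -> integ (fun z => u z * hf j z) = hn j ->
  integ (fun z => Wt c z * (v z - u z) ^ 2) <= C * delta ^ 2 /\ (E - E') ^ 2 <= C * delta ^ 2.
Proof.
  destruct (gap_weighted kappa c0 Hkappa Hc0 j) as [eta1 [He1 GW]].
  destruct (eigf_compare_base j) as [C0 [eta2 [HC0 [He2 CB]]]].
  destruct (eigf_bound j) as [eta3 [He3 GB]].
  exists (Rmin eta1 (Rmin eta2 eta3)). split; [repeat apply Rmin_glb_lt; assumption |].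
  intros c Hc. assert (Hcp : 0 <= c) by lra. destruct (GW c Hc) as [C [HC G]].
  destruct (GB (c + 2 * c0)) as [A [HA GA]]; [lra |].
  assert (F := fast_hf j).
  assert (HCA : 0 <= C * (8 * A + 2 * C0 * A)).
  { apply Rmult_le_pos; [lra |]. assert (0 <= C0 * A) by (apply Rmult_le_pos; lra). lra. }
  exists (C0 + C * (8 * A + 2 * C0 * A)). split; [lra |].
  intros U U' eta delta E E' v v1 v2 u u1 u2 HU HU' Heta HD HE HE' Hv Ov Hu Ou.
  assert (E1 := Rle_trans _ _ _ Heta (Rmin_l _ _)). assert (Heta' := Rle_trans _ _ _ Heta (Rmin_r _ _)).
  assert (E2 := Rle_trans _ _ _ Heta' (Rmin_l _ _)). assert (E3 := Rle_trans _ _ _ Heta' (Rmin_r _ _)).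
  specialize (CB U U' eta delta E E' v v1 v2 u u1 u2 HU HU' E2 HD HE HE' Hv Ov Hu Ou).
  assert (Hdl := pow2_ge_0 delta).
  split; [| apply Rle_trans with (1 := CB); apply Rmult_le_compat_r; lra].
  assert (Fv := proj1 (proj1 Hv)). assert (Fu := proj1 (proj1 Hu)).
  assert (Hw := dom_plus_scal (-1) _ _ _ _ _ _ (proj1 Hv) (proj1 Hu)).
  specialize (G U eta E _ _ _ HU E1 HE Hw).
  assert (Ow : integ (fun z => (v z + -1 * u z) * hf j z) = 0).
  { rewrite (integ_ext _ (fun z => v z * hf j z - u z * hf j z)) by (intros; ring).
    rewrite integ_minus, Ov, Ou by fast_tac. ring. }
  specialize (G Ow).
  rewrite (integ_ext _ (fun z => Wt c z * (v z - u z) ^ 2)) in G by (intros; ring).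
  apply Rle_trans with (1 := G).
  assert (HF := eigf_compare_res c A delta U U' E E' v v1 v2 u u1 u2 Hcp (adm_slow kappa c0 Hc0 U eta HU)
    (adm_slow kappa c0 Hc0 U' eta HU') HD Hv Hu (GA U' eta E' u u1 u2 HU' E3 HE' Hu Ou)).
  apply Rle_trans with (C * (2 * (delta ^ 2 * (4 * A)) + 2 * (C0 * delta ^ 2 * A))).
  - apply Rmult_le_compat_l; [lra |]. apply Rle_trans with (1 := HF).
    assert ((E - E') ^ 2 * A <= C0 * delta ^ 2 * A) by (apply Rmult_le_compat_r; lra). lra.
  - assert (0 <= C0 * delta ^ 2) by (apply Rmult_le_pos; lra). lra.
Qed.

End Eigenfunctions.

(** * Linear second-order equations *)

Lemma exp_ge_1 (x : R) : 0 <= x -> 1 <= exp x.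
Proof. intros H. generalize (exp_ineq1_le x). lra. Qed.

Lemma bounded_on (f : R -> R) (a b : R) : (forall x, continuous f x) ->
  exists M, 0 <= M /\ forall x, a <= x <= b -> Rabs (f x) <= M.
Proof.
  intros Hf. destruct (Rle_or_lt a b) as [Hab | Hab].
  - destruct (continuity_ab_maj (fun x => Rabs (f x)) a b Hab) as [m [Hm _]].
    + intros c _. apply continuity_pt_filterlim. apply (continuous_comp f Rabs); [apply Hf |].
      apply (continuous_Rabs (f c)).
    + exists (Rabs (f m)). split; [apply Rabs_pos | assumption].
  - exists 0. split; [lra |]. intros; lra.
Qed.

(** Integration against exp(lam |t|) gains a factor 1/lam. Two gains with lam = M + 1 beat a
    coefficient bounded by M, as M/(M + 1)^2 <= 1/2. *)
Lemma RInt_exp_bound (F : R -> R) (lam K L : R) : 0 < lam -> 0 <= K -> (forall x, continuous F x) ->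
  (forall t, Rabs t <= L -> Rabs (F t) <= K * exp (lam * Rabs t)) ->
  forall x, Rabs x <= L -> Rabs (RInt F 0 x) <= K / lam * exp (lam * Rabs x).
Proof.
  intros Hl HK HF HB.
  assert (P : forall G : R -> R, (forall x, continuous G x) ->
    (forall t, Rabs t <= L -> Rabs (G t) <= K * exp (lam * Rabs t)) ->
    forall x, 0 <= x <= L -> Rabs (RInt G 0 x) <= K / lam * exp (lam * x)).
  { intros G HG HGB x Hx.
    apply Rle_trans with (RInt (fun t => Rabs (G t)) 0 x).
    { apply abs_RInt_le; [lra | now apply ex_RInt_cont]. }
    apply Rle_trans with (RInt (fun t => K * exp (lam * t)) 0 x).
    - apply RInt_le; [lra | | |].
      + apply ex_RInt_cont. intros y. apply (continuous_comp G Rabs); [apply HG | apply (continuous_Rabs (G y))].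
      + apply ex_RInt_cont. intros y. apply (@ex_derive_continuous R_AbsRing R_NormedModule). auto_derive. trivial.
      + intros t Ht. rewrite <- (Rabs_pos_eq t) at 2 by lra. apply HGB. rewrite Rabs_pos_eq; lra.
    - rewrite (is_RInt_unique _ 0 x (K / lam * exp (lam * x) - K / lam * exp (lam * 0))).
      + assert (0 <= K / lam) by (apply Rmult_le_pos; [assumption | left; now apply Rinv_0_lt_compat]).
        generalize (exp_pos (lam * 0)). nra.
      + apply (@is_RInt_derive R_CompleteNormedModule (fun t => K / lam * exp (lam * t))).
        * intros y _. auto_derive; [trivial | field; lra].
        * intros y _. apply (@ex_derive_continuous R_AbsRing R_NormedModule). auto_derive. trivial. }
  intros x Hx. destruct (Rle_or_lt 0 x) as [H0 | H0].
  - rewrite (Rabs_pos_eq x) in * by assumption. apply P; auto.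
  - rewrite (Rabs_left x) in * by assumption.
    replace (RInt F 0 x) with (- RInt (fun t => F (- t)) 0 (- x)).
    + rewrite Rabs_Ropp. apply (P (fun t => F (- t))); [| | lra].
      * intros y. apply (continuous_comp Ropp F); [| apply HF].
        apply (@continuous_opp _ R_AbsRing R_NormedModule (fun x => x)), continuous_id.
      * intros t Ht. rewrite <- (Rabs_Ropp t). apply HB. now rewrite Rabs_Ropp.
    + rewrite RInt_opp_arg by assumption. rewrite Ropp_0, Ropp_involutive.
      rewrite <- (opp_RInt_swap F 0 x) by now apply ex_RInt_cont.
      apply Ropp_involutive.
Qed.

Lemma is_derive_RInt0 (F : R -> R) (x : R) : (forall y, continuous F y) ->
  is_derive (fun y => RInt F 0 y) x (F x).
Proof.
  intros HF. apply (is_derive_RInt F _ 0); [| apply HF].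
  apply filter_forall. intros y. apply (@RInt_correct R_CompleteNormedModule). now apply ex_RInt_cont.
Qed.

Lemma continuous_RInt0 (F : R -> R) (x : R) : (forall y, continuous F y) ->
  continuous (fun y => RInt F 0 y) x.
Proof.
  intros HF. apply (@ex_derive_continuous R_AbsRing R_NormedModule). eexists. now apply is_derive_RInt0.
Qed.

Lemma continuous_multR (f g : R -> R) (x : R) : continuous f x -> continuous g x ->
  continuous (fun y => f y * g y) x.
Proof. apply (@continuous_mult _ R_AbsRing f g). Qed.

Lemma continuous_plusR (f g : R -> R) (x : R) : continuous f x -> continuous g x ->
  continuous (fun y => f y + g y) x.
Proof. apply (@continuous_plus _ R_AbsRing R_NormedModule f g). Qed.

Lemma continuous_minusR (f g : R -> R) (x : R) : continuous f x -> continuous g x ->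
  continuous (fun y => f y - g y) x.
Proof. apply (@continuous_minus _ R_AbsRing R_NormedModule f g). Qed.

Lemma continuous_oppargR (f : R -> R) (x : R) : (forall y, continuous f y) ->
  continuous (fun y => f (- y)) x.
Proof.
  intros Hf. apply (continuous_comp Ropp f); [| apply Hf].
  apply (@continuous_opp _ R_AbsRing R_NormedModule (fun x => x)), continuous_id.
Qed.

(** Solution operator of y'' = q h with zero data at 0. *)
Definition volterra (q h : R -> R) (x : R) : R :=
  RInt (fun s => RInt (fun t => q t * h t) 0 s) 0 x.

Lemma continuous_volterra (q h : R -> R) (x : R) :
  (forall y, continuous q y) -> (forall y, continuous h y) -> continuous (volterra q h) x.
Proof.
  intros Hq Hh. apply continuous_RInt0. intros y. apply continuous_RInt0.
  intros z. now apply continuous_multR.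
Qed.

Lemma volterra_minus (q h g : R -> R) (x : R) :
  (forall y, continuous q y) -> (forall y, continuous h y) -> (forall y, continuous g y) ->
  volterra q (fun t => h t - g t) x = volterra q h x - volterra q g x.
Proof.
  intros Hq Hh Hg.
  assert (C : forall k, (forall y, continuous k y) -> forall y, continuous (fun t => q t * k t) y).
  { intros k Hk y. now apply continuous_multR. }
  transitivity (RInt (fun s => minus (RInt (fun t => q t * h t) 0 s) (RInt (fun t => q t * g t) 0 s)) 0 x).
  - apply RInt_ext. intros s _.
    transitivity (RInt (fun t => minus (q t * h t) (q t * g t)) 0 s).
    + apply RInt_ext. intros t _. unfold minus, plus, opp; simpl. ring.
    + apply (@RInt_minus R_CompleteNormedModule); apply ex_RInt_cont; now apply C.
  - apply (@RInt_minus R_CompleteNormedModule); apply ex_RInt_cont;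
      intros y; apply continuous_RInt0; now apply C.
Qed.

(* The weight [exp (lam |t|)] makes the Volterra operator a contraction on
   every bounded interval, so the Neumann series converges geometrically. *)
Lemma volterra_bound (q h : R -> R) (M K L : R) : 0 <= M -> 0 <= K ->
  (forall y, continuous q y) -> (forall y, continuous h y) ->
  (forall t, Rabs t <= L -> Rabs (q t) <= M) ->
  (forall t, Rabs t <= L -> Rabs (h t) <= K * exp ((M + 1) * Rabs t)) ->
  forall x, Rabs x <= L -> Rabs (volterra q h x) <= K / 2 * exp ((M + 1) * Rabs x).
Proof.
  intros HM HK Hq Hh Bq Bh x Hx.
  assert (C : forall y, continuous (fun t => q t * h t) y) by (intros; now apply continuous_multR).
  assert (B1 : forall s, Rabs s <= L -> Rabs (RInt (fun t => q t * h t) 0 s) <= M * K / (M + 1) * exp ((M + 1) * Rabs s)).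
  { apply RInt_exp_bound; [lra | now apply Rmult_le_pos | assumption |].
    intros t Ht. rewrite Rabs_mult, Rmult_assoc. apply Rmult_le_compat; auto using Rabs_pos. }
  assert (HMK : 0 <= M * K / (M + 1)).
  { apply Rmult_le_pos; [now apply Rmult_le_pos | left; apply Rinv_0_lt_compat; lra]. }
  assert (B2 := RInt_exp_bound (fun s => RInt (fun t => q t * h t) 0 s) (M + 1) (M * K / (M + 1)) L
    ltac:(lra) HMK ltac:(intros; now apply continuous_RInt0) B1 x Hx).
  apply Rle_trans with (1 := B2). apply Rmult_le_compat_r; [left; apply exp_pos |].
  apply Rmult_le_reg_r with ((M + 1) * (M + 1)); [nra |].
  replace (M * K / (M + 1) / (M + 1) * ((M + 1) * (M + 1))) with (M * K) by (field; lra).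
  nra.
Qed.

Lemma volterra_solution (q g : R -> R) :
  (forall y, continuous q y) -> (forall y, continuous g y) ->
  exists u, (forall y, continuous u y) /\ forall x, u x = g x + volterra q u x.
Proof.
  intros Hq Hg.
  set (h := fun n => Nat.iter n (volterra q) g).
  assert (hS : forall n, h (S n) = volterra q (h n)) by reflexivity.
  assert (hc : forall n y, continuous (h n) y).
  { induction n as [| n IH]; [exact Hg |]. intros y. now apply continuous_volterra. }
  (* M and G depend on the interval, but the series does not, so the sum is a solution on the whole
     line. *)
  assert (HB : forall L, 0 <= L -> exists M G, 0 <= M /\ 0 <= G /\ (forall t, Rabs t <= L -> Rabs (q t) <= M) /\
    forall n x, Rabs x <= L -> Rabs (h n x) <= G * (/ 2) ^ n * exp ((M + 1) * Rabs x)).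
  { intros L HL. destruct (bounded_on q (- L) L Hq) as [M [HM BM]].
    destruct (bounded_on g (- L) L Hg) as [G [HG BG]].
    exists M, G. split; [assumption |]. split; [assumption |].
    assert (BM' : forall t, Rabs t <= L -> Rabs (q t) <= M).
    { intros t Ht. apply BM. now apply Rabs_le_between. }
    split; [assumption |].
    induction n as [| n IH]; intros x Hx.
    - apply Rle_trans with G; [apply BG, Rabs_le_between; assumption |].
      assert (1 <= exp ((M + 1) * Rabs x)).
      { apply exp_ge_1. apply Rmult_le_pos; [lra | apply Rabs_pos]. }
      nra.
    - replace (G * (/ 2) ^ S n) with (G * (/ 2) ^ n / 2) by (simpl; field).
      apply (volterra_bound q (h n) M (G * (/ 2) ^ n) L); auto.
      apply Rmult_le_pos; [assumption | apply pow_le; lra]. }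
  set (Sn := (fun N x => sum_n (fun n => h n x) N) : nat -> R -> R).
  set (u := fun x => Series (fun n => h n x)).
  assert (HT : forall L, 0 <= L -> exists M G, 0 <= M /\ 0 <= G /\ (forall t, Rabs t <= L -> Rabs (q t) <= M) /\
    forall N x, Rabs x <= L -> Rabs (u x - Sn N x) <= G * (/ 2) ^ N * exp ((M + 1) * Rabs x)).
  { intros L HL. destruct (HB L HL) as (M & G & HM & HG & BM & B).
    exists M, G. repeat split; try assumption. intros N x Hx.
    set (e := exp ((M + 1) * Rabs x)).
    assert (Hser : is_series (fun n => (G * e) * (/ 2) ^ n) ((G * e) * / (1 - / 2))).
    { apply (is_series_scal_l (G * e) (fun n => (/ 2) ^ n)). apply is_series_geom.
      rewrite Rabs_pos_eq; lra. }
    assert (Hle : forall n, Rabs (h n x) <= (G * e) * (/ 2) ^ n).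
    { intros n. specialize (B n x Hx). fold e in B. lra. }
    assert (Hex : ex_series (fun n => h n x)).
    { apply ex_series_Rabs. apply (@ex_series_le R_AbsRing R_CompleteNormedModule _ (fun n => (G * e) * (/ 2) ^ n)).
      - intros n. rewrite Rabs_Rabsolu. apply Hle.
      - eexists. exact Hser. }
    assert (Eu : u x - Sn N x = Series (fun k => h (S N + k)%nat x)).
    { unfold u, Sn. rewrite (Series_incr_n (fun n => h n x) (S N)) by (lia || assumption).
      simpl pred. rewrite sum_n_Reals. ring. }
    rewrite Eu.
    assert (Hser2 : is_series (fun k => (G * e * (/ 2) ^ S N) * (/ 2) ^ k) ((G * e * (/ 2) ^ S N) * / (1 - / 2))).
    { apply (is_series_scal_l (G * e * (/ 2) ^ S N) (fun n => (/ 2) ^ n)). apply is_series_geom.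
      rewrite Rabs_pos_eq; lra. }
    assert (Hle2 : forall k, Rabs (h (S N + k)%nat x) <= (G * e * (/ 2) ^ S N) * (/ 2) ^ k).
    { intros k. apply Rle_trans with (1 := Hle _). rewrite pow_add. lra. }
    assert (Hexa : ex_series (fun k => Rabs (h (S N + k)%nat x))).
    { apply (@ex_series_le R_AbsRing R_CompleteNormedModule _ (fun k => (G * e * (/ 2) ^ S N) * (/ 2) ^ k)).
      - intros n. rewrite Rabs_Rabsolu. apply Hle2.
      - eexists. exact Hser2. }
    apply Rle_trans with (Series (fun k => Rabs (h (S N + k)%nat x))); [now apply Series_Rabs |].
    apply Rle_trans with (Series (fun k => (G * e * (/ 2) ^ S N) * (/ 2) ^ k)).
    - apply Series_le; [| eexists; exact Hser2]. intros n. split; [apply Rabs_pos | apply Hle2].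
    - rewrite (is_series_unique _ _ Hser2). right. simpl. field. }
  assert (Sc : forall N y, continuous (Sn N) y).
  { induction N as [| N IH]; intros y.
    - apply continuous_ext with (h 0%nat); [| apply hc]. intros x. unfold Sn. now rewrite sum_O.
    - apply continuous_ext with (fun x => Sn N x + h (S N) x).
      + intros x. unfold Sn. now rewrite sum_Sn.
      + apply continuous_plusR; auto. }
  assert (small : forall G eps, 0 <= G -> 0 < eps -> exists N0, forall N, (N0 <= N)%nat -> G * (/ 2) ^ N < eps).
  { intros G eps HG He.
    destruct (pow_lt_1_zero (/ 2)) with (y := eps / (G + 1)) as [N0 HN0].
    - rewrite Rabs_pos_eq; lra.
    - apply Rdiv_lt_0_compat; lra.
    - exists N0. intros N HN. specialize (HN0 N HN). rewrite Rabs_pos_eq in HN0 by (apply pow_le; lra).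
      assert (0 < (/ 2) ^ N) by (apply pow_lt; lra).
      apply Rlt_le_trans with ((G + 1) * (eps / (G + 1))); [nra | right; field; lra]. }
  assert (uc : forall y, continuous u y).
  { intros y. apply continuity_pt_filterlim.
    destruct (HT (Rabs y + 1)) as (M & G & HM & HG & BM & B); [generalize (Rabs_pos y); lra |].
    apply (CVU_continuity Sn u y (mkposreal 1 Rlt_0_1)).
    - intros eps He.
      destruct (small (G * exp ((M + 1) * (Rabs y + 1))) eps) as [N0 HN0].
      { apply Rmult_le_pos; [assumption | left; apply exp_pos]. }
      { assumption. }
      exists N0. intros n x Hn Hx. unfold Boule in Hx; simpl in Hx.
      assert (Hxy : Rabs x <= Rabs y + 1).
      { replace x with (y + (x - y)) by ring. eapply Rle_trans; [apply Rabs_triang |]. lra. }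
      apply Rle_lt_trans with (1 := B n x Hxy).
      apply Rle_lt_trans with (2 := HN0 n Hn).
      assert (exp ((M + 1) * Rabs x) <= exp ((M + 1) * (Rabs y + 1))).
      { apply exp_mono, Rmult_le_compat_l; lra. }
      replace (G * exp ((M + 1) * (Rabs y + 1)) * (/ 2) ^ n) with (G * (/ 2) ^ n * exp ((M + 1) * (Rabs y + 1))) by ring.
      apply Rmult_le_compat_l; [| assumption]. apply Rmult_le_pos; [assumption | apply pow_le; lra].
    - intros n x _. apply continuity_pt_filterlim. apply Sc.
    - unfold Boule; simpl. rewrite Rminus_diag, Rabs_R0. lra. }
  exists u. split; [exact uc |]. intros x.
  assert (Srec : forall N y, Sn (S N) y = g y + volterra q (Sn N) y).
  { assert (V0 : forall y, volterra q (Sn 0%nat) y = h 1%nat y).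
    { intros y. apply RInt_ext. intros s _. apply RInt_ext. intros t _.
      unfold Sn. now rewrite sum_O. }
    induction N as [| N IH]; intros y.
    - rewrite V0. unfold Sn. rewrite sum_Sn, sum_O. reflexivity.
    - assert (E : volterra q (h (S N)) y = volterra q (Sn (S N)) y - volterra q (Sn N) y).
      { rewrite <- volterra_minus by auto. apply RInt_ext. intros s _. apply RInt_ext. intros t _.
        f_equal. unfold Sn. rewrite sum_Sn. unfold plus; simpl. ring. }
      assert (E2 : Sn (S (S N)) y = Sn (S N) y + h (S (S N)) y) by (unfold Sn; now rewrite (sum_Sn _ (S N))).
      rewrite E2, IH, (hS (S N)), E. ring. }
  (* For every N the defect of the fixed-point equation is u - S_{N+1} minus the Volterra image of u
     - S_N, and both are geometrically small. *)
  apply Rminus_diag_uniq.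
  destruct (Req_dec (u x - (g x + volterra q u x)) 0) as [| Hn]; [assumption | exfalso].
  apply Rabs_pos_lt in Hn.
  destruct (HT (Rabs x)) as (M & G & HM & HG & BM & B); [apply Rabs_pos |].
  set (e := exp ((M + 1) * Rabs x)) in *. assert (He : 0 < e) by apply exp_pos.
  destruct (small (2 * (G * e)) _ ltac:(mult_pos) Hn) as [N0 HN0].
  specialize (HN0 N0 (le_n _)).
  assert (K1 := B (S N0) x (Rle_refl _)). fold e in K1.
  assert (K2 : Rabs (volterra q (fun t => u t - Sn N0 t) x) <= G * (/ 2) ^ N0 / 2 * e).
  { assert (0 <= (/ 2) ^ N0) by (apply pow_le; lra).
    apply (volterra_bound q _ M (G * (/ 2) ^ N0) (Rabs x)); auto; [mult_pos | | lra].
    intros y. apply continuous_minusR; auto. }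
  rewrite volterra_minus in K2 by auto.
  replace (u x - (g x + volterra q u x)) with ((u x - Sn (S N0) x) - (volterra q u x - volterra q (Sn N0) x)) in HN0
    by (rewrite Srec; ring).
  assert (K3 := Rabs_triang (u x - Sn (S N0) x) (- (volterra q u x - volterra q (Sn N0) x))).
  rewrite Rabs_Ropp in K3. unfold Rminus in HN0 at 1. simpl pow in K1.
  assert (P : 0 < (/ 2) ^ N0) by (apply pow_lt; lra).
  assert (0 <= G * e * (/ 2) ^ N0) by mult_pos.
  lra.
Qed.

Definition ode (q f u u1 : R -> R) : Prop :=
  (forall x, is_derive u x (u1 x)) /\ forall x, is_derive u1 x (q x * u x + f x).

(** After translating x0 to 0, two integrations give a Volterra equation whose inhomogeneity is A +
    B x plus the double integral of f. *)
Lemma ode_exists (q f : R -> R) (x0 A B : R) :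
  (forall y, continuous q y) -> (forall y, continuous f y) ->
  exists u u1, ode q f u u1 /\ u x0 = A /\ u1 x0 = B.
Proof.
  intros Hq Hf.
  assert (sc : forall k : R -> R, (forall y, continuous k y) -> forall y, continuous (fun t => k (t + x0)) y).
  { intros k Hk y. apply (continuous_comp (fun t => t + x0) k); [| apply Hk].
    apply continuous_plusR; [apply continuous_id | apply continuous_const]. }
  set (q' := fun t => q (t + x0)). set (f' := fun t => f (t + x0)).
  assert (Hq' : forall y, continuous q' y) by now apply sc.
  assert (Hf' : forall y, continuous f' y) by now apply sc.
  set (F := fun s => RInt f' 0 s).
  assert (DF : forall x, is_derive F x (f' x)) by (intros; now apply is_derive_RInt0).
  assert (FC : forall x, continuous F x) by (intros; now apply continuous_RInt0).
  set (g := fun x => A + B * x + RInt F 0 x).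
  assert (Dg : forall x, is_derive g x (B + F x)).
  { intros x. evar_last.
    - apply is_derive_plusR; [apply is_derive_plusR; [apply is_derive_const |] |].
      + apply is_derive_scal, is_derive_idR.
      + now apply is_derive_RInt0.
    - unfold zero; simpl. ring. }
  destruct (volterra_solution q' g Hq') as [u [Hu Eu]].
  { intros y. apply (@ex_derive_continuous R_AbsRing R_NormedModule). eexists. apply Dg. }
  set (Q := fun s => RInt (fun t => q' t * u t) 0 s).
  assert (CQ : forall y, continuous (fun t => q' t * u t) y) by (intros; now apply continuous_multR).
  assert (DQ : forall x, is_derive Q x (q' x * u x)) by (intros; now apply (is_derive_RInt0 (fun t => q' t * u t))).
  assert (QC : forall x, continuous Q x) by (intros; now apply continuous_RInt0).
  set (u1 := fun x => (B + F x) + Q x).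
  assert (D0 : forall x, is_derive u x (u1 x)).
  { intros x. apply is_derive_ext with (fun x => g x + volterra q' u x); [intros; now rewrite Eu |].
    apply is_derive_plusR; [apply Dg |]. now apply is_derive_RInt0. }
  assert (D1 : forall x, is_derive u1 x (q' x * u x + f' x)).
  { intros x. evar_last.
    - apply is_derive_plusR; [apply is_derive_plusR; [apply is_derive_const | apply DF] | apply DQ].
    - unfold zero; simpl. ring. }
  assert (sd : forall (k : R -> R) x d, is_derive k (x - x0) d -> is_derive (fun t => k (t - x0)) x d).
  { intros k x d Hd. evar_last.
    - apply (is_derive_comp k (fun t => t - x0)); [exact Hd |].
      apply is_derive_minusR; [apply is_derive_idR | apply is_derive_const].
    - unfold scal, zero; simpl; unfold mult; simpl. ring. }
  exists (fun x => u (x - x0)), (fun x => u1 (x - x0)). split; [split |].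
  - intros x. apply sd, D0.
  - intros x. apply sd. evar_last; [apply D1 |]. unfold q', f'.
    assert (Z : forall a b : R, a - b + b = a) by (intros; ring). now rewrite Z.
  - rewrite Rminus_diag. split.
    + rewrite Eu. unfold g, volterra. rewrite !RInt_point. unfold zero; simpl. ring.
    + unfold u1, F, Q. rewrite !RInt_point. unfold zero; simpl. ring.
Qed.

Lemma ode_combine (q f g u u1 v v1 : R -> R) (a b : R) : ode q f u u1 -> ode q g v v1 ->
  ode q (fun x => a * f x + b * g x) (fun x => a * u x + b * v x) (fun x => a * u1 x + b * v1 x).
Proof.
  intros [U0 U1] [V0 V1]. split; intros x.
  - apply is_derive_plusR; apply is_derive_scal; auto.
  - evar_last; [apply is_derive_plusR; apply is_derive_scal; auto |]. ring.
Qed.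

Lemma ode_ext (q f g u u1 : R -> R) : (forall x, f x = g x) -> ode q f u u1 -> ode q g u u1.
Proof. intros E [H0 H1]. split; [assumption |]. intros x. rewrite <- E. apply H1. Qed.

Lemma ode_reflect (q f u u1 : R -> R) : ode q f u u1 ->
  ode (fun x => q (- x)) (fun x => f (- x)) (fun x => u (- x)) (fun x => - u1 (- x)).
Proof.
  intros [H0 H1].
  assert (R : forall k d x, is_derive k (- x) d -> is_derive (fun t : R => k (- t)) x (- d)).
  { intros k d x H. evar_last.
    - apply (is_derive_comp k Ropp); [exact H |]. apply (@is_derive_opp R_AbsRing R_NormedModule (fun t => t)), is_derive_idR.
    - unfold scal, opp; simpl; unfold mult; simpl. ring. }
  split; intros x.
  - apply R, H0.
  - evar_last; [apply (@is_derive_opp R_AbsRing R_NormedModule (fun t => u1 (- t))), R, H1 |].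
    unfold opp; simpl. ring.
Qed.

Lemma derive_nonneg_incr (f df : R -> R) (a b : R) : a <= b ->
  (forall x, is_derive f x (df x)) -> (forall x, a <= x <= b -> 0 <= df x) -> f a <= f b.
Proof.
  intros Hab D H.
  destruct (MVT_gen f a b df) as [c [Hc E]].
  - intros; apply D.
  - intros x _. apply continuity_pt_filterlim, (@ex_derive_continuous R_AbsRing R_NormedModule). eexists; apply D.
  - rewrite Rmin_left, Rmax_right in Hc by assumption. specialize (H c Hc). nra.
Qed.

(** Gronwall: with M a bound for q on the interval, (u^2 + u'^2) exp(-(1 + M)(t - x0)) cannot
    increase to the right of x0; reflection treats the left. *)
Lemma ode_unique (q u u1 : R -> R) (x0 : R) : (forall y, continuous q y) ->
  ode q (fun _ => 0) u u1 -> u x0 = 0 -> u1 x0 = 0 -> forall x, u x = 0.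
Proof.
  intros Hq.
  assert (P : forall q u u1 x0, (forall y, continuous q y) -> ode q (fun _ => 0) u u1 ->
    u x0 = 0 -> u1 x0 = 0 -> forall x, x0 <= x -> u x = 0).
  { clear. intros q u u1 x0 Hq [D0 D1] H0 H1 x Hx.
    destruct (bounded_on q x0 x Hq) as [M [HM B]].
    set (z := fun t => - ((u t ^ 2 + u1 t ^ 2) * exp (- (1 + M) * (t - x0)))).
    set (dz := fun t => - ((2 * (1 + q t) * (u t * u1 t) - (1 + M) * (u t ^ 2 + u1 t ^ 2)) * exp (- (1 + M) * (t - x0)))).
    assert (Dz : forall t, is_derive z t (dz t)).
    { intros t. apply is_derive_ext with (fun t => - ((u t * u t + u1 t * u1 t) * exp (- (1 + M) * (t - x0)))).
      - intros s. unfold z. do 2 f_equal. ring.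
      - evar_last.
        + apply (@is_derive_opp R_AbsRing R_NormedModule (fun t => (u t * u t + u1 t * u1 t) * exp (- (1 + M) * (t - x0)))).
          apply is_derive_multR.
          * apply is_derive_plusR; apply is_derive_multR; (apply D0 || apply D1).
          * instantiate (1 := - (1 + M) * exp (- (1 + M) * (t - x0))). auto_derive; [trivial |]. unfold Rminus. ring.
        + unfold dz, opp; simpl. ring. }
    assert (L : z x0 <= z x).
    { apply derive_nonneg_incr with dz; [assumption | exact Dz |]. intros t Ht. unfold dz.
      specialize (B t Ht). apply Rabs_le_between in B.
      assert (2 * (1 + q t) * (u t * u1 t) <= (1 + M) * (u t ^ 2 + u1 t ^ 2)).
      { generalize (pow2_ge_0 (u t - u1 t)), (pow2_ge_0 (u t + u1 t)). intros.
        assert ((1 + q t) * (2 * (u t * u1 t)) <= (1 + M) * (u t ^ 2 + u1 t ^ 2)); [| lra].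
        destruct (Rle_or_lt 0 (1 + q t)).
        - apply Rle_trans with ((1 + q t) * (u t ^ 2 + u1 t ^ 2)); [apply Rmult_le_compat_l; lra |].
          apply Rmult_le_compat_r; lra.
        - apply Rle_trans with ((- (1 + q t)) * (u t ^ 2 + u1 t ^ 2)).
          + assert (0 <= (- (1 + q t)) * (u t + u1 t) ^ 2) by (apply Rmult_le_pos; lra). lra.
          + apply Rmult_le_compat_r; lra. }
      generalize (exp_pos (- (1 + M) * (t - x0))). nra. }
    unfold z in L. rewrite H0, H1 in L.
    assert (E := exp_pos (- (1 + M) * (x - x0))).
    assert (S : u x ^ 2 + u1 x ^ 2 <= 0).
    { apply Rmult_le_reg_r with (1 := E). lra. }
    generalize (pow2_ge_0 (u1 x)). intros. assert (u x ^ 2 = 0) by (generalize (pow2_ge_0 (u x)); lra).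
    destruct (Req_dec (u x) 0); [assumption |]. exfalso.
    apply (pow_nonzero (u x) 2); assumption. }
  intros Ho H0 H1 x. destruct (Rle_or_lt x0 x) as [Hx | Hx].
  - now apply P with q u1 x0.
  - assert (R := P (fun x => q (- x)) (fun x => u (- x)) (fun x => - u1 (- x)) (- x0)).
    rewrite <- (Ropp_involutive x). apply R; rewrite ?Ropp_involutive; try lra.
    + intros; now apply continuous_oppargR.
    + now apply ode_reflect in Ho.
Qed.

Lemma is_derive_pos_right (u : R -> R) (m d delta : R) : is_derive u m d -> 0 < d -> 0 < delta ->
  exists xi, m < xi < m + delta /\ forall t, m < t <= xi -> u m < u t.
Proof.
  intros D Hd Hdel. apply is_derive_Reals in D.
  destruct (D (d / 2)) as [e He]; [lra |].
  set (h := Rmin (delta / 2) (e / 2)).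
  assert (Hh : 0 < h) by (apply Rmin_glb_lt; [lra | generalize (cond_pos e); lra]).
  assert (h <= delta / 2) by apply Rmin_l. assert (h <= e / 2) by apply Rmin_r.
  exists (m + h). split; [lra |]. intros t Ht.
  assert (Q := He (t - m) ltac:(lra)). rewrite Rabs_pos_eq in Q by lra.
  specialize (Q ltac:(generalize (cond_pos e); lra)).
  replace (m + (t - m)) with t in Q by ring. apply Rabs_def2 in Q.
  assert (P : d / 2 < (u t - u m) / (t - m)) by lra.
  apply Rmult_lt_compat_r with (r := t - m) in P; [| lra].
  replace ((u t - u m) / (t - m) * (t - m)) with (u t - u m) in P by (field; lra). nra.
Qed.

Lemma left_max_derive_nonneg (u : R -> R) (a m d : R) : a < m -> is_derive u m d ->
  (forall x, a <= x <= m -> u x <= u m) -> 0 <= d.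
Proof.
  intros Ham D H. destruct (Rle_or_lt 0 d) as [| Hd]; [assumption | exfalso].
  destruct (is_derive_pos_right (fun t => u (- t)) (- m) (- d) (m - a)) as [xi [Hxi Hu]]; [| lra | lra |].
  - evar_last.
    + apply (is_derive_comp u Ropp); [rewrite Ropp_involutive; exact D |].
      apply (@is_derive_opp R_AbsRing R_NormedModule (fun t => t)), is_derive_idR.
    + unfold scal, opp; simpl; unfold mult; simpl. ring.
  - specialize (Hu xi ltac:(lra)). rewrite Ropp_involutive in Hu.
    specialize (H (- xi) ltac:(lra)). lra.
Qed.

(** Excludes maxima in the arguments below. The sign of the slope at the new point is recorded as
    well, because shooting needs it. *)
Lemma convex_not_max (u u1 : R -> R) (m d delta : R) : (forall x, is_derive u x (u1 x)) ->
  is_derive u1 m d -> 0 <= u1 m -> 0 < d -> 0 < delta ->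
  exists xi, m < xi < m + delta /\ u m < u xi /\ 0 < u1 xi.
Proof.
  intros D D1 H1 Hd Hdel.
  destruct (is_derive_pos_right u1 m d delta D1 Hd Hdel) as [xi [Hxi Hu]].
  exists xi. split; [assumption |].
  destruct (MVT_cor2 u u1 m xi) as [c [Ec Hc]]; [lra | intros; apply is_derive_Reals, D |].
  assert (A := Hu c ltac:(lra)). assert (B := Hu xi ltac:(lra)).
  split; [nra | lra].
Qed.

Lemma derive_continuous (u u1 : R -> R) : (forall x, is_derive u x (u1 x)) -> forall x, continuous u x.
Proof. intros D x. apply (@ex_derive_continuous R_AbsRing R_NormedModule). eexists. apply D. Qed.

Lemma max_on (u : R -> R) (a b : R) : a <= b -> (forall x, continuous u x) ->
  exists m, a <= m <= b /\ forall x, a <= x <= b -> u x <= u m.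
Proof.
  intros Hab Hu. destruct (continuity_ab_maj u a b Hab) as [m [H1 H2]].
  - intros c _. apply continuity_pt_filterlim, Hu.
  - exists m. split; assumption.
Qed.

(** At an interior maximum u would exceed F >= |f|, so u'' = q u + f > 0 by q >= 1, which is absurd.
    Hence u stays above its initial value, u'' stays nonnegative and the slope cannot drop. *)
Lemma ode_growth (q f u u1 : R -> R) (F x1 : R) : ode q f u u1 -> 0 <= F ->
  (forall x, x1 <= x -> 1 <= q x) -> (forall x, x1 <= x -> Rabs (f x) <= F) ->
  F <= u x1 -> 0 < u1 x1 -> forall x, x1 <= x -> u x1 <= u x /\ u1 x1 <= u1 x.
Proof.
  intros [D0 D1] HF Hq Hf Hu Hu1.
  assert (A : forall y, x1 <= y -> u x1 <= u y).
  { intros y Hy. destruct (Rle_or_lt (u x1) (u y)) as [| Hlt]; [assumption | exfalso].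
    assert (Hxy : x1 < y) by (destruct Hy as [| ->]; lra).
    destruct (max_on u x1 y Hy (derive_continuous u u1 D0)) as [m [Hm Mx]].
    destruct (is_derive_pos_right u x1 _ (y - x1) (D0 x1) Hu1 ltac:(lra)) as [xi [Hxi Uxi]].
    specialize (Uxi xi ltac:(lra)). assert (Mxi := Mx xi ltac:(lra)).
    assert (m <> x1) by (intros ->; lra). assert (m <> y) by (intros ->; lra).
    assert (L := left_max_derive_nonneg u x1 m _ ltac:(lra) (D0 m) ltac:(intros; apply Mx; lra)).
    assert (Hfm := Hf m ltac:(lra)). apply Rabs_le_between in Hfm. assert (Hqm := Hq m ltac:(lra)).
    destruct (convex_not_max u u1 m _ (y - m) D0 (D1 m) L) as [z [Hz [Uz _]]]; [nra | lra |].
    specialize (Mx z ltac:(lra)). lra. }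
  intros x Hx. split; [now apply A |].
  apply derive_nonneg_incr with (fun t => q t * u t + f t); [assumption | exact D1 |].
  intros t Ht. assert (Hft := Hf t ltac:(lra)). apply Rabs_le_between in Hft.
  assert (Hqt := Hq t ltac:(lra)). assert (At := A t ltac:(lra)). nra.
Qed.

(** A maximum above |u X| + F would be followed at once by a point with u > F and positive slope,
    the start of an escape. *)
Lemma ode_bounded_of_no_growth (q f u u1 : R -> R) (F X : R) : ode q f u u1 -> 0 <= F ->
  (forall x, X <= x -> 1 <= q x) -> (forall x, X <= x -> Rabs (f x) <= F) ->
  (forall x, X <= x -> ~ (F < u x /\ 0 < u1 x)) -> forall x, X <= x -> u x <= Rabs (u X) + F.
Proof.
  intros [D0 D1] HF Hq Hf HN x Hx.
  destruct (Rle_or_lt (u x) (Rabs (u X) + F)) as [| Hlt]; [assumption | exfalso].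
  destruct (max_on u X x Hx (derive_continuous u u1 D0)) as [m [Hm Mx]].
  assert (Mxx := Mx x ltac:(lra)). generalize (Rle_abs (u X)), (Rabs_pos (u X)). intros.
  assert (m <> X) by (intros ->; lra).
  assert (L := left_max_derive_nonneg u X m _ ltac:(lra) (D0 m) ltac:(intros; apply Mx; lra)).
  assert (Hfm := Hf m ltac:(lra)). apply Rabs_le_between in Hfm. assert (Hqm := Hq m ltac:(lra)).
  destruct (convex_not_max u u1 m _ 1 D0 (D1 m) L) as [z [Hz [Uz U1z]]]; [nra | lra |].
  apply (HN z); lra.
Qed.

(* Shooting: slopes whose solution escapes to +oo form an open up-set, those
   escaping to -oo are disjoint from it and open; the separating slope is bounded. *)
Lemma bounded_shot (q f p p1 e e1 : R -> R) (F X : R) :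
  ode q f p p1 -> ode q (fun _ => 0) e e1 -> e X = 0 -> e1 X = 1 -> 0 <= F ->
  (forall x, X <= x -> 1 <= q x) -> (forall x, X <= x -> Rabs (f x) <= F) ->
  exists beta B, forall x, X <= x -> Rabs (p x + beta * e x) <= B.
Proof.
  intros Hp He eX e1X HF Hq Hf.
  assert (Ge : forall x, X <= x -> 0 <= e x /\ 1 <= e1 x).
  { intros x Hx. rewrite <- eX, <- e1X.
    apply (ode_growth q (fun _ => 0) e e1 0 X); auto; try lra.
    intros; rewrite Rabs_R0; lra. }
  assert (Ge1 : e (X + 1) >= 1).
  { destruct (MVT_cor2 e e1 X (X + 1)) as [c [Ec Hc]]; [lra | intros; apply is_derive_Reals, He |].
    assert (A := Ge c ltac:(lra)). nra. }
  assert (Hs : forall b, ode q f (fun x => p x + b * e x) (fun x => p1 x + b * e1 x)).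
  { intros b. assert (O := ode_combine _ _ _ _ _ _ _ 1 b Hp He).
    destruct O as [O1 O2]. split; intros x.
    - apply is_derive_ext with (fun x => 1 * p x + b * e x); [intros; ringR |].
      replace (p1 x + b * e1 x) with (1 * p1 x + b * e1 x) by ring. apply O1.
    - apply is_derive_ext with (fun x => 1 * p1 x + b * e1 x); [intros; ringR |].
      replace (q x * (p x + b * e x) + f x) with (q x * (1 * p x + b * e x) + (1 * f x + b * 0)) by ring. apply O2. }
  set (Up := fun b => exists x, X <= x /\ F < p x + b * e x /\ 0 < p1 x + b * e1 x).
  set (Dn := fun b => exists x, X <= x /\ p x + b * e x < - F /\ p1 x + b * e1 x < 0).
  assert (UpG : forall b x y, X <= x -> F < p x + b * e x -> 0 < p1 x + b * e1 x -> x <= y -> F < p y + b * e y).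
  { intros b x y Hx H1 H2 Hxy.
    assert (G := ode_growth q f _ _ F x (Hs b) HF ltac:(intros; apply Hq; lra) ltac:(intros; apply Hf; lra)
      ltac:(lra) H2 y Hxy). lra. }
  assert (DnG : forall b x y, X <= x -> p x + b * e x < - F -> p1 x + b * e1 x < 0 -> x <= y -> p y + b * e y < - F).
  { intros b x y Hx H1 H2 Hxy.
    assert (O := ode_combine _ _ _ _ _ _ _ (-1) 0 (Hs b) He).
    assert (G := ode_growth q _ _ _ F x O HF ltac:(intros; apply Hq; lra)).
    cbv beta in G.
    specialize (G ltac:(intros z Hz; replace (-1 * f z + 0 * 0) with (- f z) by ring; rewrite Rabs_Ropp; apply Hf; lra)
      ltac:(lra) ltac:(lra) y Hxy). lra. }
  assert (Disj : forall b, Up b -> Dn b -> False).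
  { intros b [x [Hx [H1 H2]]] [y [Hy [K1 K2]]].
    assert (A := UpG b x (Rmax x y) Hx H1 H2 (Rmax_l _ _)).
    assert (B := DnG b y (Rmax x y) Hy K1 K2 (Rmax_r _ _)). lra. }
  assert (UpM : forall b b', Up b -> b <= b' -> Up b').
  { intros b b' [x [Hx [H1 H2]]] Hb. exists x. destruct (Ge x Hx).
    split; [assumption |]. split; nra. }
  (* At X + 1 both e and e' are at least 1, so a multiple of this size overrules p, p' and F
     there. *)
  set (bu := Rabs (p (X + 1)) + Rabs (p1 (X + 1)) + F + 1).
  assert (B1 := Rle_abs (p (X + 1))). assert (B2 := Rle_abs (p1 (X + 1))).
  assert (C1 := Rle_abs (- p (X + 1))). assert (C2 := Rle_abs (- p1 (X + 1))).
  rewrite Rabs_Ropp in C1, C2.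
  assert (Hbu : 0 < bu) by (unfold bu; lra).
  assert (Ge2 := Ge (X + 1) ltac:(lra)).
  assert (Ubu : Up bu).
  { exists (X + 1). split; [lra |]. split.
    - assert (bu * 1 <= bu * e (X + 1)) by (apply Rmult_le_compat_l; lra). unfold bu in *. lra.
    - assert (bu * 1 <= bu * e1 (X + 1)) by (apply Rmult_le_compat_l; lra). unfold bu in *. lra. }
  assert (Dbu : Dn (- bu)).
  { exists (X + 1). split; [lra |]. split.
    - assert (bu * 1 <= bu * e (X + 1)) by (apply Rmult_le_compat_l; lra). unfold bu in *. lra.
    - assert (bu * 1 <= bu * e1 (X + 1)) by (apply Rmult_le_compat_l; lra). unfold bu in *. lra. }
  destruct (completeness (fun b => ~ Up b)) as [b [Hub Hlub]].
  - exists bu. intros b Hb. destruct (Rle_or_lt b bu) as [| Hlt]; [assumption | exfalso].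
    apply Hb. apply (UpM bu); [assumption | lra].
  - exists (- bu). intros HU. exact (Disj _ HU Dbu).
  - assert (NU : ~ Up b).
    { intros [x [Hx [H1 H2]]]. destruct (Ge x Hx) as [G1 G2].
      set (s := Rmin ((p x + b * e x - F) / (2 * (e x + 1))) ((p1 x + b * e1 x) / (2 * (e1 x + 1)))).
      assert (Hs0 : 0 < s) by (apply Rmin_glb_lt; apply Rdiv_lt_0_compat; lra).
      assert (S1 : s * (2 * (e x + 1)) <= p x + b * e x - F).
      { apply Rle_trans with ((p x + b * e x - F) / (2 * (e x + 1)) * (2 * (e x + 1))); [| right; field; lra].
        apply Rmult_le_compat_r; [lra | apply Rmin_l]. }
      assert (S2 : s * (2 * (e1 x + 1)) <= p1 x + b * e1 x).
      { apply Rle_trans with ((p1 x + b * e1 x) / (2 * (e1 x + 1)) * (2 * (e1 x + 1))); [| right; field; lra].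
        apply Rmult_le_compat_r; [lra | apply Rmin_r]. }
      assert (Us : Up (b - s)).
      { exists x. split; [assumption |]. split; nra. }
      assert (b <= b - s); [| lra]. apply Hlub. intros y Hy.
      destruct (Rle_or_lt y (b - s)) as [| Hlt]; [assumption | exfalso].
      apply Hy, (UpM (b - s)); [assumption | lra]. }
    assert (ND : ~ Dn b).
    { intros [x [Hx [H1 H2]]]. destruct (Ge x Hx) as [G1 G2].
      set (s := Rmin ((- F - (p x + b * e x)) / (2 * (e x + 1))) (- (p1 x + b * e1 x) / (2 * (e1 x + 1)))).
      assert (Hs0 : 0 < s) by (apply Rmin_glb_lt; apply Rdiv_lt_0_compat; lra).
      assert (S1 : s * (2 * (e x + 1)) <= - F - (p x + b * e x)).
      { apply Rle_trans with ((- F - (p x + b * e x)) / (2 * (e x + 1)) * (2 * (e x + 1))); [| right; field; lra].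
        apply Rmult_le_compat_r; [lra | apply Rmin_l]. }
      assert (S2 : s * (2 * (e1 x + 1)) <= - (p1 x + b * e1 x)).
      { apply Rle_trans with (- (p1 x + b * e1 x) / (2 * (e1 x + 1)) * (2 * (e1 x + 1))); [| right; field; lra].
        apply Rmult_le_compat_r; [lra | apply Rmin_r]. }
      assert (Ds : Dn (b + s)).
      { exists x. split; [assumption |]. split; nra. }
      assert (b + s <= b); [| lra]. apply Hub. intros HU. exact (Disj _ HU Ds). }
    exists b, (Rabs (p X + b * e X) + F). intros x Hx. apply Rabs_le. split.
    + assert (O := ode_combine _ _ _ _ _ _ _ (-1) 0 (Hs b) He).
      assert (G := ode_bounded_of_no_growth q _ _ _ F X O HF Hq). cbv beta in G.
      specialize (G ltac:(intros z Hz; replace (-1 * f z + 0 * 0) with (- f z) by ring; rewrite Rabs_Ropp; apply Hf; lra)).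
      specialize (G ltac:(intros z Hz [K1 K2]; apply ND; exists z; lra) x Hx).
      replace (-1 * (p X + b * e X) + 0 * e X) with (- (p X + b * e X)) in G by ring.
      rewrite Rabs_Ropp in G. lra.
    + apply (ode_bounded_of_no_growth q f _ _ F X (Hs b) HF Hq Hf); [| assumption].
      intros z Hz [K1 K2]. apply NU. exists z. auto.
Qed.

Definition fast_right (f : R -> R) : Prop :=
  forall c, 0 <= c -> exists C, 0 <= C /\ forall x, 0 <= x -> Rabs (f x) <= C * exp (- (c * x)).

Lemma fast_of_sides (f : R -> R) : (forall x, continuous f x) -> fast_right f ->
  fast_right (fun x => f (- x)) -> fast f.
Proof.
  intros Hf R L. split; [assumption |]. intros c Hc.
  destruct (R c Hc) as [C [HC BC]]. destruct (L c Hc) as [D [HD BD]].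
  exists (2 * (C + D)). intros z.
  assert (B : Rabs (f z) <= (C + D) * exp (- (c * Rabs z))).
  { destruct (Rle_or_lt 0 z) as [Hz | Hz].
    - rewrite (Rabs_pos_eq z) by assumption. specialize (BC z Hz).
      generalize (exp_pos (- (c * z))). nra.
    - rewrite (Rabs_left z) by assumption. specialize (BD (- z) ltac:(lra)).
      rewrite Ropp_involutive in BD. generalize (exp_pos (- (c * - z))). nra. }
  apply Rle_trans with ((C + D) * exp (- (c * Rabs z)) * (2 * exp (c * Rabs z))).
  - apply Rmult_le_compat; [apply Rabs_pos | left; apply Wt_pos | assumption | now apply Wt_le_exp_abs].
  - replace ((C + D) * exp (- (c * Rabs z)) * (2 * exp (c * Rabs z)))
      with (2 * (C + D) * (exp (- (c * Rabs z)) * exp (c * Rabs z))) by ring.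
    rewrite <- exp_plus, Rplus_opp_l, exp_0. lra.
Qed.

Lemma fast_right_of_fast (f : R -> R) : fast f -> fast_right f.
Proof.
  intros Hf c Hc. destruct (fast_exp_bound f c Hc Hf) as [C [HC B]].
  exists C. split; [assumption |]. intros x Hx. rewrite <- (Rabs_pos_eq x) at 2 by assumption. apply B.
Qed.

Lemma fast_right_extend (f : R -> R) : (forall x, continuous f x) ->
  (forall c, 0 <= c -> exists X C, forall x, X <= x -> Rabs (f x) <= C * exp (- (c * x))) -> fast_right f.
Proof.
  intros Hf H c Hc. destruct (H c Hc) as [X [C B]].
  destruct (bounded_on f 0 X Hf) as [M [HM BM]].
  exists (Rabs C + M * exp (c * Rabs X)).
  assert (HC := Rabs_pos C). assert (HX := exp_pos (c * Rabs X)).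
  assert (0 <= M * exp (c * Rabs X)) by (apply Rmult_le_pos; lra).
  split; [lra |].
  intros x Hx. assert (Ex := exp_pos (- (c * x))).
  destruct (Rle_or_lt X x) as [HXx | HXx].
  - apply Rle_trans with (1 := B x HXx). apply Rmult_le_compat_r; [lra |].
    generalize (Rle_abs C). lra.
  - apply Rle_trans with (M * 1); [rewrite Rmult_1_r; apply BM; lra |].
    apply Rle_trans with (M * exp (c * Rabs X) * exp (- (c * x))).
    + rewrite Rmult_assoc, <- exp_plus. apply Rmult_le_compat_l; [assumption |]. apply exp_ge_1.
      generalize (Rle_abs X). nra.
    + apply Rmult_le_compat_r; lra.
Qed.

Lemma fast_right_lin (a b : R) (f g : R -> R) : fast_right f -> fast_right g ->
  fast_right (fun x => a * f x + b * g x).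
Proof.
  intros Hf Hg c Hc. destruct (Hf c Hc) as [C [HC B]]. destruct (Hg c Hc) as [D [HD E]].
  assert (Ha := Rabs_pos a). assert (Hb := Rabs_pos b).
  exists (Rabs a * C + Rabs b * D). split; [apply Rplus_le_le_0_compat; now apply Rmult_le_pos |].
  intros x Hx. eapply Rle_trans; [apply Rabs_triang |]. rewrite !Rabs_mult, Rmult_plus_distr_r, !Rmult_assoc.
  apply Rplus_le_compat; (apply Rmult_le_compat_l; [apply Rabs_pos | auto]).
Qed.

Lemma fast_right_slow (g f : R -> R) : slow g -> fast_right f -> fast_right (fun x => g x * f x).
Proof.
  intros [_ [d [D [Hd [HD HB]]]]] Hf c Hc.
  destruct (Hf (c + d) ltac:(lra)) as [C [HC B]]. exists (2 * D * C).
  split; [apply Rmult_le_pos; lra |]. intros x Hx. rewrite Rabs_mult.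
  apply Rle_trans with (D * (2 * exp (d * x)) * (C * exp (- ((c + d) * x)))).
  - apply Rmult_le_compat; auto using Rabs_pos.
    apply Rle_trans with (1 := HB x). apply Rmult_le_compat_l; [assumption |].
    rewrite <- (Rabs_pos_eq x) at 2 by assumption. now apply Wt_le_exp_abs.
  - replace (- ((c + d) * x)) with (- (c * x) + - (d * x)) by ring. rewrite exp_plus.
    replace (D * (2 * exp (d * x)) * (C * (exp (- (c * x)) * exp (- (d * x)))))
      with (2 * D * C * exp (- (c * x)) * (exp (d * x) * exp (- (d * x)))) by ring.
    rewrite <- exp_plus, Rplus_opp_r, exp_0. lra.
Qed.

Definition confining (q : R -> R) : Prop := forall M, exists X, forall x, X <= x -> M <= q x.

(* Maximum principle against the barrier [A exp (-c x) + eps exp (c x)]. *)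
Lemma ode_barrier (q f u u1 : R -> R) (X B c K : R) : ode q f u u1 -> 0 < c -> 0 <= K -> 0 <= B ->
  (forall x, X <= x -> u x <= B) -> (forall x, X <= x -> c ^ 2 + 1 <= q x) ->
  (forall x, X <= x -> Rabs (f x) <= K * exp (- (c * x))) ->
  forall x, X <= x -> u x <= (K + B * exp (c * X)) * exp (- (c * x)).
Proof.
  intros [D0 D1] Hc HK HB Hu Hq Hf x Hx.
  set (A := K + B * exp (c * X)).
  assert (HA0 : 0 <= B * exp (c * X)) by (apply Rmult_le_pos; [assumption | left; apply exp_pos]).
  assert (HA : K <= A) by (unfold A; lra).
  enough (E : forall eps, 0 < eps -> u x <= A * exp (- (c * x)) + eps * exp (c * x)).
  { destruct (Rle_or_lt (u x) (A * exp (- (c * x)))) as [| Hlt]; [assumption | exfalso].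
    assert (P := exp_pos (c * x)).
    specialize (E ((u x - A * exp (- (c * x))) / (2 * exp (c * x)))).
    replace ((u x - A * exp (- (c * x))) / (2 * exp (c * x)) * exp (c * x)) with ((u x - A * exp (- (c * x))) / 2) in E
      by (field; lra).
    assert (0 < (u x - A * exp (- (c * x))) / (2 * exp (c * x))) by (apply Rdiv_lt_0_compat; lra).
    specialize (E H). lra. }
  intros eps Heps.
  set (z := fun t => A * exp (- (c * t)) + eps * exp (c * t)).
  set (z1 := fun t => - c * (A * exp (- (c * t))) + c * (eps * exp (c * t))).
  assert (Dz : forall t, is_derive z t (z1 t)) by (intros; unfold z, z1; auto_derive; [trivial | ring]).
  assert (Dz1 : forall t, is_derive z1 t (c ^ 2 * z t)) by (intros; unfold z, z1; auto_derive; [trivial | ring]).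
  destruct (Rle_or_lt (u x) (z x)) as [| Hlt]; [assumption | exfalso].
  set (d := fun t => u t - z t). set (d1 := fun t => u1 t - z1 t).
  assert (Dd : forall t, is_derive d t (d1 t)) by (intros; apply is_derive_minusR; auto).
  assert (Dd1 : forall t, is_derive d1 t (q t * u t + f t - c ^ 2 * z t)) by (intros; apply is_derive_minusR; auto).
  (* Far enough that eps exp(c Y) >= B, so the maximum of u - z is not attained at the right end. *)
  set (Y := Rmax x (B / (c * eps))).
  assert (HY : x <= Y) by apply Rmax_l.
  destruct (max_on d X Y ltac:(lra) (derive_continuous d d1 Dd)) as [m [Hm Mx]].
  assert (Mxx := Mx x ltac:(lra)).
  assert (HmX : m <> X).
  { intros ->. unfold d, z in Mxx. assert (UX := Hu X ltac:(lra)).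
    assert (A * exp (- (c * X)) >= B).
    { unfold A. rewrite Rmult_plus_distr_r, Rmult_assoc, <- exp_plus, Rplus_opp_r, exp_0.
      assert (0 <= K * exp (- (c * X))) by (apply Rmult_le_pos; [assumption | left; apply exp_pos]). lra. }
    generalize (Rmult_lt_0_compat _ _ Heps (exp_pos (c * X))). unfold z in Hlt. lra. }
  assert (HmY : m <> Y).
  { intros ->. unfold d in Mxx. assert (UY := Hu Y ltac:(lra)).
    assert (B <= eps * exp (c * Y)).
    { assert (B / (c * eps) <= Y) by apply Rmax_r.
      assert (B / (c * eps) * (c * eps) <= Y * (c * eps)) by (apply Rmult_le_compat_r; nra).
      replace (B / (c * eps) * (c * eps)) with B in * by (field; lra).
      generalize (exp_ineq1_le (c * Y)). nra. }
    assert (0 <= A * exp (- (c * Y))) by (apply Rmult_le_pos; [lra | left; apply exp_pos]).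
    unfold z at 2 in Mxx. lra. }
  assert (L := left_max_derive_nonneg d X m _ ltac:(lra) (Dd m) ltac:(intros; apply Mx; lra)).
  assert (Hfm := Hf m ltac:(lra)). apply Rabs_le_between in Hfm. assert (Hqm := Hq m ltac:(lra)).
  assert (Em := exp_pos (- (c * m))). assert (Ep := exp_pos (c * m)).
  assert (Zm : K * exp (- (c * m)) < z m).
  { unfold z. assert (K * exp (- (c * m)) <= A * exp (- (c * m))) by (apply Rmult_le_compat_r; lra).
    generalize (Rmult_lt_0_compat _ _ Heps Ep). lra. }
  assert (Um : z m < u m) by (unfold d in Mxx; lra).
  destruct (convex_not_max d d1 m _ (Y - m) Dd (Dd1 m) L) as [xi [Hxi [Uxi _]]]; [| lra |].
  - assert ((c ^ 2 + 1) * u m <= q m * u m) by (apply Rmult_le_compat_r; lra).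
    assert (c ^ 2 * z m <= c ^ 2 * u m) by (apply Rmult_le_compat_l; [apply pow2_ge_0 | lra]). lra.
  - specialize (Mx xi ltac:(lra)). lra.
Qed.

Lemma ode_bounded_fast (q f u u1 : R -> R) (X B : R) : ode q f u u1 -> confining q -> fast_right f ->
  (forall x, X <= x -> Rabs (u x) <= B) -> fast_right u.
Proof.
  intros Ho Hq Hf Hu. apply fast_right_extend; [apply (derive_continuous u u1), Ho |].
  intros c0 Hc0. set (c := c0 + 1).
  destruct (Hq (c ^ 2 + 1)) as [Y HY]. destruct (Hf c ltac:(unfold c; lra)) as [K [HK BK]].
  set (X' := Rmax 0 (Rmax X Y)).
  assert (0 <= X') by apply Rmax_l. assert (X <= X') by (eapply Rle_trans; [apply Rmax_l | apply Rmax_r]).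
  assert (Y <= X') by (eapply Rle_trans; [apply Rmax_r | apply Rmax_r]).
  assert (HB : 0 <= B) by (apply Rle_trans with (2 := Hu X ltac:(lra)); apply Rabs_pos).
  exists X', (K + B * exp (c * X')). intros x Hx.
  assert (M : (K + B * exp (c * X')) * exp (- (c * x)) <= (K + B * exp (c * X')) * exp (- (c0 * x))).
  { apply Rmult_le_compat_l.
    - assert (0 <= B * exp (c * X')) by (apply Rmult_le_pos; [assumption | left; apply exp_pos]). lra.
    - apply exp_mono. unfold c. lra. }
  apply Rle_trans with (2 := M). apply Rabs_le. split.
  - assert (O := ode_combine _ _ _ _ _ _ _ (-1) 0 Ho Ho).
    assert (G := ode_barrier q _ _ _ X' B c K O ltac:(unfold c; lra) HK HB). cbv beta in G.
    specialize (G ltac:(intros y Hy; assert (Q := Hu y ltac:(lra)); apply Rabs_le_between in Q; lra)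
      ltac:(intros; apply HY; lra)).
    specialize (G ltac:(intros y Hy; replace (-1 * f y + 0 * f y) with (- f y) by ring; rewrite Rabs_Ropp; apply BK; lra) x Hx).
    lra.
  - apply (ode_barrier q f u u1 X' B c K Ho ltac:(unfold c; lra) HK HB); try assumption.
    + intros y Hy. assert (Q := Hu y ltac:(lra)). apply Rabs_le_between in Q. lra.
    + intros; apply HY; lra.
    + intros; apply BK; lra.
Qed.

(** Interpolation: the mean value theorem on [x, x + 1] gives u' at one point from u, and u''
    carries it back to x. *)
Lemma fast_right_derive (u u1 u2 : R -> R) : (forall x, is_derive u x (u1 x)) ->
  (forall x, is_derive u1 x (u2 x)) -> fast_right u -> fast_right u2 -> fast_right u1.
Proof.
  intros D0 D1 H0 H2 c Hc. destruct (H0 c Hc) as [C [HC B]]. destruct (H2 c Hc) as [D [HD E]].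
  exists (2 * C + D). split; [lra |]. intros x Hx.
  destruct (MVT_cor2 u u1 x (x + 1)) as [a [Ea Ha]]; [lra | intros; apply is_derive_Reals, D0 |].
  destruct (MVT_cor2 u1 u2 x a) as [b [Eb Hb]]; [lra | intros; apply is_derive_Reals, D1 |].
  assert (M : forall y, x <= y -> exp (- (c * y)) <= exp (- (c * x))) by (intros; apply exp_mono; nra).
  assert (B1 := B (x + 1) ltac:(lra)). assert (B0 := B x Hx). assert (B2 := E b ltac:(lra)).
  assert (M1 := M (x + 1) ltac:(lra)). assert (M2 := M b ltac:(lra)).
  assert (Bb : Rabs (u2 b) <= D * exp (- (c * x))).
  { apply Rle_trans with (1 := B2). now apply Rmult_le_compat_l. }
  assert (Bu : Rabs (u (x + 1)) <= C * exp (- (c * x))).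
  { apply Rle_trans with (1 := B1). now apply Rmult_le_compat_l. }
  apply Rabs_le_between in Bb. apply Rabs_le_between in Bu. apply Rabs_le_between in B0.
  assert (Rabs (u2 b * (a - x)) <= D * exp (- (c * x))).
  { rewrite Rabs_mult. rewrite <- (Rmult_1_r (D * _)). apply Rmult_le_compat; try apply Rabs_pos.
    - apply Rabs_le. lra.
    - apply Rabs_le. lra. }
  apply Rabs_le_between in H. apply Rabs_le. lra.
Qed.

Lemma ode_fast_right (q f u u1 : R -> R) (X B : R) : ode q f u u1 -> confining q -> slow q -> fast_right f ->
  (forall x, X <= x -> Rabs (u x) <= B) -> fast_right u /\ fast_right u1.
Proof.
  intros Ho Hq Sq Hf Hu.
  assert (Fu := ode_bounded_fast q f u u1 X B Ho Hq Hf Hu). split; [assumption |].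
  apply fast_right_derive with u (fun x => 1 * (q x * u x) + 1 * f x); [apply Ho | | assumption |].
  - intros x. evar_last; [apply Ho |]. ring.
  - apply fast_right_lin; [now apply fast_right_slow | assumption].
Qed.

(** A solution is corrected by a multiple of e, the solution with data (0, 1) at X, to a bounded and
    hence fast one. Starting the homogeneous case from the value 1 keeps it nonzero, since e
    vanishes at X. *)
Lemma ode_decaying (q f : R -> R) : slow q -> confining q -> (forall x, continuous f x) -> fast_right f ->
  (exists u u1, ode q f u u1 /\ fast_right u /\ fast_right u1) /\
  exists u u1, ode q (fun _ => 0) u u1 /\ fast_right u /\ fast_right u1 /\ exists x, u x <> 0.
Proof.
  intros Sq Hq Cf Hf.
  destruct (Hq 1) as [Y HY]. set (X := Rmax 0 Y).
  assert (HX0 : 0 <= X) by apply Rmax_l. assert (HXY : Y <= X) by apply Rmax_r.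
  destruct (ode_exists q (fun _ => 0) X 0 1 (proj1 Sq) (fun y => continuous_const 0 y)) as (e & e1 & He & eX & e1X).
  assert (G : forall g p p1, fast_right g -> ode q g p p1 -> exists b,
    ode q g (fun x => p x + b * e x) (fun x => p1 x + b * e1 x) /\
    fast_right (fun x => p x + b * e x) /\ fast_right (fun x => p1 x + b * e1 x)).
  { intros g p p1 Hg Hp. destruct (Hg 0 ltac:(lra)) as [F [HF BF]].
    destruct (bounded_shot q g p p1 e e1 F X Hp He eX e1X HF) as [b [B HB]].
    - intros; apply HY; lra.
    - intros x Hx. specialize (BF x ltac:(lra)). rewrite Rmult_0_l, Ropp_0, exp_0, Rmult_1_r in BF. exact BF.
    - exists b.
      assert (O : ode q g (fun x => p x + b * e x) (fun x => p1 x + b * e1 x)).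
      { assert (O := ode_combine _ _ _ _ _ _ _ 1 b Hp He). destruct O as [O1 O2]. split; intros x.
        - apply is_derive_ext with (fun x => 1 * p x + b * e x); [intros; ringR |].
          replace (p1 x + b * e1 x) with (1 * p1 x + b * e1 x) by ring. apply O1.
        - apply is_derive_ext with (fun x => 1 * p1 x + b * e1 x); [intros; ringR |].
          replace (q x * (p x + b * e x) + g x) with (q x * (1 * p x + b * e x) + (1 * g x + b * 0)) by ring. apply O2. }
      split; [exact O |]. now apply (ode_fast_right q g _ _ X B). }
  split.
  - destruct (ode_exists q f X 0 0 (proj1 Sq) Cf) as (p & p1 & Hp & _).
    destruct (G f p p1 Hf Hp) as [b Hb]. eauto.
  - destruct (ode_exists q (fun _ => 0) X 1 0 (proj1 Sq) (fun y => continuous_const 0 y)) as (p & p1 & Hp & pX & _).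
    destruct (G (fun _ => 0) p p1) as [b (H1 & H2 & H3)]; [| assumption |].
    + intros c _. exists 0. split; [lra |]. intros. rewrite Rabs_R0. lra.
    + exists (fun x => p x + b * e x), (fun x => p1 x + b * e1 x).
      refine (conj H1 (conj H2 (conj H3 _))).
      exists X. rewrite pX, eX. lra.
Qed.

Lemma ode_dom (q f u u1 : R -> R) : slow q -> fast f -> ode q f u u1 ->
  fast_right u -> fast_right u1 -> fast_right (fun x => u (- x)) -> fast_right (fun x => u1 (- x)) ->
  dom u u1 (fun x => q x * u x + f x).
Proof.
  intros Sq Ff [D0 D1] R0 R1 L0 L1.
  assert (F0 : fast u) by (apply fast_of_sides; auto; now apply derive_continuous with u1).
  assert (F1 : fast u1).
  { apply fast_of_sides; auto. now apply derive_continuous with (fun x => q x * u x + f x). }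
  split; [assumption |]. split; [assumption |]. split; [fast_tac | split; assumption].
Qed.

Lemma slow_reflect (q : R -> R) : slow q -> slow (fun x => q (- x)).
Proof.
  intros [Hc (c & C & H0 & H1 & B)]. split; [intros; now apply continuous_oppargR |].
  exists c, C. repeat split; auto. intros z. rewrite <- Wt_opp_r. apply B.
Qed.

(** D is the Wronskian at 0 of the homogeneous solutions decaying at +oo and at -oo. If D = 0 they
    are proportional and give an eigenfunction; otherwise Cramer's rule matches the two
    inhomogeneous solutions, each decaying at one end. *)
Lemma fredholm_alternative (q f : R -> R) : slow q -> confining q -> confining (fun x => q (- x)) -> fast f ->
  (exists v v1, dom v v1 (fun x => q x * v x) /\ exists x, v x <> 0) \/
  (exists w w1, dom w w1 (fun x => q x * w x + f x)).
Proof.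
  intros Sq Qr Ql Ff.
  assert (Ff' := fast_opp_arg f Ff).
  destruct (ode_decaying q f Sq Qr (proj1 Ff) (fast_right_of_fast f Ff))
    as [(wr & wr1 & Hwr & Fwr & Fwr1) (ur & ur1 & Hur & Fur & Fur1 & Nur)].
  destruct (ode_decaying (fun x => q (- x)) (fun x => f (- x)) (slow_reflect q Sq) Ql
    (proj1 Ff') (fast_right_of_fast _ Ff')) as [(wl & wl1 & Hwl & Fwl & Fwl1) (ul & ul1 & Hul & Ful & Ful1 & Nul)].
  assert (Back : forall g u u1, ode (fun x => q (- x)) (fun x => g (- x)) u u1 ->
    ode q g (fun x => u (- x)) (fun x => - u1 (- x))).
  { intros g u u1 H. apply ode_reflect in H. destruct H as [H0 H1]. split; [assumption |].
    intros x. specialize (H1 x). rewrite Ropp_involutive in H1. exact H1. }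
  apply Back in Hwl. apply (Back (fun _ => 0)) in Hul.
  assert (neg : forall k, fast_right k -> fast_right (fun x => - k (- - x))).
  { intros k Hk c Hc. destruct (Hk c Hc) as [C [HC B]]. exists C. split; [assumption |].
    intros x Hx. rewrite Ropp_involutive, Rabs_Ropp. now apply B. }
  assert (inv : forall k, fast_right k -> fast_right (fun x => k (- - x))).
  { intros k Hk c Hc. destruct (Hk c Hc) as [C [HC B]]. exists C. split; [assumption |].
    intros x Hx. rewrite Ropp_involutive. now apply B. }
  assert (Gwl := inv _ Fwl). assert (Gwl1 := neg _ Fwl1). assert (Gul := inv _ Ful). assert (Gul1 := neg _ Ful1).
  set (vl := fun x => ul (- x)) in *. set (vl1 := fun x => - ul1 (- x)) in *.
  set (yl := fun x => wl (- x)) in *. set (yl1 := fun x => - wl1 (- x)) in *.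
  assert (Nvl : vl 0 <> 0 \/ vl1 0 <> 0).
  { destruct (Req_dec (vl 0) 0) as [E0 |]; [| now left]. right. intros E1.
    destruct Nul as [x Hx]. apply Hx. rewrite <- (Ropp_involutive x).
    apply (ode_unique q vl vl1 0); auto. apply Sq. }
  set (D := ur 0 * vl1 0 - ur1 0 * vl 0).
  destruct (Req_dec D 0) as [HD | HD].
  - left. exists ur, ur1.
    assert (P : exists c, ur 0 = c * vl 0 /\ ur1 0 = c * vl1 0).
    { destruct (Req_dec (vl 0) 0) as [E0 | E0].
      - assert (E1 : vl1 0 <> 0) by (destruct Nvl; [contradiction | assumption]).
        exists (ur1 0 / vl1 0). split; [| field; assumption].
        unfold D in HD. rewrite E0 in *.
        assert (X : ur 0 * vl1 0 = 0) by lra. apply Rmult_integral in X. destruct X; [lra | contradiction].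
      - exists (ur 0 / vl 0). split; [field; assumption |].
        apply Rmult_eq_reg_r with (vl 0); [| assumption].
        replace (ur 0 / vl 0 * vl1 0 * vl 0) with (ur 0 * vl1 0) by (field; assumption). unfold D in HD. lra. }
    destruct P as [c [P0 P1]].
    assert (O := ode_combine _ _ _ _ _ _ _ 1 (- c) Hur Hul).
    apply (ode_ext _ _ (fun _ => 0)) in O; [| intros; ring].
    assert (Z : forall x, ur x = c * vl x).
    { intros x. assert (Z := ode_unique q _ _ 0 (proj1 Sq) O ltac:(cbv beta; lra) ltac:(cbv beta; lra) x).
      lra. }
    assert (Z1 : forall x, ur1 x = c * vl1 x).
    { intros x. assert (E1 := is_derive_unique _ _ _ (proj1 Hur x)).
      rewrite <- E1. apply is_derive_unique.
      apply is_derive_ext with (fun x => c * vl x); [intros; now rewrite Z |].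
      apply is_derive_scal, Hul. }
    split.
    + assert (F0 : fast (fun _ => 0)).
      { apply fast_ext with (fun x => 0 * f x); [intros; ring |]. apply fast_mult_r; [apply slow_const | assumption]. }
      assert (Dm := ode_dom q (fun _ => 0) ur ur1 Sq F0 Hur Fur Fur1).
      assert (L0 : fast_right (fun x => ur (- x))).
      { assert (K := fast_right_lin c 0 _ _ Gul Gul). intros a Ha. destruct (K a Ha) as [C [HC B]].
        exists C. split; [assumption |]. intros x Hx. specialize (B x Hx).
        rewrite Z. unfold vl. rewrite Ropp_involutive in *. replace (c * ul x) with (c * ul x + 0 * ul x) by ring. exact B. }
      assert (L1 : fast_right (fun x => ur1 (- x))).
      { assert (K := fast_right_lin c 0 _ _ Gul1 Gul1). intros a Ha. destruct (K a Ha) as [C [HC B]].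
        exists C. split; [assumption |]. intros x Hx. specialize (B x Hx).
        rewrite Z1. unfold vl1. rewrite Ropp_involutive in *.
        replace (c * - ul1 x) with (c * - ul1 x + 0 * - ul1 x) by ring. exact B. }
      destruct (Dm L0 L1) as (A1 & A2 & A3 & A4 & A5).
      split; [assumption |]. split; [assumption |]. split; [| split; [assumption |]].
      * apply fast_ext with (2 := A3). intros; ring.
      * intros z. evar_last; [apply A5 |]. ring.
    + exact Nur.
  - right.
    set (a := ((wr 0 - yl 0) * vl1 0 - (wr1 0 - yl1 0) * vl 0) / D).
    set (b := (ur 0 * (wr1 0 - yl1 0) - ur1 0 * (wr 0 - yl 0)) / D).
    assert (Ea : a * ur 0 + b * vl 0 = wr 0 - yl 0) by (unfold a, b; unfold D in *; field; assumption).
    assert (Eb : a * ur1 0 + b * vl1 0 = wr1 0 - yl1 0) by (unfold a, b; unfold D in *; field; assumption).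
    set (w := fun x => 1 * wr x + - a * ur x). set (w1 := fun x => 1 * wr1 x + - a * ur1 x).
    assert (Ow : ode q f w w1).
    { apply ode_ext with (2 := ode_combine _ _ _ _ _ _ _ 1 (- a) Hwr Hur). intros; ring. }
    set (y := fun x => 1 * yl x + b * vl x). set (y1 := fun x => 1 * yl1 x + b * vl1 x).
    assert (Oy : ode q f y y1).
    { apply ode_ext with (2 := ode_combine _ _ _ _ _ _ _ 1 b Hwl Hul). intros; ring. }
    assert (O := ode_combine _ _ _ _ _ _ _ 1 (-1) Ow Oy).
    apply (ode_ext _ _ (fun _ => 0)) in O; [| intros; ring].
    assert (Z : forall x, w x = y x).
    { intros x. assert (Z := ode_unique q _ _ 0 (proj1 Sq) O).
      specialize (Z ltac:(unfold w, y; lra) ltac:(unfold w1, y1; lra) x). lra. }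
    assert (Z1 : forall x, w1 x = y1 x).
    { intros x. assert (E1 := is_derive_unique _ _ _ (proj1 Ow x)).
      rewrite <- E1. apply is_derive_unique.
      apply is_derive_ext with y; [intros; now rewrite Z |]. apply Oy. }
    exists w, w1. apply ode_dom; auto.
    + now apply fast_right_lin.
    + now apply fast_right_lin.
    + assert (K := fast_right_lin 1 b _ _ Gwl Gul). intros e He. destruct (K e He) as [C [HC B]].
      exists C. split; [assumption |]. intros x Hx. rewrite Z. now apply B.
    + assert (K := fast_right_lin 1 b _ _ Gwl1 Gul1). intros e He. destruct (K e He) as [C [HC B]].
      exists C. split; [assumption |]. intros x Hx. rewrite Z1. now apply B.
Qed.

(** * Existence, uniqueness and counting of eigenvalues *)

(** Eigenvalue with a rapidly decaying eigenfunction; the passage to and from the square-integrable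
    notion [is_eigenvalue] is made when rescaling. *)
Definition iseig (U : R -> R) (E : R) : Prop :=
  exists v v1 v2, eigf U E v v1 v2 /\ exists z, v z <> 0.

Lemma integ_res_sym (U : R -> R) (E : R) (w w1 w2 v v1 v2 : R -> R) : slow U ->
  dom w w1 w2 -> dom v v1 v2 ->
  integ (fun z => res U E w w2 z * v z) = integ (fun z => w z * res U E v v2 z).
Proof.
  intros SU Hw Hv. assert (S := integ_dom_sym _ _ _ _ _ _ Hw Hv).
  assert (Fw := fast_res U E _ _ _ SU Hw). assert (Fv := fast_res U E _ _ _ SU Hv).
  destruct Hw as (W0 & W1 & W2 & _). destruct Hv as (V0 & V1 & V2 & _).
  apply Rminus_diag_uniq. rewrite <- integ_minus by fast_tac.
  rewrite (integ_ext _ (fun z => w z * v2 z - w2 z * v z)) by (intros; unfold res; ring).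
  rewrite integ_minus by fast_tac. lra.
Qed.

Lemma sq_le_abs (a b : R) : 0 <= b -> a ^ 2 <= b ^ 2 -> Rabs a <= b.
Proof.
  intros Hb H. apply Rabs_le. split.
  - destruct (Rle_or_lt (- b) a); [assumption | nra].
  - destruct (Rle_or_lt a b); [assumption | nra].
Qed.

Lemma mult_le_cancel_inv (a b : R) : 0 < b -> a <= / b -> a * b <= 1.
Proof.
  intros Hb H. apply Rle_trans with (/ b * b); [apply Rmult_le_compat_r; lra | right; field; lra].
Qed.

Lemma uniform_threshold (P : nat -> R -> Prop) :
  (forall i, exists eta0, 0 < eta0 /\ forall eta, eta <= eta0 -> P i eta) ->
  forall n, exists eta0, 0 < eta0 /\ forall eta, eta <= eta0 -> forall i, (i < n)%nat -> P i eta.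
Proof.
  intros H n. induction n as [| n [e [He IH]]].
  - exists 1. split; [lra |]. intros; lia.
  - destruct (H n) as [d [Hd D]]. exists (Rmin e d). split; [now apply Rmin_glb_lt |].
    intros eta Heta i Hi. assert (A := Rle_trans _ _ _ Heta (Rmin_l _ _)). assert (B := Rle_trans _ _ _ Heta (Rmin_r _ _)).
    destruct (Nat.eq_dec i n) as [-> | Hn]; [now apply D | apply IH; [assumption | lia]].
Qed.

Section Existence.

Variables kappa c0 : R.
Hypothesis Hkappa : 0 < kappa.
Hypothesis Hc0 : 0 <= c0.

(** t is the component along hf_j of w = (h - lam)^{-1} hf_j. With d = 2 j + 1 - lam, the gap
    applies to w - t hf_j, whose source is (1 - t d) hf_j - t (U - z^2) hf_j; testing with hf_j then
    shows d t close to 1, its value for the oscillator. *)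
Lemma resolvent_estimate (j : nat) : exists C eta0, 0 < C /\ 0 < eta0 /\
  forall U eta lam w w1 w2, adm kappa c0 U eta -> eta <= eta0 -> Rabs (lam - (2 * INR j + 1)) <= 1 ->
  dom w w1 w2 -> (forall z, res U lam w w2 z = hf j z) ->
  let t := integ (fun z => w z * hf j z) / hn j in
  integ (fun z => w z ^ 2) <= C * (1 + t ^ 2) /\
  ((2 * INR j + 1 - lam) * t - 1) ^ 2 <= C * eta ^ 2 * (1 + t ^ 2).
Proof.
  destruct (gap kappa c0 Hkappa Hc0 j) as [C [eta1 [HC [He1 G]]]].
  assert (F := fast_hf j). assert (Hn := hn_pos j).
  set (A := 4 * integ (fun z => Wt (c0 + 2 * c0) z * hf j z ^ 2)).
  set (B := integ (fun z => Wt c0 z * hf j z ^ 2)).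
  set (K := integ (fun z => (Wt c0 z * hf j z) ^ 2)).
  assert (HA : 0 <= A) by (unfold A; generalize (integ_Wt_sq_ge0 (c0 + 2 * c0) (hf j) ltac:(lra) F); lra).
  assert (HB : 0 <= B) by now apply integ_Wt_sq_ge0.
  assert (HK : 0 <= K) by (apply (integ_sq_ge0 (fun z => Wt c0 z * hf j z)); fast_tac).
  set (C1 := 2 * (C * (2 * A + 4 * B)) + 2 * hn j).
  assert (HC1 : 0 < C1).
  { unfold C1. assert (0 <= C * (2 * A + 4 * B)) by (apply Rmult_le_pos; lra). lra. }
  assert (HKn : 0 <= K / hn j ^ 2).
  { apply Rmult_le_pos; [assumption |]. left. apply Rinv_0_lt_compat, pow_lt; assumption. }
  assert (HCK : 0 <= C1 * (K / hn j ^ 2)) by (apply Rmult_le_pos; lra).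
  exists (C1 + C1 * (K / hn j ^ 2)), (Rmin 1 eta1). split; [lra |]. split; [apply Rmin_glb_lt; lra |].
  intros U eta lam w w1 w2 HU Heta Hl Hd Hr t.
  assert (Hep := adm_eta_pos _ _ _ _ HU). assert (SU := adm_slow kappa c0 Hc0 U eta HU).
  assert (SP := adm_slow_pert kappa c0 Hc0 U eta HU).
  assert (E1 : eta <= 1) by (apply Rle_trans with (1 := Heta); apply Rmin_l).
  assert (E2 : eta <= eta1) by (apply Rle_trans with (1 := Heta); apply Rmin_r).
  assert (Fw := proj1 Hd). assert (Ht2 := pow2_ge_0 t).
  set (d := 2 * INR j + 1 - lam) in *.
  assert (Hd1 : - 1 <= d <= 1) by (apply Rabs_le_between in Hl; unfold d; lra).
  assert (Hx := dom_plus_scal (- t) _ _ _ _ _ _ Hd (dom_hf j)).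
  specialize (G U eta lam _ _ _ HU E2 Hl Hx).
  assert (Ow : integ (fun z => (w z + - t * hf j z) * hf j z) = 0).
  { rewrite (integ_ext _ (fun z => w z * hf j z - t * hf j z ^ 2)) by (intros; ring).
    rewrite integ_minus, integ_scal by fast_tac. fold (hn j). unfold t. field. lra. }
  specialize (G Ow).
  rewrite (integ_ext (fun z => Wt c0 z * _)
    (fun z => Wt c0 z * ((1 - t * d) * hf j z + - t * ((U z - z ^ 2) * hf j z)) ^ 2)) in G.
  2: { intros z. f_equal. f_equal.
       replace (res U lam (fun y => w y + - t * hf j y) (fun y => w2 y + - t * hf2 j y) z)
         with (res U lam w w2 z - t * (- hf2 j z + (U z - lam) * hf j z)) by (unfold res; ring).
       rewrite Hr. unfold hf2, d. ring. }
  assert (Q : integ (fun z => Wt c0 z * ((1 - t * d) * hf j z + - t * ((U z - z ^ 2) * hf j z)) ^ 2)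
    <= 2 * ((1 - t * d) ^ 2 * B) + 2 * (t ^ 2 * (eta ^ 2 * A))).
  { eapply Rle_trans; [apply integ_Wt_sq_plus; [assumption | fast_tac | fast_tac] |].
    cbv beta. rewrite integ_Wt_sq_scal by assumption.
    rewrite (integ_Wt_sq_scal c0 (- t) (fun z => (U z - z ^ 2) * hf j z)) by (assumption || fast_tac).
    fold B. replace ((- t) ^ 2) with (t ^ 2) by ring. apply Rplus_le_compat_l, Rmult_le_compat_l; [lra |].
    apply Rmult_le_compat_l; [assumption |].
    apply (integ_Wt_pert_sq c0 Hc0 c0 eta (fun z => U z - z ^ 2)); try assumption. apply HU. }
  assert (He2 : 0 <= eta ^ 2 <= 1) by nra.
  assert (Q2 : (1 - t * d) ^ 2 <= 2 * (1 + t ^ 2)).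
  { assert (d ^ 2 <= 1) by nra. assert (t ^ 2 * d ^ 2 <= t ^ 2 * 1) by (apply Rmult_le_compat_l; assumption).
    generalize (pow2_ge_0 (1 + t * d)). lra. }
  assert (Q3 : (1 - t * d) ^ 2 * B <= 2 * (1 + t ^ 2) * B) by (apply Rmult_le_compat_r; assumption).
  assert (Q4 : t ^ 2 * (eta ^ 2 * A) <= (1 + t ^ 2) * A).
  { apply Rmult_le_compat; try lra; [mult_pos | nra]. }
  assert (W : integ (fun z => w z ^ 2) <= C1 * (1 + t ^ 2)).
  { apply Rle_trans with (2 * integ (fun z => (w z + - t * hf j z) ^ 2) + 2 * t ^ 2 * hn j).
    - unfold hn. rewrite <- !integ_scal, <- integ_plus by fast_tac. apply integ_le; [fast_tac.. |].
      intros z. generalize (pow2_ge_0 (w z - 2 * t * hf j z)). nra.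
    - unfold C1. nra. }
  split.
  - apply Rle_trans with (1 := W). apply Rmult_le_compat_r; lra.
  - assert (T := integ_test j U lam w w1 w2 SU Hd).
    rewrite (integ_ext (fun z => res U lam w w2 z * _) (fun z => hf j z ^ 2)) in T by (intros; rewrite Hr; ring).
    fold (hn j) in T. fold d in T.
    assert (PS := integ_pert_sq c0 Hc0 (fun z => U z - z ^ 2) eta (hf j) w SP (proj2 (proj2 HU)) Fw F).
    fold K in PS.
    set (p := integ (fun z => (U z - z ^ 2) * (w z * hf j z))) in *.
    assert (E : d * t - 1 = - (p / hn j)).
    { apply Rmult_eq_reg_r with (hn j); [| lra]. unfold t. field_simplify; [| lra | lra]. lra. }
    rewrite E. replace ((- (p / hn j)) ^ 2) with (p ^ 2 * / hn j ^ 2) by (field; lra).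
    apply Rle_trans with (eta ^ 2 * (C1 * (1 + t ^ 2) * K) * / hn j ^ 2).
    + apply Rmult_le_compat_r; [left; apply Rinv_0_lt_compat, pow_lt; assumption |].
      apply Rle_trans with (1 := PS). apply Rmult_le_compat_l; [lra |]. apply Rmult_le_compat_r; assumption.
    + replace (eta ^ 2 * (C1 * (1 + t ^ 2) * K) * / hn j ^ 2) with (C1 * (K / hn j ^ 2) * (eta ^ 2 * (1 + t ^ 2)))
        by (field; lra).
      rewrite (Rmult_assoc _ (eta ^ 2)). apply Rmult_le_compat_r; [mult_pos |]. lra.
Qed.

Lemma adm_confining (U : R -> R) (eta lam : R) : adm kappa c0 U eta ->
  confining (fun z => U z - lam) /\ confining (fun z => U (- z) - lam).
Proof.
  intros (_ & HU & _).
  assert (P : forall M, exists X, forall x, X <= x -> M <= kappa * x ^ 2 - 1 - lam).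
  { intros M. set (a := (Rabs M + Rabs lam + 1) / kappa).
    exists (1 + a). intros x Hx.
    assert (kappa * a = Rabs M + Rabs lam + 1) by (unfold a; field; lra).
    assert (a <= x ^ 2) by nra.
    assert (kappa * a <= kappa * x ^ 2) by (apply Rmult_le_compat_l; lra).
    generalize (Rle_abs M), (Rle_abs lam). lra. }
  split; intros M; destruct (P M) as [X HX]; exists X; intros x Hx; specialize (HX x Hx).
  - specialize (HU x). lra.
  - specialize (HU (- x)). replace ((- x) ^ 2) with (x ^ 2) in HU by ring. lra.
Qed.

(* If [lam] runs over a window around [2j+1] free of eigenvalues, then
   [1 / <(h - lam)^-1 phi_j, phi_j>] is Lipschitz, never zero, and changes sign. *)
Lemma eigenvalue_exists (j : nat) : exists eta0, 0 < eta0 /\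
  forall U eta, adm kappa c0 U eta -> eta <= eta0 ->
  exists E, Rabs (E - (2 * INR j + 1)) <= / 2 /\ iseig U E.
Proof.
  destruct (resolvent_estimate j) as [C [eta1 [HC [He1 RE]]]].
  exists (Rmin eta1 (Rmin 1 (/ (64 * (C + 1))))).
  split. { repeat apply Rmin_glb_lt; try lra. apply Rinv_0_lt_compat; lra. }
  intros U eta HU Heta.
  assert (Hep := adm_eta_pos _ _ _ _ HU). assert (SU := adm_slow kappa c0 Hc0 U eta HU).
  assert (E1 := Rle_trans _ _ _ Heta (Rmin_l _ _)). assert (Heta' := Rle_trans _ _ _ Heta (Rmin_r _ _)).
  assert (E3 : eta * (64 * (C + 1)) <= 1).
  { apply mult_le_cancel_inv; [lra |]. apply Rle_trans with (1 := Heta'). apply Rmin_r. }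
  assert (CE : C * eta ^ 2 <= / 64) by nra.
  set (L := 2 * INR j + 1) in *. assert (Hn := hn_pos j). assert (F := fast_hf j).
  apply NNPP. intros NE.
  (* Clamping to the window produces functions on all of R, since the intermediate value theorem is
     applied to a globally continuous g. *)
  set (cl := fun x => Rmax (L - / 2) (Rmin x (L + / 2))).
  assert (Hcl : forall x, Rabs (cl x - L) <= / 2).
  { intros x. apply Rabs_le. unfold cl, Rmax, Rmin. repeat destruct Rle_dec; lra. }
  assert (Hcl1 : forall x y, Rabs (cl x - cl y) <= Rabs (x - y)).
  { intros x y. apply Rabs_le.
    generalize (Rle_abs (x - y)), (Rle_abs (- (x - y))). rewrite Rabs_Ropp. intros.
    unfold cl, Rmax, Rmin. repeat destruct Rle_dec; lra. }
  set (Sol := fun x g => exists w w1 w2, dom w w1 w2 /\ (forall z, res U (cl x) w w2 z = hf j z) /\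
    g = / (integ (fun z => w z * hf j z) / hn j)).
  assert (HS : forall x, exists g, Sol x g).
  { intros x.
    destruct (adm_confining U eta (cl x) HU) as [Q1 Q2].
    destruct (fredholm_alternative (fun z => U z - cl x) (fun z => - hf j z)) as [(v & v1 & Hv & Nv) | (w & w1 & Hw)].
    - slow_tac.
    - exact Q1.
    - exact Q2.
    - fast_tac.
    - exfalso. apply NE. exists (cl x). split; [apply Hcl |]. exists v, v1, (fun z => (U z - cl x) * v z).
      split; [split; [exact Hv | reflexivity] | exact Nv].
    - eexists. exists w, w1, (fun z => (U z - cl x) * w z + - hf j z).
      split; [exact Hw |]. split; [| reflexivity]. intros z. unfold res. ring. }
  destruct (functional_choice Sol HS) as [g Hg].
  (* At the ends of the window d is 1/2 or -1/2, and d t near 1 forces t to have the sign of d.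
     Throughout, |t| >= 1, so 1/t is defined. *)
  assert (tbound : forall d t, - / 2 <= d <= / 2 -> (d * t - 1) ^ 2 <= / 64 * (1 + t ^ 2) -> 1 <= Rabs t /\
    (d = / 2 -> 0 < t) /\ (d = - / 2 -> t < 0)).
  { intros d t Hd Ht.
    assert (Q : Rabs (d * t - 1) <= / 8 * (1 + Rabs t)).
    { apply sq_le_abs; [generalize (Rabs_pos t); lra |]. apply Rle_trans with (1 := Ht).
      rewrite <- (pow2_abs t). generalize (Rabs_pos t). nra. }
    apply Rabs_le_between in Q. unfold Rabs in *. destruct (Rcase_abs t).
    - split; [nra |]. split; intros ->; lra.
    - split; [nra |]. split; intros ->; lra. }
  assert (P : forall x w w1 w2, dom w w1 w2 -> (forall z, res U (cl x) w w2 z = hf j z) ->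
    let t := integ (fun z => w z * hf j z) / hn j in
    integ (fun z => w z ^ 2) <= 2 * C * t ^ 2 /\ 1 <= Rabs t /\ (cl x = L - / 2 -> 0 < t) /\ (cl x = L + / 2 -> t < 0)).
  { intros x w w1 w2 Hd Hr t.
    assert (Hx := Hcl x).
    destruct (RE U eta (cl x) w w1 w2 HU E1 ltac:(lra) Hd Hr) as [R1 R2]. fold t in R1, R2. fold L in R2.
    apply Rabs_le_between in Hx.
    destruct (tbound (L - cl x) t) as [T1 [T2 T3]]; [lra | |].
    { apply Rle_trans with (1 := R2). apply Rmult_le_compat_r; [generalize (pow2_ge_0 t); lra | assumption]. }
    assert (1 <= t ^ 2) by (rewrite <- pow2_abs; nra).
    split; [nra |]. split; [assumption |]. split; intros E; [apply T2 | apply T3]; rewrite E; lra. }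
  (* Resolvent identity: t - s equals (cl x - cl y) <w, v> / hn j. The norms of w and v are at most
     of order |t| and |s|, which cancels in 1/t - 1/s; t itself would have no such bound. *)
  assert (Lip : forall x y, Rabs (g x - g y) <= 2 * C / hn j * Rabs (x - y)).
  { intros x y. destruct (Hg x) as (w & w1 & w2 & Hw & Rw & Ex). destruct (Hg y) as (v & v1 & v2 & Hv & Rv & Ey).
    destruct (P x w w1 w2 Hw Rw) as (N1 & T1 & _). destruct (P y v v1 v2 Hv Rv) as (N2 & T2 & _).
    assert (Sy := integ_res_sym U (cl y) _ _ _ _ _ _ SU Hw Hv).
    assert (Fw := proj1 Hw). assert (Fv := proj1 Hv).
    rewrite (integ_ext (fun z => w z * res _ _ _ _ z) (fun z => w z * hf j z)) in Sy by (intros; now rewrite Rv).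
    rewrite (integ_ext (fun z => res _ _ _ _ z * _) (fun z => v z * hf j z + (cl x - cl y) * (w z * v z))) in Sy.
    2: { intros z. replace (res U (cl y) w w2 z) with (res U (cl x) w w2 z + (cl x - cl y) * w z) by (unfold res; ring).
         rewrite Rw. ring. }
    rewrite integ_plus, integ_scal in Sy by fast_tac.
    assert (CS := integ_cauchy_schwarz w v Fw Fv).
    set (a := integ (fun z => w z * hf j z)) in *. set (b := integ (fun z => v z * hf j z)) in *.
    set (t := a / hn j) in *. set (s := b / hn j) in *. set (i := integ (fun z => w z * v z)) in *.
    assert (Hi : Rabs i <= 2 * C * (Rabs t * Rabs s)).
    { apply sq_le_abs; [repeat apply Rmult_le_pos; try lra; apply Rabs_pos |].
      apply Rle_trans with (1 := CS). replace ((2 * C * (Rabs t * Rabs s)) ^ 2) with ((2 * C * Rabs t ^ 2) * (2 * C * Rabs s ^ 2)) by ring.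
      rewrite !pow2_abs. apply Rmult_le_compat; try assumption; now apply integ_sq_ge0. }
    assert (Nt : t <> 0) by (intros Z; rewrite Z, Rabs_R0 in T1; lra).
    assert (Ns : s <> 0) by (intros Z; rewrite Z, Rabs_R0 in T2; lra).
    rewrite Ex, Ey.
    assert (Ets : t - s = (cl x - cl y) * i / hn j).
    { unfold t, s. rewrite <- Sy. field. lra. }
    replace (/ t - / s) with (- (t - s) * / (t * s)) by (field; split; assumption).
    rewrite Ets, Rabs_mult, Rabs_inv, Rabs_Ropp, (Rabs_mult t).
    unfold Rdiv. rewrite !Rabs_mult, (Rabs_pos_eq (/ hn j)) by (left; now apply Rinv_0_lt_compat).
    apply Rle_trans with (Rabs (x - y) * (2 * C * (Rabs t * Rabs s)) * / hn j * / (Rabs t * Rabs s)).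
    - apply Rmult_le_compat_r; [left; apply Rinv_0_lt_compat; nra |].
      apply Rmult_le_compat_r; [left; now apply Rinv_0_lt_compat |].
      apply Rmult_le_compat; auto using Rabs_pos.
    - right. field. repeat split; lra. }
  assert (Gc : continuity g).
  { intros x eps He. set (k := 2 * C / hn j) in *.
    assert (Hk : 0 < k) by (apply Rdiv_lt_0_compat; lra).
    exists (eps / (2 * k)). split; [apply Rdiv_lt_0_compat; lra |].
    intros y [_ Hy]. unfold dist in *; simpl in *. unfold R_dist in *.
    apply Rle_lt_trans with (1 := Lip y x).
    apply Rle_lt_trans with (k * (eps / (2 * k))); [apply Rmult_le_compat_l; lra |].
    replace (k * (eps / (2 * k))) with (eps / 2) by (field; lra). lra. }
  assert (Sg : forall x, g x <> 0 /\ (cl x = L - / 2 -> 0 < g x) /\ (cl x = L + / 2 -> g x < 0)).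
  { intros x. destruct (Hg x) as (w & w1 & w2 & Hw & Rw & Ex). destruct (P x w w1 w2 Hw Rw) as (_ & T1 & T2 & T3).
    set (t := integ (fun z => w z * hf j z) / hn j) in *.
    assert (Nt : t <> 0) by (intros Z; rewrite Z, Rabs_R0 in T1; lra).
    rewrite Ex. split; [now apply Rinv_neq_0_compat |]. split; intros E.
    - now apply Rinv_0_lt_compat, T2.
    - now apply Rinv_lt_0_compat, T3. }
  assert (clL : cl (L - / 2) = L - / 2) by (unfold cl, Rmax, Rmin; repeat destruct Rle_dec; lra).
  assert (clR : cl (L + / 2) = L + / 2) by (unfold cl, Rmax, Rmin; repeat destruct Rle_dec; lra).
  assert (gL := proj1 (proj2 (Sg _)) clL). assert (gR := proj2 (proj2 (Sg _)) clR).
  destruct (IVT_gen g (L - / 2) (L + / 2) 0 Gc) as [x [_ Hx]].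
  - rewrite Rmin_right, Rmax_left by lra. lra.
  - exact (proj1 (Sg x) Hx).
Qed.

Lemma eigf_normalize (U : R -> R) (E : R) (j : nat) (v v1 v2 : R -> R) : eigf U E v v1 v2 ->
  integ (fun z => v z * hf j z) <> 0 ->
  exists u u1 u2, eigf U E u u1 u2 /\ integ (fun z => u z * hf j z) = hn j.
Proof.
  intros Hv Hn. set (a := hn j / integ (fun z => v z * hf j z)).
  do 3 eexists. split; [exact (eigf_scal a _ _ _ _ _ Hv) |].
  assert (F := fast_hf j). assert (Fv := proj1 (proj1 Hv)).
  rewrite (integ_ext _ (fun z => a * (v z * hf j z))) by (intros; ring).
  rewrite integ_scal by fast_tac. unfold a. field. assumption.
Qed.

Lemma iseig_normalized (j : nat) : exists eta0, 0 < eta0 /\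
  forall U eta E, adm kappa c0 U eta -> eta <= eta0 -> Rabs (E - (2 * INR j + 1)) <= 1 -> iseig U E ->
  exists u u1 u2, eigf U E u u1 u2 /\ integ (fun z => u z * hf j z) = hn j.
Proof.
  destruct (eigf_nonorth kappa c0 Hkappa Hc0 j) as [eta0 [He H]].
  exists eta0. split; [assumption |]. intros U eta E HU Heta HE (v & v1 & v2 & Hv & Nv).
  apply eigf_normalize with v v1 v2; [assumption |]. now apply (H U eta E v v1 v2).
Qed.

(** The comparison estimate with equal potentials, that is with delta = 0. *)
Lemma eigenvalue_unique (j : nat) : exists eta0, 0 < eta0 /\
  forall U eta E E', adm kappa c0 U eta -> eta <= eta0 -> Rabs (E - (2 * INR j + 1)) <= 1 ->
  Rabs (E' - (2 * INR j + 1)) <= 1 -> iseig U E -> iseig U E' -> E = E'.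
Proof.
  destruct (iseig_normalized j) as [eta1 [He1 N]].
  destruct (eigf_compare_base kappa c0 Hkappa Hc0 j) as [C [eta2 [HC [He2 H]]]].
  exists (Rmin eta1 eta2). split; [now apply Rmin_glb_lt |].
  intros U eta E E' HU Heta HE HE' IE IE'.
  assert (E1 := Rle_trans _ _ _ Heta (Rmin_l _ _)). assert (E2 := Rle_trans _ _ _ Heta (Rmin_r _ _)).
  destruct (N U eta E HU E1 HE IE) as (u & u1 & u2 & Hu & Ou).
  destruct (N U eta E' HU E1 HE' IE') as (v & v1 & v2 & Hv & Ov).
  assert (Q : (E - E') ^ 2 <= C * 0 ^ 2).
  { apply (H U U eta 0 E E' u u1 u2 v v1 v2 HU HU E2); try assumption.
    intros z. rewrite Rminus_diag, Rabs_R0. lra. }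
  destruct (Req_dec (E - E') 0) as [| Hn]; [lra |]. apply pow2_gt_0 in Hn. lra.
Qed.

Lemma iseig_nonneg (U : R -> R) (E : R) : slow U -> (forall z, 0 <= U z) -> iseig U E -> 0 <= E.
Proof.
  intros SU HU (v & v1 & v2 & [Hd Hv] & [z Hz]).
  assert (G := integ_grad_sq _ _ _ Hd). destruct Hd as (H0 & H1 & H2 & _).
  destruct (Rle_or_lt 0 E) as [| HE]; [assumption | exfalso]. apply Hz.
  apply integ_sq_zero; [assumption |].
  assert (P1 := integ_sq_ge0 v1 H1).
  assert (P2 : 0 <= integ (fun z => U z * v z ^ 2)).
  { apply integ_ge0; [fast_tac |]. intros; now apply sq_nonneg_mult. }
  rewrite (integ_ext (fun z => v z * v2 z) (fun z => U z * v z ^ 2 - E * v z ^ 2)) in G by (intros; rewrite Hv; ring).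
  rewrite integ_minus, integ_scal in G by fast_tac. nra.
Qed.

(** For i < n the window [2 i, 2 i + 2] holds exactly one eigenvalue. Hence for m <= n there are at
    least m and, by nonnegativity of U, at most m eigenvalues below 2 m; having n - 1 eigenvalues
    below it places E in [2 (n - 1), 2 n]. *)
Lemma nth_eigenvalue_near (n : nat) : (1 <= n)%nat -> exists eta0, 0 < eta0 /\
  forall U eta E l, adm kappa c0 U eta -> eta <= eta0 -> (forall z, 0 <= U z) -> iseig U E ->
  length l = (n - 1)%nat -> NoDup l -> (forall y, In y l <-> iseig U y /\ y < E) ->
  Rabs (E - (2 * INR n - 1)) <= 1.
Proof.
  intros Hn.
  destruct (uniform_threshold (fun i eta => forall U, adm kappa c0 U eta ->
    (exists E, Rabs (E - (2 * INR i + 1)) <= / 2 /\ iseig U E) /\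
    forall E E', Rabs (E - (2 * INR i + 1)) <= 1 -> Rabs (E' - (2 * INR i + 1)) <= 1 -> iseig U E -> iseig U E' -> E = E')
    ) with (n := n) as [eta0 [He T]].
  { intros i. destruct (eigenvalue_exists i) as [a [Ha A]]. destruct (eigenvalue_unique i) as [b [Hb B]].
    exists (Rmin a b). split; [now apply Rmin_glb_lt |]. intros eta Heta U HU.
    assert (E1 := Rle_trans _ _ _ Heta (Rmin_l _ _)). assert (E2 := Rle_trans _ _ _ Heta (Rmin_r _ _)).
    split; [now apply (A U eta) |]. intros E E' H1 H2 I1 I2. now apply (B U eta). }
  exists eta0. split; [assumption |].
  intros U eta E l HU Heta Upos IE Hl Nl Il. specialize (T eta Heta).
  assert (SU := adm_slow kappa c0 Hc0 U eta HU).
  (* Existence puts each eigenvalue within 1/2 of the centre of its window, so those of different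
     windows are distinct. *)
  assert (Many : forall m, (m <= n)%nat -> exists L, length L = m /\ NoDup L /\ forall y, In y L -> iseig U y /\ y < 2 * INR m).
  { induction m as [| m IH]; intros Hm.
    - exists nil. split; [reflexivity |]. split; [constructor | intros y []].
    - destruct IH as [L (L1 & L2 & L3)]; [lia |].
      destruct (T m ltac:(lia) U HU) as [[e [He1 He2]] _]. apply Rabs_le_between in He1.
      exists (e :: L). split; [simpl; now rewrite L1 |]. split.
      + constructor; [| assumption]. intros HI. destruct (L3 e HI). lra.
      + rewrite S_INR. intros y [-> | HI]; [split; [assumption | lra] |]. destruct (L3 y HI). split; [assumption | lra]. }
  assert (Few : forall m, (m <= n)%nat -> forall L, NoDup L -> (forall y, In y L -> iseig U y /\ y < 2 * INR m) ->
    (length L <= m)%nat).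
  { induction m as [| m IH]; intros Hm L NL HL.
    - destruct L as [| y L]; [auto |]. destruct (HL y (or_introl eq_refl)) as [I Hy].
      apply (iseig_nonneg U y SU Upos) in I. simpl in Hy. lra.
    (* Values below 2 m fall under the induction; the others lie in the single window
       [2 m, 2 m + 2], so there is at most one. *)
    - set (p := fun y => if Rlt_dec y (2 * INR m) then true else false).
      rewrite <- (filter_length p L).
      assert (A : (length (filter p L) <= m)%nat).
      { apply IH; [lia | now apply NoDup_filter |]. intros y Hy. apply filter_In in Hy. destruct Hy as [Hy Py].
        split; [now apply HL |]. unfold p in Py. destruct Rlt_dec; [assumption | discriminate]. }
      assert (B : (length (filter (fun x => negb (p x)) L) <= 1)%nat).
      { assert (NB : NoDup (filter (fun x => negb (p x)) L)) by now apply NoDup_filter.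
        assert (HB : forall y, In y (filter (fun x => negb (p x)) L) -> iseig U y /\ Rabs (y - (2 * INR m + 1)) <= 1).
        { intros y Hy. apply filter_In in Hy. destruct Hy as [Hy Py]. destruct (HL y Hy) as [I Hlt].
          split; [assumption |]. unfold p in Py. destruct Rlt_dec; [discriminate |]. rewrite S_INR in Hlt.
          apply Rabs_le. lra. }
        destruct (filter (fun x => negb (p x)) L) as [| a [| b L']]; [simpl; lia.. |]. exfalso.
        destruct (HB a) as [I1 A1]; [now left |]. destruct (HB b) as [I2 A2]; [right; now left |].
        assert (Eab := proj2 (T m ltac:(lia) U HU) a b A1 A2 I1 I2). subst b.
        inversion NB. apply H1. now left. }
      lia. }
  assert (Sn : INR n = INR (n - 1) + 1) by (rewrite <- S_INR; f_equal; lia).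
  assert (Up : E <= 2 * INR n).
  { destruct (Rle_or_lt E (2 * INR n)) as [| Hlt]; [assumption | exfalso].
    destruct (Many n (le_n n)) as [L (L1 & L2 & L3)].
    assert (Q : incl L l). { intros y Hy. apply Il. destruct (L3 y Hy). split; [assumption | lra]. }
    apply (NoDup_incl_length L2) in Q. lia. }
  assert (Lo : 2 * INR (n - 1) <= E).
  { destruct (Rle_or_lt (2 * INR (n - 1)) E) as [| Hlt]; [assumption | exfalso].
    assert (Q := Few (n - 1)%nat ltac:(lia) (E :: l)). simpl in Q. rewrite Hl in Q.
    assert (S (n - 1) <= n - 1)%nat; [| lia]. apply Q.
    - constructor; [| assumption]. intros HI. apply Il in HI. lra.
    - intros y [<- | HI]; [split; [assumption | lra] |]. apply Il in HI. split; [apply HI | lra]. }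
  apply Rabs_le. lra.
Qed.

End Existence.

(** * Uniform bounds over a family of problems *)

Section Uniform.

Variable T : Type.

(** Big O with one constant for the whole family; T is arbitrary so that it can later collect all
    admissible data. *)
Definition bO (F G : T -> R) : Prop :=
  (forall t, 0 <= G t) /\ exists C, 0 <= C /\ forall t, Rabs (F t) <= C * G t.

(** Size of a family of functions in all weighted norms at once; the right side is squared so that G
    bounds the norm itself. *)
Definition NB (f : T -> R -> R) (G : T -> R) : Prop :=
  (forall t, 0 <= G t) /\ (forall t, fast (f t)) /\
  forall c, 0 <= c -> exists C, 0 <= C /\ forall t, integ (fun z => Wt c z * f t z ^ 2) <= (C * G t) ^ 2.

(** Multipliers: the exponent a is uniform in t, so multiplication preserves [NB] and sizes
    multiply. *)
Definition GR (g : T -> R -> R) (G : T -> R) : Prop :=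
  (forall t, 0 <= G t) /\ (forall t, slow (g t)) /\
  exists a C, 0 <= a /\ 0 <= C /\ forall t z, Rabs (g t z) <= C * G t * Wt a z.

Lemma bO_weaken (F G H : T -> R) (K : R) : 0 <= K -> (forall t, 0 <= H t) ->
  (forall t, G t <= K * H t) -> bO F G -> bO F H.
Proof.
  intros HK HH L [_ [C [HC B]]]. split; [assumption |].
  exists (C * K). split; [now apply Rmult_le_pos |]. intros t. apply Rle_trans with (1 := B t).
  rewrite Rmult_assoc. now apply Rmult_le_compat_l.
Qed.

Lemma bO_ext (F F' G : T -> R) : (forall t, F t = F' t) -> bO F G -> bO F' G.
Proof. intros E [H [C [HC B]]]. split; [assumption |]. exists C. split; [assumption |]. intros t. rewrite <- E. apply B. Qed.

Lemma bO_of_le (F G : T -> R) : (forall t, Rabs (F t) <= G t) -> bO F G.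
Proof.
  intros H. split; [intros t; apply Rle_trans with (2 := H t), Rabs_pos |].
  exists 1. split; [lra |]. intros t. rewrite Rmult_1_l. apply H.
Qed.

Lemma bO_const (k : R) : bO (fun _ => k) (fun _ => 1).
Proof. split; [intros; lra |]. exists (Rabs k). split; [apply Rabs_pos |]. intros; lra. Qed.

Lemma bO_plus (F F' G : T -> R) : bO F G -> bO F' G -> bO (fun t => F t + F' t) G.
Proof.
  intros [H [C [HC B]]] [_ [D [HD E]]]. split; [assumption |]. exists (C + D). split; [lra |].
  intros t. eapply Rle_trans; [apply Rabs_triang |]. rewrite Rmult_plus_distr_r. now apply Rplus_le_compat.
Qed.

Lemma bO_opp (F G : T -> R) : bO F G -> bO (fun t => - F t) G.
Proof. intros [H [C [HC B]]]. split; [assumption |]. exists C. split; [assumption |]. intros t. now rewrite Rabs_Ropp. Qed.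

Lemma bO_minus (F F' G : T -> R) : bO F G -> bO F' G -> bO (fun t => F t - F' t) G.
Proof. intros H K. apply bO_plus; [assumption | now apply bO_opp]. Qed.

Lemma bO_mult (F F' G G' : T -> R) : bO F G -> bO F' G' -> bO (fun t => F t * F' t) (fun t => G t * G' t).
Proof.
  intros [H [C [HC B]]] [H' [D [HD E]]]. split; [intros t; now apply Rmult_le_pos |].
  exists (C * D). split; [now apply Rmult_le_pos |]. intros t. rewrite Rabs_mult.
  replace (C * D * (G t * G' t)) with ((C * G t) * (D * G' t)) by ring.
  apply Rmult_le_compat; auto using Rabs_pos.
Qed.

Lemma bO_scal (k : R) (F G : T -> R) : bO F G -> bO (fun t => k * F t) G.
Proof.
  intros H. apply bO_weaken with (fun t => 1 * G t) 1; [lra | apply H | intros; lra |].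
  apply (bO_mult (fun _ => k) F); [apply bO_const | assumption].
Qed.

Lemma bO_div (F N G : T -> R) (n0 : R) : 0 < n0 -> (forall t, n0 <= N t) -> bO F G -> bO (fun t => F t / N t) G.
Proof.
  intros Hn HN HF. apply bO_weaken with (fun t => G t * 1) 1; [lra | apply HF | intros; lra |].
  apply bO_mult; [assumption |]. split; [intros; lra |]. exists (/ n0). split; [left; now apply Rinv_0_lt_compat |].
  intros t. specialize (HN t). rewrite Rabs_pos_eq by (left; apply Rinv_0_lt_compat; lra). rewrite Rmult_1_r.
  apply Rinv_le_contravar; assumption.
Qed.

Lemma bO_of_sq (F G : T -> R) (C : R) : 0 <= C -> (forall t, 0 <= G t) ->
  (forall t, F t ^ 2 <= C * G t ^ 2) -> bO F G.
Proof.
  intros HC HG H. split; [assumption |]. exists (C + 1). split; [lra |]. intros t.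
  specialize (H t). specialize (HG t).
  assert (0 <= (C + 1) * G t) by (apply Rmult_le_pos; lra).
  apply Rabs_le. split.
  - destruct (Rle_or_lt (- ((C + 1) * G t)) (F t)); [assumption | nra].
  - destruct (Rle_or_lt (F t) ((C + 1) * G t)); [assumption | nra].
Qed.

Lemma NB_intro (c0 : R) (f : T -> R -> R) (G : T -> R) : 0 <= c0 -> (forall t, 0 <= G t) -> (forall t, fast (f t)) ->
  (forall c, c0 <= c -> exists C, 0 < C /\ forall t, integ (fun z => Wt c z * f t z ^ 2) <= C * G t ^ 2) -> NB f G.
Proof.
  intros Hc0 HG Hf H. split; [assumption |]. split; [assumption |]. intros c Hc.
  destruct (H (Rmax c c0) (Rmax_r _ _)) as [C [HC B]]. exists (C + 1). split; [lra |]. intros t.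
  apply Rle_trans with (integ (fun z => Wt (Rmax c c0) z * f t z ^ 2)).
  - apply integ_Wt_mono; [| apply Hf]. split; [assumption | apply Rmax_l].
  - apply Rle_trans with (1 := B t). nra.
Qed.

Lemma NB_weaken (f : T -> R -> R) (G H : T -> R) (K : R) : 0 <= K -> (forall t, 0 <= H t) ->
  (forall t, G t <= K * H t) -> NB f G -> NB f H.
Proof.
  intros HK HH L [HG [Hf B]]. split; [assumption |]. split; [assumption |]. intros c Hc.
  destruct (B c Hc) as [C [HC BC]]. exists (C * K). split; [now apply Rmult_le_pos |]. intros t.
  apply Rle_trans with (1 := BC t). apply pow_incr. split; [now apply Rmult_le_pos |].
  rewrite Rmult_assoc. now apply Rmult_le_compat_l.
Qed.

Lemma NB_ext (f f' : T -> R -> R) (G : T -> R) : (forall t z, f t z = f' t z) -> NB f G -> NB f' G.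
Proof.
  intros E [HG [Hf B]]. split; [assumption |]. split; [intros t; apply fast_ext with (f t); auto |].
  intros c Hc. destruct (B c Hc) as [C [HC BC]]. exists C. split; [assumption |]. intros t.
  rewrite (integ_ext _ (fun z => Wt c z * f t z ^ 2)) by (intros; now rewrite E). apply BC.
Qed.

Lemma NB_plus (f f' : T -> R -> R) (G : T -> R) : NB f G -> NB f' G -> NB (fun t z => f t z + f' t z) G.
Proof.
  intros [HG [Hf B]] [_ [Hf' B']]. split; [assumption |]. split; [intros t; apply fast_plus; auto |].
  intros c Hc. destruct (B c Hc) as [C [HC BC]]. destruct (B' c Hc) as [D [HD BD]].
  exists (2 * (C + D)). split; [lra |]. intros t.
  eapply Rle_trans; [apply integ_Wt_sq_plus; auto |].
  specialize (BC t). specialize (BD t). specialize (HG t).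
  assert (0 <= C * G t) by now apply Rmult_le_pos. assert (0 <= D * G t) by now apply Rmult_le_pos. nra.
Qed.

Lemma NB_mult (g f : T -> R -> R) (G H : T -> R) : GR g G -> NB f H -> NB (fun t z => g t z * f t z) (fun t => G t * H t).
Proof.
  intros [HG [Sg (a & K & Ha & HK & Bg)]] [HH [Hf B]]. split; [intros t; now apply Rmult_le_pos |].
  split; [intros t; apply fast_mult_r; auto |]. intros c Hc.
  destruct (B (c + 2 * a) ltac:(lra)) as [C [HC BC]]. exists (2 * K * C). split; [mult_pos |]. intros t.
  eapply Rle_trans; [apply (integ_Wt_pert_sq a Ha c (K * G t) (g t) (f t)); auto |].
  replace ((2 * K * C * (G t * H t)) ^ 2) with ((K * G t) ^ 2 * (4 * (C * H t) ^ 2)) by ring.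
  apply Rmult_le_compat_l; [apply pow2_ge_0 |]. apply Rmult_le_compat_l; [lra | apply BC].
Qed.

Lemma GR_weaken (g : T -> R -> R) (G H : T -> R) (K : R) : 0 <= K -> (forall t, 0 <= H t) ->
  (forall t, G t <= K * H t) -> GR g G -> GR g H.
Proof.
  intros HK HH L [HG [Sg (a & C & Ha & HC & B)]]. split; [assumption |]. split; [assumption |].
  exists a, (C * K). split; [assumption |]. split; [now apply Rmult_le_pos |]. intros t z.
  apply Rle_trans with (1 := B t z). apply Rmult_le_compat_r; [left; apply Wt_pos |].
  rewrite Rmult_assoc. now apply Rmult_le_compat_l.
Qed.

Lemma GR_plus (f g : T -> R -> R) (G : T -> R) : GR f G -> GR g G -> GR (fun t z => f t z + g t z) G.
Proof.
  intros [HG [Sf (a & C & Ha & HC & B)]] [_ [Sg (b & D & Hb & HD & E)]].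
  split; [assumption |]. split; [intros t; apply slow_plus; auto |].
  exists (a + b), (C + D). split; [lra |]. split; [lra |]. intros t z.
  eapply Rle_trans; [apply Rabs_triang |].
  assert (Wt a z <= Wt (a + b) z) by (apply Wt_mono; lra).
  assert (Wt b z <= Wt (a + b) z) by (apply Wt_mono; lra).
  assert (0 <= C * G t) by (apply Rmult_le_pos; auto). assert (0 <= D * G t) by (apply Rmult_le_pos; auto).
  specialize (B t z). specialize (E t z). nra.
Qed.

Lemma GR_mult (f g : T -> R -> R) (G H : T -> R) : GR f G -> GR g H -> GR (fun t z => f t z * g t z) (fun t => G t * H t).
Proof.
  intros [HG [Sf (a & C & Ha & HC & B)]] [HH [Sg (b & D & Hb & HD & E)]].
  split; [intros t; now apply Rmult_le_pos |]. split; [intros t; apply slow_mult; auto |].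
  exists (a + b), (2 * (C * D)). split; [lra |]. split; [mult_pos |]. intros t z.
  rewrite Rabs_mult. apply Rle_trans with ((C * G t * Wt a z) * (D * H t * Wt b z)).
  - apply Rmult_le_compat; auto using Rabs_pos.
  - replace ((C * G t * Wt a z) * (D * H t * Wt b z)) with (C * G t * (D * H t) * (Wt a z * Wt b z)) by ring.
    replace (2 * (C * D) * (G t * H t) * Wt (a + b) z) with (C * G t * (D * H t) * (2 * Wt (a + b) z)) by ring.
    apply Rmult_le_compat_l; [| now apply Wt_mult].
    apply Rmult_le_pos; apply Rmult_le_pos; auto.
Qed.

Lemma GR_coef (F G : T -> R) : bO F G -> GR (fun t _ => F t) G.
Proof.
  intros [HG [C [HC B]]]. split; [assumption |]. split; [intros; apply slow_const |].
  exists 0, C. split; [lra |]. split; [assumption |]. intros t z. rewrite Wt_0.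
  specialize (B t). generalize (Rabs_pos (F t)). lra.
Qed.

Lemma GR_fixed (g : R -> R) : slow g -> GR (fun _ => g) (fun _ => 1).
Proof.
  intros Sg. split; [intros; lra |]. split; [auto |]. destruct Sg as [_ (a & C & Ha & HC & B)].
  exists a, C. repeat split; auto. intros _ z. rewrite Rmult_1_r. apply B.
Qed.

Lemma NB_fixed (f : R -> R) : fast f -> NB (fun _ => f) (fun _ => 1).
Proof.
  intros Ff. split; [intros; lra |]. split; [auto |]. intros c Hc.
  set (B := integ (fun z => Wt c z * f z ^ 2)).
  assert (HB : 0 <= B) by now apply integ_Wt_sq_ge0.
  exists (B + 1). split; [lra |]. intros _. nra.
Qed.

Lemma NB_scal (F G H : T -> R) (f : T -> R -> R) : bO F G -> NB f H -> NB (fun t z => F t * f t z) (fun t => G t * H t).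
Proof. intros HF Hf. apply (NB_mult (fun t _ => F t)); [now apply GR_coef | assumption]. Qed.

Lemma NB_opp (f : T -> R -> R) (G : T -> R) : NB f G -> NB (fun t z => - f t z) G.
Proof.
  intros H. apply NB_ext with (fun t z => -1 * f t z); [intros; ring |].
  apply NB_weaken with (fun t => 1 * G t) 1; [lra | apply H | intros; lra |].
  apply (NB_scal (fun _ => -1)); [apply bO_const | assumption].
Qed.

Lemma NB_minus (f f' : T -> R -> R) (G : T -> R) : NB f G -> NB f' G -> NB (fun t z => f t z - f' t z) G.
Proof. intros H K. apply NB_plus; [assumption | now apply NB_opp]. Qed.

Lemma bO_integ (f h : T -> R -> R) (G H : T -> R) : NB f G -> NB h H ->
  bO (fun t => integ (fun z => f t z * h t z)) (fun t => G t * H t).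
Proof.
  intros [HG [Hf B]] [HH [Hh E]]. split; [intros t; now apply Rmult_le_pos |].
  destruct (B 0 (Rle_refl _)) as [C [HC BC]]. destruct (E 0 (Rle_refl _)) as [D [HD BD]].
  exists (C * D). split; [now apply Rmult_le_pos |]. intros t.
  assert (CS := integ_cauchy_schwarz (f t) (h t) (Hf t) (Hh t)).
  assert (B1 := Rle_trans _ _ _ (integ_le_Wt 0 (f t) (Rle_refl _) (Hf t)) (BC t)).
  assert (B2 := Rle_trans _ _ _ (integ_le_Wt 0 (h t) (Rle_refl _) (Hh t)) (BD t)).
  assert (P1 := integ_sq_ge0 (f t) (Hf t)).
  assert (Q1 : 0 <= C * G t) by (apply Rmult_le_pos; auto). assert (Q2 : 0 <= D * H t) by (apply Rmult_le_pos; auto).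
  replace (C * D * (G t * H t)) with ((C * G t) * (D * H t)) by ring.
  assert (Q : 0 <= (C * G t) * (D * H t)) by now apply Rmult_le_pos.
  apply Rabs_le. split.
  - destruct (Rle_or_lt (- (C * G t * (D * H t))) (integ (fun z => f t z * h t z))); [assumption | nra].
  - destruct (Rle_or_lt (integ (fun z => f t z * h t z)) (C * G t * (D * H t))); [assumption | nra].
Qed.

End Uniform.

Arguments bO {T}. Arguments NB {T}. Arguments GR {T}.

(** * The normalized band problem *)

Definition pot (al : R -> R) (s z : R) : R := (al z - s) ^ 2.

Definition Nq (w : R -> R) : R := integ (fun z => w z * w z).
Definition Aq (al w : R -> R) : R := integ (fun z => al z * (w z * w z)).

(* Feynman-Hellmann slope of the eigenvalue of [-w'' + (al - s)^2 w]. *)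
Definition slope (al : R -> R) (s : R) (w : R -> R) : R := 2 * s - 2 * (Aq al w / Nq w).

Lemma mvt_origin (g g1 : R -> R) (z : R) : g 0 = 0 -> (forall x, is_derive g x (g1 x)) ->
  exists x, Rabs x <= Rabs z /\ g z = g1 x * z.
Proof.
  intros G0 D. destruct (MVT_gen g 0 z g1) as [x [Hx E]].
  - intros; apply D.
  - intros x _. apply continuity_pt_filterlim. now apply derive_continuous with g1.
  - exists x. split.
    + unfold Rmin, Rmax in Hx. destruct Rle_dec in Hx.
      * rewrite !Rabs_pos_eq; lra.
      * rewrite !Rabs_left1; lra.
    + lra.
Qed.

Section Frame.

Variables k1 K1 c1 : R.
Variable j : nat.
Hypothesis Hk1 : 0 < k1.
Hypothesis HK1 : 1 <= K1.
Hypothesis Hc1 : 0 <= c1.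

(** These constants come from [pot_adm]. The inequality (al - s)^2 >= al^2/2 - s^2 gives kap; the
    factors al - z - s and al + z - s of the perturbation carry the weights 1 + c1 and 1, hence c0;
    Ca collects their constants. *)
Let kap := k1 ^ 2 / 2.
Let c0 := 2 + c1.
Let Ca := 4 * (K1 + 2).
Let Lam := 2 * INR j + 1.

Lemma kap_pos : 0 < kap.
Proof. unfold kap. generalize (pow_lt k1 2 Hk1). lra. Qed.

Lemma c0_pos : 0 <= c0.
Proof. unfold c0. lra. Qed.

(** The field seen from x_k at the scale 1/sqrt(b_k): be is b/b_k and al its primitive vanishing at
    0; ep measures how far be is from constant. *)
Definition frame (al be : R -> R) (ep : R) : Prop :=
  (forall z, is_derive al z (be z)) /\ (forall z, continuous be z) /\ al 0 = 0 /\
  (forall z, k1 <= be z <= K1) /\ forall z, Rabs (be z - 1) <= ep * Wt c1 z.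

Section OneFrame.

Variables (al be : R -> R) (ep : R).
Hypothesis Hf : frame al be ep.

Lemma frame_ep_pos : 0 <= ep.
Proof.
  destruct Hf as (_ & _ & _ & _ & H). specialize (H 0). generalize (Rabs_pos (be 0 - 1)), (Wt_pos c1 0). nra.
Qed.

Lemma frame_bounds (z : R) : k1 * Rabs z <= Rabs (al z) <= K1 * Rabs z.
Proof.
  destruct Hf as (D & _ & A0 & B & _).
  destruct (mvt_origin al be z A0 D) as [x [_ ->]]. rewrite Rabs_mult. specialize (B x).
  rewrite (Rabs_pos_eq (be x)) by lra. split; apply Rmult_le_compat_r; try apply Rabs_pos; lra.
Qed.

Lemma frame_close (z : R) : Rabs (al z - z) <= ep * (Wt 1 z * Wt c1 z).
Proof.
  destruct Hf as (D & _ & A0 & _ & B).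
  destruct (mvt_origin (fun x => al x - x) (fun x => be x - 1) z) as [x [Hx ->]].
  - rewrite A0. ring.
  - intros x. apply is_derive_minusR; [apply D | apply is_derive_idR].
  - rewrite Rabs_mult. specialize (B x). assert (He := frame_ep_pos).
    assert (W := Wt_le_Rabs c1 x z Hc1 Hx). assert (W1 := abs_le_Wt1 z).
    apply Rle_trans with (ep * Wt c1 z * Wt 1 z); [| lra].
    apply Rmult_le_compat; try apply Rabs_pos; [| assumption].
    apply Rle_trans with (1 := B). now apply Rmult_le_compat_l.
Qed.

Lemma slow_al : slow al.
Proof.
  split; [apply derive_continuous with be; apply Hf |].
  exists 1, K1. split; [lra |]. split; [lra |]. intros z.
  apply Rle_trans with (1 := proj2 (frame_bounds z)). apply Rmult_le_compat_l; [lra | apply abs_le_Wt1].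
Qed.

Lemma slow_be : slow be.
Proof.
  split; [apply Hf |]. exists 0, K1. split; [lra |]. split; [lra |]. intros z.
  destruct Hf as (_ & _ & _ & B & _). specialize (B z). rewrite Wt_0, Rabs_pos_eq; lra.
Qed.

Lemma slow_pot (s : R) : slow (pot al s).
Proof. unfold pot. assert (S := slow_al). slow_tac. Qed.

Lemma pot_adm (s eta : R) : Rabs s <= 1 -> Ca * (ep + Rabs s) <= eta -> adm kap c0 (pot al s) eta.
Proof.
  intros Hs Heta. assert (He := frame_ep_pos). split; [| split].
  - apply slow_pot.
  - intros z. destruct (frame_bounds z) as [B _]. unfold pot, kap.
    assert (k1 ^ 2 * z ^ 2 <= al z ^ 2).
    { rewrite <- (pow2_abs z), <- (pow2_abs (al z)), <- Rpow_mult_distr. apply pow_incr.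
      split; [| assumption]. apply Rmult_le_pos; [lra | apply Rabs_pos]. }
    assert (s ^ 2 <= 1) by (rewrite <- pow2_abs; generalize (Rabs_pos s); nra).
    generalize (pow2_ge_0 (al z - 2 * s)). nra.
  - intros z. unfold pot. replace ((al z - s) ^ 2 - z ^ 2) with ((al z - z - s) * (al z + z - s)) by ring.
    rewrite Rabs_mult. assert (Hs0 := Rabs_pos s).
    assert (W1 := Wt_ge2 1 z ltac:(lra)). assert (Wc := Wt_ge2 c1 z Hc1).
    assert (A1 : Rabs (al z - z - s) <= (ep + Rabs s) * (Wt 1 z * Wt c1 z)).
    { eapply Rle_trans; [apply Rabs_triang |]. rewrite Rabs_Ropp.
      assert (F := frame_close z). assert (1 <= Wt 1 z * Wt c1 z) by nra. nra. }
    assert (A2 : Rabs (al z + z - s) <= (K1 + 2) * Wt 1 z).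
    { eapply Rle_trans; [apply Rabs_triang |]. rewrite Rabs_Ropp.
      assert (Q := Rabs_triang (al z) z). destruct (frame_bounds z) as [_ B].
      assert (Z := abs_le_Wt1 z). assert (K1 * Rabs z <= K1 * Wt 1 z) by (apply Rmult_le_compat_l; lra). lra. }
    apply Rle_trans with ((ep + Rabs s) * (Wt 1 z * Wt c1 z) * ((K1 + 2) * Wt 1 z)).
    + apply Rmult_le_compat; auto using Rabs_pos.
    + assert (M1 := Wt_mult 1 c1 z ltac:(lra) Hc1). assert (M2 := Wt_mult (1 + c1) 1 z ltac:(lra) ltac:(lra)).
      replace (1 + c1 + 1) with c0 in M2 by (unfold c0; ring).
      assert (M : Wt 1 z * Wt c1 z * Wt 1 z <= 4 * Wt c0 z).
      { apply Rle_trans with (2 * Wt (1 + c1) z * Wt 1 z); [apply Rmult_le_compat_r; lra | lra]. }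
      replace ((ep + Rabs s) * (Wt 1 z * Wt c1 z) * ((K1 + 2) * Wt 1 z))
        with ((ep + Rabs s) * (K1 + 2) * (Wt 1 z * Wt c1 z * Wt 1 z)) by ring.
      apply Rle_trans with ((ep + Rabs s) * (K1 + 2) * (4 * Wt c0 z)).
      * apply Rmult_le_compat_l; [mult_pos | assumption].
      * replace ((ep + Rabs s) * (K1 + 2) * (4 * Wt c0 z)) with (Ca * (ep + Rabs s) * Wt c0 z) by (unfold Ca; ring).
        apply Rmult_le_compat_r; [left; apply Wt_pos | assumption].
Qed.

Lemma pot_diff (s s' z : R) : Rabs s <= 1 -> Rabs s' <= 1 ->
  Rabs (pot al s z - pot al s' z) <= (2 * K1 + 2) * Rabs (s - s') * Wt c0 z.
Proof.
  intros Hs Hs'. unfold pot.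
  replace ((al z - s) ^ 2 - (al z - s') ^ 2) with ((s - s') * (- 2 * al z + s + s')) by ring.
  rewrite Rabs_mult.
  replace ((2 * K1 + 2) * Rabs (s - s') * Wt c0 z) with (Rabs (s - s') * ((2 * K1 + 2) * Wt c0 z)) by ring.
  apply Rmult_le_compat_l; [apply Rabs_pos |].
  destruct (frame_bounds z) as [_ B]. assert (Z := abs_le_Wt1 z).
  assert (W : Wt 1 z <= Wt c0 z) by (apply Wt_mono; unfold c0; lra). assert (W2 := Wt_ge2 1 z ltac:(lra)).
  assert (K1 * Rabs z <= K1 * Wt c0 z) by (apply Rmult_le_compat_l; lra).
  apply Rabs_le_between in Hs. apply Rabs_le_between in Hs'. apply Rabs_le_between in B.
  apply Rabs_le. lra.
Qed.

End OneFrame.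

(** The four spectral estimates at level j under one common threshold, so that all the family
    estimates can share a fixed eta0. *)
Definition good (eta0 : R) : Prop :=
  (forall c, c0 <= c -> exists C, 0 < C /\
    forall U eta E w w1 w2, adm kap c0 U eta -> eta <= eta0 -> Rabs (E - Lam) <= 1 ->
    dom w w1 w2 -> integ (fun z => w z * hf j z) = 0 ->
    integ (fun z => Wt c z * w z ^ 2) <= C * integ (fun z => Wt c z * res U E w w2 z ^ 2)) /\
  (forall c, c0 <= c -> exists C, 0 < C /\
    forall U eta E v v1 v2, adm kap c0 U eta -> eta <= eta0 -> Rabs (E - Lam) <= 1 ->
    eigf U E v v1 v2 -> integ (fun z => v z * hf j z) = hn j ->
    integ (fun z => Wt c z * (v z - hf j z) ^ 2) <= C * eta ^ 2 /\ (E - Lam) ^ 2 <= C * eta ^ 2) /\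
  (forall c, c0 <= c -> exists C, 0 < C /\
    forall U eta E v v1 v2, adm kap c0 U eta -> eta <= eta0 -> Rabs (E - Lam) <= 1 ->
    eigf U E v v1 v2 -> integ (fun z => v z * hf j z) = hn j ->
    integ (fun z => Wt c z * v z ^ 2) <= C) /\
  (forall c, c0 <= c -> exists C, 0 < C /\
    forall U U' eta delta E E' v v1 v2 u u1 u2, adm kap c0 U eta -> adm kap c0 U' eta -> eta <= eta0 ->
    (forall z, Rabs (U z - U' z) <= delta * Wt c0 z) ->
    Rabs (E - Lam) <= 1 -> Rabs (E' - Lam) <= 1 ->
    eigf U E v v1 v2 -> integ (fun z => v z * hf j z) = hn j ->
    eigf U' E' u u1 u2 -> integ (fun z => u z * hf j z) = hn j ->
    integ (fun z => Wt c z * (v z - u z) ^ 2) <= C * delta ^ 2 /\ (E - E') ^ 2 <= C * delta ^ 2).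

Lemma good_exists : exists eta0, 0 < eta0 /\ good eta0.
Proof.
  destruct (gap_weighted kap c0 kap_pos c0_pos j) as [e1 [P1 G1]].
  destruct (eigf_close kap c0 kap_pos c0_pos j) as [e2 [P2 G2]].
  destruct (eigf_bound kap c0 kap_pos c0_pos j) as [e3 [P3 G3]].
  destruct (eigf_compare kap c0 kap_pos c0_pos j) as [e4 [P4 G4]].
  set (e := Rmin (Rmin e1 e2) (Rmin e3 e4)).
  assert (L1 : e <= e1) by (eapply Rle_trans; [apply Rmin_l | apply Rmin_l]).
  assert (L2 : e <= e2) by (eapply Rle_trans; [apply Rmin_l | apply Rmin_r]).
  assert (L3 : e <= e3) by (eapply Rle_trans; [apply Rmin_r | apply Rmin_l]).
  assert (L4 : e <= e4) by (eapply Rle_trans; [apply Rmin_r | apply Rmin_r]).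
  exists e. split; [repeat apply Rmin_glb_lt; assumption |].
  split; [| split; [| split]]; intros c Hc.
  - destruct (G1 c Hc) as [C [HC G]]. exists C. split; [assumption |].
    exact (fun U eta E w w1 w2 A B => G U eta E w w1 w2 A (Rle_trans _ _ _ B L1)).
  - destruct (G2 c Hc) as [C [HC G]]. exists C. split; [assumption |].
    exact (fun U eta E v v1 v2 A B => G U eta E v v1 v2 A (Rle_trans _ _ _ B L2)).
  - destruct (G3 c Hc) as [C [HC G]]. exists C. split; [assumption |].
    exact (fun U eta E v v1 v2 A B => G U eta E v v1 v2 A (Rle_trans _ _ _ B L3)).
  - destruct (G4 c Hc) as [C [HC G]]. exists C. split; [assumption |].
    exact (fun U U' eta delta E E' v v1 v2 u u1 u2 A A' B => G U U' eta delta E E' v v1 v2 u u1 u2 A A' (Rle_trans _ _ _ B L4)).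
Qed.

Variables eta0 e0 s0 : R.
Hypothesis Hgood : good eta0.
Hypothesis He0 : e0 <= 1.
Hypothesis Hs0 : s0 <= 1.
Hypothesis Hthr : Ca * (e0 + s0) <= eta0.

Definition state (al be : R -> R) (ep s E : R) (w w1 w2 : R -> R) : Prop :=
  frame al be ep /\ ep <= e0 /\ Rabs s <= s0 /\ Rabs (E - Lam) <= 1 /\
  eigf (pot al s) E w w1 w2 /\ integ (fun z => w z * hf j z) = hn j.

Lemma state_adm (al be : R -> R) (ep s E : R) (w w1 w2 : R -> R) : state al be ep s E w w1 w2 ->
  adm kap c0 (pot al s) eta0.
Proof.
  intros (F & E1 & S1 & _). apply pot_adm with be ep; [assumption | lra |].
  apply Rle_trans with (2 := Hthr). apply Rmult_le_compat_l; [unfold Ca; lra | lra].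
Qed.

Lemma state_fast (al be : R -> R) (ep s E : R) (w w1 w2 : R -> R) : state al be ep s E w w1 w2 -> fast w.
Proof. intros (_ & _ & _ & _ & [[F _] _] & _). exact F. Qed.

(** Cauchy-Schwarz and the normalization against [hf j]; it licenses the divisions by [Nq]. *)
Lemma state_norm (al be : R -> R) (ep s E : R) (w w1 w2 : R -> R) : state al be ep s E w w1 w2 -> hn j <= Nq w.
Proof.
  intros H. assert (Fw := state_fast _ _ _ _ _ _ _ _ H). destruct H as (_ & _ & _ & _ & _ & O).
  assert (F := fast_hf j). assert (Hn := hn_pos j).
  assert (CS := integ_cauchy_schwarz w (hf j) Fw F). rewrite O in CS. fold (hn j) in CS.
  unfold Nq. rewrite (integ_ext _ (fun z => w z ^ 2)) by (intros; ring).
  apply Rmult_le_reg_r with (hn j); [assumption |]. lra.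
Qed.

Section Family.

Variable T : Type.
Variables (al be : T -> R -> R) (ep : T -> R).
Hypothesis Hfr : forall t, frame (al t) (be t) (ep t).

Lemma ep_nonneg (t : T) : 0 <= ep t.
Proof. apply (frame_ep_pos (al t) (be t)), Hfr. Qed.

Lemma GR_id : GR (fun (_ : T) z => z) (fun _ => 1).
Proof. apply (GR_fixed T (fun z => z)), slow_id. Qed.

Lemma GR_al : GR al (fun _ => 1).
Proof.
  split; [intros; lra |]. split; [intros t; apply (slow_al (al t) (be t) (ep t)), Hfr |].
  exists 1, K1. split; [lra |]. split; [lra |]. intros t z. rewrite Rmult_1_r.
  apply Rle_trans with (1 := proj2 (frame_bounds _ _ _ (Hfr t) z)).
  apply Rmult_le_compat_l; [lra | apply abs_le_Wt1].
Qed.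

Lemma GR_al_close : GR (fun t z => al t z - z) ep.
Proof.
  split; [apply ep_nonneg |]. split.
  - intros t. assert (S := slow_al _ _ _ (Hfr t)). slow_tac.
  - exists (1 + c1), 2. split; [lra |]. split; [lra |]. intros t z.
    apply Rle_trans with (1 := frame_close _ _ _ (Hfr t) z).
    assert (M := Wt_mult 1 c1 z ltac:(lra) Hc1). generalize (ep_nonneg t). nra.
Qed.

Lemma GR_be_close : GR (fun t z => be t z - 1) ep.
Proof.
  split; [apply ep_nonneg |]. split.
  - intros t. assert (S := slow_be _ _ _ (Hfr t)). slow_tac.
  - exists c1, 1. split; [assumption |]. split; [lra |]. intros t z.
    destruct (Hfr t) as (_ & _ & _ & _ & B). rewrite Rmult_1_l. apply B.
Qed.

Section OneState.

Variables (s E : T -> R) (v v1 v2 : T -> R -> R).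
Hypothesis Hv : forall t, state (al t) (be t) (ep t) (s t) (E t) (v t) (v1 t) (v2 t).

Lemma NB_state : NB v (fun _ => 1).
Proof.
  apply NB_intro with c0; [apply c0_pos | intros; lra | intros t; now apply (state_fast _ _ _ _ _ _ _ _ (Hv t)) |].
  intros c Hc. destruct (proj1 (proj2 (proj2 Hgood)) c Hc) as [C [HC G]]. exists C. split; [assumption |].
  intros t. rewrite pow1, Rmult_1_r. assert (A := state_adm _ _ _ _ _ _ _ _ (Hv t)).
  destruct (Hv t) as (_ & _ & _ & H1 & H2 & H3). now apply (G (pot (al t) (s t)) eta0 (E t) (v t) (v1 t) (v2 t) A (Rle_refl _)).
Qed.

(** The weighted energy identity has zero residual here. As the potential is nonnegative, the
    squared weighted norm of v' is at most M times that of v. *)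
Lemma NB_state_derive : NB v1 (fun _ => 1).
Proof.
  assert (N := NB_state). split; [intros; lra |]. split; [intros t; apply (Hv t) |].
  intros c Hc. destruct N as [_ [_ N]]. destruct (N c Hc) as [C [HC B]].
  set (M := 2 * INR j + 2 + c ^ 2 / 2). assert (HM : 0 <= M) by (unfold M; generalize (pos_INR j), (pow2_ge_0 c); lra).
  exists (M * C ^ 2 + 1). assert (HMC : 0 <= M * C ^ 2) by (apply sq_nonneg_mult; assumption). split; [lra |].
  intros t. specialize (B t).
  destruct (Hv t) as (Hf & _ & _ & H1 & H2 & _). apply Rabs_le_between in H1.
  assert (SU := slow_pot _ _ _ Hf (s t)).
  assert (I := integ_weighted_energy c (E t) (pot (al t) (s t)) (v t) (v1 t) (v2 t) Hc SU (proj1 H2)).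
  rewrite (integ_ext (fun z => Wt c z * (res _ _ _ _ z * _)) (fun _ => 0)), integ_0 in I.
  2: { intros z. rewrite (eigf_res _ _ _ _ _ H2). ring. }
  destruct H2 as [(F0 & F1 & F2 & _) _].
  assert (L : - (M * integ (fun z => Wt c z * v t z ^ 2)) <=
    integ (fun z => Wt c z * ((pot (al t) (s t) z - E t - c ^ 2 / 2) * v t z ^ 2))).
  { rewrite <- integ_scal, <- integ_opp by fast_tac. apply integ_le; [fast_tac.. |].
    intros z. replace (- (M * (Wt c z * v t z ^ 2))) with (Wt c z * (- M * v t z ^ 2)) by ring.
    apply Rmult_le_compat_l; [left; apply Wt_pos |]. apply Rmult_le_compat_r; [apply pow2_ge_0 |].
    unfold M, pot. unfold Lam in H1. generalize (pow2_ge_0 (al t z - s t)). lra. }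
  nra.
Qed.

Lemma bO_inv_norm (F G : T -> R) : bO F G -> bO (fun t => F t / Nq (v t)) G.
Proof.
  apply bO_div with (hn j); [apply hn_pos |]. intros t. apply (state_norm _ _ _ _ _ _ _ _ (Hv t)).
Qed.

Lemma bO_Aq_state : bO (fun t => Aq (al t) (v t)) (fun _ => 1).
Proof.
  apply bO_ext with (fun t => integ (fun z => (al t z * v t z) * v t z)).
  { intros t. apply integ_ext. intros; ring. }
  apply bO_weaken with (fun _ => 1 * 1 * 1) 1; [lra | intros; lra | intros; lra |].
  apply (bO_integ T (fun t z => al t z * v t z) v); [| apply NB_state].
  apply (NB_mult T al v); [apply GR_al | apply NB_state].
Qed.

(* The gap transfers a bound on the source to a bound on the solution. *)
Lemma NB_gap (w w1 w2 : T -> R -> R) (G : T -> R) : (forall t, dom (w t) (w1 t) (w2 t)) ->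
  (forall t, integ (fun z => w t z * hf j z) = 0) ->
  NB (fun t => res (pot (al t) (s t)) (E t) (w t) (w2 t)) G -> NB w G.
Proof.
  intros Hd Ho [HG [Hr N]].
  apply NB_intro with c0; [apply c0_pos | assumption | intros t; apply (Hd t) |].
  intros c Hc. assert (Hcp := Rle_trans _ _ _ c0_pos Hc).
  destruct (N c Hcp) as [D [HD B]]. destruct (proj1 Hgood c Hc) as [C [HC GG]].
  exists (C * D ^ 2 + 1). assert (0 <= C * D ^ 2) by (apply sq_nonneg_mult; lra). split; [lra |].
  intros t. assert (A := state_adm _ _ _ _ _ _ _ _ (Hv t)). destruct (Hv t) as (_ & _ & _ & H1 & _).
  specialize (GG (pot (al t) (s t)) eta0 (E t) (w t) (w1 t) (w2 t) A (Rle_refl _) H1 (Hd t) (Ho t)).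
  apply Rle_trans with (1 := GG). apply Rle_trans with (C * (D * G t) ^ 2).
  - apply Rmult_le_compat_l; [lra | apply B].
  - nra.
Qed.

End OneState.

Section TwoStates.

Variables (s E s' E' : T -> R) (v v1 v2 y y1 y2 : T -> R -> R).
Hypothesis Hv : forall t, state (al t) (be t) (ep t) (s t) (E t) (v t) (v1 t) (v2 t).
Hypothesis Hy : forall t, state (al t) (be t) (ep t) (s' t) (E' t) (y t) (y1 t) (y2 t).

Let dl (t : T) : R := Rabs (s' t - s t).

Lemma compare_states (c : R) : c0 <= c -> exists C, 0 < C /\ forall t,
  integ (fun z => Wt c z * (y t z - v t z) ^ 2) <= C * dl t ^ 2 /\ (E' t - E t) ^ 2 <= C * dl t ^ 2.
Proof.
  intros Hc. destruct (proj2 (proj2 (proj2 Hgood)) c Hc) as [C [HC G]].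
  exists (C * (2 * K1 + 2) ^ 2 + 1). assert (0 <= C * (2 * K1 + 2) ^ 2) by (apply sq_nonneg_mult; lra).
  split; [lra |]. intros t.
  assert (A := state_adm _ _ _ _ _ _ _ _ (Hv t)). assert (A' := state_adm _ _ _ _ _ _ _ _ (Hy t)).
  destruct (Hv t) as (F1 & _ & S1 & H1 & H2 & H3). destruct (Hy t) as (_ & _ & S2 & H1' & H2' & H3').
  destruct (G (pot (al t) (s' t)) (pot (al t) (s t)) eta0 ((2 * K1 + 2) * dl t) (E' t) (E t)
    (y t) (y1 t) (y2 t) (v t) (v1 t) (v2 t)) as [Q1 Q2]; auto; try lra.
  - intros z. apply (pot_diff (al t) (be t) (ep t)); [assumption | lra | lra].
  - intros. split; nra.
Qed.

Lemma NB_states_diff : NB (fun t z => y t z - v t z) dl.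
Proof.
  apply NB_intro with c0; [apply c0_pos | intros t; apply Rabs_pos | |].
  - intros t. assert (F1 := state_fast _ _ _ _ _ _ _ _ (Hv t)). assert (F2 := state_fast _ _ _ _ _ _ _ _ (Hy t)). fast_tac.
  - intros c Hc. destruct (compare_states c Hc) as [C [HC G]]. exists C. split; [assumption | apply G].
Qed.

Lemma bO_energy_diff : bO (fun t => E' t - E t) dl.
Proof.
  destruct (compare_states c0 (Rle_refl _)) as [C [HC G]].
  apply bO_of_sq with C; [lra | intros t; apply Rabs_pos | apply G].
Qed.

(** Symmetry applied to the eigenfunctions for s and s'. The potentials differ by exactly (s' -
    s)(s' + s - 2 al), so no expansion is involved. *)
Lemma energy_diff_identity (t : T) :
  (E' t - E t) * integ (fun z => v t z * y t z) =
  (s' t - s t) * integ (fun z => (s' t + s t - 2 * al t z) * (v t z * y t z)).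
Proof.
  destruct (Hv t) as (F1 & _ & _ & _ & H2 & _). destruct (Hy t) as (_ & _ & _ & _ & H2' & _).
  assert (Sa := slow_al _ _ _ F1).
  assert (S := integ_dom_sym _ _ _ _ _ _ (proj1 H2) (proj1 H2')).
  destruct H2 as [(V0 & _) Ev]. destruct H2' as [(Y0 & _) Ey].
  rewrite (integ_ext (fun z => v2 t z * _) (fun z => (al t z - s t) ^ 2 * (v t z * y t z) - E t * (v t z * y t z))) in S
    by (intros; rewrite Ev; unfold pot; ring).
  rewrite (integ_ext (fun z => v t z * y2 t z) (fun z => (al t z - s' t) ^ 2 * (v t z * y t z) - E' t * (v t z * y t z))) in S
    by (intros; rewrite Ey; unfold pot; ring).
  rewrite !integ_minus, !integ_scal in S by fast_tac.
  replace ((E' t - E t) * integ (fun z => v t z * y t z)) with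
    (integ (fun z => (al t z - s' t) ^ 2 * (v t z * y t z)) - integ (fun z => (al t z - s t) ^ 2 * (v t z * y t z))) by lra.
  rewrite <- integ_minus, <- integ_scal by fast_tac. apply integ_ext. intros; ring.
Qed.

(** Insert y = v + w in the exact identity: w and E' - E are O(dl), so what remains after the slope
    term is quadratic. *)
Lemma energy_first_order :
  bO (fun t => E' t - E t - (s' t - s t) * slope (al t) (s t) (v t)) (fun t => dl t ^ 2).
Proof.
  assert (Nv := NB_state _ _ _ _ _ Hv). assert (Ny := NB_state _ _ _ _ _ Hy). assert (Nw := NB_states_diff).
  set (w := fun t z => y t z - v t z) in *.
  assert (Hd : bO (fun t => s' t - s t) dl) by (apply bO_of_le; intros; unfold dl; lra).
  assert (Nsv : NB (fun t z => (al t z - s t) * v t z) (fun _ => 1)).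
  { apply NB_weaken with (fun _ => 1 * 1) 1; [lra | intros; lra | intros; lra |].
    apply (NB_mult T (fun t z => al t z - s t) v); [| assumption].
    apply (GR_plus T al (fun t _ => - s t)); [apply GR_al |]. apply (GR_coef T (fun t => - s t)).
    apply bO_of_le. intros t. rewrite Rabs_Ropp. destruct (Hv t) as (_ & _ & Q & _). lra. }
  apply bO_ext with (fun t => ((s' t - s t) * (-2 * integ (fun z => ((al t z - s t) * v t z) * w t z)
    + (s' t - s t) * integ (fun z => v t z * y t z)) - (E' t - E t) * integ (fun z => v t z * w t z)) / Nq (v t)).
  - intros t. assert (I := energy_diff_identity t).
    assert (HN := state_norm _ _ _ _ _ _ _ _ (Hv t)). assert (Hn := hn_pos j).
    assert (Fv := state_fast _ _ _ _ _ _ _ _ (Hv t)). assert (Fy := state_fast _ _ _ _ _ _ _ _ (Hy t)).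
    assert (Sa := slow_al _ _ _ (Hfr t)).
    apply Rmult_eq_reg_r with (Nq (v t)); [| lra].
    unfold slope. field_simplify; [| lra | lra].
    assert (Ew : integ (fun z => v t z * w t z) = integ (fun z => v t z * y t z) - Nq (v t)).
    { unfold Nq, w. rewrite <- integ_minus by fast_tac. apply integ_ext. intros; ring. }
    assert (Ea : integ (fun z => (al t z - s t) * v t z * w t z) =
      integ (fun z => al t z * (v t z * y t z)) - s t * integ (fun z => v t z * y t z)
      - Aq (al t) (v t) + s t * Nq (v t)).
    { unfold Nq, Aq, w. rewrite <- !integ_scal, <- !integ_minus, <- integ_plus by fast_tac. apply integ_ext. intros; ring. }
    rewrite (integ_ext (fun z => (s' t + s t - 2 * al t z) * _)
      (fun z => (s' t + s t) * (v t z * y t z) - 2 * (al t z * (v t z * y t z)))) in I by (intros; ring).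
    rewrite integ_minus, !integ_scal in I by fast_tac.
    nra.
  - apply bO_inv_norm with s E v1 v2; [assumption |].
    apply bO_minus.
    + apply bO_weaken with (fun t => dl t * dl t) 1; [lra | intros; apply pow2_ge_0 | intros; simpl; lra |].
      apply bO_mult; [assumption |]. apply bO_plus.
      * apply bO_scal. apply bO_weaken with (fun t => 1 * dl t) 1; [lra | intros; apply Rabs_pos | intros; lra |].
        now apply (bO_integ T (fun t z => (al t z - s t) * v t z) w).
      * apply bO_weaken with (fun t => dl t * (1 * 1)) 1; [lra | intros; apply Rabs_pos | intros; lra |].
        apply bO_mult; [assumption |]. now apply bO_integ.
    + apply bO_weaken with (fun t => dl t * (1 * dl t)) 1; [lra | intros; apply pow2_ge_0 | intros; simpl; lra |].
      apply bO_mult; [apply bO_energy_diff | now apply bO_integ].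
Qed.

End TwoStates.

(** * The second derivative in the shift *)

Section SecondOrder.

Variables (Eu : T -> R) (u u1 u2 : T -> R -> R).
Hypothesis Hu : forall t, state (al t) (be t) (ep t) 0 (Eu t) (u t) (u1 t) (u2 t).

Let u3 (t : T) (z : R) : R := 2 * (al t z * be t z) * u t z + (pot (al t) 0 z - Eu t) * u1 t z.

Let pj (t : T) : R := integ (fun z => u1 t z * hf j z) / hn j.

(** u' has source -2 al be u, and the difference quotient has source (2 al + slope) u up to O(s).
    Twice this function is the source of their sum; it is of order ep because be is close to 1 and
    the slope close to 0. *)
Definition virial_source (t : T) (z : R) : R :=
  al t z * (1 - be t z) * u t z + slope (al t) 0 (u t) / 2 * u t z.

(** The s-derivative of the slope is to leading order 2 - 4 <q, (al - m) u> / N, with q the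
    difference quotient and m the mean of al. Here the pairing is taken from [quotient_pairing]
    without its [corr] and [src_rem] terms. For be = 1 it is N/2 and the total is 0, as in a
    constant field. *)
Definition curvature (t : T) : R :=
  2 - 4 * ((/ 2 * integ (fun z => be t z * (u t z * u t z)) - integ (fun z => virial_source t z * u1 t z)) / Nq (u t)).

Lemma dom_derive_state (t : T) : dom (u1 t) (u2 t) (u3 t).
Proof.
  assert (Sa := slow_al _ _ _ (Hfr t)). assert (Sb := slow_be _ _ _ (Hfr t)). assert (Sp := slow_pot _ _ _ (Hfr t) 0).
  destruct (Hu t) as (F1 & _ & _ & _ & [(F0 & Fu1 & Fu2 & D0 & D1) Ee] & _).
  split; [assumption |]. split; [assumption |]. split; [unfold u3; fast_tac |]. split; [assumption |].
  intros z. apply is_derive_ext with (fun z => (al t z * al t z - Eu t) * u t z).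
  { intros x. rewrite Ee. unfold pot. ringR. }
  evar_last.
  - apply is_derive_multR; [| apply D0]. apply is_derive_minusR; [| apply is_derive_const].
    apply is_derive_multR; apply F1.
  - unfold u3, pot, zero; simpl. ring.
Qed.

Lemma res_derive_state (t : T) (z : R) :
  res (pot (al t) 0) (Eu t) (u1 t) (u3 t) z = -2 * (al t z * be t z) * u t z.
Proof. unfold res, u3. ring. Qed.

(** Force balance in a stationary state: pairing the eigenvalue equation with u' isolates 2 al be,
    the derivative of the potential. *)
Lemma virial (t : T) : integ (fun z => al t z * be t z * (u t z * u t z)) = 0.
Proof.
  destruct (Hu t) as (F1 & _ & _ & _ & H2 & _).
  assert (Sa := slow_al _ _ _ F1). assert (Sb := slow_be _ _ _ F1). assert (Fu := proj1 (proj1 H2)).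
  assert (S := integ_res_sym (pot (al t) 0) (Eu t) _ _ _ _ _ _ (slow_pot _ _ _ F1 0) (dom_derive_state t) (proj1 H2)).
  rewrite (integ_ext (fun z => u1 t z * _) (fun _ => 0)), integ_0 in S
    by (intros; rewrite (eigf_res _ _ _ _ _ H2); ring).
  rewrite (integ_ext _ (fun z => -2 * (al t z * be t z * (u t z * u t z)))) in S
    by (intros; rewrite res_derive_state; ring).
  rewrite integ_scal in S by fast_tac. lra.
Qed.

(** Subtracting the virial identity replaces al by al (1 - be), which exhibits the mean of al as a
    quantity of order ep. *)
Lemma Aq_virial (t : T) : Aq (al t) (u t) = - integ (fun z => (al t z * u t z) * ((be t z - 1) * u t z)).
Proof.
  assert (Sa := slow_al _ _ _ (Hfr t)). assert (Sb := slow_be _ _ _ (Hfr t)).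
  assert (Fu := state_fast _ _ _ _ _ _ _ _ (Hu t)).
  rewrite <- (Rplus_0_r (- _)), <- (virial t).
  rewrite <- integ_opp, <- integ_plus by fast_tac. apply integ_ext. intros; ring.
Qed.

Lemma NB_mult_1 (g f : T -> R -> R) (G : T -> R) : GR g (fun _ => 1) -> NB f G -> NB (fun t z => g t z * f t z) G.
Proof.
  intros Hg Hfn. apply NB_weaken with (fun t => 1 * G t) 1; [lra | apply Hfn | intros; lra |]. now apply NB_mult.
Qed.

Lemma NB_mult_r1 (g f : T -> R -> R) (G : T -> R) : GR g G -> NB f (fun _ => 1) -> NB (fun t z => g t z * f t z) G.
Proof.
  intros Hg Hfn. apply NB_weaken with (fun t => G t * 1) 1; [lra | apply Hg | intros; lra |]. now apply NB_mult.
Qed.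

Lemma bO_integ_l1 (f h : T -> R -> R) (G : T -> R) : NB f (fun _ => 1) -> NB h G ->
  bO (fun t => integ (fun z => f t z * h t z)) G.
Proof.
  intros H K. apply bO_weaken with (fun t => 1 * G t) 1; [lra | apply K | intros; lra |]. now apply bO_integ.
Qed.

Lemma bO_integ_r1 (f h : T -> R -> R) (G : T -> R) : NB f G -> NB h (fun _ => 1) ->
  bO (fun t => integ (fun z => f t z * h t z)) G.
Proof.
  intros H K. apply bO_weaken with (fun t => G t * 1) 1; [lra | apply H | intros; lra |]. now apply bO_integ.
Qed.

Lemma bO_mult_l1 (F F' G : T -> R) : bO F (fun _ => 1) -> bO F' G -> bO (fun t => F t * F' t) G.
Proof.
  intros H K. apply bO_weaken with (fun t => 1 * G t) 1; [lra | apply K | intros; lra |]. now apply bO_mult.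
Qed.

Lemma bO_mult_r1 (F F' G : T -> R) : bO F G -> bO F' (fun _ => 1) -> bO (fun t => F t * F' t) G.
Proof.
  intros H K. apply bO_weaken with (fun t => G t * 1) 1; [lra | apply H | intros; lra |]. now apply bO_mult.
Qed.

Lemma bO_slope_0 : bO (fun t => slope (al t) 0 (u t)) ep.
Proof.
  assert (Nu := NB_state _ _ _ _ _ Hu).
  apply bO_ext with (fun t => 2 * (integ (fun z => (al t z * u t z) * ((be t z - 1) * u t z)) / Nq (u t))).
  - intros t. unfold slope. rewrite (Aq_virial t). unfold Rdiv. ring.
  - apply bO_scal. apply bO_inv_norm with (fun _ => 0) Eu u1 u2; [assumption |].
    apply (bO_integ_l1 (fun t z => al t z * u t z) (fun t z => (be t z - 1) * u t z)).
    + apply NB_mult_1; [apply GR_al | assumption].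
    + apply (NB_mult_r1 (fun t z => be t z - 1) u); [apply GR_be_close | assumption].
Qed.

Lemma NB_virial_source : NB virial_source ep.
Proof.
  assert (Nu := NB_state _ _ _ _ _ Hu). apply NB_plus.
  - apply NB_ext with (fun t z => - (al t z * ((be t z - 1) * u t z))); [intros; ring |].
    apply NB_opp. apply (NB_mult_1 al (fun t z => (be t z - 1) * u t z)); [apply GR_al |].
    apply (NB_mult_r1 (fun t z => be t z - 1) u); [apply GR_be_close | assumption].
  - apply (NB_mult_r1 (fun t _ => slope (al t) 0 (u t) / 2) u); [| assumption].
    apply (GR_coef T (fun t => slope (al t) 0 (u t) / 2)).
    apply bO_ext with (fun t => / 2 * slope (al t) 0 (u t)); [intros; unfold Rdiv; ring |].
    apply bO_scal, bO_slope_0.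
Qed.

Section DifferenceQuotient.

Variables (s Ev : T -> R) (v v1 v2 : T -> R -> R).
Hypothesis Hv : forall t, state (al t) (be t) (ep t) (s t) (Ev t) (v t) (v1 t) (v2 t).
Hypothesis Hs : forall t, s t <> 0.

Let q (t : T) (z : R) : R := / s t * (v t z - u t z).
Let yv (t : T) : R := (Ev t - Eu t) / s t - s t.

(* The difference quotient is [- u'] to leading order because [u] is close to
   a translate of a fixed profile. *)
Definition corr (t : T) (z : R) : R := / s t * (v t z - u t z) + u1 t z - pj t * u t z.

(** The part of the source of [corr] that vanishes with s: the first term is the error of replacing
    v by u, the second that of replacing yv by the slope. *)
Definition src_rem (t : T) (z : R) : R :=
  (2 * al t z + slope (al t) 0 (u t)) * (v t z - u t z) + (yv t - slope (al t) 0 (u t)) * v t z.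

Definition quot (t : T) : R := (slope (al t) (s t) (v t) - slope (al t) 0 (u t)) / s t.

Lemma bO_abs_s : bO s (fun t => Rabs (s t)).
Proof. apply bO_of_le. intros; lra. Qed.

Lemma bO_inv_s : bO (fun t => / s t) (fun t => / Rabs (s t)).
Proof. apply bO_of_le. intros t. rewrite Rabs_inv. lra. Qed.

Lemma bO_abs_s_1 : bO s (fun _ => 1).
Proof.
  apply bO_of_le. intros t. destruct (Hv t) as (_ & _ & Q & _). lra.
Qed.

Lemma NB_diff : NB (fun t z => v t z - u t z) (fun t => Rabs (s t)).
Proof.
  apply NB_weaken with (fun t => Rabs (s t - 0)) 1; [lra | intros; apply Rabs_pos | intros; rewrite Rminus_0_r; lra |].
  now apply (NB_states_diff (fun _ => 0) Eu s Ev u u1 u2 v v1 v2).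
Qed.

Lemma NB_quotient : NB q (fun _ => 1).
Proof.
  apply NB_weaken with (fun t => / Rabs (s t) * Rabs (s t)) 1; [lra | intros; lra | |].
  - intros t. rewrite Rinv_l; [lra | apply Rabs_no_R0, Hs].
  - apply (NB_scal T (fun t => / s t) _ _ (fun t z => v t z - u t z)); [apply bO_inv_s | apply NB_diff].
Qed.

(** First-order expansion of the energy divided by s; the - s in yv comes from the s^2 in the
    potential. *)
Lemma bO_yv : bO (fun t => yv t - slope (al t) 0 (u t)) (fun t => Rabs (s t)).
Proof.
  assert (B := energy_first_order (fun _ => 0) Eu s Ev u u1 u2 v v1 v2 Hu Hv).
  apply bO_ext with (fun t => / s t * (Ev t - Eu t - (s t - 0) * slope (al t) 0 (u t)) - s t).
  - intros t. unfold yv. field. apply Hs.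
  - apply bO_minus; [| apply bO_abs_s].
    apply bO_weaken with (fun t => / Rabs (s t) * Rabs (s t - 0) ^ 2) 1; [lra | intros; apply Rabs_pos | |].
    + intros t. rewrite Rminus_0_r. right. field. apply Rabs_no_R0, Hs.
    + apply bO_mult; [apply bO_inv_s | exact B].
Qed.

Lemma bO_slope_0_1 : bO (fun t => slope (al t) 0 (u t)) (fun _ => 1).
Proof.
  apply bO_weaken with ep 1; [lra | intros; lra | | apply bO_slope_0].
  intros t. destruct (Hu t) as (_ & Q & _). lra.
Qed.

Lemma NB_src_rem : NB src_rem (fun t => Rabs (s t)).
Proof.
  apply NB_plus.
  - apply (NB_mult_1 (fun t z => 2 * al t z + slope (al t) 0 (u t)) (fun t z => v t z - u t z)); [| apply NB_diff].
    apply (GR_plus T (fun t z => 2 * al t z) (fun t _ => slope (al t) 0 (u t))).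
    + apply GR_weaken with (fun _ => 1 * 1) 1; [lra | intros; lra | intros; lra |].
      apply (GR_mult T (fun _ _ => 2) al); [apply (GR_coef T (fun _ => 2)), bO_const | apply GR_al].
    + apply (GR_coef T (fun t => slope (al t) 0 (u t))), bO_slope_0_1.
  - apply (NB_mult_r1 (fun t _ => yv t - slope (al t) 0 (u t)) v); [| apply (NB_state _ _ _ _ _ Hv)].
    apply (GR_coef T (fun t => yv t - slope (al t) 0 (u t))), bO_yv.
Qed.

Lemma dom_corr (t : T) : dom (corr t)
  (fun z => (/ s t * (v1 t z + -1 * u1 t z) + 1 * u2 t z) + - pj t * u1 t z)
  (fun z => (/ s t * (v2 t z + -1 * u2 t z) + 1 * u3 t z) + - pj t * u2 t z).
Proof.
  destruct (Hv t) as (_ & _ & _ & _ & [Dv _] & _). destruct (Hu t) as (_ & _ & _ & _ & [Du _] & _).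
  assert (D1 := dom_plus_scal (-1) _ _ _ _ _ _ Dv Du).
  assert (D0 := dom_plus_scal (/ s t - 1) _ _ _ _ _ _ D1 D1).
  assert (D2 := dom_plus_scal 1 _ _ _ _ _ _ D0 (dom_derive_state t)).
  assert (D3 := dom_plus_scal (- pj t) _ _ _ _ _ _ D2 Du).
  destruct D3 as (A1 & A2 & A3 & A4 & A5).
  assert (E0 : forall z, v t z + -1 * u t z + (/ s t - 1) * (v t z + -1 * u t z) + 1 * u1 t z + - pj t * u t z = corr t z).
  { intros z. unfold corr. field. apply Hs. }
  assert (E1 : forall z, v1 t z + -1 * u1 t z + (/ s t - 1) * (v1 t z + -1 * u1 t z) + 1 * u2 t z + - pj t * u1 t z
    = (/ s t * (v1 t z + -1 * u1 t z) + 1 * u2 t z) + - pj t * u1 t z) by (intros; ring).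
  assert (E2 : forall z, v2 t z + -1 * u2 t z + (/ s t - 1) * (v2 t z + -1 * u2 t z) + 1 * u3 t z + - pj t * u2 t z
    = (/ s t * (v2 t z + -1 * u2 t z) + 1 * u3 t z) + - pj t * u2 t z) by (intros; ring).
  split; [apply fast_ext with (2 := A1); exact E0 |].
  split; [apply fast_ext with (2 := A2); exact E1 |].
  split; [apply fast_ext with (2 := A3); exact E2 |].
  split; intros z.
  - rewrite <- E1. apply is_derive_ext with (2 := A4 z). exact E0.
  - rewrite <- E2. apply is_derive_ext with (2 := A5 z). exact E1.
Qed.

(** [pj] is chosen for this: subtracting a multiple of the eigenfunction u leaves the residual
    unchanged and brings [corr] within reach of the gap. *)
Lemma orth_corr (t : T) : integ (fun z => corr t z * hf j z) = 0.
Proof.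
  assert (F := fast_hf j). assert (Hn := hn_pos j).
  assert (Fv := state_fast _ _ _ _ _ _ _ _ (Hv t)). assert (Fu := state_fast _ _ _ _ _ _ _ _ (Hu t)).
  assert (Fu1 : fast (u1 t)) by apply (dom_derive_state t).
  destruct (Hv t) as (_ & _ & _ & _ & _ & Ov). destruct (Hu t) as (_ & _ & _ & _ & _ & Ou).
  unfold corr. rewrite (integ_ext _ (fun z => / s t * (v t z * hf j z - u t z * hf j z) + u1 t z * hf j z - pj t * (u t z * hf j z)))
    by (intros; ring).
  rewrite integ_minus, integ_plus, !integ_scal, integ_minus, Ov, Ou by fast_tac.
  unfold pj. field. split; [lra | apply Hs].
Qed.

Lemma res_corr (t : T) (z : R) :
  res (pot (al t) 0) (Eu t) (corr t) (fun z => (/ s t * (v2 t z + -1 * u2 t z) + 1 * u3 t z) + - pj t * u2 t z) z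
  = 2 * virial_source t z + src_rem t z.
Proof.
  destruct (Hv t) as (_ & _ & _ & _ & [_ Ev'] & _). destruct (Hu t) as (_ & _ & _ & _ & [_ Eu'] & _).
  unfold res, corr, u3, virial_source, src_rem, yv. rewrite Ev', Eu'. unfold pot. field. apply Hs.
Qed.

Lemma NB_corr : NB corr (fun t => ep t + Rabs (s t)).
Proof.
  assert (P : forall t, 0 <= ep t + Rabs (s t)) by (intros t; generalize (ep_nonneg t), (Rabs_pos (s t)); lra).
  apply NB_gap with (fun _ => 0) Eu u u1 u2
    (fun t z => (/ s t * (v1 t z + -1 * u1 t z) + 1 * u2 t z) + - pj t * u1 t z)
    (fun t z => (/ s t * (v2 t z + -1 * u2 t z) + 1 * u3 t z) + - pj t * u2 t z);
    [exact Hu | exact dom_corr | exact orth_corr |].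
  apply NB_ext with (fun t z => (virial_source t z + virial_source t z) + src_rem t z).
  - intros. rewrite res_corr. ring.
  - apply NB_plus.
    + apply NB_weaken with ep 1; [lra | exact P | intros t; generalize (Rabs_pos (s t)); lra |].
      apply NB_plus; apply NB_virial_source.
    + apply NB_weaken with (fun t => Rabs (s t)) 1; [lra | exact P | intros t; generalize (ep_nonneg t); lra |].
      apply NB_src_rem.
Qed.

(** Write q = corr - u' + pj u. In <corr, al u> the part al be u is -1/2 times the residual of u',
    so symmetry moves the operator onto [corr] and leaves its source paired with u'. Only <corr,
    virial_source> stays implicit, and both its factors are small. *)
Lemma quotient_pairing (t : T) :
  integ (fun z => q t z * ((al t z - Aq (al t) (u t) / Nq (u t)) * u t z)) =
  / 2 * integ (fun z => be t z * (u t z * u t z)) - integ (fun z => virial_source t z * u1 t z)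
  - / 2 * integ (fun z => src_rem t z * u1 t z) + integ (fun z => corr t z * virial_source t z).
Proof.
  assert (Sa := slow_al _ _ _ (Hfr t)). assert (Sb := slow_be _ _ _ (Hfr t)).
  assert (Fu := state_fast _ _ _ _ _ _ _ _ (Hu t)).
  assert (HN := state_norm _ _ _ _ _ _ _ _ (Hu t)). assert (Hn := hn_pos j).
  assert (Fc := proj1 (dom_corr t)). assert (Fs : fast (virial_source t)) by apply NB_virial_source.
  assert (Fr : fast (src_rem t)) by apply NB_src_rem.
  assert (Fu1 : fast (u1 t)) by apply (dom_derive_state t).
  assert (Du : forall z, is_derive (u t) z (u1 t z)) by apply (Hu t).
  assert (Da : forall z, is_derive (al t) z (be t z)) by apply (Hfr t).
  assert (S := integ_res_sym (pot (al t) 0) (Eu t) _ _ _ _ _ _ (slow_pot _ _ _ (Hfr t) 0) (dom_corr t) (dom_derive_state t)).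
  rewrite (integ_ext (fun z => res _ _ _ _ z * _) (fun z => 2 * (virial_source t z * u1 t z) + src_rem t z * u1 t z)) in S
    by (intros; rewrite res_corr; ring).
  rewrite (integ_ext (fun z => corr t z * res _ _ _ _ z) (fun z => -2 * (corr t z * (al t z * be t z * u t z)))) in S
    by (intros; rewrite res_derive_state; ring).
  rewrite integ_plus, !integ_scal in S by fast_tac.
  assert (Z1 : integ (fun z => be t z * (u t z * u t z) + 2 * (al t z * (u t z * u1 t z))) = 0).
  { apply integ_derive with (fun z => al t z * (u t z * u t z)); [fast_tac.. |]. intros z. evar_last.
    - apply is_derive_multR; [apply Da |]. apply is_derive_multR; apply Du.
    - cbv beta. ring. }
  assert (Z2 : integ (fun z => 2 * (u t z * u1 t z)) = 0).
  { apply integ_derive with (fun z => u t z * u t z); [fast_tac.. |]. intros z. evar_last.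
    - apply is_derive_multR; apply Du.
    - ring. }
  rewrite integ_plus, !integ_scal in Z1 by fast_tac. rewrite integ_scal in Z2 by fast_tac.
  set (m := Aq (al t) (u t) / Nq (u t)) in *.
  assert (Z3 : integ (fun z => al t z * (u t z * u t z)) - m * integ (fun z => u t z * u t z) = 0).
  { fold (Aq (al t) (u t)). fold (Nq (u t)). unfold m. field. lra. }
  assert (Em : slope (al t) 0 (u t) / 2 = - m) by (unfold slope, m; field; lra).
  assert (I1 : integ (fun z => q t z * ((al t z - m) * u t z)) =
    integ (fun z => corr t z * (al t z * be t z * u t z)) + integ (fun z => corr t z * virial_source t z)
    - integ (fun z => al t z * (u t z * u1 t z)) + m * integ (fun z => u t z * u1 t z)
    + pj t * (integ (fun z => al t z * (u t z * u t z)) - m * integ (fun z => u t z * u t z))).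
  { rewrite Rmult_minus_distr_l, <- Rmult_assoc.
    rewrite <- !integ_scal, <- integ_minus, <- integ_plus, <- integ_minus, <- integ_plus, <- integ_plus by fast_tac.
    apply integ_ext. intros z. unfold virial_source. rewrite Em. unfold q, corr. ring. }
  rewrite I1, Z3. replace (integ (fun z => u t z * u1 t z)) with 0 by lra. lra.
Qed.

Lemma quotient_norms (t : T) :
  Nq (v t) = Nq (u t) + 2 * s t * integ (fun z => q t z * u t z) + s t ^ 2 * integ (fun z => q t z * q t z) /\
  Aq (al t) (v t) = Aq (al t) (u t) + 2 * s t * integ (fun z => q t z * (al t z * u t z))
    + s t ^ 2 * integ (fun z => q t z * (al t z * q t z)).
Proof.
  assert (Sa := slow_al _ _ _ (Hfr t)).
  assert (Fu := state_fast _ _ _ _ _ _ _ _ (Hu t)).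
  assert (Fq : fast (q t)) by apply NB_quotient.
  assert (Eq : forall z, v t z = u t z + s t * q t z) by (intros z; unfold q; field; apply Hs).
  unfold Nq, Aq. split; rewrite <- !integ_scal, <- !integ_plus by fast_tac; apply integ_ext; intros z; rewrite Eq; ring.
Qed.

(** The [corr] term is kept explicit on the left: it is small with ep but need not vanish with s,
    while differentiability requires an error that does. *)
Lemma quot_expansion :
  bO (fun t => quot t - curvature t + 4 * (integ (fun z => corr t z * virial_source t z) / Nq (u t))) (fun t => Rabs (s t)).
Proof.
  assert (Nu := NB_state _ _ _ _ _ Hu). assert (Nu1 := NB_state_derive _ _ _ _ _ Hu). assert (Nqq := NB_quotient).
  set (X1 := fun t => integ (fun z => q t z * (al t z * u t z))).
  set (X2 := fun t => integ (fun z => q t z * u t z)).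
  set (Y1 := fun t => integ (fun z => q t z * (al t z * q t z))).
  set (Y2 := fun t => integ (fun z => q t z * q t z)).
  set (m := fun t => Aq (al t) (u t) / Nq (u t)).
  assert (BX1 : bO X1 (fun _ => 1)).
  { apply (bO_integ_l1 q (fun t z => al t z * u t z)); [assumption |]. apply NB_mult_1; [apply GR_al | assumption]. }
  assert (BX2 : bO X2 (fun _ => 1)) by now apply (bO_integ_l1 q u).
  assert (BY1 : bO Y1 (fun _ => 1)).
  { apply (bO_integ_l1 q (fun t z => al t z * q t z)); [assumption |]. apply NB_mult_1; [apply GR_al | assumption]. }
  assert (BY2 : bO Y2 (fun _ => 1)) by now apply (bO_integ_l1 q q).
  assert (Bm : bO m (fun _ => 1)).
  { apply bO_inv_norm with (fun _ => 0) Eu u1 u2; [assumption |]. now apply (bO_Aq_state _ _ _ _ _ Hu). }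
  apply bO_ext with (fun t => 2 * (integ (fun z => src_rem t z * u1 t z) / Nq (u t))
    + 4 * ((s t * ((X1 t - m t * X2 t) * (2 * X2 t + s t * Y2 t))) / Nq (u t) / Nq (v t))
    - 2 * (s t * (Y1 t - m t * Y2 t) / Nq (v t))).
  - intros t. assert (QP := quotient_pairing t). destruct (quotient_norms t) as [E1 E2].
    fold (X2 t) (Y2 t) in E1. fold (X1 t) (Y1 t) in E2.
    assert (HNu := state_norm _ _ _ _ _ _ _ _ (Hu t)). assert (HNv := state_norm _ _ _ _ _ _ _ _ (Hv t)).
    assert (Hn := hn_pos j).
    assert (Sa := slow_al _ _ _ (Hfr t)). assert (Fu := state_fast _ _ _ _ _ _ _ _ (Hu t)).
    assert (Fq : fast (q t)) by apply NB_quotient.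
    fold (m t) in QP.
    assert (EZ : integ (fun z => q t z * ((al t z - m t) * u t z)) = X1 t - m t * X2 t).
    { unfold X1, X2. rewrite <- integ_scal, <- integ_minus by fast_tac. apply integ_ext. intros; ring. }
    unfold quot, curvature, slope.
    set (I1 := integ (fun z => be t z * (u t z * u t z))) in *.
    set (I2 := integ (fun z => virial_source t z * u1 t z)) in *.
    set (I3 := integ (fun z => src_rem t z * u1 t z)) in *.
    set (I4 := integ (fun z => corr t z * virial_source t z)) in *.
    assert (EI : I3 = 2 * (/ 2 * I1 - I2 + I4 - (X1 t - m t * X2 t))) by lra.
    rewrite EI, E2. unfold m.
    assert (Hst := Hs t).
    set (Nv := Nq (v t)) in *. set (N0 := Nq (u t)) in *.
    assert (HNv0 : Nv <> 0) by lra. assert (HN00 : N0 <> 0) by lra.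
    clearbody Nv. subst Nv. field. repeat split; assumption.
  - apply bO_minus; [apply bO_plus |].
    + apply bO_scal. apply bO_inv_norm with (fun _ => 0) Eu u1 u2; [assumption |].
      apply (bO_integ_r1 src_rem u1); [apply NB_src_rem | assumption].
    + apply bO_scal. apply bO_inv_norm with s Ev v1 v2; [assumption |].
      apply bO_inv_norm with (fun _ => 0) Eu u1 u2; [assumption |].
      apply bO_mult_r1; [apply bO_abs_s |]. apply bO_mult_l1.
      * apply bO_minus; [assumption |]. now apply bO_mult_l1.
      * apply bO_plus; [now apply bO_scal |]. apply bO_mult_l1; [apply bO_abs_s_1 | assumption].
    + apply bO_scal. apply bO_inv_norm with s Ev v1 v2; [assumption |].
      apply bO_mult_r1; [apply bO_abs_s |]. apply bO_minus; [assumption |]. now apply bO_mult_l1.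
Qed.

(** [corr] is O(ep + |s|) and the virial source O(ep), so their pairing is quadratic in ep up to
    O(s). This is the gain that the second-derivative expansion rests on. *)
Lemma quot_curvature : bO (fun t => quot t - curvature t) (fun t => ep t ^ 2 + Rabs (s t)).
Proof.
  assert (P : forall t, 0 <= ep t ^ 2 + Rabs (s t)) by (intros t; generalize (pow2_ge_0 (ep t)), (Rabs_pos (s t)); lra).
  apply bO_ext with (fun t => (quot t - curvature t + 4 * (integ (fun z => corr t z * virial_source t z) / Nq (u t)))
    - 4 * (integ (fun z => corr t z * virial_source t z) / Nq (u t))); [intros; ring |].
  apply bO_minus.
  - apply bO_weaken with (fun t => Rabs (s t)) 1; [lra | exact P | | apply quot_expansion].
    intros t. generalize (pow2_ge_0 (ep t)). lra.
  - apply bO_scal. apply bO_inv_norm with (fun _ => 0) Eu u1 u2; [assumption |].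
    apply bO_weaken with (fun t => (ep t + Rabs (s t)) * ep t) 1; [lra | exact P | |].
    + intros t. destruct (Hu t) as (_ & Q & _). assert (Rabs (s t) * ep t <= Rabs (s t) * 1); [| lra].
      apply Rmult_le_compat_l; [apply Rabs_pos | lra].
    + apply bO_integ; [apply NB_corr | apply NB_virial_source].
Qed.

End DifferenceQuotient.

Section TwoQuotients.

Variables (s Ev s' Ey : T -> R) (v v1 v2 y y1 y2 : T -> R -> R).
Hypothesis Hv : forall t, state (al t) (be t) (ep t) (s t) (Ev t) (v t) (v1 t) (v2 t).
Hypothesis Hs : forall t, s t <> 0.
Hypothesis Hy : forall t, state (al t) (be t) (ep t) (s' t) (Ey t) (y t) (y1 t) (y2 t).
Hypothesis Hs' : forall t, s' t <> 0.

(** The two [corr] functions have the same leading source, so the gap bounds their difference by the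
    remainders alone. This gives a Cauchy property without knowledge of the limit. *)
Lemma quot_cauchy : bO (fun t => quot s v t - quot s' y t) (fun t => Rabs (s t) + Rabs (s' t)).
Proof.
  assert (P : forall t, 0 <= Rabs (s t) + Rabs (s' t)) by (intros t; generalize (Rabs_pos (s t)), (Rabs_pos (s' t)); lra).
  assert (WL : forall F, bO F (fun t => Rabs (s t)) -> bO F (fun t => Rabs (s t) + Rabs (s' t))).
  { intros F. apply bO_weaken with 1; [lra | exact P |]. intros t. generalize (Rabs_pos (s' t)). lra. }
  assert (WR : forall F, bO F (fun t => Rabs (s' t)) -> bO F (fun t => Rabs (s t) + Rabs (s' t))).
  { intros F. apply bO_weaken with 1; [lra | exact P |]. intros t. generalize (Rabs_pos (s t)). lra. }
  assert (Dv := dom_corr s Ev v v1 v2 Hv Hs). assert (Dy := dom_corr s' Ey y y1 y2 Hy Hs').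
  set (cv := corr s v) in *. set (cy := corr s' y) in *.
  assert (Fs : forall t, fast (virial_source t)) by apply NB_virial_source.
  assert (Nd : NB (fun t z => cv t z + -1 * cy t z) (fun t => Rabs (s t) + Rabs (s' t))).
  { assert (Dd := fun t => dom_plus_scal (-1) _ _ _ _ _ _ (Dv t) (Dy t)).
    apply (NB_gap _ _ _ _ _ Hu _ _ _ _ Dd).
    - intros t. assert (F := fast_hf j). destruct (Dv t) as (F1 & _). destruct (Dy t) as (F2 & _).
      rewrite (integ_ext _ (fun z => cv t z * hf j z + -1 * (cy t z * hf j z))) by (intros; ring).
      rewrite integ_plus, integ_scal by fast_tac. unfold cv, cy.
      rewrite (orth_corr s Ev v v1 v2 Hv Hs t), (orth_corr s' Ey y y1 y2 Hy Hs' t). ring.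
    - apply NB_ext with (fun t z => src_rem s Ev v t z - src_rem s' Ey y t z).
      + intros t z. assert (Ra := res_corr s Ev v v1 v2 Hv Hs t z). assert (Rb := res_corr s' Ey y y1 y2 Hy Hs' t z).
        unfold res in *. fold cv in Ra. fold cy in Rb. lra.
      + apply NB_minus.
        * apply NB_weaken with (fun t => Rabs (s t)) 1; [lra | exact P | intros t; generalize (Rabs_pos (s' t)); lra |].
          now apply NB_src_rem with v1 v2.
        * apply NB_weaken with (fun t => Rabs (s' t)) 1; [lra | exact P | intros t; generalize (Rabs_pos (s t)); lra |].
          now apply NB_src_rem with y1 y2. }
  apply bO_ext with (fun t =>
    (quot s v t - curvature t + 4 * (integ (fun z => cv t z * virial_source t z) / Nq (u t)))
    - (quot s' y t - curvature t + 4 * (integ (fun z => cy t z * virial_source t z) / Nq (u t)))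
    - 4 * (integ (fun z => (cv t z + -1 * cy t z) * virial_source t z) / Nq (u t))).
  - intros t. specialize (Fs t). destruct (Dv t) as (F1 & _). destruct (Dy t) as (F2 & _).
    rewrite (integ_ext (fun z => (cv t z + -1 * cy t z) * virial_source t z)
      (fun z => cv t z * virial_source t z - cy t z * virial_source t z)) by (intros; ring).
    rewrite integ_minus by fast_tac. unfold Rdiv. ring.
  - apply bO_minus; [apply bO_minus |].
    + apply WL. now apply (quot_expansion s Ev v v1 v2).
    + apply WR. now apply (quot_expansion s' Ey y y1 y2).
    + apply bO_scal. apply bO_inv_norm with (fun _ => 0) Eu u1 u2; [assumption |].
      apply (bO_integ_r1 (fun t z => cv t z + -1 * cy t z) virial_source); [assumption |].
      apply NB_weaken with ep 1; [lra | intros; lra | | apply NB_virial_source].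
      intros t. destruct (Hu t) as (_ & Q & _). lra.
Qed.

End TwoQuotients.

(** * Expansion of the profile to second order *)

Section Taylor.

Variables b1 b2 b3 : T -> R.
Hypothesis Hb1 : forall t, Rabs (b1 t) <= ep t.
Hypothesis Hb2 : forall t, Rabs (b2 t) <= ep t.
Hypothesis Htay : forall t z, Rabs (be t z - 1 - b1 t * z - b2 t / 2 * z ^ 2) <= b3 t * Wt c1 z.

(** In the original variables ep is of order b', so this has the shape b'^2 + |b' b''| + |b'''| of
    epsilon(k). *)
Let err (t : T) : R := ep t ^ 2 + ep t * Rabs (b2 t) + b3 t.

Lemma b3_nonneg (t : T) : 0 <= b3 t.
Proof.
  specialize (Htay t 0). generalize (Rabs_pos (be t 0 - 1 - b1 t * 0 - b2 t / 2 * 0 ^ 2)), (Wt_pos c1 0). nra.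
Qed.

Lemma err_nonneg (t : T) : 0 <= err t.
Proof.
  unfold err. assert (0 <= ep t * Rabs (b2 t)) by (apply Rmult_le_pos; [apply ep_nonneg | apply Rabs_pos]).
  generalize (pow2_ge_0 (ep t)), (b3_nonneg t). lra.
Qed.

Lemma err_ep2 (F : T -> R) : bO F (fun t => ep t * ep t) -> bO F err.
Proof.
  apply bO_weaken with 1; [lra | apply err_nonneg |]. intros t. unfold err.
  assert (0 <= ep t * Rabs (b2 t)) by (apply Rmult_le_pos; [apply ep_nonneg | apply Rabs_pos]).
  generalize (b3_nonneg t). lra.
Qed.

Lemma err_b2 (F : T -> R) : bO F (fun t => Rabs (b2 t) * ep t) -> bO F err.
Proof.
  apply bO_weaken with 1; [lra | apply err_nonneg |]. intros t. unfold err.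
  generalize (b3_nonneg t), (pow2_ge_0 (ep t)). lra.
Qed.

Lemma err_b3 (F : T -> R) : bO F b3 -> bO F err.
Proof.
  apply bO_weaken with 1; [lra | apply err_nonneg |]. intros t. unfold err.
  assert (0 <= ep t * Rabs (b2 t)) by (apply Rmult_le_pos; [apply ep_nonneg | apply Rabs_pos]).
  generalize (pow2_ge_0 (ep t)). lra.
Qed.

Lemma bO_b1 : bO b1 ep.
Proof. apply bO_of_le, Hb1. Qed.

Lemma bO_b2 : bO b2 (fun t => Rabs (b2 t)).
Proof. apply bO_of_le. intros; lra. Qed.

Let rho (t : T) (z : R) : R := be t z - 1 - b1 t * z - b2 t / 2 * z ^ 2.
Let rem (t : T) (z : R) : R := al t z - z - b1 t / 2 * z ^ 2 - b2 t / 6 * z ^ 3.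

Lemma GR_rho : GR rho b3.
Proof.
  split; [apply b3_nonneg |]. split.
  - intros t. unfold rho. assert (S := slow_be _ _ _ (Hfr t)). slow_tac.
  - exists c1, 1. split; [assumption |]. split; [lra |]. intros t z. rewrite Rmult_1_l. apply Htay.
Qed.

Lemma GR_rem : GR rem b3.
Proof.
  split; [apply b3_nonneg |]. split.
  - intros t. unfold rem. assert (S := slow_al _ _ _ (Hfr t)). slow_tac.
  - exists (c1 + 1), 2. split; [lra |]. split; [lra |]. intros t z.
    destruct (Hfr t) as (D & _ & A0 & _).
    destruct (mvt_origin (rem t) (rho t) z) as [x [Hx ->]].
    + unfold rem. rewrite A0. ring.
    + intros x. unfold rem, rho. evar_last.
      * apply is_derive_minusR; [apply is_derive_minusR; [apply is_derive_minusR; [apply D | apply is_derive_idR] |] |].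
        -- instantiate (1 := b1 t * x). auto_derive; [trivial | field].
        -- instantiate (1 := b2 t / 2 * x ^ 2). auto_derive; [trivial | field].
      * ring.
    + rewrite Rabs_mult. assert (H3 := b3_nonneg t).
      assert (W := Wt_le_Rabs c1 x z Hc1 Hx). assert (W1 := abs_le_Wt1 z). assert (M := Wt_mult c1 1 z Hc1 ltac:(lra)).
      apply Rle_trans with (b3 t * Wt c1 z * Wt 1 z).
      * apply Rmult_le_compat; try apply Rabs_pos; [| assumption].
        apply Rle_trans with (1 := Htay t x). now apply Rmult_le_compat_l.
      * rewrite Rmult_assoc, (Rmult_comm 2 (b3 t)), Rmult_assoc. now apply Rmult_le_compat_l.
Qed.

(** At s = 0 the potential is admissible with eta = Ca ep rather than just eta0, so the distance to
    the Hermite function is proportional to ep. *)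
Lemma NB_profile : NB (fun t z => u t z - hf j z) ep.
Proof.
  apply NB_intro with c0; [apply c0_pos | apply ep_nonneg | |].
  - intros t. assert (F := fast_hf j). assert (Fu := state_fast _ _ _ _ _ _ _ _ (Hu t)). fast_tac.
  - intros c Hc. destruct (proj1 (proj2 Hgood) c Hc) as [C [HC G]].
    exists (C * Ca ^ 2 + 1). assert (0 <= C * Ca ^ 2) by (apply sq_nonneg_mult; lra). split; [lra |]. intros t.
    destruct (Hu t) as (F1 & Q1 & Q2 & H1 & H2 & H3).
    assert (A : adm kap c0 (pot (al t) 0) (Ca * ep t)).
    { apply pot_adm with (be t) (ep t); [assumption | rewrite Rabs_R0; lra | rewrite Rabs_R0, Rplus_0_r; lra]. }
    assert (HC0 : 0 <= Ca) by (unfold Ca; lra).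
    assert (L : Ca * ep t <= eta0).
    { apply Rle_trans with (2 := Hthr). apply Rmult_le_compat_l; [assumption |]. generalize (Rabs_pos 0). lra. }
    destruct (G _ _ _ _ _ _ A L H1 H2 H3) as [B _].
    nra.
Qed.

Lemma GR_power (k : nat) : GR (fun (_ : T) z => z ^ k) (fun _ => 1).
Proof. apply (GR_fixed T (fun z => z ^ k)), slow_pow, slow_id. Qed.

Lemma profile_moment (k : nat) :
  bO (fun t => integ (fun z => z ^ k * u t z * u t z) - integ (fun z => z ^ k * hf j z ^ 2)) ep.
Proof.
  assert (N := NB_profile). assert (Nu := NB_state _ _ _ _ _ Hu). assert (Nh := NB_fixed T (hf j) (fast_hf j)).
  apply bO_ext with (fun t => integ (fun z => (z ^ k * (u t z - hf j z)) * (u t z + hf j z))).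
  - intros t. assert (F := fast_hf j). assert (Fu := state_fast _ _ _ _ _ _ _ _ (Hu t)).
    rewrite <- integ_minus by first [fast_tac | apply fast_mult_r; [apply slow_pow, slow_id | fast_tac]].
    apply integ_ext. intros; ring.
  - apply (bO_integ_r1 (fun t z => z ^ k * (u t z - hf j z)) (fun t z => u t z + hf j z)).
    + apply (NB_mult_1 (fun _ z => z ^ k) (fun t z => u t z - hf j z)); [apply GR_power | assumption].
    + now apply (NB_plus T u (fun _ => hf j)).
Qed.

Let m (k : nat) (t : T) : R := integ (fun z => z ^ k * u t z * u t z).

Lemma moment_1 : bO (m 1) ep.
Proof.
  apply bO_ext with (2 := profile_moment 1). intros t.
  rewrite (integ_ext (fun z => z ^ 1 * hf j z ^ 2) (fun z => z * hf j z ^ 2)) by (intros; ring).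
  rewrite (proj1 (hf_moments j)). unfold m. ring.
Qed.

Lemma moment_3 : bO (m 3) ep.
Proof.
  apply bO_ext with (2 := profile_moment 3). intros t.
  rewrite (proj1 (proj2 (proj2 (hf_moments j)))). unfold m. ring.
Qed.

Lemma moment_2 : bO (fun t => m 2 t - Lam / 2 * Nq (u t)) ep.
Proof.
  apply bO_ext with (fun t => (m 2 t - integ (fun z => z ^ 2 * hf j z ^ 2))
    - Lam / 2 * (integ (fun z => z ^ 0 * u t z * u t z) - integ (fun z => z ^ 0 * hf j z ^ 2))).
  - intros t. rewrite (proj1 (proj2 (hf_moments j))). fold Lam.
    rewrite (integ_ext (fun z => z ^ 0 * hf j z ^ 2) (fun z => hf j z ^ 2)) by (intros; ring). fold (hn j).
    rewrite (integ_ext (fun z => z ^ 0 * u t z * u t z) (fun z => u t z * u t z)) by (intros; ring).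
    fold (Nq (u t)). field.
  - apply bO_minus; [apply (profile_moment 2) | apply bO_scal, (profile_moment 0)].
Qed.

Lemma bO_integ_GR (g f h : T -> R -> R) (G : T -> R) : GR g G -> NB f (fun _ => 1) -> NB h (fun _ => 1) ->
  bO (fun t => integ (fun z => g t z * f t z * h t z)) G.
Proof.
  intros Hg Hf' Hh. apply (bO_integ_r1 (fun t z => g t z * f t z) h); [| assumption]. now apply NB_mult_r1.
Qed.

(** Testing with hf_j uses al^2 - z^2 = b1 z^3 + (b2/3) z^4 + 2 z rem + (al - z)^2. The cubic moment
    vanishes and the quartic one gives (b2/3)(3/8)(Lam^2 + 1). *)
Lemma energy_asymptotics : bO (fun t => Eu t - (Lam + (Lam ^ 2 + 1) / 8 * b2 t)) err.
Proof.
  assert (N := NB_profile). assert (Nu := NB_state _ _ _ _ _ Hu). assert (Nh := NB_fixed T (hf j) (fast_hf j)).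
  assert (Hn := hn_pos j).
  assert (Nz : forall k, bO (fun t => integ (fun z => (z ^ k * (u t z - hf j z)) * hf j z)) ep).
  { intros k. apply (bO_integ_r1 (fun t z => z ^ k * (u t z - hf j z)) (fun _ => hf j)); [| assumption].
    apply (NB_mult_1 (fun _ z => z ^ k) (fun t z => u t z - hf j z)); [apply GR_power | assumption]. }
  apply bO_ext with (fun t => (b1 t * integ (fun z => (z ^ 3 * (u t z - hf j z)) * hf j z)
    + / 3 * (b2 t * integ (fun z => (z ^ 4 * (u t z - hf j z)) * hf j z))
    + (2 * integ (fun z => (z * rem t z) * u t z * hf j z)
    + integ (fun z => ((al t z - z) * (al t z - z)) * u t z * hf j z))) / hn j).
  - intros t. destruct (Hu t) as (F1 & _ & _ & _ & H2 & O).
    assert (Sp := slow_pot _ _ _ F1 0). assert (Sa := slow_al _ _ _ F1). assert (Fh := fast_hf j).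
    assert (Fu := proj1 (proj1 H2)). assert (Sr : slow (rem t)) by apply GR_rem.
    assert (Tt := integ_test j (pot (al t) 0) (Eu t) _ _ _ Sp (proj1 H2)).
    rewrite (integ_ext (fun z => res _ _ _ _ z * _) (fun _ => 0)), integ_0, O in Tt
      by (intros; rewrite (eigf_res _ _ _ _ _ H2); ring). fold Lam in Tt.
    destruct (hf_moments j) as (_ & _ & M3 & M4). fold Lam in M4.
    assert (EE : integ (fun z => (pot (al t) 0 z - z ^ 2) * (u t z * hf j z)) =
      b1 t * integ (fun z => (z ^ 3 * (u t z - hf j z)) * hf j z)
      + b2 t / 3 * integ (fun z => (z ^ 4 * (u t z - hf j z)) * hf j z)
      + (2 * integ (fun z => (z * rem t z) * u t z * hf j z)
      + integ (fun z => ((al t z - z) * (al t z - z)) * u t z * hf j z))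
      + (b1 t * integ (fun z => z ^ 3 * hf j z ^ 2) + b2 t / 3 * integ (fun z => z ^ 4 * hf j z ^ 2))).
    { rewrite <- !integ_scal, <- !integ_plus by fast_tac. apply integ_ext. intros z. unfold pot, rem. field. }
    rewrite M3, M4 in EE. apply Rmult_eq_reg_r with (hn j); [| lra].
    unfold Rdiv at 1. rewrite Rmult_assoc, Rinv_l, Rmult_1_r by lra. lra.
  - apply bO_div with (hn j); [assumption | intros; lra |]. apply bO_plus; [apply bO_plus | apply bO_plus].
    + apply err_ep2. apply bO_mult; [apply bO_b1 | apply Nz].
    + apply bO_scal, err_b2. apply bO_mult; [apply bO_b2 | apply Nz].
    + apply bO_scal, err_b3. apply bO_integ_GR; [| assumption | assumption].
      apply GR_weaken with (fun t => 1 * b3 t) 1; [lra | apply b3_nonneg | intros; lra |].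
      apply (GR_mult T (fun _ z => z) rem); [apply GR_id | apply GR_rem].
    + apply err_ep2. apply (bO_integ_GR (fun t z => (al t z - z) * (al t z - z)) u (fun _ => hf j)); [| assumption..].
      apply (GR_mult T (fun t z => al t z - z) (fun t z => al t z - z)); apply GR_al_close.
Qed.

(* [al (be - 1)] to second order, paired with any two bounded profiles. *)
Lemma product_expansion (f h : T -> R -> R) : NB f (fun _ => 1) -> NB h (fun _ => 1) ->
  bO (fun t => integ (fun z => al t z * (be t z - 1) * f t z * h t z)
    - (b1 t * integ (fun z => z ^ 2 * f t z * h t z) + b2 t / 2 * integ (fun z => z ^ 3 * f t z * h t z))) err.
Proof.
  intros Nf Nh.
  apply bO_ext with (fun t => integ (fun z => (z * rho t z) * f t z * h t z)
    + integ (fun z => ((al t z - z) * (be t z - 1)) * f t z * h t z)).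
  - intros t. assert (Sa := slow_al _ _ _ (Hfr t)). assert (Sb := slow_be _ _ _ (Hfr t)).
    assert (Ff : fast (f t)) by apply Nf. assert (Fh : fast (h t)) by apply Nh.
    assert (Sr : slow (rho t)) by apply GR_rho.
    rewrite <- !integ_scal, <- !integ_plus, <- integ_minus by fast_tac.
    apply integ_ext. intros z. unfold rho. field.
  - apply bO_plus.
    + apply err_b3. apply bO_integ_GR; [| assumption | assumption].
      apply GR_weaken with (fun t => 1 * b3 t) 1; [lra | apply b3_nonneg | intros; lra |].
      apply (GR_mult T (fun _ z => z) rho); [apply GR_id | apply GR_rho].
    + apply err_ep2. apply (bO_integ_GR (fun t z => (al t z - z) * (be t z - 1)) f h); [| assumption..].
      apply (GR_mult T (fun t z => al t z - z) (fun t z => be t z - 1)); [apply GR_al_close | apply GR_be_close].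
Qed.

(** By [Aq_virial] the slope is 2 <al (be - 1) u, u> / N. The leading term b1 z^2 has mean close to
    b1 Lam/2, and the cubic moment multiplying b2 is O(ep). *)
Lemma slope_asymptotics : bO (fun t => slope (al t) 0 (u t) - Lam * b1 t) err.
Proof.
  assert (Nu := NB_state _ _ _ _ _ Hu). assert (Hn := hn_pos j).
  apply bO_ext with (fun t => (2 * (integ (fun z => al t z * (be t z - 1) * u t z * u t z)
      - (b1 t * m 2 t + b2 t / 2 * m 3 t))
    + (2 * (b1 t * (m 2 t - Lam / 2 * Nq (u t))) + b2 t * m 3 t)) / Nq (u t)).
  - intros t. assert (HN := state_norm _ _ _ _ _ _ _ _ (Hu t)). unfold slope. rewrite (Aq_virial t).
    rewrite (integ_ext (fun z => al t z * (be t z - 1) * u t z * u t z)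
      (fun z => (al t z * u t z) * ((be t z - 1) * u t z))) by (intros; ring).
    field. lra.
  - apply bO_inv_norm with (fun _ => 0) Eu u1 u2; [assumption |].
    apply bO_plus; [| apply bO_plus].
    + apply bO_scal. now apply product_expansion.
    + apply bO_scal, err_ep2. apply bO_mult; [apply bO_b1 | apply moment_2].
    + apply err_b2. apply bO_mult; [apply bO_b2 | apply moment_3].
Qed.

(** Integration by parts gives <z^2 u, u'> = -<z u, u> and <z^3 u, u'> = -(3/2) <z^2 u, u>. The
    coefficient of b2 is then -Lam/2 from the integral of be plus 3 Lam/2 from the virial source. *)
Lemma curvature_asymptotics : bO (fun t => curvature t - Lam * b2 t) err.
Proof.
  assert (Nu := NB_state _ _ _ _ _ Hu). assert (Nu1 := NB_state_derive _ _ _ _ _ Hu).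
  apply bO_ext with (fun t => (-2 * integ (fun z => rho t z * u t z * u t z)
    - 4 * (integ (fun z => al t z * (be t z - 1) * u t z * u1 t z)
      - (b1 t * integ (fun z => z ^ 2 * u t z * u1 t z) + b2 t / 2 * integ (fun z => z ^ 3 * u t z * u1 t z)))
    + (2 * (b1 t * m 1 t) + 2 * (b2 t * (m 2 t - Lam / 2 * Nq (u t))))) / Nq (u t)).
  - intros t. assert (HN := state_norm _ _ _ _ _ _ _ _ (Hu t)). assert (Hn := hn_pos j).
    assert (Sa := slow_al _ _ _ (Hfr t)). assert (Sb := slow_be _ _ _ (Hfr t)).
    assert (Fu : fast (u t)) by apply Nu. assert (Fu1 : fast (u1 t)) by apply Nu1.
    assert (Sr : slow (rho t)) by apply GR_rho.
    assert (Du : forall z, is_derive (u t) z (u1 t z)) by apply (Hu t).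
    assert (Z0 : integ (fun z => 2 * (u t z * u1 t z)) = 0).
    { apply integ_derive with (fun z => u t z * u t z); [fast_tac.. |]. intros z. evar_last.
      - apply is_derive_multR; apply Du.
      - ring. }
    assert (Z2 : integ (fun z => 2 * (z * u t z * u t z) + 2 * (z ^ 2 * u t z * u1 t z)) = 0).
    { apply integ_derive with (fun z => z * z * (u t z * u t z)); [fast_tac.. |]. intros z. evar_last.
      - apply is_derive_multR; apply is_derive_multR; [apply is_derive_idR | apply is_derive_idR | apply Du | apply Du].
      - cbv beta. ring. }
    assert (Z3 : integ (fun z => 3 * (z ^ 2 * u t z * u t z) + 2 * (z ^ 3 * u t z * u1 t z)) = 0).
    { apply integ_derive with (fun z => (z * z * z) * (u t z * u t z)); [fast_tac.. |]. intros z. evar_last.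
      - apply is_derive_multR; [apply is_derive_multR; [apply is_derive_multR |]; apply is_derive_idR |].
        apply is_derive_multR; apply Du.
      - cbv beta. ring. }
    rewrite integ_scal in Z0 by fast_tac.
    rewrite integ_plus, !integ_scal in Z2 by fast_tac. rewrite integ_plus, !integ_scal in Z3 by fast_tac.
    assert (E1 : integ (fun z => be t z * (u t z * u t z)) = Nq (u t) + integ (fun z => rho t z * u t z * u t z)
      + b1 t * m 1 t + b2 t / 2 * m 2 t).
    { unfold Nq, m. rewrite <- !integ_scal, <- !integ_plus by fast_tac. apply integ_ext. intros z. unfold rho. field. }
    assert (E2 : integ (fun z => virial_source t z * u1 t z) = slope (al t) 0 (u t) / 2 * integ (fun z => u t z * u1 t z)
      - integ (fun z => al t z * (be t z - 1) * u t z * u1 t z)).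
    { rewrite <- integ_scal, <- integ_minus by fast_tac. apply integ_ext. intros z. unfold virial_source. ring. }
    assert (E3 : m 1 t = integ (fun z => z * u t z * u t z)) by (apply integ_ext; intros; ring).
    replace (integ (fun z => u t z * u1 t z)) with 0 in E2 by lra.
    unfold curvature. rewrite E1, E2, E3.
    replace (integ (fun z => z ^ 2 * u t z * u1 t z)) with (- integ (fun z => z * u t z * u t z)) by lra.
    replace (integ (fun z => z ^ 3 * u t z * u1 t z)) with (- (3 / 2) * m 2 t) by (unfold m; lra).
    field. lra.
  - apply bO_inv_norm with (fun _ => 0) Eu u1 u2; [assumption |].
    apply bO_plus; [apply bO_minus | apply bO_plus].
    + apply bO_scal, err_b3. apply bO_integ_GR; [apply GR_rho | assumption..].
    + apply bO_scal. now apply product_expansion.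
    + apply bO_scal, err_ep2. apply bO_mult; [apply bO_b1 | apply moment_1].
    + apply bO_scal, err_b2. apply bO_mult; [apply bO_b2 | apply moment_2].
Qed.

End Taylor.

End SecondOrder.

End Family.

End Frame.

(** * From difference quotients to derivatives *)

Lemma is_derive_of_quadratic (f : R -> R) (x D C r : R) : 0 < r ->
  (forall y, Rabs (y - x) < r -> Rabs (f y - f x - (y - x) * D) <= C * (y - x) ^ 2) -> is_derive f x D.
Proof.
  intros Hr H. apply is_derive_Reals. intros eps He.
  set (d := Rmin r (eps / (Rabs C + 1))). assert (HC := Rabs_pos C).
  assert (Hd : 0 < d) by (apply Rmin_glb_lt; [assumption | apply Rdiv_lt_0_compat; lra]).
  exists (mkposreal d Hd). intros h Hh0 Hh.
  assert (H1 : Rabs h < r) by (apply Rlt_le_trans with (1 := Hh); apply Rmin_l).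
  assert (H2 : Rabs h < eps / (Rabs C + 1)) by (apply Rlt_le_trans with (1 := Hh); apply Rmin_r).
  specialize (H (x + h)). replace (x + h - x) with h in H by ring. specialize (H H1).
  replace ((f (x + h) - f x) / h - D) with ((f (x + h) - f x - h * D) / h) by (field; assumption).
  unfold Rdiv. rewrite Rabs_mult, Rabs_inv. assert (P := Rabs_pos_lt h Hh0).
  apply Rle_lt_trans with (Rabs C * Rabs h).
  - apply Rmult_le_reg_r with (Rabs h); [assumption |]. rewrite Rmult_assoc, Rinv_l, Rmult_1_r by lra.
    apply Rle_trans with (1 := H). rewrite <- (pow2_abs h).
    replace (Rabs C * Rabs h * Rabs h) with (Rabs C * Rabs h ^ 2) by ring.
    apply Rmult_le_compat_r; [apply pow2_ge_0 | apply Rle_abs].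
  - apply Rle_lt_trans with (Rabs C * (eps / (Rabs C + 1))); [apply Rmult_le_compat_l; lra |].
    apply Rlt_le_trans with ((Rabs C + 1) * (eps / (Rabs C + 1))); [| right; field; lra].
    apply Rmult_lt_compat_r; [apply Rdiv_lt_0_compat; lra | lra].
Qed.

(** Completeness along the steps r/(n + 2) produces D, which is not known in advance; the rate C |s|
    is kept in order to compare D with the explicit curvature. *)
Lemma is_derive_of_cauchy_quotients (f : R -> R) (C r : R) : 0 < r -> 0 <= C ->
  (forall s s', s <> 0 -> s' <> 0 -> Rabs s < r -> Rabs s' < r ->
    Rabs ((f s - f 0) / s - (f s' - f 0) / s') <= C * (Rabs s + Rabs s')) ->
  exists D, is_derive f 0 D /\ forall s, s <> 0 -> Rabs s < r -> Rabs ((f s - f 0) / s - D) <= C * Rabs s.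
Proof.
  intros Hr HC H.
  set (h := fun n => r / (INR n + 2)). set (a := fun n => (f (h n) - f 0) / h n).
  assert (Hh : forall n, 0 < h n /\ h n < r).
  { intros n. unfold h. assert (P := pos_INR n). split; [apply Rdiv_lt_0_compat; lra |].
    apply Rmult_lt_reg_r with (INR n + 2); [lra |]. unfold Rdiv. rewrite Rmult_assoc, Rinv_l by lra. nra. }
  assert (Hl : is_lim_seq h 0).
  { apply is_lim_seq_ext with (fun n => r * / (INR n + 2)); [reflexivity |].
    replace 0 with (r * 0) by ring. apply (is_lim_seq_scal_l _ r 0).
    apply (is_lim_seq_inv (fun n => INR n + 2) p_infty); [| discriminate].
    apply (is_lim_seq_plus INR (fun _ => 2) p_infty 2); [apply is_lim_seq_INR | apply is_lim_seq_const | reflexivity]. }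
  assert (K : forall s, s <> 0 -> Rabs s < r -> forall n, Rabs ((f s - f 0) / s - a n) <= C * (Rabs s + h n)).
  { intros s Hs Hsr n. destruct (Hh n) as [A B]. assert (R := H s (h n) Hs ltac:(lra) Hsr).
    rewrite (Rabs_pos_eq (h n)) in R by lra. apply R. lra. }
  assert (L : ex_finite_lim_seq a).
  { apply ex_lim_seq_cauchy_corr. intros eps.
    apply is_lim_seq_spec in Hl.
    assert (He : 0 < eps / (2 * (C + 1))) by (apply Rdiv_lt_0_compat; [apply cond_pos | lra]).
    destruct (Hl (mkposreal _ He)) as [N HN]. simpl in HN. exists N. intros n k Hn Hk.
    assert (A := HN n Hn). assert (B := HN k Hk). destruct (Hh n) as [n1 n2]. destruct (Hh k) as [k1 k2].
    rewrite Rminus_0_r, Rabs_pos_eq in A, B by lra.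
    assert (Q := K (h n) ltac:(lra) ltac:(rewrite Rabs_pos_eq; lra) k). rewrite (Rabs_pos_eq (h n)) in Q by lra.
    apply Rle_lt_trans with (1 := Q).
    apply Rlt_le_trans with ((C + 1) * (2 * (eps / (2 * (C + 1))))); [nra | right; field; lra]. }
  destruct L as [D HD]. exists D.
  assert (B : forall s, s <> 0 -> Rabs s < r -> Rabs ((f s - f 0) / s - D) <= C * Rabs s).
  { intros s Hs Hsr.
    assert (Q : Rbar_le (Rabs ((f s - f 0) / s - D)) (C * (Rabs s + 0))).
    { apply (is_lim_seq_le (fun n => Rabs ((f s - f 0) / s - a n)) (fun n => C * (Rabs s + h n))).
      - intros n. now apply K.
      - apply (is_lim_seq_abs _ ((f s - f 0) / s - D)). apply is_lim_seq_minus'; [apply is_lim_seq_const | assumption].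
      - apply (is_lim_seq_scal_l _ C (Rabs s + 0)). apply is_lim_seq_plus'; [apply is_lim_seq_const | assumption]. }
    rewrite Rplus_0_r in Q. exact Q. }
  split; [| exact B].
  apply is_derive_of_quadratic with C r; [assumption |]. intros y Hy. rewrite Rminus_0_r in *.
  destruct (Req_dec y 0) as [-> | Hy0].
  - rewrite Rminus_diag, Rmult_0_l, Rminus_diag, Rabs_R0. lra.
  - replace (f y - f 0 - y * D) with (y * ((f y - f 0) / y - D)) by (field; assumption).
    rewrite Rabs_mult. specialize (B y Hy0 Hy). rewrite <- (pow2_abs y).
    replace (C * Rabs y ^ 2) with (Rabs y * (C * Rabs y)) by ring.
    apply Rmult_le_compat_l; [apply Rabs_pos | assumption].
Qed.

(** * The band near one value of k *)

Section LocalBand.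

Variables k1 K1 c1 : R.
Variable j : nat.
Hypothesis Hk1 : 0 < k1.
Hypothesis HK1 : 1 <= K1.
Hypothesis Hc1 : 0 <= c1.

Let Lam := 2 * INR j + 1.

(** Index type for the uniform estimates: an inhabitant is one arbitrary admissible configuration,
    so taking T to be the record turns [bO] into a constant valid for all of them. *)
Record config1 (e0 s0 : R) := Config1 {
  a_al : R -> R; a_be : R -> R; a_ep : R;
  a_s : R; a_E : R; a_v : R -> R; a_v1 : R -> R; a_v2 : R -> R;
  a_s' : R; a_E' : R; a_y : R -> R; a_y1 : R -> R; a_y2 : R -> R;
  a_frame : frame k1 K1 c1 a_al a_be a_ep;
  a_Hv : state k1 K1 c1 j e0 s0 a_al a_be a_ep a_s a_E a_v a_v1 a_v2;
  a_Hy : state k1 K1 c1 j e0 s0 a_al a_be a_ep a_s' a_E' a_y a_y1 a_y2 }.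

Record config2 (e0 s0 : R) := Config2 {
  d_al : R -> R; d_be : R -> R; d_ep : R; d_b1 : R; d_b2 : R; d_b3 : R;
  d_Eu : R; d_u : R -> R; d_u1 : R -> R; d_u2 : R -> R;
  d_s : R; d_E : R; d_v : R -> R; d_v1 : R -> R; d_v2 : R -> R;
  d_s' : R; d_E' : R; d_y : R -> R; d_y1 : R -> R; d_y2 : R -> R;
  d_frame : frame k1 K1 c1 d_al d_be d_ep;
  d_Hu : state k1 K1 c1 j e0 s0 d_al d_be d_ep 0 d_Eu d_u d_u1 d_u2;
  d_Hv : state k1 K1 c1 j e0 s0 d_al d_be d_ep d_s d_E d_v d_v1 d_v2;
  d_Hs : d_s <> 0;
  d_Hy : state k1 K1 c1 j e0 s0 d_al d_be d_ep d_s' d_E' d_y d_y1 d_y2;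
  d_Hs' : d_s' <> 0;
  d_Hb1 : Rabs d_b1 <= d_ep;
  d_Hb2 : Rabs d_b2 <= d_ep;
  d_tay : forall z, Rabs (d_be z - 1 - d_b1 * z - d_b2 / 2 * z ^ 2) <= d_b3 * Wt c1 z }.

(** Eigenfunctions are picked separately at each s. The estimates see at most three at a time, at 0,
    s and s', so no regular choice in s is required. *)
Theorem local_band : exists C e0, 0 < C /\ 0 < e0 /\
  forall (al be : R -> R) (ep b1 b2 b3 : R) (E : R -> R) (r0 : R),
  frame k1 K1 c1 al be ep -> ep <= e0 -> Rabs b1 <= ep -> Rabs b2 <= ep ->
  (forall z, Rabs (be z - 1 - b1 * z - b2 / 2 * z ^ 2) <= b3 * Wt c1 z) ->
  0 < r0 -> (forall s, Rabs s < r0 -> iseig (pot al s) (E s) /\ Rabs (E s - Lam) <= 1) ->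
  exists D1 D2 r1, 0 < r1 /\ (forall s, Rabs s < r1 -> is_derive E s (D1 s)) /\ is_derive D1 0 D2 /\
  Rabs (E 0 - (Lam + (Lam ^ 2 + 1) / 8 * b2)) <= C * (ep ^ 2 + ep * Rabs b2 + b3) /\
  Rabs (D1 0 - Lam * b1) <= C * (ep ^ 2 + ep * Rabs b2 + b3) /\
  Rabs (D2 - Lam * b2) <= C * (ep ^ 2 + ep * Rabs b2 + b3).
Proof.
  destruct (good_exists k1 c1 j Hk1 Hc1) as [h1 [Ph1 Hgood]].
  assert (Hkap : 0 < k1 ^ 2 / 2) by (generalize (pow_lt k1 2 Hk1); lra).
  destruct (iseig_normalized (k1 ^ 2 / 2) (2 + c1) Hkap ltac:(lra) j) as [h2 [Ph2 Hnorm]].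
  set (Ca := 4 * (K1 + 2)). assert (HCa : 0 < Ca) by (unfold Ca; lra).
  (* One number bounds both ep and |s|, each taking half of the threshold on Ca (ep + |s|). *)
  set (e0 := Rmin 1 (Rmin h1 h2 / (2 * Ca))).
  assert (Hh : 0 < Rmin h1 h2) by now apply Rmin_glb_lt.
  assert (He0 : 0 < e0) by (apply Rmin_glb_lt; [lra | apply Rdiv_lt_0_compat; lra]).
  assert (He1 : e0 <= 1) by apply Rmin_l.
  assert (Hthr : Ca * (e0 + e0) <= Rmin h1 h2).
  { apply Rle_trans with (2 * Ca * (Rmin h1 h2 / (2 * Ca))); [| right; field; lra].
    assert (e0 <= Rmin h1 h2 / (2 * Ca)) by apply Rmin_r. nra. }
  assert (Hthr1 : Ca * (e0 + e0) <= h1) by (apply Rle_trans with (1 := Hthr); apply Rmin_l).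
  assert (Hthr2 : Ca * (e0 + e0) <= h2) by (apply Rle_trans with (1 := Hthr); apply Rmin_r).
  assert (U1 : exists C, 0 <= C /\ forall al be ep s E v v1 v2 s' E' y y1 y2, frame k1 K1 c1 al be ep ->
    state k1 K1 c1 j e0 e0 al be ep s E v v1 v2 -> state k1 K1 c1 j e0 e0 al be ep s' E' y y1 y2 ->
    Rabs (E' - E - (s' - s) * slope al s v) <= C * (s' - s) ^ 2).
  { destruct (energy_first_order k1 K1 c1 j Hk1 HK1 Hc1 h1 e0 e0 Hgood He1 Hthr1 (config1 e0 e0)
      (a_al _ _) (a_be _ _) (a_ep _ _) (a_frame _ _) (a_s _ _) (a_E _ _) (a_s' _ _) (a_E' _ _)
      (a_v _ _) (a_v1 _ _) (a_v2 _ _) (a_y _ _) (a_y1 _ _) (a_y2 _ _) (a_Hv _ _) (a_Hy _ _)) as [_ [C [HC B]]].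
    exists C. split; [assumption |]. intros al be ep s E v v1 v2 s' E' y y1 y2 Hf Hv Hy.
    specialize (B (Config1 e0 e0 al be ep s E v v1 v2 s' E' y y1 y2 Hf Hv Hy)).
    change (Rabs (s' - s) * (Rabs (s' - s) * 1)) with (Rabs (s' - s) ^ 2) in B. rewrite pow2_abs in B. exact B. }
  assert (U2 : exists C, 0 <= C /\ forall al be ep b1 b2 b3 Eu u u1 u2 s E v v1 v2 s' E' y y1 y2,
    frame k1 K1 c1 al be ep -> state k1 K1 c1 j e0 e0 al be ep 0 Eu u u1 u2 ->
    state k1 K1 c1 j e0 e0 al be ep s E v v1 v2 -> s <> 0 ->
    state k1 K1 c1 j e0 e0 al be ep s' E' y y1 y2 -> s' <> 0 ->
    Rabs b1 <= ep -> Rabs b2 <= ep ->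
    (forall z, Rabs (be z - 1 - b1 * z - b2 / 2 * z ^ 2) <= b3 * Wt c1 z) ->
    let err := ep ^ 2 + ep * Rabs b2 + b3 in
    exists M, Rabs ((slope al s v - slope al 0 u) / s - M) <= C * (ep ^ 2 + Rabs s) /\
    Rabs ((slope al s v - slope al 0 u) / s - (slope al s' y - slope al 0 u) / s') <= C * (Rabs s + Rabs s') /\
    Rabs (Eu - (Lam + (Lam ^ 2 + 1) / 8 * b2)) <= C * err /\
    Rabs (slope al 0 u - Lam * b1) <= C * err /\ Rabs (M - Lam * b2) <= C * err).
  { set (TT := config2 e0 e0).
    assert (Fr : forall t : TT, frame k1 K1 c1 (d_al _ _ t) (d_be _ _ t) (d_ep _ _ t)) by apply d_frame.
    destruct (quot_curvature k1 K1 c1 j Hk1 HK1 Hc1 h1 e0 e0 Hgood He1 He1 Hthr1 TT _ _ _ Fr _ _ _ _ (d_Hu _ _) _ _ _ _ _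
      (d_Hv _ _) (d_Hs _ _)) as [_ [C1 [HC1 B1]]].
    destruct (quot_cauchy k1 K1 c1 j Hk1 HK1 Hc1 h1 e0 e0 Hgood He1 He1 Hthr1 TT _ _ _ Fr _ _ _ _ (d_Hu _ _) _ _ _ _ _ _ _ _ _ _
      (d_Hv _ _) (d_Hs _ _) (d_Hy _ _) (d_Hs' _ _)) as [_ [C2 [HC2 B2]]].
    destruct (energy_asymptotics k1 K1 c1 j Hk1 HK1 Hc1 h1 e0 e0 Hgood He1 Hthr1 TT _ _ _ Fr _ _ _ _ (d_Hu _ _)
      (d_b1 _ _) (d_b2 _ _) (d_b3 _ _) (d_Hb1 _ _) (d_tay _ _)) as [_ [C3 [HC3 B3]]].
    destruct (slope_asymptotics k1 K1 c1 j Hk1 HK1 Hc1 h1 e0 e0 Hgood He1 Hthr1 TT _ _ _ Fr _ _ _ _ (d_Hu _ _)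
      (d_b1 _ _) (d_b2 _ _) (d_b3 _ _) (d_Hb1 _ _) (d_tay _ _)) as [_ [C4 [HC4 B4]]].
    destruct (curvature_asymptotics k1 K1 c1 j Hk1 HK1 Hc1 h1 e0 e0 Hgood He1 Hthr1 TT _ _ _ Fr _ _ _ _ (d_Hu _ _)
      (d_b1 _ _) (d_b2 _ _) (d_b3 _ _) (d_Hb1 _ _) (d_tay _ _)) as [_ [C5 [HC5 B5]]].
    exists (C1 + C2 + C3 + C4 + C5). split; [lra |].
    intros al be ep b1 b2 b3 Eu u u1 u2 s E v v1 v2 s' E' y y1 y2 Hf Hu Hv Hs Hy Hs' Hb1 Hb2 Ht err.
    set (t := Config2 e0 e0 al be ep b1 b2 b3 Eu u u1 u2 s E v v1 v2 s' E' y y1 y2 Hf Hu Hv Hs Hy Hs' Hb1 Hb2 Ht).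
    exists (curvature TT (d_al _ _) (d_be _ _) (d_u _ _) (d_u1 _ _) t).
    assert (X1 := B1 t). assert (X2 := B2 t). assert (X3 := B3 t). assert (X4 := B4 t). assert (X5 := B5 t).
    assert (W : forall (a x c : R), 0 <= c -> 0 <= x -> c <= C1 + C2 + C3 + C4 + C5 -> a <= c * x -> a <= (C1 + C2 + C3 + C4 + C5) * x).
    { intros a x c P Q L1 L2. apply Rle_trans with (1 := L2). now apply Rmult_le_compat_r. }
    assert (Herr : 0 <= err).
    { assert (P := frame_ep_pos _ _ _ _ _ _ Hf). assert (Ht0 := Ht 0).
      assert (0 <= b3). { generalize (Rabs_pos (be 0 - 1 - b1 * 0 - b2 / 2 * 0 ^ 2)), (Wt_pos c1 0). nra. }
      unfold err. assert (0 <= ep * Rabs b2) by (apply Rmult_le_pos; [assumption | apply Rabs_pos]).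
      generalize (pow2_ge_0 ep). lra. }
    assert (Ps := Rabs_pos s). assert (Ps' := Rabs_pos s').
    split; [apply W with C1; [assumption | generalize (pow2_ge_0 ep); lra | lra | exact X1] |].
    split; [apply W with C2; [assumption | lra | lra | exact X2] |].
    split; [apply W with C3; [assumption | exact Herr | lra | exact X3] |].
    split; [apply W with C4; [assumption | exact Herr | lra | exact X4] |].
    apply W with C5; [assumption | exact Herr | lra | exact X5]. }
  destruct U1 as [A1 [HA1 U1]]. destruct U2 as [A2 [HA2 U2]].
  exists (2 * A2 + 1), e0. split; [lra |]. split; [assumption |].
  intros al be ep b1 b2 b3 E r0 Hf Hep Hb1 Hb2 Ht Hr0 HE.
  set (r := Rmin r0 e0). assert (Hr : 0 < r) by now apply Rmin_glb_lt.
  assert (St : forall s, Rabs s < r -> exists v v1 v2, state k1 K1 c1 j e0 e0 al be ep s (E s) v v1 v2).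
  { intros s Hs. assert (S1 : Rabs s < r0) by (apply Rlt_le_trans with (1 := Hs); apply Rmin_l).
    assert (S2 : Rabs s < e0) by (apply Rlt_le_trans with (1 := Hs); apply Rmin_r).
    destruct (HE s S1) as [I1 I2].
    assert (Ad : adm (k1 ^ 2 / 2) (2 + c1) (pot al s) (Ca * (e0 + e0))).
    { apply (pot_adm k1 K1 c1 Hk1 HK1 Hc1 al be ep Hf s); [lra |]. apply Rmult_le_compat_l; unfold Ca; lra. }
    destruct (Hnorm _ _ _ Ad Hthr2 I2 I1) as (v & v1 & v2 & Hv & Ov).
    exists v, v1, v2. split; [assumption |]. split; [assumption |]. split; [lra |]. split; [exact I2 |]. split; assumption. }
  assert (Der : forall s v v1 v2, Rabs s < r -> state k1 K1 c1 j e0 e0 al be ep s (E s) v v1 v2 ->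
    is_derive E s (slope al s v)).
  { intros s v v1 v2 Hs Hv. apply is_derive_of_quadratic with A1 (r - Rabs s); [lra |].
    intros y Hy. assert (Hyr : Rabs y < r).
    { replace y with (s + (y - s)) by ring. eapply Rle_lt_trans; [apply Rabs_triang | lra]. }
    destruct (St y Hyr) as (w & w1 & w2 & Hw). now apply (U1 al be ep s (E s) v v1 v2 y (E y) w w1 w2). }
  assert (DE : forall s v v1 v2, Rabs s < r -> state k1 K1 c1 j e0 e0 al be ep s (E s) v v1 v2 -> Derive E s = slope al s v).
  { intros s v v1 v2 Hs Hv. apply is_derive_unique. now apply Der with v1 v2. }
  assert (R0 : Rabs 0 < r) by (rewrite Rabs_R0; assumption).
  destruct (St 0 R0) as (u & u1 & u2 & Hu).
  assert (Main : forall s s', s <> 0 -> s' <> 0 -> Rabs s < r -> Rabs s' < r ->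
    exists M, Rabs ((Derive E s - Derive E 0) / s - M) <= A2 * (ep ^ 2 + Rabs s) /\
    Rabs ((Derive E s - Derive E 0) / s - (Derive E s' - Derive E 0) / s') <= A2 * (Rabs s + Rabs s') /\
    Rabs (E 0 - (Lam + (Lam ^ 2 + 1) / 8 * b2)) <= A2 * (ep ^ 2 + ep * Rabs b2 + b3) /\
    Rabs (Derive E 0 - Lam * b1) <= A2 * (ep ^ 2 + ep * Rabs b2 + b3) /\
    Rabs (M - Lam * b2) <= A2 * (ep ^ 2 + ep * Rabs b2 + b3)).
  { intros s s' Hs Hs' Hsr Hsr'.
    destruct (St s Hsr) as (v & v1 & v2 & Hv). destruct (St s' Hsr') as (y & y1 & y2 & Hy).
    rewrite (DE s v v1 v2 Hsr Hv), (DE s' y y1 y2 Hsr' Hy), (DE 0 u u1 u2 R0 Hu).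
    now apply (U2 al be ep b1 b2 b3 (E 0) u u1 u2 s (E s) v v1 v2 s' (E s') y y1 y2). }
  destruct (is_derive_of_cauchy_quotients (Derive E) A2 r Hr HA2) as [D2 [HD2 HQ]].
  { intros s s' Hs Hs' Hsr Hsr'. destruct (Main s s' Hs Hs' Hsr Hsr') as (M & _ & Q & _). exact Q. }
  exists (Derive E), D2, r. split; [assumption |]. split.
  { intros s Hs. destruct (St s Hs) as (v & v1 & v2 & Hv). rewrite (DE s v v1 v2 Hs Hv). now apply Der with v1 v2. }
  split; [exact HD2 |].
  set (err := ep ^ 2 + ep * Rabs b2 + b3) in *.
  assert (Herr : ep ^ 2 <= err).
  { assert (Ht0 := Ht 0). assert (0 <= b3). { generalize (Rabs_pos (be 0 - 1 - b1 * 0 - b2 / 2 * 0 ^ 2)), (Wt_pos c1 0). nra. }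
    unfold err. assert (0 <= ep * Rabs b2) by (apply Rmult_le_pos; [apply (frame_ep_pos _ _ _ _ _ _ Hf) | apply Rabs_pos]). lra. }
  assert (W : forall a, a <= A2 * err -> a <= (2 * A2 + 1) * err) by (intros; nra).
  (* The bounds on E 0 and on its derivative there do not involve s; r/2 is just an admissible
     nonzero shift. *)
  assert (Half : Rabs (r / 2) < r) by (rewrite Rabs_pos_eq; lra).
  destruct (Main (r / 2) (r / 2) ltac:(lra) ltac:(lra) Half Half) as (M0 & _ & _ & Q1 & Q2 & _).
  split; [now apply W |]. split; [now apply W |].
  (* D2 is compared with M through the quotient at a small s. Letting s tend to 0 leaves A2 ep^2 +
     A2 err, hence the factor 2 A2. *)
  apply le_epsilon. intros eps Heps.
  set (s := Rmin (r / 2) (eps / (2 * A2 + 1))).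
  assert (Hs : 0 < s) by (apply Rmin_glb_lt; [lra | apply Rdiv_lt_0_compat; lra]).
  assert (Hsr : Rabs s < r) by (rewrite Rabs_pos_eq by lra; assert (s <= r / 2) by apply Rmin_l; lra).
  destruct (Main s s ltac:(lra) ltac:(lra) Hsr Hsr) as (M & P1 & _ & _ & _ & P2).
  specialize (HQ s ltac:(lra) Hsr). rewrite (Rabs_pos_eq s) in HQ, P1 by lra.
  assert (Es : s * (2 * A2 + 1) <= eps).
  { apply Rle_trans with (eps / (2 * A2 + 1) * (2 * A2 + 1)); [| right; field; lra].
    apply Rmult_le_compat_r; [lra | apply Rmin_r]. }
  set (Q := (Derive E s - Derive E 0) / s) in *.
  replace (D2 - Lam * b2) with (- (Q - D2) + (Q - M) + (M - Lam * b2)) by ring.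
  eapply Rle_trans; [apply Rabs_triang |].
  assert (T2 := Rabs_triang (- (Q - D2)) (Q - M)). rewrite Rabs_Ropp in T2.
  nra.
Qed.

End LocalBand.

(** * The magnetic profile *)

Lemma mvt_between (g g1 : R -> R) (z : R) : g 0 = 0 -> (forall x, is_derive g x (g1 x)) ->
  exists x, Rmin 0 z <= x <= Rmax 0 z /\ g z = g1 x * z.
Proof.
  intros G0 D. destruct (MVT_gen g 0 z g1) as [x [Hx E]].
  - intros; apply D.
  - intros x _. apply continuity_pt_filterlim. now apply derive_continuous with g1.
  - exists x. split; [assumption |]. lra.
Qed.

Lemma is_derive_shift (f : R -> R) (t s d : R) : is_derive f (t + s) d -> is_derive (fun s => f (t + s)) s d.
Proof.
  intros H. evar_last.
  - apply (is_derive_comp f (fun s => t + s)); [exact H |].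
    apply is_derive_plusR; [apply is_derive_const | apply is_derive_idR].
  - unfold scal, zero; simpl; unfold mult; simpl. ring.
Qed.

(* A function with [|f'| <= |f|] varies at most exponentially. *)
Lemma slowly_varying (f f1 : R -> R) (X x y : R) : (forall x, is_derive f x (f1 x)) ->
  (forall x, X <= x -> Rabs (f1 x) <= Rabs (f x)) -> X <= x -> X <= y ->
  Rabs (f x) <= Rabs (f y) * exp (Rabs (x - y)).
Proof.
  intros D H Hx Hy.
  (* f^2 exp(2 z) increases and f^2 exp(-2 z) decreases; the sign c treats both at once. Squares
     avoid differentiating |f|. *)
  assert (K : forall c, c = 1 \/ c = -1 -> forall p q, X <= p <= q ->
    c * (f p ^ 2 * exp (2 * c * p)) <= c * (f q ^ 2 * exp (2 * c * q))).
  { intros c Hc p q Hpq.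
    apply (derive_nonneg_incr (fun z => c * (f z ^ 2 * exp (2 * c * z)))
      (fun z => c * (2 * (f z * f1 z + c * f z ^ 2) * exp (2 * c * z)))); [lra | |].
    - intros z. apply is_derive_ext with (fun z => c * ((f z * f z) * exp (2 * c * z))).
      + intros w. replace (f w * f w) with (f w ^ 2) by ring. reflexivity.
      + evar_last.
        * apply is_derive_scal, is_derive_multR.
          -- apply is_derive_multR; apply D.
          -- instantiate (1 := 2 * c * exp (2 * c * z)). auto_derive; [trivial | ring].
        * cbv beta. ring.
    - intros z Hz. specialize (H z ltac:(lra)).
      assert (Q : 0 <= c * (f z * f1 z + c * f z ^ 2)).
      { assert (Q2 : Rabs (f z * f1 z) <= f z ^ 2).
        { rewrite Rabs_mult, <- (pow2_abs (f z)). simpl. rewrite Rmult_1_r.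
          apply Rmult_le_compat_l; [apply Rabs_pos | assumption]. }
        apply Rabs_le_between in Q2. destruct Hc as [-> | ->]; lra. }
      replace (c * (2 * (f z * f1 z + c * f z ^ 2) * exp (2 * c * z)))
        with (2 * (c * (f z * f1 z + c * f z ^ 2)) * exp (2 * c * z)) by ring.
      apply Rmult_le_pos; [lra | left; apply exp_pos]. }
  assert (Fin : f x ^ 2 <= f y ^ 2 * exp (2 * Rabs (x - y))).
  { destruct (Rle_or_lt x y) as [Hxy | Hxy].
    - specialize (K 1 (or_introl eq_refl) x y ltac:(lra)). rewrite Rabs_left1 by lra.
      apply Rmult_le_reg_r with (exp (2 * 1 * x)); [apply exp_pos |].
      rewrite (Rmult_assoc (f y ^ 2)), <- exp_plus. replace (2 * - (x - y) + 2 * 1 * x) with (2 * 1 * y) by ring. lra.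
    - specialize (K (-1) (or_intror eq_refl) y x ltac:(lra)). rewrite Rabs_pos_eq by lra.
      apply Rmult_le_reg_r with (exp (2 * -1 * x)); [apply exp_pos |].
      rewrite (Rmult_assoc (f y ^ 2)), <- exp_plus. replace (2 * (x - y) + 2 * -1 * x) with (2 * -1 * y) by ring. lra. }
  assert (E : exp (2 * Rabs (x - y)) = exp (Rabs (x - y)) ^ 2).
  { replace (2 * Rabs (x - y)) with (Rabs (x - y) + Rabs (x - y)) by ring. rewrite exp_plus. ring. }
  rewrite E, <- Rpow_mult_distr in Fin.
  apply sq_le_abs; [apply Rmult_le_pos; [apply Rabs_pos | left; apply exp_pos] |].
  rewrite (Rpow_mult_distr (Rabs _)), pow2_abs, <- Rpow_mult_distr. exact Fin.
Qed.

Lemma Wt_add (c x y : R) : 0 <= c -> Wt c (x + y) <= Wt c x * Wt c y.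
Proof.
  intros Hc. unfold Wt. rewrite Rmult_plus_distr_l, Ropp_plus_distr, !exp_plus.
  assert (0 <= exp (c * x) * exp (- (c * y))) by (apply Rmult_le_pos; left; apply exp_pos).
  assert (0 <= exp (- (c * x)) * exp (c * y)) by (apply Rmult_le_pos; left; apply exp_pos). lra.
Qed.

Lemma fast_affine (f : R -> R) (p t : R) : p <> 0 -> fast f -> fast (fun x => f (p * (x - t))).
Proof.
  intros Hp [H1 H2]. split.
  - intros x. apply (continuous_comp (fun x => p * (x - t)) f); [| apply H1].
    apply (@ex_derive_continuous R_AbsRing R_NormedModule). auto_derive. trivial.
  - intros c Hc. assert (Hpa := Rabs_pos_lt p Hp).
    assert (Hcp : 0 <= c / Rabs p) by (apply Rmult_le_pos; [assumption | left; now apply Rinv_0_lt_compat]).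
    destruct (H2 (c / Rabs p) Hcp) as [C HC].
    exists (C * Wt c t). intros x. specialize (HC (p * (x - t))).
    assert (E : Wt (c / Rabs p) (p * (x - t)) = Wt c (x - t)).
    { destruct (Rle_or_lt 0 p).
      - unfold Wt. rewrite Rabs_pos_eq by lra. replace (c / p * (p * (x - t))) with (c * (x - t)) by (field; lra). reflexivity.
      - rewrite <- Wt_opp_r. unfold Wt. rewrite Rabs_left by lra.
        replace (c / - p * - (p * (x - t))) with (c * (x - t)) by (field; lra). reflexivity. }
    rewrite E in HC. assert (A := Wt_add c (x - t) t Hc). replace (x - t + t) with x in A by ring.
    apply Rle_trans with (Rabs (f (p * (x - t))) * (Wt c (x - t) * Wt c t)).
    + apply Rmult_le_compat_l; [apply Rabs_pos | assumption].
    + rewrite <- Rmult_assoc. apply Rmult_le_compat_r; [left; apply Wt_pos | assumption].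
Qed.

(** [sq_integrable] quantifies over proofs of Riemann integrability; continuity supplies one for
    each interval. *)
Lemma sq_integrable_RInt (u : R -> R) : (forall x, continuous u x) -> sq_integrable u ->
  exists B, forall L, RInt (fun x => u x * u x) (- L) L <= B.
Proof.
  intros Hu [B H]. exists B. intros L.
  assert (ex : ex_RInt (fun x => u x * u x) (- L) L).
  { apply ex_RInt_cont. intros x. now apply continuous_multR. }
  apply ex_RInt_Reals_0 in ex. rewrite (RInt_Reals _ _ _ ex). apply H.
Qed.

Lemma fast_sq_integrable (u : R -> R) : fast u -> sq_integrable u.
Proof.
  intros Hu. assert (Hf : fast (fun x => u x * u x)) by fast_tac.
  destruct (integ_tail _ Hf) as [C [HC T]].
  exists (2 * C). intros L pr. rewrite <- RInt_Reals.
  assert (ex : forall a b, ex_RInt (fun x => u x * u x) a b) by (intros; apply ex_RInt_cont, Hf).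
  destruct (Rle_or_lt 0 L) as [HL | HL].
  - destruct (T 0 L ltac:(lra)) as [T1 T2]. rewrite Ropp_0, exp_0, Rmult_1_r in *.
    rewrite <- (RInt_Chasles _ (- L) 0 L) by auto.
    apply Rabs_le_between in T1. apply Rabs_le_between in T2.
    assert (Z : forall p q : R, p <= C -> q <= C -> p + q <= 2 * C) by (intros; lra). apply Z; lra.
  - rewrite <- (opp_RInt_swap _ L (- L)) by auto.
    assert (0 <= RInt (fun x => u x * u x) L (- L)).
    { apply RInt_ge_0; [lra | auto |]. intros x _. generalize (pow2_ge_0 (u x)). lra. }
    assert (Z : forall p : R, 0 <= p -> - p <= 2 * C) by (intros; lra). now apply Z.
Qed.

(* [(u^2)' = 2 u u'] is nondecreasing where the potential is nonnegative, so
   it cannot become positive if [u] is square integrable. *)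
Lemma sq_integrable_bounded (q u u1 : R -> R) (X : R) : ode q (fun _ => 0) u u1 ->
  (forall x, X <= x -> 0 <= q x) -> (exists B, forall L, RInt (fun x => u x * u x) (- L) L <= B) ->
  forall x, X <= x -> Rabs (u x) <= Rabs (u X).
Proof.
  intros [D0 D1] Hq [B HB] x Hx.
  assert (Cu := derive_continuous u u1 D0).
  assert (W : forall p r, X <= p <= r -> u p * u1 p <= u r * u1 r).
  { intros p r Hp. apply (derive_nonneg_incr (fun z => u z * u1 z) (fun z => u1 z ^ 2 + q z * u z ^ 2)); [lra | |].
    - intros z. evar_last; [apply is_derive_multR; [apply D0 | apply D1] |]. ring.
    - intros z Hz. specialize (Hq z ltac:(lra)). generalize (pow2_ge_0 (u1 z)), (sq_nonneg_mult _ (u z) Hq). lra. }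
  assert (S : forall p r c, p <= r -> (forall z, p <= z <= r -> c <= u z * u1 z) -> u p ^ 2 + 2 * c * (r - p) <= u r ^ 2).
  { intros p r c Hpr Hz.
    assert (u p ^ 2 - 2 * c * p <= u r ^ 2 - 2 * c * r); [| lra].
    apply (derive_nonneg_incr (fun z => u z ^ 2 - 2 * c * z) (fun z => 2 * (u z * u1 z) - 2 * c)); [assumption | |].
    - intros z. apply is_derive_ext with (fun z => u z * u z - 2 * c * z).
      + intros w. replace (u w * u w) with (u w ^ 2) by ring. reflexivity.
      + evar_last; [apply is_derive_minusR; [apply is_derive_multR; apply D0 | apply is_derive_scal, is_derive_idR] |]. ring.
    - intros z Hzz. specialize (Hz z Hzz). lra. }
  assert (NP : forall p, X <= p -> u p * u1 p <= 0).
  { intros p Hp. destruct (Rle_or_lt (u p * u1 p) 0) as [| Hpos]; [assumption | exfalso].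
    set (c := u p * u1 p) in *.
    assert (G : forall z, p <= z -> 2 * c * (z - p) <= u z ^ 2).
    { intros z Hz. assert (Q := S p z c Hz ltac:(intros w Hw; apply W; lra)). generalize (pow2_ge_0 (u p)). lra. }
    (* Beyond p + 1 one has u^2 >= 2 c, so the integral over [-L, L] exceeds B. *)
    set (L := Rabs p + 1 + (Rabs B + 1) / (2 * c)).
    assert (HBc : 0 < (Rabs B + 1) / (2 * c)) by (apply Rdiv_lt_0_compat; [generalize (Rabs_pos B) |]; lra).
    assert (Pp := Rle_abs p). assert (Pm := Rle_abs (- p)). rewrite Rabs_Ropp in Pm.
    assert (ex : forall a b, ex_RInt (fun x => u x * u x) a b) by (intros; apply ex_RInt_cont; intros; now apply continuous_multR).
    assert (Lo : (L - (p + 1)) * (2 * c) <= RInt (fun x => u x * u x) (- L) L).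
    { rewrite <- (RInt_Chasles _ (- L) (p + 1) L) by auto.
      assert (I1 : 0 <= RInt (fun x => u x * u x) (- L) (p + 1)).
      { apply RInt_ge_0; [unfold L; lra | auto |]. intros y _. generalize (pow2_ge_0 (u y)). lra. }
      assert (I2 : (L - (p + 1)) * (2 * c) <= RInt (fun x => u x * u x) (p + 1) L).
      { replace ((L - (p + 1)) * (2 * c)) with (RInt (fun _ => 2 * c) (p + 1) L).
        - apply RInt_le; [unfold L; lra | apply ex_RInt_const | auto |].
          intros y Hy. specialize (G y ltac:(lra)). nra.
        - rewrite RInt_const. unfold scal; simpl; unfold mult; simpl. ring. }
      assert (Z : forall a b d : R, 0 <= a -> d <= b -> d <= a + b) by (intros; lra). now apply Z. }
    assert (Q : Rabs B + 1 <= (L - (p + 1)) * (2 * c)).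
    { replace (Rabs B + 1) with ((Rabs B + 1) / (2 * c) * (2 * c)) by (field; lra).
      apply Rmult_le_compat_r; [lra | unfold L; lra]. }
    specialize (HB L). generalize (Rle_abs B). lra. }
  assert (Fin : u x ^ 2 <= u X ^ 2).
  { assert (- u X ^ 2 <= - u x ^ 2); [| lra].
    apply (derive_nonneg_incr (fun z => - u z ^ 2) (fun z => - (2 * (u z * u1 z)))); [assumption | |].
    - intros z. apply is_derive_ext with (fun z => - (u z * u z)).
      + intros w. replace (u w * u w) with (u w ^ 2) by ring. reflexivity.
      + evar_last; [apply (@is_derive_opp R_AbsRing R_NormedModule (fun z => u z * u z)); apply is_derive_multR; apply D0 |].
        unfold opp; simpl. ring.
    - intros z Hz. specialize (NP z ltac:(lra)). lra. }
  apply sq_le_abs; [apply Rabs_pos |]. now rewrite pow2_abs.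
Qed.

(** * Rescaling to the normalized problem *)

Section Rescaling.

Variables (kappa c0 : R) (a : R -> R) (k t r : R).
Hypothesis Hr : 0 < r.

(** At x = t + z/r one has a(x) - (k + r s) = r (scaled z - s), so the shift scales by r and the
    energy by r^2. It will be used with t = x_k and r = sqrt(b_k). *)
Definition scaled (z : R) : R := (a (t + z / r) - k) / r.

Lemma iseig_is_eigenvalue (s E : R) : iseig (pot scaled s) E -> is_eigenvalue a (k + r * s) (r ^ 2 * E).
Proof.
  intros (v & v1 & v2 & [(F0 & F1 & F2 & D0 & D1) Ev] & [z0 Hz0]).
  assert (sd : forall f x d, is_derive f (r * (x - t)) d -> is_derive (fun x => f (r * (x - t))) x (r * d)).
  { intros f x d H. evar_last.
    - apply (is_derive_comp f (fun x => r * (x - t))); [exact H |].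
      instantiate (1 := r). auto_derive; [trivial | ring].
    - unfold scal; simpl; unfold mult; simpl. ring. }
  exists (fun x => v (r * (x - t))), (fun x => r * v1 (r * (x - t))), (fun x => r ^ 2 * v2 (r * (x - t))).
  split; [| split; [| split; [| split]]].
  - intros x. apply is_derive_Reals, sd, D0.
  - intros x. apply is_derive_Reals. evar_last; [apply is_derive_scal, sd, D1 |]. ring.
  - intros x. rewrite Ev. unfold pot, scaled. replace (t + r * (x - t) / r) with x by (field; lra). field. lra.
  - exists (t + z0 / r). replace (r * (t + z0 / r - t)) with z0 by (field; lra). assumption.
  - apply fast_sq_integrable. apply (fast_affine v r t); [lra | assumption].
Qed.

(** A square-integrable solution is bounded at each end, where the coefficient is nonnegative, and
    bounded solutions of a confining equation are fast. *)
Lemma is_eigenvalue_iseig (s E : R) : slow (pot scaled s) -> confining (fun z => pot scaled s z - E) ->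
  confining (fun z => pot scaled s (- z) - E) -> is_eigenvalue a (k + r * s) (r ^ 2 * E) -> iseig (pot scaled s) E.
Proof.
  intros Sp Cr Cl (u & u1 & u2 & D0 & D1 & Hu & [x0 Hx0] & Hsq).
  set (q := fun z => pot scaled s z - E).
  assert (Sq : slow q) by (unfold q; slow_tac).
  set (Q := fun x => r ^ 2 * q (r * (x - t))).
  assert (HQ : forall x, u2 x = Q x * u x).
  { intros x. specialize (Hu x). unfold Q, q, pot, scaled.
    replace (t + r * (x - t) / r) with x by (field; lra).
    replace (r ^ 2 * (((a x - k) / r - s) ^ 2 - E)) with ((a x - (k + r * s)) ^ 2 - r ^ 2 * E) by (field; lra). lra. }
  assert (OQ : ode Q (fun _ => 0) u u1).
  { split; intros x; [apply is_derive_Reals, D0 |]. rewrite <- HQ, Rplus_0_r. apply is_derive_Reals, D1. }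
  assert (Cu := derive_continuous u u1 (proj1 OQ)).
  assert (HB := sq_integrable_RInt u Cu Hsq).
  set (v := fun z => u (t + / r * z)). set (v1 := fun z => / r * u1 (t + / r * z)).
  assert (sd : forall f z d, is_derive f (t + / r * z) d -> is_derive (fun z => f (t + / r * z)) z (/ r * d)).
  { intros f z d H. evar_last.
    - apply (is_derive_comp f (fun z => t + / r * z)); [exact H |].
      instantiate (1 := / r). auto_derive; [trivial | ring].
    - unfold scal; simpl; unfold mult; simpl. ring. }
  assert (Ov : ode q (fun _ => 0) v v1).
  { split; intros z.
    - apply sd, OQ.
    - evar_last; [apply is_derive_scal, sd, OQ |]. unfold Q, v.
      assert (Z : forall y : R, r * (t + / r * y - t) = y) by (intros; field; lra). rewrite Z.
      match goal with |- @eq _ ?x ?y => assert (Z2 : @eq R x y) by (field; lra); exact Z2 end. }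
  assert (F00 : fast_right (fun _ => 0)).
  { intros c _. exists 0. split; [lra |]. intros. rewrite Rabs_R0. lra. }
  assert (BR : exists Z B, forall z, Z <= z -> Rabs (v z) <= B).
  { destruct (Cr 0) as [Z HZ]. exists Z, (Rabs (u (t + / r * Z))). intros z Hz.
    apply (sq_integrable_bounded Q u u1 (t + / r * Z) OQ).
    - intros x Hx. apply Rmult_le_pos; [apply pow2_ge_0 |]. apply HZ.
      replace Z with (r * (/ r * Z)) by (field; lra). apply Rmult_le_compat_l; lra.
    - exact HB.
    - apply Rplus_le_compat_l, Rmult_le_compat_l; [left; now apply Rinv_0_lt_compat | assumption]. }
  assert (BL : exists Z B, forall z, Z <= z -> Rabs (v (- z)) <= B).
  { destruct (Cl 0) as [Z HZ]. exists Z, (Rabs (u (- (- t + / r * Z)))). intros z Hz.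
    unfold v. replace (t + / r * - z) with (- (- t + / r * z)) by ring.
    apply (sq_integrable_bounded (fun x => Q (- x)) (fun x => u (- x)) (fun x => - u1 (- x)) (- t + / r * Z)).
    - apply (ode_reflect Q (fun _ => 0) u u1 OQ).
    - intros x Hx. apply Rmult_le_pos; [apply pow2_ge_0 |].
      replace (r * (- x - t)) with (- (r * (x + t))) by ring. apply HZ.
      replace Z with (r * (/ r * Z)) by (field; lra). apply Rmult_le_compat_l; lra.
    - destruct HB as [B HB]. exists B. intros L.
      rewrite (RInt_opp_arg (fun x => u x * u x)) by (intros; now apply continuous_multR).
      rewrite Ropp_involutive. apply HB.
    - apply Rplus_le_compat_l, Rmult_le_compat_l; [left; now apply Rinv_0_lt_compat | assumption]. }
  destruct BR as (Z & B & BR). destruct BL as (Z' & B' & BL).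
  destruct (ode_fast_right q (fun _ => 0) v v1 Z B Ov Cr Sq F00 BR) as [R0 R1].
  destruct (ode_fast_right (fun z => q (- z)) (fun _ => 0) (fun z => v (- z)) (fun z => - v1 (- z)) Z' B'
    (ode_reflect q (fun _ => 0) v v1 Ov) Cl (slow_reflect q Sq) F00 BL) as [L0 L1].
  assert (L1' : fast_right (fun z => v1 (- z))).
  { intros c Hc. destruct (L1 c Hc) as [C [HC H]]. exists C. split; [assumption |].
    intros x Hx. rewrite <- Rabs_Ropp. now apply H. }
  assert (F0 : fast (fun _ : R => 0)).
  { apply fast_of_sides; [intros; apply continuous_const | exact F00 | exact F00]. }
  exists v, v1, (fun z => q z * v z + 0).
  split; [split |].
  - now apply (ode_dom q (fun _ => 0)).
  - intros z. unfold q. ring.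
  - exists (r * (x0 - t)). unfold v. replace (t + / r * (r * (x0 - t))) with x0 by (field; lra). assumption.
Qed.

End Rescaling.

(** * The assumptions on b and its Taylor expansion *)

Section Profile.

Variables (bd : nat -> R -> R) (bm bp : R) (a : R -> R).
Hypothesis HD : forall p x, is_derive (bd p) x (bd (S p) x).
Hypothesis Hincr : forall x y, x < y -> bd 0%nat x < bd 0%nat y.
Hypothesis Hbm : forall eps, 0 < eps -> exists X, forall x, x <= X -> Rabs (bd 0%nat x - bm) <= eps.
Hypothesis Hbp : forall eps, 0 < eps -> exists X, forall x, X <= x -> Rabs (bd 0%nat x - bp) <= eps.
Hypothesis Hbpm : 0 < bm < bp.
Hypothesis Ha0 : a 0 = 0.
Hypothesis Ha : forall x, is_derive a x (bd 0%nat x).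
Hypothesis HA : exists x0, forall (p : nat) (x : R), x0 <= x -> bd p x <> 0.
Hypothesis HB1 : little_o_infty (bd 1%nat) (fun x => bp - bd 0%nat x).
Hypothesis HB2 : forall p : nat, little_o_infty (bd (S p)) (bd p).

Lemma profile_bounds (x : R) : bm < bd 0%nat x < bp.
Proof.
  split.
  - destruct (Rlt_or_le bm (bd 0%nat x)) as [| H]; [assumption | exfalso].
    assert (H1 := Hincr (x - 1) x ltac:(lra)).
    destruct (Hbm ((bm - bd 0%nat (x - 1)) / 2)) as [X HX]; [lra |].
    set (y := Rmin X (x - 2)). assert (y <= X) by apply Rmin_l. assert (y <= x - 2) by apply Rmin_r.
    specialize (HX y H0). apply Rabs_le_between in HX. assert (Q := Hincr y (x - 1) ltac:(lra)). lra.
  - destruct (Rlt_or_le (bd 0%nat x) bp) as [| H]; [assumption | exfalso].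
    assert (H1 := Hincr x (x + 1) ltac:(lra)).
    destruct (Hbp ((bd 0%nat (x + 1) - bp) / 2)) as [X HX]; [lra |].
    set (y := Rmax X (x + 2)). assert (X <= y) by apply Rmax_l. assert (x + 2 <= y) by apply Rmax_r.
    specialize (HX y H0). apply Rabs_le_between in HX. assert (Q := Hincr (x + 1) y ltac:(lra)). lra.
Qed.

Lemma flux_growth (x y : R) : x <= y -> bm * (y - x) <= a y - a x <= bp * (y - x).
Proof.
  intros Hxy.
  assert (L : a x - bm * x <= a y - bm * y).
  { apply (derive_nonneg_incr (fun z => a z - bm * z) (fun z => bd 0%nat z - bm)); [assumption | |].
    - intros z. evar_last; [apply is_derive_minusR; [apply Ha | apply is_derive_scal, is_derive_idR] |]. ring.
    - intros z _. generalize (profile_bounds z). lra. }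
  assert (U : bp * x - a x <= bp * y - a y).
  { apply (derive_nonneg_incr (fun z => bp * z - a z) (fun z => bp - bd 0%nat z)); [assumption | |].
    - intros z. evar_last; [apply is_derive_minusR; [apply is_derive_scal, is_derive_idR | apply Ha] |]. ring.
    - intros z _. generalize (profile_bounds z). lra. }
  lra.
Qed.

Lemma flux_inverse (k : R) : 0 <= k -> exists t, 0 <= t /\ a t = k.
Proof.
  intros Hk. assert (Hq : 0 <= k / bm) by (apply Rmult_le_pos; [assumption | left; apply Rinv_0_lt_compat; lra]).
  assert (G := flux_growth 0 (k / bm) Hq).
  replace (bm * (k / bm - 0)) with k in G by (field; lra).
  destruct (IVT_gen a 0 (k / bm) k) as [t [Ht E]].
  - intros x. apply continuity_pt_filterlim. now apply derive_continuous with (bd 0%nat).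
  - rewrite Ha0, Rmin_left, Rmax_right by lra. lra.
  - exists t. rewrite Rmin_left in Ht by assumption. split; [apply Ht | exact E].
Qed.

Lemma slope_small (del : R) : 0 < del -> exists X, forall x, X <= x -> Rabs (bd 1%nat x) <= del.
Proof.
  intros Hd. destruct (HB1 (del / (bp - bm))) as [X HX]; [apply Rdiv_lt_0_compat; lra |].
  exists X. intros x Hx. apply Rle_trans with (1 := HX x Hx).
  assert (B := profile_bounds x). rewrite Rabs_pos_eq by lra.
  apply Rle_trans with (del / (bp - bm) * (bp - bm)); [| right; field; lra].
  apply Rmult_le_compat_l; [left; apply Rdiv_lt_0_compat |]; lra.
Qed.

(** Condition (b) with the constant 1 makes b''' vary slowly; condition (a) makes it nonzero, so
    that one can divide by |b'''| at the edge of the region. *)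
Lemma tame_region : exists X, 0 <= X /\ forall x, X <= x ->
  Rabs (bd 1%nat x) <= 1 /\ Rabs (bd 2%nat x) <= Rabs (bd 1%nat x) /\ Rabs (bd 3%nat x) <= Rabs (bd 2%nat x) /\
  Rabs (bd 4%nat x) <= Rabs (bd 3%nat x) /\ 0 < Rabs (bd 3%nat x).
Proof.
  destruct (slope_small 1 Rlt_0_1) as [X1 H1]. destruct HA as [X0 H0].
  destruct (HB2 1%nat 1 Rlt_0_1) as [X2 H2]. destruct (HB2 2%nat 1 Rlt_0_1) as [X3 H3].
  destruct (HB2 3%nat 1 Rlt_0_1) as [X4 H4].
  exists (Rabs X0 + Rabs X1 + Rabs X2 + Rabs X3 + Rabs X4).
  assert (P0 := Rabs_pos X0). assert (P1 := Rabs_pos X1). assert (P2 := Rabs_pos X2).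
  assert (P3 := Rabs_pos X3). assert (P4 := Rabs_pos X4).
  assert (Q0 := Rle_abs X0). assert (Q1 := Rle_abs X1). assert (Q2 := Rle_abs X2).
  assert (Q3 := Rle_abs X3). assert (Q4 := Rle_abs X4).
  split; [lra |]. intros x Hx.
  specialize (H1 x ltac:(lra)). specialize (H2 x ltac:(lra)). specialize (H3 x ltac:(lra)). specialize (H4 x ltac:(lra)).
  rewrite Rmult_1_l in *. split; [assumption |]. split; [assumption |]. split; [assumption |]. split; [assumption |].
  apply Rabs_pos_lt, H0. lra.
Qed.

(* To the left of the tame region the remainder is only O(1 + s^2), but there
   [|b'''(t)| exp |s|] is bounded below since [b'''] decays subexponentially. *)
Lemma profile_taylor (X : R) : 0 <= X -> (forall x, X <= x ->
  Rabs (bd 1%nat x) <= 1 /\ Rabs (bd 2%nat x) <= Rabs (bd 1%nat x) /\ Rabs (bd 3%nat x) <= Rabs (bd 2%nat x) /\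
  Rabs (bd 4%nat x) <= Rabs (bd 3%nat x) /\ 0 < Rabs (bd 3%nat x)) ->
  exists C, 0 <= C /\ forall t s, X <= t ->
  Rabs (bd 0%nat (t + s) - bd 0%nat t - bd 1%nat t * s - bd 2%nat t / 2 * s ^ 2) <= C * Rabs (bd 3%nat t) * Wt 4 s.
Proof.
  intros HX0 HX. destruct (HX X (Rle_refl _)) as (_ & _ & _ & _ & PX).
  set (A := (bp - bm + 2) / Rabs (bd 3%nat X)).
  assert (HAp : 0 <= A) by (apply Rmult_le_pos; [lra | left; now apply Rinv_0_lt_compat]).
  exists (8 + 4 * A). split; [lra |]. intros t s Ht.
  assert (SV : forall x y, X <= x -> X <= y -> Rabs (bd 3%nat x) <= Rabs (bd 3%nat y) * exp (Rabs (x - y))).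
  { intros x y. apply slowly_varying with (bd 4%nat); [apply HD |]. intros z Hz. apply (HX z Hz). }
  assert (W1 := Wt_ge2 1 s ltac:(lra)). assert (Ws := abs_le_Wt1 s).
  assert (We : exp (Rabs s) <= Wt 1 s) by (rewrite <- (Rmult_1_l (Rabs s)); apply exp_abs_le_Wt).
  assert (W12 := Wt_mult 1 1 s ltac:(lra) ltac:(lra)). assert (W13 := Wt_mult (1 + 1) 1 s ltac:(lra) ltac:(lra)).
  assert (W14 := Wt_mult (1 + 1 + 1) 1 s ltac:(lra) ltac:(lra)). replace (1 + 1 + 1 + 1) with 4 in W14 by ring.
  (* Three factors |s| come from the mean value theorem and one factor exp |s| from the slow
     variation of b'''; each is at most Wt 1 s. *)
  assert (W4 : Wt 1 s ^ 4 <= 8 * Wt 4 s).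
  { replace (Wt 1 s ^ 4) with (Wt 1 s * Wt 1 s * Wt 1 s * Wt 1 s) by ring.
    assert (Wt 1 s * Wt 1 s * Wt 1 s <= 4 * Wt (1 + 1 + 1) s).
    { apply Rle_trans with (2 * Wt (1 + 1) s * Wt 1 s); [apply Rmult_le_compat_r; lra | lra]. }
    apply Rle_trans with (4 * Wt (1 + 1 + 1) s * Wt 1 s); [apply Rmult_le_compat_r; lra | lra]. }
  assert (P3 := Rabs_pos (bd 3%nat t)). assert (P4 := Wt_pos 4 s).
  assert (A4 : 0 <= A * Rabs (bd 3%nat t) * Wt 4 s) by (apply Rmult_le_pos; [now apply Rmult_le_pos | lra]).
  destruct (Rle_or_lt X (t + s)) as [Hts | Hts].
  - set (f0 := fun s => bd 0%nat (t + s) - bd 0%nat t - bd 1%nat t * s - bd 2%nat t / 2 * s ^ 2).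
    set (f1 := fun s => bd 1%nat (t + s) - bd 1%nat t - bd 2%nat t * s).
    set (f2 := fun s => bd 2%nat (t + s) - bd 2%nat t).
    destruct (mvt_between f0 f1 s) as [x1 [Hx1 E1]].
    { unfold f0. rewrite Rplus_0_r. ring. }
    { intros x. evar_last.
      - apply is_derive_minusR; [apply is_derive_minusR; [apply is_derive_minusR |] |].
        + apply is_derive_shift, HD.
        + apply is_derive_const.
        + apply is_derive_scal, is_derive_idR.
        + instantiate (1 := bd 2%nat t * x). auto_derive; [trivial | field].
      - unfold f1, zero; simpl. ring. }
    destruct (mvt_between f1 f2 x1) as [x2 [Hx2 E2]].
    { unfold f1. rewrite Rplus_0_r. ring. }
    { intros x. evar_last.
      - apply is_derive_minusR; [apply is_derive_minusR |].
        + apply is_derive_shift, HD.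
        + apply is_derive_const.
        + apply is_derive_scal, is_derive_idR.
      - unfold f2, zero; simpl. ring. }
    destruct (mvt_between f2 (fun s => bd 3%nat (t + s)) x2) as [x3 [Hx3 E3]].
    { unfold f2. rewrite Rplus_0_r. ring. }
    { intros x. evar_last.
      - apply is_derive_minusR; [apply is_derive_shift, HD | apply is_derive_const].
      - unfold zero; simpl. ring. }
    change (Rabs (f0 s) <= (8 + 4 * A) * Rabs (bd 3%nat t) * Wt 4 s).
    rewrite E1, E2, E3, !Rabs_mult.
    assert (Bt : forall x y, Rmin 0 y <= x <= Rmax 0 y -> Rabs x <= Rabs y /\ Rmin 0 y <= Rmin 0 x).
    { intros x y. unfold Rmin, Rmax, Rabs. repeat destruct Rle_dec; repeat destruct Rcase_abs; lra. }
    destruct (Bt x1 s Hx1) as [L1 M1]. destruct (Bt x2 x1 Hx2) as [L2 M2]. destruct (Bt x3 x2 Hx3) as [L3 M3].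
    assert (Tx : X <= t + x3).
    { assert (Rmin 0 s <= x3) by lra. unfold Rmin in H. destruct Rle_dec; lra. }
    assert (S3 := SV (t + x3) t Tx Ht). replace (t + x3 - t) with x3 in S3 by ring.
    assert (S3' : Rabs (bd 3%nat (t + x3)) <= Rabs (bd 3%nat t) * Wt 1 s).
    { apply Rle_trans with (1 := S3). apply Rmult_le_compat_l; [assumption |].
      apply Rle_trans with (2 := We). apply exp_mono. lra. }
    apply Rle_trans with (Rabs (bd 3%nat t) * Wt 1 s * Wt 1 s * Wt 1 s * Wt 1 s).
    + repeat apply Rmult_le_compat; try apply Rabs_pos; try lra; repeat apply Rmult_le_pos; apply Rabs_pos.
    + apply Rle_trans with (Rabs (bd 3%nat t) * (8 * Wt 4 s)); [| lra].
      replace (Rabs (bd 3%nat t) * Wt 1 s * Wt 1 s * Wt 1 s * Wt 1 s) with (Rabs (bd 3%nat t) * Wt 1 s ^ 4) by ring.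
      now apply Rmult_le_compat_l.
  - destruct (HX t Ht) as (B1 & B2 & _ & _ & _).
    assert (Bts := profile_bounds (t + s)). assert (Bt := profile_bounds t).
    assert (R1 : Rabs (bd 0%nat (t + s) - bd 0%nat t - bd 1%nat t * s - bd 2%nat t / 2 * s ^ 2) <= (bp - bm + 2) * Wt 1 s ^ 2).
    { eapply Rle_trans; [apply Rabs_triang |]. rewrite Rabs_Ropp.
      assert (T1 := Rabs_triang (bd 0%nat (t + s) - bd 0%nat t) (- (bd 1%nat t * s))). rewrite Rabs_Ropp in T1.
      assert (Rabs (bd 0%nat (t + s) - bd 0%nat t) <= bp - bm) by (apply Rabs_le; lra).
      assert (Rabs (bd 1%nat t * s) <= 1 * Wt 1 s).
      { rewrite Rabs_mult. apply Rmult_le_compat; auto using Rabs_pos. }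
      assert (Rabs (bd 2%nat t / 2 * s ^ 2) <= 1 * Wt 1 s ^ 2).
      { rewrite Rabs_mult. apply Rmult_le_compat; try apply Rabs_pos.
        - unfold Rdiv. rewrite Rabs_mult, (Rabs_pos_eq (/ 2)) by lra. lra.
        - rewrite <- RPow_abs. apply pow_incr. split; [apply Rabs_pos | assumption]. }
      assert (Wt 1 s <= Wt 1 s ^ 2) by nra.
      assert (bp - bm <= (bp - bm) * Wt 1 s ^ 2) by nra. unfold Rminus in *. lra. }
    assert (R2 : 1 <= Rabs (bd 3%nat t) / Rabs (bd 3%nat X) * Wt 1 s).
    { assert (S3 := SV X t (Rle_refl _) Ht).
      assert (exp (Rabs (X - t)) <= exp (Rabs s)).
      { apply exp_mono. rewrite !Rabs_left1 by lra. lra. }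
      apply Rmult_le_reg_r with (Rabs (bd 3%nat X)); [assumption |].
      replace (Rabs (bd 3%nat t) / Rabs (bd 3%nat X) * Wt 1 s * Rabs (bd 3%nat X)) with (Rabs (bd 3%nat t) * Wt 1 s) by (field; lra).
      rewrite Rmult_1_l. apply Rle_trans with (1 := S3). apply Rmult_le_compat_l; [assumption | lra]. }
    apply Rle_trans with (1 := R1).
    apply Rle_trans with ((bp - bm + 2) * Wt 1 s ^ 2 * (Rabs (bd 3%nat t) / Rabs (bd 3%nat X) * Wt 1 s)).
    { rewrite <- (Rmult_1_r ((bp - bm + 2) * Wt 1 s ^ 2)) at 1. apply Rmult_le_compat_l; [| assumption].
      apply Rmult_le_pos; [lra | apply pow2_ge_0]. }
    replace ((bp - bm + 2) * Wt 1 s ^ 2 * (Rabs (bd 3%nat t) / Rabs (bd 3%nat X) * Wt 1 s))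
      with (A * Rabs (bd 3%nat t) * Wt 1 s ^ 3) by (unfold A; field; lra).
    assert (W3 : Wt 1 s ^ 3 <= 4 * Wt 4 s).
    { assert (0 <= Wt 1 s ^ 3) by (apply pow_le; lra). assert (Wt 1 s ^ 3 * 2 <= Wt 1 s ^ 3 * Wt 1 s) by (apply Rmult_le_compat_l; lra).
      replace (Wt 1 s ^ 4) with (Wt 1 s ^ 3 * Wt 1 s) in W4 by ring. lra. }
    assert (0 <= A * Rabs (bd 3%nat t)) by now apply Rmult_le_pos.
    assert (A * Rabs (bd 3%nat t) * Wt 1 s ^ 3 <= A * Rabs (bd 3%nat t) * (4 * Wt 4 s)) by now apply Rmult_le_compat_l.
    assert (0 <= Rabs (bd 3%nat t) * Wt 4 s) by (apply Rmult_le_pos; lra). lra.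
Qed.

(** Wt 4 (z / r) has the exponent 4 / r <= 4 / sqrt bm, and the 2 accommodates the z^2 of the Taylor
    polynomial. *)
Definition frame_weight : R := 2 + 4 / sqrt bm.

(** The powers of r come from scaling: b(t + z/r) / r^2 has at z = 0 the derivatives b'/r^3 and
    b''/r^4. In the tame region |b'''| <= |b''| <= |b'|, so ep can be a multiple of |b'(t)|
    alone. *)
Lemma profile_frame (X C : R) : 0 <= C -> (forall x, X <= x ->
  Rabs (bd 1%nat x) <= 1 /\ Rabs (bd 2%nat x) <= Rabs (bd 1%nat x) /\ Rabs (bd 3%nat x) <= Rabs (bd 2%nat x) /\
  Rabs (bd 4%nat x) <= Rabs (bd 3%nat x) /\ 0 < Rabs (bd 3%nat x)) ->
  (forall t s, X <= t ->
  Rabs (bd 0%nat (t + s) - bd 0%nat t - bd 1%nat t * s - bd 2%nat t / 2 * s ^ 2) <= C * Rabs (bd 3%nat t) * Wt 4 s) ->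
  let M := / sqrt bm ^ 3 + / sqrt bm ^ 4 + C / bm in
  forall t, X <= t -> let r := sqrt (bd 0%nat t) in
  frame (bm / bp) (bp / bm) frame_weight (scaled a (a t) t r) (fun z => bd 0%nat (t + z / r) / r ^ 2) (M * Rabs (bd 1%nat t)) /\
  Rabs (bd 1%nat t / r ^ 3) <= M * Rabs (bd 1%nat t) /\ Rabs (bd 2%nat t / r ^ 4) <= M * Rabs (bd 1%nat t) /\
  forall z, Rabs (bd 0%nat (t + z / r) / r ^ 2 - 1 - bd 1%nat t / r ^ 3 * z - bd 2%nat t / r ^ 4 / 2 * z ^ 2) <=
    C / bm * Rabs (bd 3%nat t) * Wt frame_weight z.
Proof.
  intros HC HX HT M t Ht r.
  assert (Bt := profile_bounds t). destruct (HX t Ht) as (Q1 & Q2 & Q3 & _).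
  assert (Hq : 0 < sqrt bm) by (apply sqrt_lt_R0; lra).
  assert (Hr : sqrt bm <= r) by (apply sqrt_le_1; lra).
  assert (Hr2 : r ^ 2 = bd 0%nat t) by (apply pow2_sqrt; lra).
  assert (Hq2 : sqrt bm ^ 2 = bm) by (apply pow2_sqrt; lra).
  assert (P3 := Rabs_pos (bd 3%nat t)).
  assert (Hpow : forall k, 0 < / r ^ k <= / sqrt bm ^ k).
  { intros k. split; [apply Rinv_0_lt_compat, pow_lt; lra |].
    apply Rinv_le_contravar; [apply pow_lt; lra | apply pow_incr; lra]. }
  assert (HCb : 0 <= C / bm) by (apply Rmult_le_pos; [assumption | left; apply Rinv_0_lt_compat; lra]).
  assert (H3 := Hpow 3%nat). assert (H4 := Hpow 4%nat).
  assert (Eb1 : Rabs (bd 1%nat t / r ^ 3) <= / sqrt bm ^ 3 * Rabs (bd 1%nat t)).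
  { unfold Rdiv. rewrite Rabs_mult, (Rabs_pos_eq (/ r ^ 3)), Rmult_comm by lra. apply Rmult_le_compat_r; lra. }
  assert (Eb2 : Rabs (bd 2%nat t / r ^ 4) <= / sqrt bm ^ 4 * Rabs (bd 1%nat t)).
  { unfold Rdiv. rewrite Rabs_mult, (Rabs_pos_eq (/ r ^ 4)), Rmult_comm by lra. apply Rmult_le_compat; lra. }
  assert (Eb3 : C / bm * Rabs (bd 3%nat t) <= C / bm * Rabs (bd 1%nat t)) by (apply Rmult_le_compat_l; lra).
  assert (Z1 : 0 <= / sqrt bm ^ 3 * Rabs (bd 1%nat t)) by (apply Rmult_le_pos; lra).
  assert (Z2 : 0 <= / sqrt bm ^ 4 * Rabs (bd 1%nat t)) by (apply Rmult_le_pos; lra).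
  assert (Z3 : 0 <= C / bm * Rabs (bd 1%nat t)) by (apply Rmult_le_pos; lra).
  assert (Hw : 4 / r <= 4 / sqrt bm).
  { apply Rmult_le_compat_l; [lra |]. apply Rinv_le_contravar; lra. }
  assert (Hw0 : 0 < 4 / r) by (apply Rdiv_lt_0_compat; lra).
  assert (T : forall z, Rabs (bd 0%nat (t + z / r) / r ^ 2 - 1 - bd 1%nat t / r ^ 3 * z - bd 2%nat t / r ^ 4 / 2 * z ^ 2) <=
    C / bm * Rabs (bd 3%nat t) * Wt frame_weight z).
  { intros z. specialize (HT t (z / r) Ht).
    replace (bd 0%nat (t + z / r) / r ^ 2 - 1 - bd 1%nat t / r ^ 3 * z - bd 2%nat t / r ^ 4 / 2 * z ^ 2)
      with ((bd 0%nat (t + z / r) - bd 0%nat t - bd 1%nat t * (z / r) - bd 2%nat t / 2 * (z / r) ^ 2) * / r ^ 2)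
      by (rewrite <- Hr2; field; lra).
    rewrite Rabs_mult, (Rabs_pos_eq (/ r ^ 2)) by (apply Rlt_le, Hpow).
    assert (W : Wt 4 (z / r) <= Wt frame_weight z).
    { replace (Wt 4 (z / r)) with (Wt (4 / r) z).
      - apply Wt_mono. unfold frame_weight. lra.
      - unfold Wt. replace (4 / r * z) with (4 * (z / r)) by (field; lra). reflexivity. }
    apply Rle_trans with (C * Rabs (bd 3%nat t) * Wt frame_weight z * / bm).
    - apply Rmult_le_compat; [apply Rabs_pos | apply Rlt_le, Hpow | |].
      + apply Rle_trans with (1 := HT). apply Rmult_le_compat_l; [now apply Rmult_le_pos | assumption].
      + rewrite <- Hq2. apply Hpow.
    - right. field. lra. }
  split; [| split; [| split]].
  - split; [| split; [| split; [| split]]].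
    + intros z. unfold scaled. evar_last.
      * apply is_derive_ext with (fun z => / r * (a (t + / r * z) - a t)).
        { intros y. unfold Rdiv. rewrite (Rmult_comm y), Rmult_comm. reflexivity. }
        apply is_derive_scal, is_derive_minusR; [| apply is_derive_const].
        apply (is_derive_comp a (fun z => t + / r * z)); [apply Ha |].
        instantiate (1 := / r). auto_derive; [trivial | ring].
      * unfold scal, zero; simpl; unfold mult; simpl. replace (/ r * z) with (z / r) by (unfold Rdiv; ring). field. lra.
    + intros z. apply (continuous_comp (fun z => t + z / r) (fun y => bd 0%nat y / r ^ 2)).
      * apply (@ex_derive_continuous R_AbsRing R_NormedModule). auto_derive. trivial.
      * apply continuous_multR; [apply derive_continuous with (bd 1%nat), HD | apply continuous_const].
    + unfold scaled. unfold Rdiv. rewrite Rmult_0_l, Rplus_0_r. ring.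
    + intros z. assert (Bz := profile_bounds (t + z / r)). split.
      * apply Rmult_le_compat; try lra; [left; apply Rinv_0_lt_compat; lra |]. apply Rinv_le_contravar; lra.
      * apply Rmult_le_compat; try lra; [left; apply Rinv_0_lt_compat; lra |]. apply Rinv_le_contravar; lra.
    + intros z. specialize (T z).
      assert (W1 : Wt 1 z <= Wt frame_weight z) by (apply Wt_mono; unfold frame_weight; lra).
      assert (W2 : Wt (1 + 1) z <= Wt frame_weight z) by (apply Wt_mono; unfold frame_weight; lra).
      assert (W12 := Wt_mult 1 1 z ltac:(lra) ltac:(lra)). assert (Wz := abs_le_Wt1 z).
      assert (Pz := Rabs_pos z).
      assert (Rz2 : z ^ 2 <= 2 * Wt frame_weight z) by (rewrite <- pow2_abs; nra).
      assert (Rz1 : Rabs z <= Wt frame_weight z) by lra.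
      set (b1 := bd 1%nat t / r ^ 3) in *. set (b2 := bd 2%nat t / r ^ 4) in *.
      set (g := bd 0%nat (t + z / r) / r ^ 2 - 1) in *.
      replace g with ((g - b1 * z - b2 / 2 * z ^ 2) + b1 * z + b2 / 2 * z ^ 2) by ring.
      eapply Rle_trans; [apply Rabs_triang |].
      assert (T1 := Rabs_triang (g - b1 * z - b2 / 2 * z ^ 2) (b1 * z)).
      assert (G1 : Rabs (b1 * z) <= Rabs b1 * Wt frame_weight z).
      { rewrite Rabs_mult. apply Rmult_le_compat_l; [apply Rabs_pos | assumption]. }
      assert (G2 : Rabs (b2 / 2 * z ^ 2) <= Rabs b2 * Wt frame_weight z).
      { unfold Rdiv. rewrite !Rabs_mult, (Rabs_pos_eq (/ 2)), (Rabs_pos_eq (z ^ 2)) by (try lra; apply pow2_ge_0).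
        rewrite Rmult_assoc. apply Rmult_le_compat_l; [apply Rabs_pos | lra]. }
      apply Rle_trans with ((Rabs b1 + Rabs b2 + C / bm * Rabs (bd 3%nat t)) * Wt frame_weight z); [lra |].
      apply Rmult_le_compat_r; [lra |]. unfold M. lra.
  - unfold M. lra.
  - unfold M. lra.
  - exact T.
Qed.

End Profile.

(** * Return to the original variables *)

Theorem theorem2p1
  (bd : nat -> R -> R) (bm bp : R) (a : R -> R)
  (* standing assumptions *)
  (Hsmooth : smooth_derivs bd)
  (Hincr : forall x y, x < y -> bd 0%nat x < bd 0%nat y)
  (Hbm : forall eps, 0 < eps -> exists X, forall x, x <= X -> Rabs (bd 0%nat x - bm) <= eps)
  (Hbp : forall eps, 0 < eps -> exists X, forall x, X <= x -> Rabs (bd 0%nat x - bp) <= eps)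
  (Hbpm : 0 < bm < bp)
  (Ha0 : a 0 = 0)
  (Ha : forall x, derivable_pt_lim a x (bd 0%nat x))
  (* (a) *)
  (HA : exists x0, forall (p : nat) (x : R), x0 <= x -> bd p x <> 0)
  (* (b) *)
  (HB1 : little_o_infty (bd 1%nat) (fun x => bp - bd 0%nat x))
  (HB2 : forall p : nat, little_o_infty (bd (S p)) (bd p))
  (* (c) *)
  (HC : little_o_infty (fun x => (bd 1%nat x) ^ 2) (bd 2%nat))
  (n : nat) (Hn : (1 <= n)%nat)
  (En : R -> R) (HEn : forall k, is_band a n k (En k)) :
  let Lam := 2 * INR n - 1 in
  let gam := / 4 * (2 * INR n ^ 2 - 2 * INR n + 1) in
  exists sigma tau, 0 < sigma /\ 0 < tau /\
  exists (C K : R) (E1 E2 : R -> R),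
    forall k, K <= k ->
      derivable_pt_lim En k (E1 k) /\
      derivable_pt_lim E1 k (E2 k) /\
      forall xk e, a xk = k -> is_eps bd a sigma tau k e ->
        Rabs (En k - (bd 0%nat xk * Lam + gam * / bd 0%nat xk * bd 2%nat xk)) <= C * e /\
        Rabs (E1 k - (/ bd 0%nat xk * Lam * bd 1%nat xk)) <= C * e /\
        Rabs (E2 k - (/ (bd 0%nat xk) ^ 2 * Lam * bd 2%nat xk)) <= C * e.
Proof.
  intros Lam gam.
  assert (HD : forall p x, is_derive (bd p) x (bd (S p) x)) by (intros; apply is_derive_Reals, Hsmooth).
  assert (HaD : forall x, is_derive a x (bd 0%nat x)) by (intros; apply is_derive_Reals, Ha).
  assert (Bd := profile_bounds bd bm bp Hincr Hbm Hbp).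
  assert (Fl := flux_growth bd bm bp a Hincr Hbm Hbp HaD).
  set (k1 := bm / bp). set (K1 := bp / bm). set (c1 := frame_weight bm).
  assert (Hk1 : 0 < k1) by (apply Rdiv_lt_0_compat; lra).
  assert (HK1 : 1 <= K1).
  { unfold K1. apply Rmult_le_reg_r with bm; [lra |]. replace (bp / bm * bm) with bp by (field; lra). lra. }
  assert (Hc1 : 0 <= c1).
  { unfold c1, frame_weight. assert (0 < 4 / sqrt bm) by (apply Rdiv_lt_0_compat; [lra | apply sqrt_lt_R0; lra]). lra. }
  assert (Hkap : 0 < k1 ^ 2 / 2) by (generalize (pow_lt k1 2 Hk1); lra).
  (* Bands are numbered from 1 and Hermite functions from 0, so that 2 j + 1 = Lam. *)
  set (j := (n - 1)%nat).
  assert (Hnj : INR n = INR j + 1) by (unfold j; rewrite minus_INR by lia; simpl; ring).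
  assert (HLam : 2 * INR j + 1 = Lam) by (unfold Lam; lra).
  destruct (local_band k1 K1 c1 j Hk1 HK1 Hc1) as (C1 & e1 & HC1 & He1 & LB).
  destruct (nth_eigenvalue_near (k1 ^ 2 / 2) (2 + c1) Hkap ltac:(lra) n Hn) as (h0 & Hh0 & NE).
  destruct (tame_region bd bm bp Hincr Hbm Hbp Hbpm HA HB1 HB2) as (X & HX0 & HX).
  destruct (profile_taylor bd bm bp HD Hincr Hbm Hbp Hbpm X HX0 HX) as (CT & HCT & HT).
  assert (PF := profile_frame bd bm bp a HD Hincr Hbm Hbp Hbpm HaD X CT HCT HX HT). cbv zeta in PF.
  set (M := / sqrt bm ^ 3 + / sqrt bm ^ 4 + CT / bm) in *.
  assert (HM : 0 < M).
  { assert (0 < sqrt bm) by (apply sqrt_lt_R0; lra). unfold M.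
    assert (0 < / sqrt bm ^ 3) by (apply Rinv_0_lt_compat, pow_lt; assumption).
    assert (0 < / sqrt bm ^ 4) by (apply Rinv_0_lt_compat, pow_lt; assumption).
    assert (0 <= CT / bm) by (apply Rmult_le_pos; [assumption | left; apply Rinv_0_lt_compat; lra]). lra. }
  set (Ca := 4 * (K1 + 2)). assert (HCa : 0 < Ca) by (unfold Ca; lra).
  (* ep <= h meets the threshold of [local_band] and, leaving an equal share to |s|, the one for
     counting eigenvalues. *)
  set (h := Rmin e1 (h0 / (2 * Ca))).
  assert (Hh : 0 < h) by (apply Rmin_glb_lt; [assumption | apply Rdiv_lt_0_compat; lra]).
  destruct (slope_small bd bm bp Hincr Hbm Hbp Hbpm HB1 (h / M)) as [X1 HX1]; [apply Rdiv_lt_0_compat; lra |].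
  (* a is increasing, so k above a (Rmax X X1) puts t beyond both X and X1; the added 1 + |a (Rmax X
     X1)| also makes k, hence t, positive. *)
  assert (Large : forall k t, a (Rmax X X1) + 1 + Rabs (a (Rmax X X1)) <= k -> a t = k -> Rmax X X1 <= t /\ 0 < t /\ 0 < k).
  { intros k t Hk Et. assert (Hm : X <= Rmax X X1) by apply Rmax_l.
    assert (0 < k) by (generalize (Rle_abs (- a (Rmax X X1))); rewrite Rabs_Ropp; lra).
    assert (Hle : Rmax X X1 <= t).
    { destruct (Rle_or_lt (Rmax X X1) t) as [| Hlt]; [assumption | exfalso].
      assert (F := Fl t (Rmax X X1) ltac:(lra)). assert (0 <= bm * (Rmax X X1 - t)) by (apply Rmult_le_pos; lra).
      generalize (Rabs_pos (a (Rmax X X1))). lra. }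
    split; [assumption |]. split; [| assumption].
    destruct (Rle_lt_or_eq_dec 0 t) as [| E0]; [lra | assumption |]. rewrite <- E0, Ha0 in Et. lra. }
  set (K := a (Rmax X X1) + 1 + Rabs (a (Rmax X X1))) in *.
  (* Converts err to b'^2 + |b' b''| + |b'''|, using ep = M |b'| and r^4 = b(t)^2 >= bm^2. *)
  set (C' := M ^ 2 + M / bm ^ 2 + CT / bm).
  assert (HMb : 0 <= M / bm ^ 2) by (apply Rmult_le_pos; [lra | left; apply Rinv_0_lt_compat, pow_lt; lra]).
  assert (HCb : 0 <= CT / bm) by (apply Rmult_le_pos; [assumption | left; apply Rinv_0_lt_compat; lra]).
  assert (HC' : 0 <= C') by (unfold C'; generalize (pow2_ge_0 M); lra).
  (* Undoing the scaling multiplies the energy by r^2, the first derivative by r and the second by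
     1, all at most bp + sqrt bp + 1. *)
  set (CC := (bp + sqrt bp + 1) * C1 * C').
  assert (Hsq : 0 <= sqrt bp) by apply sqrt_pos.
  assert (Main : forall k t, K <= k -> a t = k ->
    (exists r1, 0 < r1 /\ forall k', Rabs (k' - k) < r1 -> ex_derive En k') /\
    ex_derive (Derive En) k /\
    let e0 := bd 1%nat t ^ 2 + Rabs (bd 1%nat t * bd 2%nat t) + Rabs (bd 3%nat t) in
    Rabs (En k - (bd 0%nat t * Lam + gam * / bd 0%nat t * bd 2%nat t)) <= CC * e0 /\
    Rabs (Derive En k - (/ bd 0%nat t * Lam * bd 1%nat t)) <= CC * e0 /\
    Rabs (Derive (Derive En) k - (/ (bd 0%nat t) ^ 2 * Lam * bd 2%nat t)) <= CC * e0).
  { intros k t Hk Et. destruct (Large k t Hk Et) as (Hmx & Ht0 & Hk0).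
    assert (HXt : X <= t) by (eapply Rle_trans; [apply Rmax_l | exact Hmx]).
    assert (HX1t : X1 <= t) by (eapply Rle_trans; [apply Rmax_r | exact Hmx]).
    destruct (PF t HXt) as (Fr & Hb1 & Hb2 & Ht3). specialize (HX1 t HX1t).
    assert (Bt := Bd t).
    set (r := sqrt (bd 0%nat t)) in *.
    assert (Hr : 0 < r) by (apply sqrt_lt_R0; lra).
    assert (Hr2 : r ^ 2 = bd 0%nat t) by (apply pow2_sqrt; lra).
    assert (Hrp : r <= sqrt bp) by (apply sqrt_le_1; lra).
    set (ep := M * Rabs (bd 1%nat t)) in *.
    assert (Hep0 : 0 <= ep) by (apply Rmult_le_pos; [lra | apply Rabs_pos]).
    assert (Hep : ep <= h).
    { unfold ep. apply Rle_trans with (M * (h / M)); [apply Rmult_le_compat_l; lra | right; field; lra]. }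
    assert (Hep1 : ep <= e1) by (apply Rle_trans with (1 := Hep); apply Rmin_l).
    rewrite Et in Fr.
    set (al := scaled a k t r) in *.
    set (E := fun s => En (k + r * s) / r ^ 2).
    set (r0 := Rmin 1 (h0 / (2 * Ca))).
    assert (Hr0 : 0 < r0) by (apply Rmin_glb_lt; [lra | apply Rdiv_lt_0_compat; lra]).
    assert (HE : forall s, Rabs s < r0 -> iseig (pot al s) (E s) /\ Rabs (E s - (2 * INR j + 1)) <= 1).
    { intros s Hs. assert (S1 : Rabs s < 1) by (apply Rlt_le_trans with (1 := Hs); apply Rmin_l).
      assert (S2 : Rabs s < h0 / (2 * Ca)) by (apply Rlt_le_trans with (1 := Hs); apply Rmin_r).
      assert (Hth : Ca * (ep + Rabs s) <= h0).
      { apply Rle_trans with (Ca * (h0 / (2 * Ca) + h0 / (2 * Ca))); [| right; field; lra].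
        apply Rmult_le_compat_l; [lra |]. assert (h <= h0 / (2 * Ca)) by apply Rmin_r. lra. }
      assert (Ad := pot_adm k1 K1 c1 Hk1 HK1 Hc1 al _ ep Fr s _ ltac:(lra) (Rle_refl _)). fold Ca in Ad.
      assert (Sp := adm_slow (k1 ^ 2 / 2) (2 + c1) ltac:(lra) _ _ Ad).
      assert (Tr : forall y, is_eigenvalue a (k + r * s) (r ^ 2 * y) -> iseig (pot al s) y).
      { intros y. destruct (adm_confining _ _ Hkap _ _ y Ad). now apply is_eigenvalue_iseig. }
      assert (Rr : forall y, r ^ 2 * (y / r ^ 2) = y) by (intros; field; lra).
      destruct (HEn (k + r * s)) as [IE (l & Ll & Nl & Il)].
      assert (IE' : iseig (pot al s) (E s)) by (apply Tr; unfold E; now rewrite Rr).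
      split; [exact IE' |]. rewrite HLam.
      (* The list of lower eigenvalues is transported by y -> y / r^2, which is injective and
         increasing. *)
      apply (NE (pot al s) (Ca * (ep + Rabs s)) (E s) (map (fun y => y / r ^ 2) l) Ad Hth).
      - intros z. unfold pot. apply pow2_ge_0.
      - exact IE'.
      - now rewrite length_map.
      - apply Injective_map_NoDup; [| assumption]. intros x y Hxy. rewrite <- (Rr x), <- (Rr y). now rewrite Hxy.
      - assert (Hr20 : 0 < r ^ 2) by (apply pow_lt; assumption).
        intros y. rewrite in_map_iff. split.
        + intros (x & <- & Hx). apply Il in Hx. destruct Hx as [Ix Lx]. split; [apply Tr; now rewrite Rr |].
          unfold E. apply Rmult_lt_compat_r; [now apply Rinv_0_lt_compat | assumption].
        + intros [Iy Ly]. exists (r ^ 2 * y). split; [field; lra |]. apply Il. split.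
          * now apply iseig_is_eigenvalue in Iy.
          * rewrite <- (Rr (En (k + r * s))). now apply Rmult_lt_compat_l. }
    destruct (LB al _ ep (bd 1%nat t / r ^ 3) (bd 2%nat t / r ^ 4) (CT / bm * Rabs (bd 3%nat t)) E r0
      Fr Hep1 Hb1 Hb2 Ht3 Hr0 HE) as (D1 & D2 & r1 & Hr1 & HD1 & HD2 & B0 & B1 & B2).
    rewrite HLam in B0, B1, B2.
    assert (DEn : forall k', Rabs (k' - k) < r * r1 -> is_derive En k' (r * D1 (/ r * (k' - k)))).
    { intros k' Hk'.
      assert (Hs : Rabs (/ r * (k' - k)) < r1).
      { rewrite Rabs_mult, Rabs_pos_eq by (left; now apply Rinv_0_lt_compat).
        apply Rmult_lt_reg_l with r; [assumption |]. rewrite <- Rmult_assoc, Rinv_r, Rmult_1_l by lra. exact Hk'. }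
      apply is_derive_ext with (fun x => r ^ 2 * E (/ r * (x - k))).
      { assert (Q : forall x : R, r ^ 2 * E (/ r * (x - k)) = En x); [| exact Q].
        intros x. unfold E. replace (k + r * (/ r * (x - k))) with x by (field; lra). field. lra. }
      evar_last.
      - apply is_derive_scal. apply (is_derive_comp E (fun x => / r * (x - k))); [now apply HD1 |].
        instantiate (1 := / r). auto_derive; [trivial | ring].
      - unfold scal; simpl; unfold mult; simpl. field. lra. }
    assert (Hrr : 0 < r * r1) by now apply Rmult_lt_0_compat.
    assert (DDE : is_derive (Derive En) k D2).
    { apply is_derive_ext_loc with (fun x => r * D1 (/ r * (x - k))).
      - exists (mkposreal _ Hrr). intros x Hx. symmetry. apply is_derive_unique, DEn. exact Hx.
      - evar_last.
        + apply is_derive_scal. apply (is_derive_comp D1 (fun x => / r * (x - k))).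
          * rewrite Rminus_diag, Rmult_0_r. exact HD2.
          * instantiate (1 := / r). auto_derive; [trivial | ring].
        + unfold scal; simpl; unfold mult; simpl. field. lra. }
    assert (E1k : Derive En k = r * D1 0).
    { apply is_derive_unique. assert (Q := DEn k). rewrite Rminus_diag, Rabs_R0, Rmult_0_r in Q. now apply Q. }
    split; [exists (r * r1); split; [assumption | intros k' Hk'; eexists; now apply DEn] |].
    split; [now exists D2 |]. intros e0.
    set (err := ep ^ 2 + ep * Rabs (bd 2%nat t / r ^ 4) + CT / bm * Rabs (bd 3%nat t)) in *.
    assert (Q1 := Rabs_pos (bd 1%nat t)). assert (Q2 := Rabs_pos (bd 2%nat t)). assert (Q3 := Rabs_pos (bd 3%nat t)).
    assert (He0 : 0 <= e0).
    { unfold e0. generalize (pow2_ge_0 (bd 1%nat t)), (Rabs_pos (bd 1%nat t * bd 2%nat t)). lra. }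
    assert (Herr : err <= C' * e0).
    { unfold err, C', e0, ep.
      assert (R4 : Rabs (bd 2%nat t / r ^ 4) <= Rabs (bd 2%nat t) / bm ^ 2).
      { unfold Rdiv. rewrite Rabs_mult. apply Rmult_le_compat_l; [assumption |].
        replace (r ^ 4) with (bd 0%nat t ^ 2) by (rewrite <- Hr2; ring).
        rewrite Rabs_pos_eq by (left; apply Rinv_0_lt_compat, pow_lt; lra).
        apply Rinv_le_contravar; [apply pow_lt; lra | apply pow_incr; lra]. }
      assert (Y1 : M * Rabs (bd 1%nat t) * Rabs (bd 2%nat t / r ^ 4) <= M / bm ^ 2 * Rabs (bd 1%nat t * bd 2%nat t)).
      { apply Rle_trans with (M * Rabs (bd 1%nat t) * (Rabs (bd 2%nat t) / bm ^ 2)).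
        - now apply Rmult_le_compat_l.
        - rewrite Rabs_mult. right. field. lra. }
      rewrite Rpow_mult_distr, pow2_abs.
      set (x := bd 1%nat t ^ 2) in *. set (y := Rabs (bd 1%nat t * bd 2%nat t)) in *. set (z := Rabs (bd 3%nat t)) in *.
      assert (0 <= x) by apply pow2_ge_0. assert (0 <= y) by apply Rabs_pos.
      assert (HM2 := pow2_ge_0 M).
      assert (0 <= M ^ 2 * (y + z)) by (apply Rmult_le_pos; lra).
      assert (0 <= M / bm ^ 2 * (x + z)) by (apply Rmult_le_pos; lra).
      assert (0 <= CT / bm * (x + y)) by (apply Rmult_le_pos; lra). lra. }
    assert (Sc : forall c x, 0 <= c <= bp + sqrt bp + 1 -> Rabs x <= C1 * err -> Rabs (c * x) <= CC * e0).
    { intros c x Hc Hx. rewrite Rabs_mult, Rabs_pos_eq by lra.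
      apply Rle_trans with ((bp + sqrt bp + 1) * (C1 * (C' * e0))); [| unfold CC; lra].
      apply Rmult_le_compat; try lra; [apply Rabs_pos |]. apply Rle_trans with (1 := Hx).
      apply Rmult_le_compat_l; lra. }
    assert (Hrb : bd 0%nat t = r ^ 2) by lra.
    split; [| split].
    (* Here gam = (Lam^2 + 1) / 8, and multiplying b''/r^4 by b = r^2 leaves b''/b. *)
    - replace (En k - (bd 0%nat t * Lam + gam * / bd 0%nat t * bd 2%nat t))
        with (bd 0%nat t * (E 0 - (Lam + (Lam ^ 2 + 1) / 8 * (bd 2%nat t / r ^ 4)))).
      + apply Sc; [lra | exact B0].
      + unfold E, gam. rewrite Rmult_0_r, Rplus_0_r, Hrb. unfold Lam. field. lra.
    - rewrite E1k. replace (r * D1 0 - / bd 0%nat t * Lam * bd 1%nat t)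
        with (r * (D1 0 - Lam * (bd 1%nat t / r ^ 3))) by (rewrite Hrb; field; lra).
      apply Sc; [lra | exact B1].
    - rewrite (is_derive_unique _ _ _ DDE). replace (D2 - / bd 0%nat t ^ 2 * Lam * bd 2%nat t)
        with (1 * (D2 - Lam * (bd 2%nat t / r ^ 4))) by (rewrite Hrb; field; lra).
      apply Sc; [lra | exact B2]. }
  (* From k = a(x_k) <= bp x_k follows sigma k < x_k, so the supremum in epsilon covers the point
     x_k itself. *)
  exists (/ (2 * bp)), 1. split; [apply Rinv_0_lt_compat; lra |]. split; [lra |].
  exists CC, K, (Derive En), (Derive (Derive En)). intros k Hk.
  assert (Hk0 : 0 <= k).
  { unfold K in Hk. generalize (Rle_abs (- a (Rmax X X1))). rewrite Rabs_Ropp. lra. }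
  destruct (flux_inverse bd bm bp a Hincr Hbm Hbp Hbpm Ha0 HaD k Hk0) as (t & _ & Et).
  destruct (Main k t Hk Et) as ((r1 & Hr1 & X1k) & X2k & Bk).
  split; [apply is_derive_Reals, Derive_correct, X1k; rewrite Rminus_diag, Rabs_R0; exact Hr1 |].
  split; [apply is_derive_Reals, Derive_correct, X2k |].
  assert (inj : forall x y, a x = a y -> x = y).
  { intros x y Hxy. destruct (Rtotal_order x y) as [L | [L | L]]; [exfalso | assumption | exfalso].
    - assert (F := Fl x y ltac:(lra)). assert (0 < bm * (y - x)) by (apply Rmult_lt_0_compat; lra). lra.
    - assert (F := Fl y x ltac:(lra)). assert (0 < bm * (x - y)) by (apply Rmult_lt_0_compat; lra). lra. }
  intros xk e Exk (xk' & S & Exk' & [Hub _] & Ee).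
  assert (xk = t) by (apply inj; lra). assert (xk' = t) by (apply inj; lra). subst xk xk'.
  destruct (Large k t Hk Et) as (_ & Ht0 & Hkp).
  assert (HS : Rabs (bd 1%nat t * bd 2%nat t) + Rabs (bd 3%nat t) <= S).
  { apply Hub. exists t. split; [| reflexivity].
    assert (F := Fl 0 t ltac:(lra)). rewrite Ha0, Et, !Rminus_0_r in F.
    apply Rmult_lt_reg_l with (2 * bp); [lra |]. rewrite <- Rmult_assoc, Rinv_r, Rmult_1_l by lra.
    assert (0 < bp * t) by (apply Rmult_lt_0_compat; lra). lra. }
  assert (He : bd 1%nat t ^ 2 + Rabs (bd 1%nat t * bd 2%nat t) + Rabs (bd 3%nat t) <= e).
  { rewrite Ee. generalize (exp_pos (- (1) * k ^ 2)). lra. }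
  assert (HCC : 0 <= CC) by (unfold CC; mult_pos).
  assert (Fin := Rmult_le_compat_l CC _ _ HCC He).
  destruct Bk as (G0 & G1 & G2).
  split; [apply Rle_trans with (1 := G0); exact Fin |].
  split; [apply Rle_trans with (1 := G1); exact Fin | apply Rle_trans with (1 := G2); exact Fin].
Qed.
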